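(* Let $d\in\{2,3\}$, let $D\subset\mathbb R^d$ be a bounded domain, and let $f$ be a $\mathbb C$-valued centered GMIG random field of order $-m$ in $D$, whose covariance and relation operators have principal symbols $a^c(x)|\xi|^{-m}$ and $a^r(x)|\xi|^{-m}$, respectively, with $a^c,a^r\in C_0^\infty(D)$, and $m\in(d-6,d]$. Let $$u^\infty(\hat x,\kappa)=\frac{C_d}2\,\kappa^{\frac{d-7}2}\int_{\mathbb R^d}e^{-{\rm i}\kappa\hat x\cdot y}f(y)\,dy$$ be the far-field pattern of the radiating solution of the biharmonic wave equation $\Delta^2u-\kappa^4u=f$ in $\mathbb R^d$. Then for all $\hat x\in\mathbb S^{d-1}$ and $\tau\ge0$, it holds almost surely that $$\lim_{Q\to\infty}\frac1Q\int_Q^{2Q}\kappa^{m+7-d}\,u^\infty(\hat x,\kappa+\tau)\overline{u^\infty(\hat x,\kappa)}\,d\kappa=\frac14|C_d|^2\,\widehat{a^c}(\tau\hat x),$$ $$\lim_{Q\to\infty}\frac1Q\int_Q^{2Q}\kappa^{m+7-d}\,u^\infty(\hat x,\kappa+\tau)u^\infty(-\hat x,\kappa)\,d\kappa=\frac14C_d^2\,\widehat{a^r}(\tau\hat x).$$ Moreover, for any nonempty open set $\Theta\subset\mathbb R_+\times\mathbb S^{d-1}$, the functions $a^c$ and $a^r$ are uniquely determined by the values of the first and, respectively, the second of these limits for $(\tau,\hat x)\in\Theta$.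
   Context: Constants: $C_2=\frac{e^{{\rm i}\pi/4}}{\sqrt{8\pi}}$, $C_3=\frac1{4\pi}$. $\mathbb R_+=(0,\infty)$. Fourier transform: $\hat\varphi(\xi)=\int_{\mathbb R^d}e^{-{\rm i}x\cdot\xi}\varphi(x)\,dx$. The radiating solution $u$ is required to satisfy $\lim_{|x|\to\infty}|x|^{\frac{d-1}2}(\partial_{|x|}u-{\rm i}\kappa u)=0$ and $\lim_{|x|\to\infty}|x|^{\frac{d-1}2}(\partial_{|x|}\Delta u-{\rm i}\kappa\Delta u)=0$; the source $f$ does not depend on $\kappa>0$; and $u^\infty$ satisfies $u(x,\kappa)=\frac{e^{{\rm i}\kappa|x|}}{|x|^{(d-1)/2}}\left(u^\infty(\hat x,\kappa)+O(|x|^{-1})\right)$ as $|x|\to\infty$, $\hat x=x/|x|$. The integral defining $u^\infty$ is the pairing of the compactly supported distribution $f$ with the smooth function $y\mapsto e^{-{\rm i}\kappa\hat x\cdot y}$. Random fields. $(\Omega,\mathcal F,\mathbb P)$ is a complete probability space; $\mathcal D(\mathbb R^d)=C_0^\infty(\mathbb R^d;\mathbb C)$ and $\mathcal D'(\mathbb R^d)$ is the space of distributions, with bilinear pairing $\langle\cdot,\cdot\rangle$. A $\mathbb C$-valued generalized Gaussian random field is a map $f:\Omega\to\mathcal D'(\mathbb R^d)$ such that $\langle f,\psi\rangle$ is a $\mathbb C$-valued Gaussian random variable for every $\psi\in\mathcal D(\mathbb R^d)$; it is centered if $\mathbb E\langle f,\psi\rangle=0$ for all $\psi$. For centered $f$,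 the covariance operator $\mathcal C_f$ and relation operator $\mathcal R_f$, both $\mathcal D(\mathbb R^d)\to\mathcal D'(\mathbb R^d)$, are defined by $\langle\mathcal C_f\varphi,\psi\rangle=\mathbb E[\langle\overline f,\varphi\rangle\langle f,\psi\rangle]$ and $\langle\mathcal R_f\varphi,\psi\rangle=\mathbb E[\langle f,\varphi\rangle\langle f,\psi\rangle]$. Symbols: $\mathcal S^{-m}(\mathbb R^d\times\mathbb R^d)$ is the set of $\sigma\in C^\infty(\mathbb R^d\times\mathbb R^d)$ with $|\partial_\xi^{\gamma_1}\partial_x^{\gamma_2}\sigma(x,\xi)|\le C_{\gamma_1,\gamma_2}(1+|\xi|)^{-m-|\gamma_1|}$ for all multi-indices $\gamma_1,\gamma_2$. GMIG (generalized microlocally isotropic Gaussian) of order $-m$ in $D$: $\mathcal C_f$ and $\mathcal R_f$ are pseudo-differential operators, $\mathcal C_f\varphi(x)=(2\pi)^{-d}\int e^{{\rm i}x\cdot\xi}\sigma^c(x,\xi)\hat\varphi(\xi)\,d\xi$ and $\mathcal R_f\varphi(x)=(2\pi)^{-d}\int e^{{\rm i}x\cdot\xi}\sigma^r(x,\xi)\hat\varphi(\xi)\,d\xi$, and for $\eta\in\{c,r\}$: $\sigma^\eta\in\mathcal S^{-m}$, $\sigma^\eta(\cdot,\xi)\in C_0^\infty(D)$ for every $\xi$, and $\sigma^\eta(x,\xi)=a^\eta(x)|\xi|^{-m}+b^\eta(x,\xi)$ for $|\xi|\ge1$, with $a^\eta\in C_0^\infty(D)$, $b^\eta\in\mathcal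 S^{-m-1}$, $b^\eta(\cdot,\xi)\in C_0^\infty(D)$. In particular $f$ is almost surely a distribution supported in $\overline D$. *)

(* Defs.v *)
From HB Require Import structures.
From mathcomp Require Import all_boot all_order all_algebra.
From mathcomp Require Import all_classical all_reals all_analysis.
From mathcomp Require Import complex.

Set Implicit Arguments.
Unset Strict Implicit.
Unset Printing Implicit Defensive.

Import Order.TTheory GRing.Theory Num.Theory.
Import numFieldNormedType.Exports.
Export numFieldNormedType.Exports.

Local Open Scope classical_set_scope.
Local Open Scope ring_scope.
Local Open Scope complex_scope.

(* Lebesgue measure on R^n, carried by the measurable type n.-tuple R: the
   library provides only binary products, so it is built by recursion on n as
   the image of lebesgue_measure \x (Lebesgue measure on R^n) under consing. *)
Section lebesgue_tuple.
Context {R : realType}.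

Definition tuple_cons n (p : R * n.-tuple R) : n.+1.-tuple R :=
  [the n.+1.-tuple R of p.1 :: p.2].

Definition tuple_uncons n (t : n.+1.-tuple R) : R * n.-tuple R :=
  (tnth t ord0, [tuple of behead t]).

Lemma measurable_tuple_cons n : measurable_fun [set: R * n.-tuple R]
  (@tuple_cons n).
Proof. exact: measurable_cons. Qed.

Lemma measurable_tuple_uncons n : measurable_fun [set: n.+1.-tuple R]
  (@tuple_uncons n).
Proof.
apply: measurable_fun_pair; first exact: measurable_tnth.
exact: measurable_behead.
Qed.

Lemma tuple_consK n : cancel (@tuple_cons n) (@tuple_uncons n).
Proof. by case=> x t; congr (_, _); apply: val_inj. Qed.

Section step.
Context n (mu : {sigma_finite_measure set (n.-tuple R) -> \bar R}).

Definition lebesgue_cons : set (n.+1.-tuple R) -> \bar R :=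
  pushforward (lebesgue_measure \x mu)%E (@tuple_cons n).

Let lebesgue_cons0 : lebesgue_cons set0 = 0%E.
Proof. by rewrite /lebesgue_cons /pushforward preimage_set0 measure0. Qed.

Let lebesgue_cons_ge0 A : (0 <= lebesgue_cons A)%E.
Proof. by rewrite /lebesgue_cons /pushforward measure_ge0. Qed.

Let lebesgue_cons_sigma_additive : semi_sigma_additive lebesgue_cons.
Proof.
have mf := @measurable_tuple_cons n.
move=> F mF tF mUF; rewrite /lebesgue_cons /pushforward preimage_bigcup.
apply: measure_semi_sigma_additive.
- by move=> k; rewrite -[X in measurable X]setTI; exact: mf.
- apply/trivIsetP => /= i j _ _ ij; rewrite -preimage_setI.
  by move/trivIsetP : tF => /(_ _ _ _ _ ij) ->//; rewrite preimage_set0.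
- by rewrite -preimage_bigcup -[X in measurable X]setTI; exact: mf.
Qed.

HB.instance Definition _ := isMeasure.Build _ _ _ lebesgue_cons
  lebesgue_cons0 lebesgue_cons_ge0 lebesgue_cons_sigma_additive.

Let lebesgue_cons_sigma_finite : sigma_finite setT lebesgue_cons.
Proof.
have /sigma_finiteP[F [TF ndF Foo]] := sigma_finiteT (@lebesgue_measure R).
have /sigma_finiteP[G [TG ndG Goo]] := sigma_finiteT mu.
exists (fun k => @tuple_uncons n @^-1` (F k `*` G k)).
  rewrite predeqE => t; split => // _.
  have [i _ Fi] : (\bigcup_i F i) (tnth t ord0) by rewrite -TF.
  have [j _ Gj] : (\bigcup_i G i) [tuple of behead t] by rewrite -TG.
  exists (maxn i j) => //; split => /=.
    by move: Fi; exact/subsetPset/ndF/leq_maxl.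
  by move: Gj; exact/subsetPset/ndG/leq_maxr.
move=> k; have [mF Fk] := Foo k; have [mG Gk] := Goo k.
split.
  rewrite -[X in measurable X]setTI.
  by apply: measurable_tuple_uncons => //; exact: measurableX.
rewrite /lebesgue_cons /pushforward -comp_preimage.
rewrite (_ : _ \o _ = id); last exact/funext/tuple_consK.
by rewrite preimage_id product_measure1E// lte_mul_pinfty// ge0_fin_numE.
Qed.

HB.instance Definition _ := Measure_isSigmaFinite.Build _ _ _ lebesgue_cons
  lebesgue_cons_sigma_finite.

End step.

Fixpoint lebesgue_tuple n : {sigma_finite_measure set (n.-tuple R) -> \bar R} :=
  if n is n'.+1 then lebesgue_cons (lebesgue_tuple n') else \d_[tuple].

End lebesgue_tuple.

Section complex_analysis.
Context {R : realType}.

(* e^{it} *)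
Definition expi (t : R) : R[i] := cos t +i* sin t.

Definition cintegral d (T : measurableType d) (mu : {measure set T -> \bar R})
    (A : set T) (F : T -> R[i]) : R[i] :=
  (\int[mu]_(x in A) complex.Re (F x)) +i* (\int[mu]_(x in A) complex.Im (F x)).

Definition integral_Rd d (F : 'rV[R]_d -> R[i]) : R[i] :=
  cintegral (lebesgue_tuple d) setT (fun t => F (\row_i tnth t i)).

Definition ccvg_pinfty (g : R -> R[i]) (l : R[i]) : Prop :=
  Normc.normc (g Q - l) @[Q --> +oo] --> (0 : R).

(* |x| is the Euclidean norm, whereas the norm of 'rV[R]_d is the sup norm. *)
Definition dot d (x y : 'rV[R]_d) : R := \sum_i x 0 i * y 0 i.
Definition enorm d (x : 'rV[R]_d) : R := Num.sqrt (dot x x).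

Definition fourier d (phi : 'rV[R]_d -> R[i]) (xi : 'rV[R]_d) : R[i] :=
  integral_Rd (fun x => expi (- dot x xi) * phi x).

(* Iterated directional derivative; the last direction is applied first. *)
Definition dirD (V : normedModType R) (vs : seq V) (f : V -> R) : V -> R :=
  foldr (fun v g x => 'D_v g x) f vs.

Definition smooth (V : normedModType R) (f : V -> R) : Prop :=
  forall vs : seq V, continuous (dirD vs f) /\
    forall x v, derivable (dirD vs f) x v.

Definition csmooth (V : normedModType R) (f : V -> R[i]) : Prop :=
  smooth (fun x => complex.Re (f x)) /\ smooth (fun x => complex.Im (f x)).

Definition cdirD (V : normedModType R) (vs : seq V) (f : V -> R[i]) (x : V) :
    R[i] :=
  dirD vs (fun y => complex.Re (f y)) x +i*
  dirD vs (fun y => complex.Im (f y)) x.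

(* Multi-indices are encoded as lists of coordinates: [:: i_1; ...; i_k]
   stands for the derivative of order k along e_{i_1}, ..., e_{i_k}. *)
Definition pderiv d (alpha : seq 'I_d) (f : 'rV[R]_d -> R[i]) :
    'rV[R]_d -> R[i] :=
  cdirD [seq delta_mx 0 i | i <- alpha] f.

Definition csupport d (f : 'rV[R]_d -> R[i]) : set 'rV[R]_d :=
  closure [set x | f x != 0].

(* C_0^oo(D); the case D = setT is the space of test functions on R^d *)
Definition test_on d (D : set 'rV[R]_d) (f : 'rV[R]_d -> R[i]) : Prop :=
  [/\ csmooth f, compact (csupport f) & csupport f `<=` D].

Definition test d (f : 'rV[R]_d -> R[i]) : Prop := test_on setT f.

(* An element of D'(R^d). Only the values of dpair on test functions are
   meaningful; dpair_continuous is continuity for the LF topology, expressed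
   by seminorm estimates. *)
Record schwartz_distr d := SchwartzDistr {
  dpair :> ('rV[R]_d -> R[i]) -> R[i] ;
  dpair_linear : forall (a : R[i]) phi psi, test phi -> test psi ->
    dpair (fun x => a * phi x + psi x) = a * dpair phi + dpair psi ;
  dpair_continuous : forall K : set 'rV[R]_d, compact K ->
    exists (C : R) (N : nat), forall phi (M : R),
      test phi -> csupport phi `<=` K ->
      (forall alpha x, (size alpha <= N)%N ->
        Normc.normc (pderiv alpha phi x) <= M) ->
      Normc.normc (dpair phi) <= C * M }.

(* <conj T, phi> = conj <T, conj phi> *)
Definition conj_pair d (T : schwartz_distr d) (phi : 'rV[R]_d -> R[i]) : R[i] :=
  (T (fun x => (phi x)^*))^*.

(* The class S^r of symbols of order r; sigma is a function of (x, xi). *)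
Definition symbol_class d (r : R) (sigma : 'rV[R]_d * 'rV[R]_d -> R[i]) :
    Prop :=
  csmooth sigma /\
  forall gamma1 gamma2 : seq 'I_d, exists C : R, forall x xi,
    Normc.normc (cdirD ([seq (0, delta_mx 0 i) | i <- gamma1] ++
                   [seq (delta_mx 0 i, 0) | i <- gamma2]) sigma (x, xi))
    <= C * (1 + enorm xi) `^ (r - (size gamma1)%:R).

Definition pseudo_diff d (sigma : 'rV[R]_d * 'rV[R]_d -> R[i])
    (phi : 'rV[R]_d -> R[i]) (x : 'rV[R]_d) : R[i] :=
  (((2 * pi) ^+ d)^-1)%:C *
  integral_Rd (fun xi => expi (dot x xi) * sigma (x, xi) * fourier phi xi).

(* B phi psi stands for <B phi, psi>. *)
Definition has_symbol d
    (B : ('rV[R]_d -> R[i]) -> ('rV[R]_d -> R[i]) -> R[i])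
    (sigma : 'rV[R]_d * 'rV[R]_d -> R[i]) : Prop :=
  forall phi psi, test phi -> test psi ->
    B phi psi = integral_Rd (fun x => pseudo_diff sigma phi x * psi x).

Definition microlocally_isotropic d (D : set 'rV[R]_d) (m : R)
    (B : ('rV[R]_d -> R[i]) -> ('rV[R]_d -> R[i]) -> R[i])
    (a : 'rV[R]_d -> R[i]) : Prop :=
  exists sigma b : 'rV[R]_d * 'rV[R]_d -> R[i],
    [/\ has_symbol B sigma,
        symbol_class (- m) sigma /\
          (forall xi, test_on D (fun x => sigma (x, xi))),
        test_on D a,
        symbol_class (- m - 1) b /\
          (forall xi, test_on D (fun x => b (x, xi))) &
        forall x xi, 1 <= enorm xi ->
          sigma (x, xi) = a x * (enorm xi `^ (- m))%:C + b (x, xi)].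

(* chi is a smooth compactly supported cutoff equal to 1 near K. *)
Definition cutoff d (K : set 'rV[R]_d) (chi : 'rV[R]_d -> R[i]) : Prop :=
  test chi /\ exists U, [/\ open U, K `<=` U & forall x, U x -> chi x = 1].

(* C_2 = e^{i pi/4} / sqrt (8 pi) and C_3 = 1 / (4 pi); d is 2 or 3 *)
Definition Cst (d : nat) : R[i] :=
  if d == 2%N then expi (pi / 4) * ((Num.sqrt (8 * pi))^-1)%:C
  else ((4 * pi)^-1)%:C.

(* The pairing of a distribution T supported in K with a smooth function g is
   T (chi * g) for any cutoff chi of K. *)
Definition far_field d (chi : 'rV[R]_d -> R[i]) (T : schwartz_distr d)
    (xhat : 'rV[R]_d) (kappa : R) : R[i] :=
  Cst d / 2 * (kappa `^ ((d%:R - 7) / 2))%:C *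
  T (fun y => chi y * expi (- (kappa * dot xhat y))).

Definition band_average (s : R) (F : R -> R[i]) (Q : R) : R[i] :=
  (Q^-1)%:C *
  cintegral lebesgue_measure `[Q, 2 * Q]
    (fun kappa => (kappa `^ s)%:C * F kappa).

Definition Rplus_sphere d : set (R * 'rV[R]_d) :=
  [set p | 0 < p.1 /\ enorm p.2 = 1].

Definition open_in (T : topologicalType) (X A : set T) : Prop :=
  exists2 U, open U & A = U `&` X.

Definition domain d (D : set 'rV[R]_d) : Prop :=
  [/\ open D, connected D & D !=set0].

End complex_analysis.

Arguments Rplus_sphere {R} d.

Section random_fields.
Context {R : realType}.

(* The laws of real Gaussian variables, Dirac masses included. *)
Definition gaussian_law (nu : set R -> \bar R) : Prop :=
  exists mean : R,
    (exists2 s : R, 0 < s &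
       forall A : set R, measurable A -> nu A = normal_prob mean s A) \/
    (forall A : set R, measurable A -> nu A = \d_mean A).

(* Z is a complex Gaussian variable: (Re Z, Im Z) is a (possibly degenerate)
   Gaussian vector, i.e. all its real linear combinations are Gaussian. *)
Definition complex_gaussian disp (Omega : measurableType disp)
    (P : probability Omega R) (Z : Omega -> R[i]) : Prop :=
  [/\ measurable_fun setT (fun w => complex.Re (Z w)),
      measurable_fun setT (fun w => complex.Im (Z w)) &
      forall a b : R,
        gaussian_law (pushforward P
          (fun w => a * complex.Re (Z w) + b * complex.Im (Z w)))].

Definition cexpectation disp (Omega : measurableType disp)
    (P : probability Omega R) (Z : Omega -> R[i]) : R[i] :=
  cintegral P setT Z.

Definition covariance_op disp (Omega : measurableType disp)
    (P : probability Omega R) d (f : Omega -> @schwartz_distr R d)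
    (phi psi : 'rV[R]_d -> R[i]) : R[i] :=
  cexpectation P (fun w => conj_pair (f w) phi * f w psi).

Definition relation_op disp (Omega : measurableType disp)
    (P : probability Omega R) d (f : Omega -> @schwartz_distr R d)
    (phi psi : 'rV[R]_d -> R[i]) : R[i] :=
  cexpectation P (fun w => f w phi * f w psi).

(* f is a centered GMIG random field of order -m in D, whose covariance and
   relation operators have principal symbols ac(x)|xi|^-m and ar(x)|xi|^-m. *)
Definition centered_GMIG disp (Omega : measurableType disp)
    (P : probability Omega R) d (D : set 'rV[R]_d) (m : R)
    (f : Omega -> @schwartz_distr R d) (ac ar : 'rV[R]_d -> R[i]) : Prop :=
  [/\ forall psi, test psi -> complex_gaussian P (fun w => f w psi),
      forall psi, test psi -> cexpectation P (fun w => f w psi) = 0,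
      microlocally_isotropic D m (covariance_op P f) ac &
      microlocally_isotropic D m (relation_op P f) ar].

Definition covariance_limit d (chi : 'rV[R]_d -> R[i]) (m : R)
    (T : schwartz_distr d) (xhat : 'rV[R]_d) (tau : R) (L : R[i]) : Prop :=
  ccvg_pinfty (band_average (m + 7 - d%:R) (fun kappa =>
    far_field chi T xhat (kappa + tau) * (far_field chi T xhat kappa)^*)) L.

Definition relation_limit d (chi : 'rV[R]_d -> R[i]) (m : R)
    (T : schwartz_distr d) (xhat : 'rV[R]_d) (tau : R) (L : R[i]) : Prop :=
  ccvg_pinfty (band_average (m + 7 - d%:R) (fun kappa =>
    far_field chi T xhat (kappa + tau) * far_field chi T (- xhat) kappa)) L.

End random_fields.

(* Main.v *)
(* Up to explicit factors the far field at frequency k is the complex Gaussian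
   variable Z k = <f, chi e^{-i k x.y}>. Its covariances E conj(Z s) Z t and
   relations E (Z s Z t) are oscillatory integrals of the symbols: translating the
   integration variable by half a period of the character shows that they decay
   like 1 / (1 + |t - s|), resp. 1 / (1 + |t + s|), relative to the size of the
   symbol, and dominated convergence with Fourier inversion gives their limit at
   (k, k + tau), resp. (-k, k + tau).

   For jointly Gaussian centered X, Y one has Cov(X^2, Y^2) = 2 (E X Y)^2. Hence
   the integral of X^2 - E X^2 over a band of length Q has second moment O(Q), so
   that its averages along Q = n^2 are almost surely summable in square, and the
   monotonicity of the integral of X^2 fills the gaps between these Q.
   Polarization extends this law of large numbers to products of components of Z.

   For uniqueness, a test function whose Fourier transform vanishes on the open
   cone spanned by Theta has, by Taylor expansion of the exponential along a line
   through the cone, vanishing directional moments; so its transform vanishes on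
   the whole line, hence everywhere. *)

Require Import Defs.
From HB Require Import structures.
From mathcomp Require Import all_boot all_order all_algebra.
From mathcomp Require Import all_classical all_reals all_analysis.
From mathcomp Require Import measurable_realfun complex.
From mathcomp Require Import ring lra.

Set Implicit Arguments.
Unset Strict Implicit.
Unset Printing Implicit Defensive.

Import Order.TTheory GRing.Theory Num.Theory.

Local Open Scope classical_set_scope.
Local Open Scope ring_scope.
Local Open Scope complex_scope.

Local Notation Re := complex.Re.
Local Notation Im := complex.Im.
Local Notation normc := Normc.normc.

(** * Complex-valued limits and integrals *)

(** What is extracted from a symbol is a size bound and a Lipschitz bound in the space variable;
    half-period translation takes the place of integration by parts. The resulting rate 1 / (1 + |t
    - s|) is not integrable, but the covariance of two squares is twice the square of a covariance,
    so the rate that has to be integrated is 1 / (1 + |t - s|)^2. Products of real and imaginary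
    parts of Z mix covariances and relations. At frequencies of the same sign the relation is
    negligible, at opposite signs the covariance is; hence each limit in the theorem sees one symbol
    only. The kernel bounds carry the symbol size at one of the two frequencies, while the law of
    large numbers asks for a uniform bound. The square root of [weight] is therefore attached to
    each process, and the two asymmetric bounds are combined by a geometric mean. Integrals over R^n
    are dominated by multiples of one product weight, [cauchyw], so that integrability, Fubini and
    dominated convergence reduce to pointwise inequalities. *)

Section complex_numbers.
Context {R : realType}.
Implicit Types z w : R[i].

Lemma normc_ge0 z : 0 <= normc z.
Proof. by case: z => a b; exact: sqrtr_ge0. Qed.

Lemma normcD z w : normc (z + w) <= normc z + normc w.
Proof. exact: (@le_normcD R). Qed.

Lemma normcN z : normc (- z) = normc z.
Proof. by case: z => a b /=; rewrite !sqrrN. Qed.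

Lemma normcBC z w : normc (z - w) = normc (w - z).
Proof. by rewrite -normcN opprB. Qed.

Lemma normc_real (x : R) : normc x%:C = `|x|.
Proof. by rewrite /= expr0n /= addr0 sqrtr_sqr. Qed.

Lemma normr_Re_le z : `|Re z| <= normc z.
Proof.
case: z => a b /=; rewrite -sqrtr_sqr ler_sqrt ?lerDl ?sqr_ge0//.
by rewrite addr_ge0 ?sqr_ge0.
Qed.

Lemma normr_Im_le z : `|Im z| <= normc z.
Proof.
case: z => a b /=; rewrite -sqrtr_sqr ler_sqrt ?lerDr ?sqr_ge0//.
by rewrite addr_ge0 ?sqr_ge0.
Qed.

Lemma normc_ReIm z : normc z <= `|Re z| + `|Im z|.
Proof.
have -> : z = (Re z)%:C + 'i * (Im z)%:C.
  by case: z => a b; apply/eqP; rewrite eq_complex /=; apply/andP; split;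
    apply/eqP; ring.
apply: le_trans (normcD _ _) _; rewrite Normc.normcM !normc_real /=.
rewrite expr0n expr1n /= add0r sqrtr1 mul1r.
by rewrite mul0r mulr0 subr0 !addr0 mul1r mulr0 !add0r.
Qed.

Lemma normc_conj z : normc (conjc z) = normc z.
Proof. by case: z => a b /=; rewrite sqrrN. Qed.

Lemma RecM z w : Re (z * w) = Re z * Re w - Im z * Im w.
Proof. by case: z w => a b [c e]. Qed.

Lemma ImcM z w : Im (z * w) = Re z * Im w + Im z * Re w.
Proof. by case: z w => a b [c e]. Qed.

Lemma RecD z w : Re (z + w) = Re z + Re w.
Proof. by case: z w => a b [c e]. Qed.

Lemma ImcD z w : Im (z + w) = Im z + Im w.
Proof. by case: z w => a b [c e]. Qed.

Lemma RecN z : Re (- z) = - Re z.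
Proof. by case: z. Qed.

Lemma ImcN z : Im (- z) = - Im z.
Proof. by case: z. Qed.

Lemma Rec_conj z : Re (conjc z) = Re z.
Proof. by case: z. Qed.

Lemma Imc_conj z : Im (conjc z) = - Im z.
Proof. by case: z. Qed.

Lemma complex_ext z w : Re z = Re w -> Im z = Im w -> z = w.
Proof. by case: z w => a b [c e] /= -> ->. Qed.

Lemma conjcM z w : conjc (z * w) = conjc z * conjc w.
Proof. by apply: complex_ext; rewrite !(RecM, ImcM, Rec_conj, Imc_conj); ring. Qed.

Lemma conjc_involutive z : conjc (conjc z) = z.
Proof. by case: z => a b /=; rewrite opprK. Qed.

Lemma expiD (s t : R) : expi (s + t) = expi s * expi t.
Proof. by apply: complex_ext; rewrite ?RecM ?ImcM /= ?cosD ?sinD//; ring. Qed.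

Lemma expi0 : expi (0 : R) = 1.
Proof. by rewrite /expi cos0 sin0. Qed.

Lemma expiN (s : R) : expi (- s) = conjc (expi s).
Proof. by rewrite /expi cosN sinN. Qed.

Lemma expi_pi : expi (pi : R) = - 1.
Proof. by apply: complex_ext; rewrite /expi cospi sinpi /= ?oppr0. Qed.

Lemma normc_expi (s : R) : normc (expi s) = 1.
Proof. by rewrite /expi /= cos2Dsin2 sqrtr1. Qed.

Lemma normc_expiM (s : R) z : normc (expi s * z) = normc z.
Proof. by rewrite Normc.normcM normc_expi mul1r. Qed.

End complex_numbers.

Section complex_convergence.
Context {R : realType}.

(** Convergence is taken componentwise so that limit theorems for real functions apply directly;
    [ccvg_normc] and [normc_ccvg] translate to convergence of the modulus, the form used in the
    theorem. *)
Definition ccvg {T : Type} (F : set_system T) (u : T -> R[i]) (l : R[i]) :=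
  (Re (u x) @[x --> F] --> Re l) /\ (Im (u x) @[x --> F] --> Im l).

Context {T : Type} {F : set_system T} {FF : Filter F}.
Implicit Types (u v : T -> R[i]) (l k : R[i]).

Lemma ccvg_cst l : ccvg F (fun=> l) l.
Proof. by split; exact: cvg_cst. Qed.

Lemma ccvgD u v l k : ccvg F u l -> ccvg F v k ->
  ccvg F (fun x => u x + v x) (l + k).
Proof.
move=> [ul ul'] [vk vk']; rewrite /ccvg RecD ImcD; split.
  by under eq_fun do rewrite RecD; exact: cvgD.
by under eq_fun do rewrite ImcD; exact: cvgD.
Qed.

Lemma ccvgN u l : ccvg F u l -> ccvg F (fun x => - u x) (- l).
Proof.
move=> [ul ul']; rewrite /ccvg RecN ImcN; split.
  by under eq_fun do rewrite RecN; exact: cvgN.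
by under eq_fun do rewrite ImcN; exact: cvgN.
Qed.

Lemma ccvgM u v l k : ccvg F u l -> ccvg F v k ->
  ccvg F (fun x => u x * v x) (l * k).
Proof.
move=> [ul ul'] [vk vk']; rewrite /ccvg RecM ImcM; split.
  by under eq_fun do rewrite RecM; apply: cvgB; exact: cvgM.
by under eq_fun do rewrite ImcM; apply: cvgD; exact: cvgM.
Qed.

Lemma ccvg_conj u l : ccvg F u l -> ccvg F (fun x => conjc (u x)) (conjc l).
Proof.
move=> [ul ul']; rewrite /ccvg Rec_conj Imc_conj; split.
  by under eq_fun do rewrite Rec_conj; exact: ul.
by under eq_fun do rewrite Imc_conj; exact: cvgN.
Qed.

Lemma ccvg_real (f : T -> R) (l : R) : f x @[x --> F] --> l ->
  ccvg F (fun x => (f x)%:C) l%:C.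
Proof. by move=> fl; split => //=; exact: cvg_cst. Qed.

Lemma ccvg_expi (f : T -> R) (l : R) : f x @[x --> F] --> l ->
  ccvg F (fun x => expi (f x)) (expi l).
Proof.
move=> fl; split => /=; apply: continuous_cvg fl.
  exact: continuous_cos.
exact: continuous_sin.
Qed.

Lemma ccvg_normc u l : ccvg F u l -> normc (u x - l) @[x --> F] --> (0 : R).
Proof.
move=> [ul ul'].
have h : (fun x => `|Re (u x) - Re l| + `|Im (u x) - Im l|) @ F --> (0 : R).
  rewrite -(addr0 0); apply: cvgD.
    by rewrite -(normr0 R) -(subrr (Re l)); apply: cvg_norm; apply: cvgB => //;
      exact: cvg_cst.
  by rewrite -(normr0 R) -(subrr (Im l)); apply: cvg_norm; apply: cvgB => //;
    exact: cvg_cst.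
apply: (squeeze_cvgr _ _ h); last exact: cvg_cst.
apply: nearW => x; rewrite normc_ge0 /=.
by apply: le_trans (normc_ReIm _) _; rewrite RecD ImcD RecN ImcN.
Qed.

Lemma normc_ccvg u l : normc (u x - l) @[x --> F] --> (0 : R) -> ccvg F u l.
Proof.
move=> h; split; apply/cvgrPdist_le => e e0; move/cvgrPdist_le : h => /(_ e e0).
  apply: filterS => x; rewrite sub0r normrN (ger0_norm (normc_ge0 _)) => le.
  rewrite distrC; apply: le_trans _ le; rewrite -RecN -RecD.
  exact: normr_Re_le.
apply: filterS => x; rewrite sub0r normrN (ger0_norm (normc_ge0 _)) => le.
rewrite distrC; apply: le_trans _ le; rewrite -ImcN -ImcD.
exact: normr_Im_le.
Qed.

Lemma ccvg_squeeze u l (g : T -> R) : g x @[x --> F] --> (0 : R) ->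
  (\forall x \near F, normc (u x - l) <= g x) -> ccvg F u l.
Proof.
move=> g0 ug; apply: normc_ccvg.
apply: (@squeeze_cvgr _ _ _ _ (fun=> 0) g); [|exact: cvg_cst|exact: g0].
by move: ug; apply: filterS => x ->; rewrite normc_ge0.
Qed.

End complex_convergence.

Section complex_continuity.
Context {R : realType} {X : topologicalType}.
Implicit Types f g : X -> R[i].

Definition ccontinuous f := forall x, ccvg (nbhs x) f (f x).

Lemma ccontinuousP f : ccontinuous f <->
  continuous (fun x => Re (f x)) /\ continuous (fun x => Im (f x)).
Proof. split=> [fc|[fr fi] x]; first by split=> x; case: (fc x).
by split; [exact: fr|exact: fi]. Qed.

Lemma ccontinuous_cst (z : R[i]) : ccontinuous (fun _ : X => z).
Proof. by move=> x; exact: ccvg_cst. Qed.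

Lemma ccontinuousD f g : ccontinuous f -> ccontinuous g ->
  ccontinuous (fun x => f x + g x).
Proof. by move=> fc gc x; apply: ccvgD; [exact: fc|exact: gc]. Qed.

Lemma ccontinuousN f : ccontinuous f -> ccontinuous (fun x => - f x).
Proof. by move=> fc x; apply: ccvgN; exact: fc. Qed.

Lemma ccontinuousM f g : ccontinuous f -> ccontinuous g ->
  ccontinuous (fun x => f x * g x).
Proof. by move=> fc gc x; apply: ccvgM; [exact: fc|exact: gc]. Qed.

Lemma ccontinuous_conj f : ccontinuous f -> ccontinuous (fun x => conjc (f x)).
Proof. by move=> fc x; apply: ccvg_conj; exact: fc. Qed.

Lemma ccontinuous_real (f : X -> R) : continuous f ->
  ccontinuous (fun x => (f x)%:C).
Proof. by move=> fc x; apply: ccvg_real; exact: fc. Qed.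

Lemma ccontinuous_expi (f : X -> R) : continuous f ->
  ccontinuous (fun x => expi (f x)).
Proof. by move=> fc x; apply: ccvg_expi; exact: fc. Qed.

Lemma continuous_normc f : ccontinuous f -> continuous (fun x => normc (f x)).
Proof.
move=> fc x; apply/cvgrPdist_le => e e0.
have h : normc (f y - f x) @[y --> x] --> (0 : R) by apply: ccvg_normc (fc x).
move/cvgrPdist_le : h => /(_ e e0).
apply: filterS => y; rewrite sub0r normrN (ger0_norm (normc_ge0 _)) => le.
apply: le_trans _ le; rewrite ler_norml lerBlDr lerNl opprB lerBlDr.
by rewrite {2}normcBC; apply/andP; split; apply: le_trans (normcD _ _); rewrite subrK.
Qed.

End complex_continuity.

Lemma ccontinuous_comp {R : realType} {X Y : topologicalType} (f : Y -> R[i])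
  (h : X -> Y) : ccontinuous f -> continuous h -> ccontinuous (fun x => f (h x)).
Proof.
move=> /ccontinuousP[fr fi] hc; apply/ccontinuousP; split => x.
  by apply: (@continuous_comp _ _ _ h (fun y => Re (f y))); [exact: hc|exact: fr].
by apply: (@continuous_comp _ _ _ h (fun y => Im (f y))); [exact: hc|exact: fi].
Qed.

Section complex_integral.
Context {R : realType} {d : measure_display} {T : measurableType d}.
Context {mu : {measure set T -> \bar R}} {D : set T} (mD : measurable D).
Implicit Types F G : T -> R[i].

Definition cmeasurable (A : set T) F :=
  measurable_fun A (fun x => Re (F x)) /\ measurable_fun A (fun x => Im (F x)).

Definition cintegrable (nu : {measure set T -> \bar R}) (A : set T) F :=
  nu.-integrable A (EFin \o (fun x => Re (F x))) /\
  nu.-integrable A (EFin \o (fun x => Im (F x))).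

Lemma eq_cintegral F G : (forall x, D x -> F x = G x) ->
  cintegral mu D F = cintegral mu D G.
Proof.
move=> FG; rewrite /cintegral; congr (_ +i* _); apply: eq_Rintegral => x;
  by rewrite inE => Dx; rewrite FG.
Qed.

Lemma Re_cintegral F : Re (cintegral mu D F) = \int[mu]_(x in D) Re (F x).
Proof. by []. Qed.

Lemma Im_cintegral F : Im (cintegral mu D F) = \int[mu]_(x in D) Im (F x).
Proof. by []. Qed.

Lemma le_integrableR (f g : T -> R) : measurable_fun D f ->
  (forall x, D x -> `|f x| <= g x) -> mu.-integrable D (EFin \o g) ->
  mu.-integrable D (EFin \o f).
Proof.
move=> mf fg; apply: le_integrable => //; first exact/measurable_EFinP.
by move=> x Dx /=; rewrite lee_fin; exact: le_trans (fg _ Dx) (ler_norm _).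
Qed.

Lemma le_cintegrable F (g : T -> R) : cmeasurable D F ->
  (forall x, D x -> normc (F x) <= g x) -> mu.-integrable D (EFin \o g) ->
  cintegrable mu D F.
Proof.
move=> [mr mi] Fg ig; split.
  by apply: le_integrableR ig => // x Dx; apply: le_trans (normr_Re_le _) (Fg _ Dx).
by apply: le_integrableR ig => // x Dx; apply: le_trans (normr_Im_le _) (Fg _ Dx).
Qed.

Lemma cintegrableD F G : cintegrable mu D F -> cintegrable mu D G ->
  cintegrable mu D (fun x => F x + G x).
Proof.
move=> [Fr Fi] [Gr Gi]; split.
  have := integrableD mD Fr Gr; apply: eq_integrable => // x _ /=.
  by rewrite RecD EFinD.
have := integrableD mD Fi Gi; apply: eq_integrable => // x _ /=.
by rewrite ImcD EFinD.
Qed.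

Lemma cintegralD F G : cintegrable mu D F -> cintegrable mu D G ->
  cintegral mu D (fun x => F x + G x) = cintegral mu D F + cintegral mu D G.
Proof.
move=> [Fr Fi] [Gr Gi]; apply: complex_ext.
  by rewrite RecD !Re_cintegral -RintegralD//; under eq_Rintegral do rewrite RecD.
by rewrite ImcD !Im_cintegral -RintegralD//; under eq_Rintegral do rewrite ImcD.
Qed.

Lemma integrableZlR (f : T -> R) (k : R) : mu.-integrable D (EFin \o f) ->
  mu.-integrable D (EFin \o (fun x => k * f x)).
Proof.
move=> fi; have := integrableZl mD k fi.
by apply: eq_integrable => // x _ /=; rewrite EFinM.
Qed.

Lemma integrableBR (f g : T -> R) : mu.-integrable D (EFin \o f) ->
  mu.-integrable D (EFin \o g) -> mu.-integrable D (EFin \o (fun x => f x - g x)).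
Proof.
move=> fi gi; have := integrableB mD fi gi.
by apply: eq_integrable => // x _ /=; rewrite EFinB.
Qed.

Lemma integrableDR (f g : T -> R) : mu.-integrable D (EFin \o f) ->
  mu.-integrable D (EFin \o g) -> mu.-integrable D (EFin \o (fun x => f x + g x)).
Proof.
move=> fi gi; have := integrableD mD fi gi.
by apply: eq_integrable => // x _ /=; rewrite EFinD.
Qed.

Lemma cintegrableZ F (z : R[i]) : cintegrable mu D F ->
  cintegrable mu D (fun x => z * F x).
Proof.
move=> [Fr Fi]; split.
  have := integrableBR (integrableZlR (Re z) Fr) (integrableZlR (Im z) Fi).
  by apply: eq_integrable => // x _ /=; rewrite RecM.
have := integrableDR (integrableZlR (Re z) Fi) (integrableZlR (Im z) Fr).
by apply: eq_integrable => // x _ /=; rewrite ImcM.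
Qed.

Lemma cintegralZ F (z : R[i]) : cintegrable mu D F ->
  cintegral mu D (fun x => z * F x) = z * cintegral mu D F.
Proof.
move=> [Fr Fi]; apply: complex_ext.
  rewrite RecM !Re_cintegral !Im_cintegral -!RintegralZl//.
  rewrite -RintegralB//; [|exact: integrableZlR..].
  by under eq_Rintegral do rewrite RecM.
rewrite ImcM !Re_cintegral !Im_cintegral -!RintegralZl//.
rewrite -RintegralD//; [|exact: integrableZlR..].
by under eq_Rintegral do rewrite ImcM.
Qed.

Lemma cintegralB F G : cintegrable mu D F -> cintegrable mu D G ->
  cintegral mu D (fun x => F x - G x) = cintegral mu D F - cintegral mu D G.
Proof.
move=> iF iG.
have -> : (fun x => F x - G x) = (fun x => F x + (- 1) * G x).
  by apply/funext => x; rewrite mulN1r.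
by rewrite cintegralD ?cintegralZ ?mulN1r//; exact: cintegrableZ.
Qed.

(** The factor 2 comes from bounding the real and imaginary integrals separately. It is harmless,
    since constants are never optimised later. *)
Lemma normc_cintegral_le F (g : T -> R) : cmeasurable D F ->
  (forall x, D x -> normc (F x) <= g x) -> mu.-integrable D (EFin \o g) ->
  normc (cintegral mu D F) <= 2 * \int[mu]_(x in D) g x.
Proof.
move=> mF Fg ig; have [Fr Fi] := le_cintegrable mF Fg ig.
have le1 (f : T -> R) : mu.-integrable D (EFin \o f) ->
    (forall x, D x -> `|f x| <= g x) ->
    `|\int[mu]_(x in D) f x| <= \int[mu]_(x in D) g x.
  move=> fi fg; apply: le_trans (le_normr_Rintegral mD fi) _.
  by apply: le_Rintegral => //; have := integrable_abse fi.
rewrite mulr_natl mulr2n; apply: le_trans (normc_ReIm _) (lerD _ _).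
  by apply: le1 => // x Dx; exact: le_trans (normr_Re_le _) (Fg _ Dx).
by apply: le1 => // x Dx; exact: le_trans (normr_Im_le _) (Fg _ Dx).
Qed.

Lemma Rintegral_dominated_cvg (f_ : nat -> T -> R) (f g : T -> R) :
  (forall n, measurable_fun D (f_ n)) ->
  (forall x, D x -> f_ n x @[n --> \oo] --> f x) ->
  mu.-integrable D (EFin \o g) ->
  (forall n x, D x -> `|f_ n x| <= g x) ->
  \int[mu]_(x in D) f_ n x @[n --> \oo] --> \int[mu]_(x in D) f x.
Proof.
move=> mf fc ig fg.
have mf0 : measurable_fun D f by apply: (measurable_fun_cvg mf).
have f0g x : D x -> `|f x| <= g x.
  move=> Dx; have fx : `|f_ n x| @[n --> \oo] --> `|f x|.
    by apply: cvg_norm; exact: fc.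
  rewrite -(cvg_lim _ fx)//; apply: limr_le; first by apply/cvg_ex; exists `|f x|.
  by apply: nearW => n; exact: fg.
have if0 : mu.-integrable D (EFin \o f) by exact: le_integrableR f0g ig.
have := @dominated_cvg _ _ _ mu D mD (fun n => EFin \o f_ n) (EFin \o f)
  (EFin \o g).
move=> /(_ _ _ _ ig); rewrite /Rintegral => h.
apply: fine_cvg; rewrite fineK; last exact: integrable_fin_num.
apply: h => //.
- by move=> n; exact/measurable_EFinP.
- by move=> x Dx; apply: cvg_EFin; [exact: nearW|exact: fc].
Qed.

Lemma cintegral_dominated_ccvg (F_ : nat -> T -> R[i]) F (g : T -> R) :
  (forall n, cmeasurable D (F_ n)) ->
  (forall x, D x -> ccvg \oo (fun n => F_ n x) (F x)) ->
  mu.-integrable D (EFin \o g) ->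
  (forall n x, D x -> normc (F_ n x) <= g x) ->
  ccvg \oo (fun n => cintegral mu D (F_ n)) (cintegral mu D F).
Proof.
move=> mF Fc ig Fg; split; apply: Rintegral_dominated_cvg ig _.
- by move=> n; have [] := mF n.
- by move=> x Dx; have [] := Fc x Dx.
- by move=> n x Dx; exact: le_trans (normr_Re_le _) (Fg _ _ Dx).
- by move=> n; have [] := mF n.
- by move=> x Dx; have [] := Fc x Dx.
- by move=> n x Dx; exact: le_trans (normr_Im_le _) (Fg _ _ Dx).
Qed.

Lemma cmeasurable_cst (z : R[i]) : cmeasurable D (fun=> z).
Proof. by split; exact: measurable_cst. Qed.

Lemma cmeasurableD F G : cmeasurable D F -> cmeasurable D G ->
  cmeasurable D (fun x => F x + G x).
Proof.
move=> [Fr Fi] [Gr Gi]; split.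
  by under eq_fun do rewrite RecD; exact: measurable_funD.
by under eq_fun do rewrite ImcD; exact: measurable_funD.
Qed.

Lemma cmeasurableM F G : cmeasurable D F -> cmeasurable D G ->
  cmeasurable D (fun x => F x * G x).
Proof.
move=> [Fr Fi] [Gr Gi]; split.
  by under eq_fun do rewrite RecM; apply: measurable_funB; exact: measurable_funM.
by under eq_fun do rewrite ImcM; apply: measurable_funD; exact: measurable_funM.
Qed.

Lemma cmeasurable_real (f : T -> R) : measurable_fun D f ->
  cmeasurable D (fun x => (f x)%:C).
Proof. by move=> mf; split => //=; exact: measurable_cst. Qed.

End complex_integral.

Lemma ccvg_pinftyE {R : realType} (g : R -> R[i]) l :
  ccvg_pinfty g l <-> ccvg (pinfty_nbhs R) g l.
Proof. by split => h; [exact: normc_ccvg|exact: ccvg_normc]. Qed.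

(** Dominated convergence is a statement about sequences; this criterion reduces limits at +oo to
    arbitrary sequences tending to +oo. *)
Lemma ccvg_pinfty_seq {R : realType} (g : R -> R[i]) l :
  (forall u : R^nat, u n @[n --> \oo] --> +oo -> ccvg \oo (fun n => g (u n)) l) ->
  ccvg (pinfty_nbhs R) g l.
Proof.
move=> h; split.
  by apply/(cvg_pinftyP (fun x => Re (g x))) => u /h[].
by apply/(cvg_pinftyP (fun x => Im (g x))) => u /h[].
Qed.
(** * Integration over R^d *)

Section measurable_basis.
(* Makes every open set measurable for h without requiring a Borel structure on X. *)
Definition measurable_basis {d} {T : measurableType d} {X : topologicalType}
    (h : T -> X) :=
  exists B : nat -> set X, (forall n, measurable (h @^-1` B n)) /\
    forall x U, nbhs x U -> exists2 n, B n x & B n `<=` U.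

Lemma measurable_basis_countable {d} {T : measurableType d}
    {X : topologicalType} (h : T -> X) (I : countType) (B : I -> set X) :
  (forall i, measurable (h @^-1` B i)) ->
  (forall x U, nbhs x U -> exists2 i, B i x & B i `<=` U) ->
  measurable_basis h.
Proof.
move=> mB BU; exists (fun n => if unpickle n is Some i then B i else set0).
split=> [n|x U /BU[i Bi BiU]]; last by exists (pickle i); rewrite pickleK.
by case: unpickle => [i|]; [exact: mB|rewrite preimage_set0].
Qed.

Lemma measurable_basis_open {d} {T : measurableType d} {X : topologicalType}
    (h : T -> X) (U : set X) : measurable_basis h -> open U ->
  measurable (h @^-1` U).
Proof.
move=> [B [mB BU]] oU.
rewrite (_ : _ @^-1` _ = \bigcup_(n in [set n | B n `<=` U]) (h @^-1` B n)).
  by apply: bigcup_measurable => n _; exact: mB.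
apply/seteqP; split=> [x /= Ux|x [n /= BnU /BnU]//].
by have [|n] := BU (h x) U; [exact: open_nbhs_nbhs|exists n].
Qed.

(** Serves to obtain joint measurability of continuous functions of two vectors for the product
    sigma-algebra, as Fubini requires. *)
Lemma measurable_basis_pair {d1 d2} {T1 : measurableType d1}
    {T2 : measurableType d2} {X Y : topologicalType} (h : T1 -> X)
    (k : T2 -> Y) : measurable_basis h -> measurable_basis k ->
  measurable_basis (fun p : T1 * T2 => (h p.1, k p.2)).
Proof.
move=> [A [mA AU]] [B [mB BU]].
apply: (@measurable_basis_countable _ _ _ _ (nat * nat)%type
  (fun n => A n.1 `*` B n.2)).
  move=> n; rewrite (_ : _ @^-1` _ = (h @^-1` A n.1) `*` (k @^-1` B n.2)).
    by apply: measurableX; [exact: mA|exact: mB].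
  by apply/seteqP; split.
move=> [x y] U [[P Q] /= [xP yQ] PQU].
have [m Am AmP] := AU _ _ xP; have [n Bn BnQ] := BU _ _ yQ.
by exists (m, n) => //= -[a b] /= [Ama Bnb]; apply: PQU; split; [exact: AmP|exact: BnQ].
Qed.

Context {R : realType}.

Lemma measurable_basis_continuous {d} {T : measurableType d}
    {X : topologicalType} (h : T -> X) (f : X -> R) : measurable_basis h ->
  continuous f -> measurable_fun setT (fun t => f (h t)).
Proof.
move=> hB /continuousP cf; apply: (measurability _ (RGenOpens.measurableE R)).
move=> _ [_ [a [b ->] <-]]; rewrite setTI.
apply: (@measurable_basis_open _ _ _ h (f @^-1` `]a, b[)) => //.
exact/cf/interval_open.
Qed.

Definition rowt n (t : n.-tuple R) : 'rV[R]_n := \row_i tnth t i.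

Lemma rowt_measurable_basis n : measurable_basis (@rowt n).
Proof.
(* The basis consists of sup-norm cubes with rational centre and radius 1 / (m + 1). A radius below
   e / 2 leaves room to move the centre from x to a rational point. *)
apply: (@measurable_basis_countable _ _ _ _ ({ffun 'I_n -> rat} * nat)%type
  (fun p => [set x : 'rV[R]_n | forall i, `|x 0 i - ratr (p.1 i)| < p.2.+1%:R^-1])).
  move=> [q m] /=; rewrite (_ : _ @^-1` _ = \bigcap_(i : 'I_n)
      ((fun t : n.-tuple R => tnth t i) @^-1`
        ball (ratr (q i) : R) (m.+1%:R^-1))).
    apply: fin_bigcap_measurable => // i _.
    rewrite -[X in measurable X]setTI; apply: measurable_tnth => //.
    exact: measurable_ball.
  apply/seteqP; split=> t /=.
    by move=> h i _; have := h i; rewrite mxE /ball /= distrC.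
  by move=> h i; have := h i Logic.I; rewrite mxE /ball /= distrC.
move=> x U /nbhs_ballP[e /= e0 xeU].
have [m m2] : exists m : nat, m.+1%:R^-1 < e / 2.
  have [m h] := ltr_add_invr (y := 0) (x := e / 2) (divr_gt0 e0 (ltr0Sn _ 1)).
  by exists m; rewrite add0r in h.
have q_ (i : 'I_n) : {q : rat | `|x 0 i - ratr q| < m.+1%:R^-1}.
  apply: cid; have [] := @rat_in_itvoo R (x 0 i - m.+1%:R^-1) (x 0 i + m.+1%:R^-1).
    by rewrite ltrD2l gtrN// invr_gt0.
  move=> q; rewrite in_itv/= => /andP[q1 q2]; exists q.
  by rewrite distrC ltr_distl q1 q2.
exists ([ffun i => sval (q_ i)], m) => /=.
  by move=> i; rewrite ffunE; exact: (svalP (q_ i)).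
move=> y /= yq; apply: xeU; rewrite mx_norm_ball /ball_ /=.
rewrite [`|_|]mx_normrE; apply: bigmax_lt => // -[i j] _ /=; rewrite !mxE (ord1 i).
have := yq j; rewrite ffunE => yj; have xj := svalP (q_ j).
rewrite (_ : x 0 j - y 0 j = (x 0 j - ratr (sval (q_ j))) +
  (ratr (sval (q_ j)) - y 0 j)); last by ring.
apply: le_lt_trans (ler_normD _ _) _; rewrite (distrC (ratr _)).
apply: lt_trans (ltrD xj yj) _.
by rewrite [ltRHS]splitr ltrD.
Qed.

End measurable_basis.

Section image_measure.
Context {R : realType} {d1 d2 : measure_display}.
Context {X : measurableType d1} {Y : measurableType d2}.
Variables (mu : {measure set X -> \bar R}) (nu : {measure set Y -> \bar R}).
Variables (phi : X -> Y) (mphi : measurable_fun setT phi) (c : {nonneg R}).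
Hypothesis munu : forall A, measurable A ->
  mu (phi @^-1` A) = ((c%:num)%:E * nu A)%E.

(** By [munu] the image of mu under phi is c nu. One change of variables thus serves dilations and
    translations, reflections, and the consing map behind [lebesgue_tuple]. *)
Lemma ge0_integral_image (f : Y -> \bar R) : measurable_fun setT f ->
  (forall y, 0 <= f y)%E ->
  (\int[mu]_x f (phi x) = (c%:num)%:E * \int[nu]_y f y)%E.
Proof.
move=> mf f0.
have := ge0_integral_pushforward mphi mu measurableT mf (fun x _ => f0 x).
rewrite preimage_setT => <-.
rewrite -(ge0_integral_mscale nu measurableT c mf (fun x _ => f0 x)).
by apply: eq_measure_integral => A mA _; exact: munu.
Qed.

Lemma integral_image (f : Y -> \bar R) : nu.-integrable setT f ->
  (\int[mu]_x f (phi x) = (c%:num)%:E * \int[nu]_y f y)%E.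
Proof.
move=> fi; have mf := measurable_int _ fi.
rewrite integralE (integralE nu).
have -> : (\int[mu]_x (fun x => f (phi x))^\+%E x =
    (c%:num)%:E * \int[nu]_y f^\+%E y)%E.
  rewrite -ge0_integral_image//; last exact: measurable_funepos.
  by apply: eq_integral => x _; rewrite !funeposE.
have -> : (\int[mu]_x (fun x => f (phi x))^\-%E x =
    (c%:num)%:E * \int[nu]_y f^\-%E y)%E.
  rewrite -ge0_integral_image//; last exact: measurable_funeneg.
  by apply: eq_integral => x _; rewrite !funenegE.
by rewrite -muleBr// fin_num_adde_defr// integrable_pos_fin_num.
Qed.

Lemma Rintegral_image (f : Y -> R) : nu.-integrable setT (EFin \o f) ->
  \int[mu]_x f (phi x) = c%:num * \int[nu]_y f y.
Proof.
move=> fi; rewrite /Rintegral (integral_image fi) fineM//.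
exact: integrable_fin_num.
Qed.

End image_measure.

Section lebesgue_affine.
Context {R : realType}.
Local Notation mu := (@lebesgue_measure R).

Lemma measurable_affine (a b : R) : measurable_fun setT (fun x : R => a * x + b).
Proof.
apply: continuous_measurable_fun => x.
by apply: cvgD; [apply: cvgM; [exact: cvg_cst|exact: cvg_id]|exact: cvg_cst].
Qed.

(** Lebesgue measure is characterised by its values on the intervals []u, v]], and a times the image
    measure gives each of them its length. *)
Lemma lebesgue_measure_affine (a b : R) (A : set R) : 0 < a -> measurable A ->
  (mu ((fun x => (a * x + b)%R) @^-1` A) = a^-1%:E * mu A)%E.
Proof.
move=> a0 mA; pose phi x : R := a * x + b.
have mphi : measurable_fun setT phi by exact: measurable_affine.
have [nu nuE] : exists nu : {measure set (measurableTypeR R) -> \bar R},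
    forall B, nu B = (a%:E * mu (phi @^-1` B))%E.
  by exists (mscale (NngNum (ltW a0))
    (@measure_function_pushforward__canonical__measure_function_Measure
      _ _ (measurableTypeR R) (measurableTypeR R) R mu phi mphi)).
have -> : mu A = nu A.
  apply: lebesgue_measure_unique => // _ [[u v] _ <-] /=.
  rewrite nuE; have -> : phi @^-1` `]u, v] = `](u - b) / a, (v - b) / a]%classic.
    apply/seteqP; split=> x /=; rewrite /phi !in_itv /= ltr_pdivrMr// ler_pdivlMr//.
      by rewrite ltrBlDr lerBrDr (mulrC x).
    by rewrite ltrBlDr lerBrDr (mulrC x).
  rewrite !lebesgue_measure_itv /= !lte_fin ltr_pM2r ?invr_gt0// ltrD2r.
  case: ifP => _; last by rewrite mule0.
  by rewrite -!EFinB -EFinM; congr EFin; field; rewrite gt_eqF.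
by rewrite nuE muleA -EFinM mulVf ?gt_eqF// mul1e.
Qed.

Lemma ge0_integral_affine (a b : R) (f : R -> \bar R) : 0 < a ->
  measurable_fun setT f -> (forall x, 0 <= f x)%E ->
  (\int[mu]_x f (a * x + b)%R = a^-1%:E * \int[mu]_x f x)%E.
Proof.
move=> a0 mf f0; have an : 0 <= a^-1 by rewrite invr_ge0 ltW.
apply: (@ge0_integral_image _ _ _ (measurableTypeR R) (measurableTypeR R) mu mu
  (fun x => a * x + b) (measurable_affine a b) (NngNum an)) => // A mA.
exact: lebesgue_measure_affine.
Qed.

End lebesgue_affine.

Section tuple_integral.
Context {R : realType}.
Local Notation mu := (@lebesgue_measure R).
Local Notation lam n := (@lebesgue_tuple R n).

Let mcons n : measurable_fun setT
  (@tuple_cons R n : measurableTypeR R * n.-tuple R -> n.+1.-tuple R).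
Proof. exact: measurable_tuple_cons. Qed.

Lemma ge0_integral_tuple_cons n (f : n.+1.-tuple R -> \bar R) :
  measurable_fun setT f -> (forall t, 0 <= f t)%E ->
  (\int[lam n.+1]_t f t = \int[mu]_x \int[lam n]_t f (tuple_cons (x, t)))%E.
Proof.
move=> mf f0.
rewrite -(fubini_tonelli1 (m1 := mu) (m2 := lam n) (fun p => f (tuple_cons p)))//.
  rewrite (@ge0_integral_image _ _ _ _ _ (mu \x lam n)%E (lam n.+1) _ (@mcons n) 1%:nng)//.
    by rewrite mul1e.
  by move=> A mA; rewrite mul1e.
exact: (measurableT_comp mf (@mcons n)).
Qed.

Definition tuple_affine n (a : R) (b t : n.-tuple R) : n.-tuple R :=
  [tuple a * tnth t i + tnth b i | i < n].

Lemma measurable_tuple_affine n a b :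
  measurable_fun setT (@tuple_affine n a b).
Proof.
apply/measurable_fun_tnthP => i.
rewrite (_ : _ \o _ = (fun x => a * x + tnth b i) \o (fun t => tnth t i)).
  by apply: (measurableT_comp (measurable_affine a (tnth b i))); exact: measurable_tnth.
by apply/funext => t /=; rewrite tnth_mktuple.
Qed.

Lemma tuple_affine_cons n a (b : n.+1.-tuple R) x (t : n.-tuple R) :
  tuple_affine a b (tuple_cons (x, t)) =
  tuple_cons (a * x + tnth b ord0, tuple_affine a [tuple of behead b] t).
Proof.
apply: eq_from_tnth => i; rewrite tnth_mktuple.
have [j ->|->] := unliftP ord0 i; last by rewrite !(tnth_nth 0).
rewrite !(tnth_nth 0) /= -(tnth_nth 0 (tuple_affine _ _ _)) tnth_mktuple.
by rewrite !(tnth_nth 0) /= nth_behead.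
Qed.

(** Induction on n: Tonelli splits off the head coordinate, whose dilation contributes one factor 1
    / a. *)
Lemma ge0_integral_tuple_affine n a b (f : n.-tuple R -> \bar R) : 0 < a ->
  measurable_fun setT f -> (forall t, 0 <= f t)%E ->
  (\int[lam n]_t f (tuple_affine a b t) = (a ^- n)%:E * \int[lam n]_t f t)%E.
Proof.
move=> a0; elim: n b f => [|n IH] b f mf f0.
  rewrite expr0 invr1 mul1e; apply: eq_integral => t _.
  by rewrite [tuple_affine _ _ _]tuple0 [t]tuple0.
have mfc : measurable_fun setT (f \o @tuple_cons R n).
  exact: (measurableT_comp mf (@measurable_tuple_cons R n)).
have mF : measurable_fun setT (fun x => \int[lam n]_t f (tuple_cons (x, t)))%E.
  have := @measurable_fun_fubini_tonelli_F _ _ (measurableTypeR R) _ R (lam n)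
    (fun p => f (tuple_cons p)).
  by rewrite /fubini_F; apply; first exact: (measurableT_comp mf (@mcons n)).
rewrite ge0_integral_tuple_cons//; last first.
  exact: (measurableT_comp mf (@measurable_tuple_affine _ _ _)).
rewrite [X in (_ * X)%E]ge0_integral_tuple_cons//.
under eq_integral => x _.
  under eq_integral do rewrite tuple_affine_cons.
  rewrite (IH _ (fun t => f (tuple_cons (a * x + tnth b ord0, t))))//; last first.
    by apply: (measurableT_comp mfc); exact: pair1_measurable.
  over.
rewrite ge0_integralZl.
- rewrite (@ge0_integral_affine _ a _ (fun x => \int[lam n]_t f (tuple_cons (x, t)))%E)//.
    by rewrite muleA -EFinM exprSr invfM.
  by move=> x; exact: integral_ge0.
- exact: measurableT.
- exact: (measurableT_comp mF (measurable_affine _ _)).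
- by move=> x _; exact: integral_ge0.
- by rewrite lee_fin invr_ge0 exprn_ge0// ltW.
Qed.

Lemma lebesgue_tuple_affine n a b (A : set (n.-tuple R)) : 0 < a ->
  measurable A -> (lam n (tuple_affine a b @^-1` A) = (a ^- n)%:E * lam n A)%E.
Proof.
move=> a0 mA; rewrite -[in RHS](setIT A) -integral_indic//.
have := @ge0_integral_tuple_affine n a b (fun t => (\1_A t)%:E) a0.
move=> <-; [|exact/measurable_EFinP/measurable_indicP|by move=> t; rewrite lee_fin].
rewrite -[X in lam n X](setIT (tuple_affine a b @^-1` A)) -integral_indic//.
by rewrite -[X in measurable X]setTI; exact: measurable_tuple_affine.
Qed.

Lemma Rintegral_tuple_affine n a b (f : n.-tuple R -> R) : 0 < a ->
  (lam n).-integrable setT (EFin \o f) ->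
  \int[lam n]_t f (tuple_affine a b t) = a ^- n * \int[lam n]_t f t.
Proof.
move=> a0; have an : 0 <= a ^- n by rewrite invr_ge0 exprn_ge0// ltW.
apply: (@Rintegral_image _ _ _ _ _ _ _ _ (@measurable_tuple_affine n a b) (NngNum an)).
by move=> A mA; exact: lebesgue_tuple_affine.
Qed.

End tuple_integral.

Section real_fubini.
Context {R : realType} {d1 d2 : measure_display}.
Context {T1 : measurableType d1} {T2 : measurableType d2}.
Variables (m1 : {sigma_finite_measure set T1 -> \bar R}).
Variables (m2 : {sigma_finite_measure set T2 -> \bar R}).
Variables (f : T1 * T2 -> R) (g : T1 -> R) (h : T2 -> R).
Hypothesis mf : measurable_fun setT f.
Hypothesis fgh : forall x y, `|f (x, y)| <= g x * h y.
Hypothesis ig : m1.-integrable setT (EFin \o g).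
Hypothesis ih : m2.-integrable setT (EFin \o h).

Lemma integrable_pair1 y : m1.-integrable setT (EFin \o (fun x => f (x, y))).
Proof.
apply: (le_integrableR measurableT (g := fun x => h y * g x)) => //.
- exact: measurable_fun_pair1.
- by move=> x _; rewrite mulrC; exact: fgh.
- exact: integrableZlR.
Qed.

Lemma integrable_pair2 x : m2.-integrable setT (EFin \o (fun y => f (x, y))).
Proof.
apply: (le_integrableR measurableT (g := fun y => g x * h y)) => //.
- exact: measurable_fun_pair2.
- exact: integrableZlR.
Qed.

(** A product majorant turns the iterated integral of the modulus into a product of two finite
    integrals. *)
Lemma integrable_prod_dominated : (m1 \x m2)%E.-integrable setT (EFin \o f).
Proof.
apply/integrable12ltyP; first exact/measurable_EFinP.
have [mg mh] : measurable_fun setT g /\ measurable_fun setT h.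
  by split; apply/measurable_EFinP; [exact: measurable_int ig|exact: measurable_int ih].
apply: (@le_lt_trans _ _ (\int[m1]_x (`|g x|%:E * \int[m2]_y `|h y|%:E))%E).
  apply: ge0_le_integral => //.
  - by move=> x _; exact: integral_ge0.
  - apply: (measurable_fun_fubini_tonelli_F (fun p => `|(f p)%:E|%E)) => //.
    by apply/measurableT_comp => //; exact/measurable_EFinP.
  - apply: emeasurable_funM; last exact: measurable_cst.
    by apply/measurable_EFinP; exact: measurableT_comp.
  - move=> x _; rewrite -ge0_integralZl//; last first.
      by apply/measurable_EFinP; exact: measurableT_comp.
    apply: ge0_le_integral => //.
    + apply: measurableT_comp => //; apply/measurable_EFinP.
      exact: measurable_fun_pair2.
    + by apply: emeasurable_funM; [exact: measurable_cst|apply/measurable_EFinP; exact: measurableT_comp].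
    + move=> y _; rewrite /= -EFinM lee_fin -normrM.
      exact: le_trans (fgh _ _) (ler_norm _).
rewrite ge0_integralZr//; last first.
- exact: integral_ge0.
- by apply/measurable_EFinP; exact: measurableT_comp.
have /integrableP[_ goo] := ig; have /integrableP[_ hoo] := ih.
rewrite lte_mul_pinfty//; first exact: integral_ge0.
by rewrite ge0_fin_numE// integral_ge0.
Qed.

Lemma measurable_Rintegral2 :
  measurable_fun setT (fun x => \int[m2]_y f (x, y)).
Proof.
have mF := measurable_fubini_F integrable_prod_dominated.
exact: (measurableT_comp (fine_measurable _) mF).
Qed.

Lemma Rintegral_prod12 :
  \int[m1]_x \int[m2]_y f (x, y) = \int[(m1 \x m2)%E]_z f z.
Proof.
rewrite /Rintegral -(integral12_prod_meas1 integrable_prod_dominated).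
congr fine; apply: eq_integral => x _.
by rewrite /fubini_F fineK// integrable_fin_num// integrable_pair2.
Qed.

Lemma Rintegral_prod21 :
  \int[m2]_y \int[m1]_x f (x, y) = \int[(m1 \x m2)%E]_z f z.
Proof.
rewrite /Rintegral -(integral21_prod_meas1 integrable_prod_dominated).
congr fine; apply: eq_integral => x _.
by rewrite /fubini_G fineK// integrable_fin_num// integrable_pair1.
Qed.

Lemma Rfubini :
  \int[m1]_x \int[m2]_y f (x, y) = \int[m2]_y \int[m1]_x f (x, y).
Proof. by rewrite Rintegral_prod12 Rintegral_prod21. Qed.

End real_fubini.

Section tuple_products.
Context {R : realType}.
Local Notation mu := (@lebesgue_measure R).
Local Notation lam n := (@lebesgue_tuple R n).

Lemma integrable_tuple_prod n (g : 'I_n -> R -> R) :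
  (forall i, mu.-integrable setT (EFin \o g i)) ->
  (lam n).-integrable setT (EFin \o (fun t => \prod_i g i (tnth t i))).
Proof.
elim: n g => [|n IH] g ig.
  have : (\d_([tuple] : 0.-tuple R)).-integrable setT (EFin \o cst (1 : R)).
    exact: finite_measure_integrable_cst.
  by apply: eq_integrable => // t _ /=; rewrite big_ord0.
have ig' := IH (fun i => g (lift ord0 i)) (fun i => ig _).
apply/integrableP; split.
  apply/measurable_EFinP; apply: (@measurable_prod _ _ _ _ _ _ (fun i t => g i (tnth t i))) => i _.
  apply: (measurableT_comp _ (measurable_tnth i)).
  by apply/measurable_EFinP; exact: measurable_int (ig i).
rewrite ge0_integral_tuple_cons//; last first.
  apply/measurable_EFinP; apply: measurableT_comp => //.
  apply: (@measurable_prod _ _ _ _ _ _ (fun i t => g i (tnth t i))) => i _.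
  apply: (measurableT_comp _ (measurable_tnth i)).
  by apply/measurable_EFinP; exact: measurable_int (ig i).
have [mg0 mg'] : measurable_fun setT (g ord0) /\ measurable_fun setT
    (fun t : n.-tuple R => \prod_i g (lift ord0 i) (tnth t i)).
  split; apply/measurable_EFinP; first exact: measurable_int (ig ord0).
  exact: measurable_int ig'.
under eq_integral => x _.
  under eq_integral => t _.
    rewrite /= big_ord_recl normrM EFinM [tnth (tuple_cons _) ord0](tnth_nth 0) /=.
    rewrite (eq_bigr (fun i => g (lift ord0 i) (tnth t i))); last first.
      by move=> i _; rewrite !(tnth_nth 0).
    over.
  rewrite ge0_integralZl//; last first.
    by apply/measurable_EFinP; exact: measurableT_comp.
  over.
rewrite ge0_integralZr//; last first.
- exact: integral_ge0.
- by apply/measurable_EFinP; exact: measurableT_comp.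
have /integrableP[_ goo] := ig ord0; have /integrableP[_ hoo] := ig'.
rewrite lte_mul_pinfty//; first exact: integral_ge0.
by rewrite ge0_fin_numE// integral_ge0.
Qed.

Lemma Rintegral_tuple_cons n (f : n.+1.-tuple R -> R) (g : R -> R)
    (h : n.-tuple R -> R) : (lam n.+1).-integrable setT (EFin \o f) ->
  (forall x t, `|f (tuple_cons (x, t))| <= g x * h t) ->
  mu.-integrable setT (EFin \o g) -> (lam n).-integrable setT (EFin \o h) ->
  \int[lam n.+1]_t f t = \int[mu]_x \int[lam n]_t f (tuple_cons (x, t)).
Proof.
move=> fi fgh ig ih.
have mc : measurable_fun setT
    (@tuple_cons R n : measurableTypeR R * n.-tuple R -> n.+1.-tuple R).
  exact: measurable_tuple_cons.
rewrite (@Rintegral_prod12 _ _ _ (measurableTypeR R) _ mu (lam n)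
  (fun p => f (tuple_cons p)) g h)//; last first.
  by apply: (measurableT_comp _ mc); apply/measurable_EFinP; exact: measurable_int fi.
rewrite (@Rintegral_image _ _ _ _ _ (mu \x lam n)%E (lam n.+1) _ mc 1%:nng)//.
  by rewrite mul1r.
by move=> A mA; rewrite mul1e.
Qed.

Lemma cmeasurable_prod d (T : measurableType d) (I : Type) (s : seq I)
    (F : I -> T -> R[i]) : (forall i, cmeasurable setT (F i)) ->
  cmeasurable setT (fun t => \prod_(i <- s) F i t).
Proof.
move=> mF; elim: s => [|a s IH].
  by under eq_fun do rewrite big_nil; exact: cmeasurable_cst.
by under eq_fun do rewrite big_cons; apply: cmeasurableM.
Qed.

Lemma normc_prod (I : Type) (s : seq I) (F : I -> R[i]) :
  normc (\prod_(i <- s) F i) = \prod_(i <- s) normc (F i).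
Proof.
elim: s => [|a s IH]; first by rewrite !big_nil Normc.normc1.
by rewrite !big_cons Normc.normcM IH.
Qed.

Lemma cmeasurable_tuple_prod n (K : 'I_n -> R -> R[i]) :
  (forall i, cmeasurable setT (K i)) ->
  cmeasurable setT (fun t : n.-tuple R => \prod_i K i (tnth t i)).
Proof.
move=> mK; apply: cmeasurable_prod => i; have [mr mi] := mK i.
by split; [apply: (measurableT_comp mr)|apply: (measurableT_comp mi)];
  exact: measurable_tnth.
Qed.

(** Fubini peels off one coordinate at a time. This reduces the Poisson kernel and the total mass of
    the Cauchy weight to dimension one. *)
Lemma cintegral_tuple_prod n (K : 'I_n -> R -> R[i]) (g : 'I_n -> R -> R) :
  (forall i, cmeasurable setT (K i)) -> (forall i x, normc (K i x) <= g i x) ->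
  (forall i, mu.-integrable setT (EFin \o g i)) ->
  cintegral (lam n) setT (fun t => \prod_i K i (tnth t i)) =
  \prod_i cintegral mu setT (K i).
Proof.
elim: n K g => [|n IH] K g mK Kg ig.
  rewrite big_ord0; under eq_cintegral do rewrite big_ord0.
  rewrite /cintegral !Rintegral_cst//= mul0r mul1r; congr (_ +i* _).
  by rewrite indicE mem_set.
rewrite big_ord_recl -(IH _ (fun i => g (lift ord0 i)))//.
pose G (t : n.-tuple R) := \prod_i K (lift ord0 i) (tnth t i).
pose F (t : n.+1.-tuple R) := \prod_i K i (tnth t i).
have gG m (L : 'I_m -> R -> R[i]) (l : 'I_m -> R -> R) :
    (forall i x, normc (L i x) <= l i x) -> forall t : m.-tuple R,
    normc (\prod_i L i (tnth t i)) <= \prod_i l i (tnth t i).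
  by move=> Ll t; rewrite normc_prod; apply: ler_prod => i _; rewrite normc_ge0 Ll.
have Fcons x t : F (tuple_cons (x, t)) = K ord0 x * G t.
  rewrite /F big_ord_recl (tnth_nth 0) /=; congr (_ * _).
  by apply: eq_bigr => i _; rewrite !(tnth_nth 0).
have [iFr iFi] : cintegrable (lam n.+1) setT F.
  apply: (le_cintegrable measurableT (g := fun t => \prod_i g i (tnth t i))).
  - exact: cmeasurable_tuple_prod.
  - by move=> t _; exact: gG.
  - exact: integrable_tuple_prod.
have iG : cintegrable (lam n) setT G.
  apply: (le_cintegrable measurableT (g := fun t => \prod_i g (lift ord0 i) (tnth t i))).
  - exact: (@cmeasurable_tuple_prod n (fun i => K (lift ord0 i))).
  - by move=> t _; apply: (gG _ (fun i => K (lift ord0 i)) (fun i => g (lift ord0 i))).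
  - exact: (integrable_tuple_prod (g := fun i => g (lift ord0 i))).
have iK : cintegrable mu setT (K ord0).
  apply: (@le_cintegrable R _ (measurableTypeR R) mu setT measurableT (K ord0) (g ord0)).
  - exact: mK.
  - by move=> x _; exact: Kg.
  - exact: ig.
have gF x t : normc (F (tuple_cons (x, t))) <=
    g ord0 x * \prod_i g (lift ord0 i) (tnth t i).
  rewrite Fcons Normc.normcM ler_pM// ?normc_ge0//.
  exact: (gG _ (fun i => K (lift ord0 i)) (fun i => g (lift ord0 i))).
have ig' := integrable_tuple_prod (fun i => ig (lift ord0 i)).
transitivity (cintegral mu setT (fun x => cintegral (lam n) setT
    (fun t => F (tuple_cons (x, t))))).
  rewrite /cintegral; congr (_ +i* _) => /=.
    apply: (Rintegral_tuple_cons iFr _ (ig ord0) ig') => x t.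
    exact: le_trans (normr_Re_le _) (gF x t).
  apply: (Rintegral_tuple_cons iFi _ (ig ord0) ig') => x t.
  exact: le_trans (normr_Im_le _) (gF x t).
rewrite [RHS]mulrC -cintegralZ//; apply: eq_cintegral => x _.
under eq_cintegral do rewrite Fcons.
by rewrite cintegralZ// mulrC.
Qed.

End tuple_products.

(** * The Cauchy weight and integrals over R^n that it dominates *)

Section cauchy_weight.
Context {R : realType}.
Local Notation mu := (@lebesgue_measure R).
Local Notation lam n := (@lebesgue_tuple R n).

(** The Cauchy density up to the factor pi. It is integrable and comparable to its translates, and
    it reappears, rescaled, as the Fourier transform of [expR (- (eps * |t|))]. *)
Definition cauchy (x : R) : R := (1 + x ^+ 2)^-1.

Lemma cauchy_gt0 x : 0 < cauchy x.
Proof. by rewrite invr_gt0 ltr_wpDr ?sqr_ge0. Qed.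

Lemma continuous_cauchy : continuous cauchy.
Proof.
move=> x; apply: cvgV; first by rewrite gt_eqF// ltr_wpDr ?sqr_ge0.
by apply: cvgD; [exact: cvg_cst|exact: exprn_continuous].
Qed.

Lemma integral_cauchy : (\int[mu]_x (cauchy x)%:E = pi%:E)%E.
Proof.
rewrite ge0_symfun_integralT; [|by move=> x; exact: ltW (cauchy_gt0 x)
  |exact: continuous_cauchy|by move=> x; rewrite /cauchy /= sqrrN].
have := @integral0y_oneDsqr R; rewrite set_itvE => h.
rewrite (_ : (\int[mu]_(x in _) _)%E = (pi / 2)%:E) ?h//.
  by rewrite -EFinM mulrC divfK.
Qed.

Lemma integrable_cauchy : mu.-integrable setT (EFin \o cauchy).
Proof.
apply/integrableP; split.
  by apply/measurable_EFinP; exact: continuous_measurable_fun continuous_cauchy.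
under eq_integral do rewrite /= ger0_norm ?ltW ?cauchy_gt0//.
by rewrite integral_cauchy ltry.
Qed.

Lemma Rintegral_cauchy : \int[mu]_x cauchy x = pi.
Proof. by rewrite /Rintegral integral_cauchy. Qed.

Lemma cauchy_shift x v : cauchy (x + v) <= 2 * (1 + v ^+ 2) * cauchy x.
Proof.
have p y : 0 < 1 + y ^+ 2 :> R by rewrite ltr_wpDr ?sqr_ge0.
rewrite /cauchy -[leLHS]mul1r ler_pdivrMr// mulrAC ler_pdivlMr// mul1r.
(* With y = x + v the claim reads 1 + (y - v)^2 <= 2 (1 + v^2) (1 + y^2), which follows from (y +
   v)^2 >= 0 and y^2 v^2 >= 0. *)
have -> : x = (x + v) - v by ring.
move: (x + v) => y; have := sqr_ge0 (y + v); have := mulr_ge0 (sqr_ge0 y) (sqr_ge0 v); nra.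
Qed.

(* The common dominating function of all integrals over R^n below. *)
Definition cauchyw n (x : 'rV[R]_n) : R := \prod_i cauchy (x 0 i).

Lemma cauchyw_gt0 n (x : 'rV[R]_n) : 0 < cauchyw x.
Proof. by apply: prodr_gt0 => i _; exact: cauchy_gt0. Qed.

Lemma integrable_cauchyw n :
  (lam n).-integrable setT (EFin \o (fun t => cauchyw (rowt t))).
Proof.
have := integrable_tuple_prod (fun _ : 'I_n => integrable_cauchy).
apply: eq_integrable => // t _ /=; congr EFin.
by apply: eq_bigr => i _; rewrite mxE.
Qed.

Definition shift_const n (v : 'rV[R]_n) : R := \prod_i (2 * (1 + v 0 i ^+ 2)).

Lemma cauchyw_shift n (x v : 'rV[R]_n) :
  cauchyw (x + v) <= shift_const v * cauchyw x.
Proof.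
rewrite -big_split /=; apply: ler_prod => i _; rewrite mxE cauchy_shift andbT.
exact: ltW (cauchy_gt0 _).
Qed.

End cauchy_weight.

Section rd_integral.
Context {R : realType} {n : nat}.
Local Notation lam := (@lebesgue_tuple R n).
Implicit Types (F G : 'rV[R]_n -> R[i]) (C : R).

Definition rd_measurable F := cmeasurable setT (fun t => F (rowt t)).

(** For a measurable F one constant certifies integrability, and the bound survives multiplication
    by characters and, up to [shift_const], translations. *)
Definition rd_bounded C F := forall x, normc (F x) <= C * cauchyw x.

Definition rd_const : R := 2 * \int[lam]_t cauchyw (rowt t).

Lemma rd_const_ge0 : 0 <= rd_const.
Proof.
by rewrite mulr_ge0// Rintegral_ge0// => t _; exact: ltW (cauchyw_gt0 _).
Qed.

Lemma rd_bounded_ge0 C F : rd_bounded C F -> 0 <= C.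
Proof.
by move=> /(_ 0) /(le_trans (normc_ge0 _)); rewrite pmulr_lge0// cauchyw_gt0.
Qed.

Lemma ccontinuous_rd_measurable F : ccontinuous F -> rd_measurable F.
Proof.
move=> /ccontinuousP[fr fi]; split.
  exact: (measurable_basis_continuous (rowt_measurable_basis n) fr).
exact: (measurable_basis_continuous (rowt_measurable_basis n) fi).
Qed.

Lemma rd_measurableM F G : rd_measurable F -> rd_measurable G ->
  rd_measurable (fun x => F x * G x).
Proof. exact: cmeasurableM. Qed.

Lemma rd_measurableD F G : rd_measurable F -> rd_measurable G ->
  rd_measurable (fun x => F x + G x).
Proof. exact: cmeasurableD. Qed.

Lemma integrable_rd_bound C :
  lam.-integrable setT (EFin \o (fun t => C * cauchyw (rowt t))).
Proof. exact: (integrableZlR measurableT _ (integrable_cauchyw n)). Qed.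

Lemma rd_integrable C F : rd_measurable F -> rd_bounded C F ->
  cintegrable lam setT (fun t => F (rowt t)).
Proof.
move=> mF FC; apply: (le_cintegrable measurableT mF) (integrable_rd_bound C) => t _.
exact: FC.
Qed.

Lemma normc_integral_Rd C F : rd_measurable F -> rd_bounded C F ->
  normc (integral_Rd F) <= C * rd_const.
Proof.
move=> mF FC; have := normc_cintegral_le measurableT mF (fun t _ => FC (rowt t))
  (integrable_rd_bound C).
move=> /le_trans; apply; rewrite RintegralZl//; last exact: integrable_cauchyw.
by rewrite mulrCA.
Qed.

Lemma eq_integral_Rd F G : F =1 G -> integral_Rd F = integral_Rd G.
Proof. by move=> FG; apply: eq_cintegral => t _. Qed.

Lemma integral_RdB C F C' G : rd_measurable F -> rd_bounded C F ->
  rd_measurable G -> rd_bounded C' G ->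
  integral_Rd (fun x => F x - G x) = integral_Rd F - integral_Rd G.
Proof.
move=> mF FC mG GC; apply: (cintegralB measurableT (rd_integrable mF FC)).
exact: rd_integrable mG GC.
Qed.

Lemma integral_RdZ C F (z : R[i]) : rd_measurable F -> rd_bounded C F ->
  integral_Rd (fun x => z * F x) = z * integral_Rd F.
Proof. by move=> mF FC; exact: (cintegralZ measurableT _ (rd_integrable mF FC)). Qed.

Lemma integral_Rd_affine C F (a : R) (v : 'rV[R]_n) : 0 < a ->
  rd_measurable F -> rd_bounded C F ->
  integral_Rd (fun x => F (a *: x + v)) = (a ^- n)%:C * integral_Rd F.
Proof.
move=> a0 mF FC; have [Fr Fi] := rd_integrable mF FC.
pose b := [tuple v 0 i | i < n].
have e t : a *: rowt t + v = rowt (tuple_affine a b t).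
  by apply/rowP => i; rewrite !mxE tnth_mktuple tnth_mktuple.
rewrite /integral_Rd /cintegral.
under eq_Rintegral do rewrite -/(rowt _) e.
under [X in _ +i* X]eq_Rintegral do rewrite -/(rowt _) e.
rewrite (Rintegral_tuple_affine (f := fun t => Re (F (rowt t))) b a0 Fr).
rewrite (Rintegral_tuple_affine (f := fun t => Im (F (rowt t))) b a0 Fi).
by apply: complex_ext; rewrite ?RecM ?ImcM /= !mul0r ?subr0 ?addr0.
Qed.

Lemma integral_Rd_shift C F (v : 'rV[R]_n) :
  rd_measurable F -> rd_bounded C F ->
  integral_Rd (fun x => F (x + v)) = integral_Rd F.
Proof.
move=> mF FC; have := integral_Rd_affine v ltr01 mF FC.
rewrite expr1n invr1 mul1r => <-.
by apply: eq_integral_Rd => x; rewrite scale1r.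
Qed.

Lemma rd_bounded_shift C F (v : 'rV[R]_n) : rd_bounded C F ->
  rd_bounded (C * shift_const v) (fun x => F (x + v)).
Proof.
move=> FC x; apply: le_trans (FC _) _; rewrite -mulrA ler_wpM2l//.
  exact: rd_bounded_ge0 FC.
exact: cauchyw_shift.
Qed.

Lemma integral_Rd_ccvg C (F_ : nat -> 'rV[R]_n -> R[i]) F :
  (forall k, rd_measurable (F_ k)) -> (forall k, rd_bounded C (F_ k)) ->
  (forall x, ccvg \oo (fun k => F_ k x) (F x)) ->
  ccvg \oo (fun k => integral_Rd (F_ k)) (integral_Rd F).
Proof.
move=> mF FC Fc; apply: (cintegral_dominated_ccvg measurableT mF _ (integrable_rd_bound C)).
  by move=> t _; exact: Fc.
by move=> k t _; exact: FC.
Qed.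

End rd_integral.

Section rd_fubini.
Context {R : realType} {n : nat}.
Local Notation lam := (@lebesgue_tuple R n).
Variables (F : 'rV[R]_n * 'rV[R]_n -> R[i]) (C : R).
Hypothesis mF : cmeasurable setT (fun p => F (rowt p.1, rowt p.2)).
Hypothesis FC : forall x y, normc (F (x, y)) <= C * cauchyw x * cauchyw y.

Let boundRe x y :
  `|Re (F (rowt x, rowt y))| <= (C * cauchyw (rowt x)) * cauchyw (rowt y).
Proof. exact: le_trans (normr_Re_le _) (FC _ _). Qed.

Let boundIm x y :
  `|Im (F (rowt x, rowt y))| <= (C * cauchyw (rowt x)) * cauchyw (rowt y).
Proof. exact: le_trans (normr_Im_le _) (FC _ _). Qed.

Lemma rd_measurable_inner : rd_measurable (fun x => integral_Rd (fun y => F (x, y))).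
Proof.
have [mr mi] := mF; split => /=.
  exact: (measurable_Rintegral2 mr boundRe (integrable_rd_bound C)
    (integrable_cauchyw n)).
exact: (measurable_Rintegral2 mi boundIm (integrable_rd_bound C)
    (integrable_cauchyw n)).
Qed.

Lemma rd_measurable_pair2 x : rd_measurable (fun y => F (rowt x, y)).
Proof.
have [mr mi] := mF; split.
  exact: (measurable_fun_pair2 x mr).
exact: (measurable_fun_pair2 x mi).
Qed.

Lemma integral_Rd_fubini :
  integral_Rd (fun x => integral_Rd (fun y => F (x, y))) =
  integral_Rd (fun y => integral_Rd (fun x => F (x, y))).
Proof.
have [mr mi] := mF; apply: complex_ext.
  exact: (Rfubini mr boundRe (integrable_rd_bound C) (integrable_cauchyw n)).
exact: (Rfubini mi boundIm (integrable_rd_bound C) (integrable_cauchyw n)).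
Qed.

End rd_fubini.

Lemma ccontinuous_pair_measurable {R : realType} {n : nat}
    (F : 'rV[R]_n * 'rV[R]_n -> R[i]) : ccontinuous F ->
  cmeasurable setT (fun p => F (rowt p.1, rowt p.2)).
Proof.
move=> /ccontinuousP[fr fi].
have b := measurable_basis_pair (@rowt_measurable_basis R n) (@rowt_measurable_basis R n).
split; first exact: (measurable_basis_continuous b fr).
exact: (measurable_basis_continuous b fi).
Qed.
(** * Smooth functions and test functions *)

Section continuous_functions.
Context {R : realType} {X : topologicalType}.
Implicit Types f g : X -> R.

Lemma continuousD_fun f g : continuous f -> continuous g ->
  continuous (fun x => f x + g x).
Proof. by move=> fc gc x; apply: (@cvgD _ _ _ _ _ f g); [exact: fc|exact: gc]. Qed.

Lemma continuousM_fun f g : continuous f -> continuous g ->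
  continuous (fun x => f x * g x).
Proof. by move=> fc gc x; apply: (@cvgM _ _ _ _ f g); [exact: fc|exact: gc]. Qed.

Lemma continuousN_fun f : continuous f -> continuous (fun x => - f x).
Proof. by move=> fc x; apply: (@cvgN _ _ _ _ _ f); exact: fc. Qed.

Lemma continuousV_fun f : (forall x, f x != 0) -> continuous f ->
  continuous (fun x => (f x)^-1).
Proof. by move=> f0 fc x; apply: cvgV; [exact: f0|exact: fc]. Qed.

Lemma continuous_sum (I : Type) (s : seq I) (F : I -> X -> R) :
  (forall i, continuous (F i)) -> continuous (fun x => \sum_(i <- s) F i x).
Proof.
move=> Fc; elim: s => [|i s IH].
  under eq_fun do rewrite big_nil; exact: cst_continuous.
under eq_fun do rewrite big_cons.
exact: (continuousD_fun (Fc i) IH).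
Qed.

Lemma continuous_prod (I : Type) (s : seq I) (F : I -> X -> R) :
  (forall i, continuous (F i)) -> continuous (fun x => \prod_(i <- s) F i x).
Proof.
move=> Fc; elim: s => [|i s IH].
  under eq_fun do rewrite big_nil; exact: cst_continuous.
under eq_fun do rewrite big_cons.
exact: (continuousM_fun (Fc i) IH).
Qed.

Lemma continuous_fst_comp {Y : topologicalType} f : continuous f ->
  continuous (fun p : X * Y => f p.1).
Proof.
by move=> fc p; apply: (@continuous_comp _ _ _ fst f); [exact: cvg_fst|exact: fc].
Qed.

End continuous_functions.

(** * Differential calculus along directions *)

Section smooth_calculus.
Context {R : realType} {V : normedModType R}.
Implicit Types (f g q : V -> R) (x v : V).

Lemma shift_line f x v (t h : R) :
  ((fun s => f (x + s *: v)) \o shift t) (h *: 1) = (f \o shift (x + t *: v)) (h *: v).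
Proof. by rewrite /shift /= [h *: 1]mulr1 scalerDl addrCA. Qed.

(** A directional derivative is an ordinary derivative of the restriction to a line, so the chain
    rule and the mean value theorem in one variable become available. *)
Lemma is_derive_line f x v (t l : R) : is_derive (x + t *: v) v f l <->
  is_derive t (1 : R) (fun s : R => f (x + s *: v)) l.
Proof.
have e : (fun h : R => h^-1 *: ((f \o shift (x + t *: v)) (h *: v) - f (x + t *: v))) =
    (fun h : R => h^-1 *: (((fun s : R => f (x + s *: v)) \o shift t) (h *: (1 : R)) -
       f (x + t *: v))).
  by apply/funext => h; rewrite shift_line.
split=> -[ex <-]; split.
- by move: ex; rewrite /derivable /= e.
- by rewrite /derive e.
- by rewrite /derivable /= e.
- by rewrite /derive e.
Qed.

Lemma derivable_is_derive_line f x v (t : R) : derivable f (x + t *: v) v ->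
  is_derive t (1 : R) (fun s : R => f (x + s *: v)) ('D_v f (x + t *: v)).
Proof. by move=> df; apply/is_derive_line; exact/derivableP. Qed.

Lemma is_derive_line0 f x v (l : R) :
  is_derive (0 : R) (1 : R) (fun s : R => f (x + s *: v)) l -> is_derive x v f l.
Proof. by move=> /is_derive_line; rewrite scale0r addr0. Qed.

Lemma derivable_comp (G : R -> R) (G' : R -> R) q x v :
  (forall s : R, is_derive s (1 : R) G (G' s)) -> derivable q x v ->
  is_derive x v (fun y => G (q y)) (G' (q x) * 'D_v q x).
Proof.
move=> dG dq; apply: is_derive_line0.
have := @derivable_is_derive_line q x v 0; rewrite scale0r addr0 => /(_ dq) dq'.
apply: (@is_derive1_comp _ G (fun s : R => q (x + s *: v))) => //.
by rewrite scale0r addr0.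
Qed.

(** Smoothness graded by order. Since [dirD] applies the last direction of its list first, peeling
    off the innermost derivative gives a class whose closure under products and compositions is
    proved by induction on the order; order 0 already includes derivability, as [smooth] does for
    the empty list. *)
Inductive smoothn : nat -> (V -> R) -> Prop :=
| smoothn0 f : continuous f -> (forall x v, derivable f x v) -> smoothn 0 f
| smoothnS k f : continuous f -> (forall x v, derivable f x v) ->
    (forall v, smoothn k ('D_v f)) -> smoothn k.+1 f.

Lemma smoothn_continuous k f : smoothn k f -> continuous f.
Proof. by case. Qed.

Lemma smoothn_derivable k f x v : smoothn k f -> derivable f x v.
Proof. by case=> [{}f _ + |{k}k {}f _ + _]; apply. Qed.

Lemma smoothn_derive k f v : smoothn k.+1 f -> smoothn k ('D_v f).
Proof. by move=> sf; inversion sf. Qed.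

Lemma smoothn_step k f : continuous f -> (forall x v, derivable f x v) ->
  (forall k' v, k = k'.+1 -> smoothn k' ('D_v f)) -> smoothn k f.
Proof.
case: k => [|k] fc fd fD; first exact: smoothn0.
by apply: smoothnS fc fd _ => v; exact: fD.
Qed.

Lemma smoothn_pred k f : smoothn k.+1 f -> smoothn k f.
Proof.
elim: k f => [|k IH] f sf; have fc := smoothn_continuous sf;
  have fd := fun x v => @smoothn_derivable _ _ x v sf.
  exact: smoothn0.
by apply: smoothnS fc fd _ => v; apply: IH; exact: smoothn_derive.
Qed.

Lemma dirD_rcons (vs : seq V) v f : dirD (rcons vs v) f = dirD vs ('D_v f).
Proof. by rewrite /dirD foldr_rcons. Qed.

Lemma smoothn_dirD (vs : seq V) f : smoothn (size vs) f ->
  continuous (dirD vs f) /\ forall x v, derivable (dirD vs f) x v.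
Proof.
elim/last_ind: vs f => [|vs v IH] f sf.
  split; first exact: smoothn_continuous sf.
  by move=> x v; exact: smoothn_derivable sf.
rewrite dirD_rcons; apply: IH; apply: smoothn_derive.
by rewrite size_rcons in sf.
Qed.

Lemma smooth_derive v f : smooth f -> smooth ('D_v f).
Proof. by move=> fs vs; rewrite -dirD_rcons; exact: fs. Qed.

Lemma smooth_dirD (vs : seq V) f : smooth f -> smooth (dirD vs f).
Proof.
elim/last_ind: vs f => [|vs v IH] f fs; first exact: fs.
by rewrite dirD_rcons; exact/IH/smooth_derive.
Qed.

Lemma smooth_continuous f : smooth f -> continuous f.
Proof. by move=> /(_ [::])[]. Qed.

Lemma smooth_derivable f x v : smooth f -> derivable f x v.
Proof. by move=> /(_ [::])[_]. Qed.

Lemma smoothP f : smooth f <-> forall k, smoothn k f.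
Proof.
split=> [fs k|fs vs]; last by apply: smoothn_dirD; exact: fs.
elim: k f fs => [|k IH] f fs; apply: smoothn_step.
- exact: smooth_continuous.
- by move=> x v; exact: smooth_derivable.
- by [].
- exact: smooth_continuous.
- by move=> x v; exact: smooth_derivable.
- by move=> _ v [<-]; apply: IH; exact: smooth_derive.
Qed.

Lemma deriveD_fun f g v x : derivable f x v -> derivable g x v ->
  'D_v (fun x => f x + g x) x = 'D_v f x + 'D_v g x.
Proof. exact: deriveD. Qed.

Lemma deriveM_fun f g v x : derivable f x v -> derivable g x v ->
  'D_v (fun x => f x * g x) x = f x * 'D_v g x + g x * 'D_v f x.
Proof. exact: deriveM. Qed.

Lemma derivableD_fun f g v x : derivable f x v -> derivable g x v ->
  derivable (fun x => f x + g x) x v.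
Proof. exact: derivableD. Qed.

Lemma derivableM_fun f g v x : derivable f x v -> derivable g x v ->
  derivable (fun x => f x * g x) x v.
Proof. exact: derivableM. Qed.

Lemma smoothn_cst k (c : R) : smoothn k (fun _ : V => c).
Proof.
elim: k c => [|k IH] c; apply: smoothn_step.
- exact: cst_continuous.
- by move=> x v; exact: derivable_cst.
- by [].
- exact: cst_continuous.
- by move=> x v; exact: derivable_cst.
- move=> _ v [<-]; rewrite (_ : 'D_v _ = fun=> 0); first exact: IH.
  by apply/funext => x; exact: derive_cst.
Qed.

Lemma smoothnD k f g : smoothn k f -> smoothn k g ->
  smoothn k (fun x => f x + g x).
Proof.
elim: k f g => [|k IH] f g sf sg; apply: smoothn_step.
- by apply: continuousD_fun; apply: smoothn_continuous; eassumption.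
- by move=> x v; apply: derivableD_fun; apply: smoothn_derivable; eassumption.
- by [].
- by apply: continuousD_fun; apply: smoothn_continuous; eassumption.
- by move=> x v; apply: derivableD_fun; apply: smoothn_derivable; eassumption.
move=> _ v [<-]; rewrite (_ : 'D_v _ = fun x => 'D_v f x + 'D_v g x).
  by apply: IH; exact: smoothn_derive.
apply/funext => x; apply: deriveD_fun; apply: smoothn_derivable; eassumption.
Qed.

Lemma smoothnM k f g : smoothn k f -> smoothn k g ->
  smoothn k (fun x => f x * g x).
Proof.
elim: k f g => [|k IH] f g sf sg; apply: smoothn_step.
- by apply: continuousM_fun; apply: smoothn_continuous; eassumption.
- by move=> x v; apply: derivableM_fun; apply: smoothn_derivable; eassumption.
- by [].
- by apply: continuousM_fun; apply: smoothn_continuous; eassumption.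
- by move=> x v; apply: derivableM_fun; apply: smoothn_derivable; eassumption.
move=> _ v [<-]; rewrite (_ : 'D_v _ = fun x => f x * 'D_v g x + g x * 'D_v f x).
  by apply: smoothnD; apply: IH; solve [exact: smoothn_pred|exact: smoothn_derive].
apply/funext => x; apply: deriveM_fun; apply: smoothn_derivable; eassumption.
Qed.

Lemma continuous_cos_comp q : continuous q -> continuous (fun x => cos (q x)).
Proof. by move=> qc x; apply: continuous_comp; [exact: qc|exact: continuous_cos]. Qed.

Lemma continuous_sin_comp q : continuous q -> continuous (fun x => sin (q x)).
Proof. by move=> qc x; apply: continuous_comp; [exact: qc|exact: continuous_sin]. Qed.

Lemma is_derive_cos_comp q x v : derivable q x v ->
  is_derive x v (fun y => cos (q y)) (- sin (q x) * 'D_v q x).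
Proof. by apply: (@derivable_comp cos (fun s => - sin s)) => s; exact: is_derive_cos. Qed.

Lemma is_derive_sin_comp q x v : derivable q x v ->
  is_derive x v (fun y => sin (q y)) (cos (q x) * 'D_v q x).
Proof. by apply: (@derivable_comp sin cos) => s; exact: is_derive_sin. Qed.

(** Sine and cosine are treated together, since each appears in the derivative of the other. *)
Lemma smoothn_trig k q : smoothn k q ->
  smoothn k (fun x => cos (q x)) /\ smoothn k (fun x => sin (q x)).
Proof.
elim: k q => [|k IH] q sq; have qc := smoothn_continuous sq;
  have qd := fun x v => @smoothn_derivable _ _ x v sq.
  split; apply: smoothn0.
  - exact: continuous_cos_comp.
  - by move=> x v; have [] := is_derive_cos_comp (qd x v).
  - exact: continuous_sin_comp.
  - by move=> x v; have [] := is_derive_sin_comp (qd x v).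
have [sc ss] := IH q (smoothn_pred sq).
split; apply: smoothnS.
- exact: continuous_cos_comp.
- by move=> x v; have [] := is_derive_cos_comp (qd x v).
- move=> v; rewrite (_ : 'D_v _ = fun x => ((-1) * sin (q x)) * 'D_v q x).
    apply: smoothnM; last exact: smoothn_derive.
    by apply: smoothnM ss; exact: smoothn_cst.
  by apply/funext => x; have [_ ->] := is_derive_cos_comp (qd x v); rewrite mulN1r.
- exact: continuous_sin_comp.
- by move=> x v; have [] := is_derive_sin_comp (qd x v).
- move=> v; rewrite (_ : 'D_v _ = fun x => cos (q x) * 'D_v q x).
    by apply: smoothnM; [exact: sc|exact: smoothn_derive].
  by apply/funext => x; have [_ ->] := is_derive_sin_comp (qd x v).
Qed.

Lemma smoothn_linear k q : continuous q ->
  (forall x v (t : R), q (x + t *: v) = q x + t * q v) -> smoothn k q.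
Proof.
move=> qc ql.
have d x v : is_derive x v q (q v).
  apply: is_derive_line0; under eq_fun do rewrite ql.
  have h : is_derive (0 : R) (1 : R) (fun s : R => s * q v) (q v).
    have := @is_deriveZ R R R id (q v) 0 1 1 (is_derive_id _ _).
    rewrite [_ *: 1]mulr1; congr is_derive.
    by apply/funext => s; rewrite /= mulrC.
  by have := is_deriveD (is_derive_cst (q x) (0 : R) (1 : R)) h; rewrite add0r.
apply: smoothn_step => [//|x v|k' v _]; first by have [] := d x v.
rewrite (_ : 'D_v q = fun=> q v); first exact: smoothn_cst.
by apply/funext => x; have [_ ->] := d x v.
Qed.

Lemma smooth_cst (c : R) : smooth (fun _ : V => c).
Proof. by apply/smoothP => k; exact: smoothn_cst. Qed.

Lemma smoothD f g : smooth f -> smooth g -> smooth (fun x => f x + g x).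
Proof. by move=> /smoothP sf /smoothP sg; apply/smoothP => k; exact: smoothnD. Qed.

Lemma smoothM f g : smooth f -> smooth g -> smooth (fun x => f x * g x).
Proof. by move=> /smoothP sf /smoothP sg; apply/smoothP => k; exact: smoothnM. Qed.

Lemma smoothN f : smooth f -> smooth (fun x => - f x).
Proof.
move=> sf; under eq_fun do rewrite -mulN1r.
by apply: smoothM sf; exact: smooth_cst.
Qed.

Lemma smooth_linear q : continuous q ->
  (forall x v (t : R), q (x + t *: v) = q x + t * q v) -> smooth q.
Proof. by move=> qc ql; apply/smoothP => k; exact: smoothn_linear. Qed.

Lemma smooth_trig q : smooth q ->
  smooth (fun x => cos (q x)) /\ smooth (fun x => sin (q x)).
Proof.
by move=> /smoothP sq; split; apply/smoothP => k; have [] := smoothn_trig (sq k).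
Qed.

Local Opaque smooth.

Lemma csmooth_cst (z : R[i]) : csmooth (fun _ : V => z).
Proof. by split; exact: smooth_cst. Qed.

Lemma csmoothD (f g : V -> R[i]) : csmooth f -> csmooth g ->
  csmooth (fun x => f x + g x).
Proof.
move=> [fr fi] [gr gi]; split; under eq_fun do rewrite ?RecD ?ImcD; exact: smoothD.
Qed.

Lemma csmoothM (f g : V -> R[i]) : csmooth f -> csmooth g ->
  csmooth (fun x => f x * g x).
Proof.
move=> [fr fi] [gr gi]; split.
  under eq_fun do rewrite RecM.
  by apply: smoothD; [exact: smoothM|apply: smoothN; exact: smoothM].
by under eq_fun do rewrite ImcM; apply: smoothD; exact: smoothM.
Qed.

Lemma csmooth_conj (f : V -> R[i]) : csmooth f -> csmooth (fun x => conjc (f x)).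
Proof.
move=> [fr fi]; split.
  under eq_fun do rewrite Rec_conj; exact: fr.
under eq_fun do rewrite Imc_conj; exact: smoothN.
Qed.

Lemma csmooth_expi q : smooth q -> csmooth (fun x => expi (q x)).
Proof. by move=> sq; have [sc ss] := smooth_trig sq; split; [exact: sc|exact: ss]. Qed.

Lemma csmooth_ccontinuous (f : V -> R[i]) : csmooth f -> ccontinuous f.
Proof.
move=> [fr fi]; apply/ccontinuousP; split.
  exact: (smooth_continuous fr).
exact: (smooth_continuous fi).
Qed.

Lemma csmooth_cdirD (vs : seq V) (f : V -> R[i]) : csmooth f -> csmooth (cdirD vs f).
Proof. by move=> [fr fi]; split; exact: smooth_dirD. Qed.

Lemma cdirD_rcons (vs : seq V) v (f : V -> R[i]) :
  cdirD (rcons vs v) f = cdirD vs (cdirD [:: v] f).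
Proof. by apply/funext => x; rewrite /cdirD !dirD_rcons. Qed.

Lemma csmooth_derivable (f : V -> R[i]) x v : csmooth f ->
  derivable (fun y => Re (f y)) x v /\ derivable (fun y => Im (f y)) x v.
Proof.
move=> [fr fi]; split.
  exact: (@smooth_derivable _ x v fr).
exact: (@smooth_derivable _ x v fi).
Qed.

Lemma cdirD1D v (f g : V -> R[i]) : csmooth f -> csmooth g ->
  cdirD [:: v] (fun x => f x + g x) = fun x => cdirD [:: v] f x + cdirD [:: v] g x.
Proof.
move=> sf sg; apply/funext => x.
have [fr fi] := csmooth_derivable x v sf; have [gr gi] := csmooth_derivable x v sg.
apply: complex_ext.
  rewrite RecD /cdirD /=; under eq_fun do rewrite RecD.
  exact: (deriveD_fun fr gr).
rewrite ImcD /cdirD /=; under eq_fun do rewrite ImcD.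
exact: (deriveD_fun fi gi).
Qed.

Lemma deriveB_fun f g v x : derivable f x v -> derivable g x v ->
  'D_v (fun x => f x - g x) x = 'D_v f x - 'D_v g x.
Proof. exact: deriveB. Qed.

Lemma cdirD1M v (f g : V -> R[i]) : csmooth f -> csmooth g ->
  cdirD [:: v] (fun x => f x * g x) =
  fun x => cdirD [:: v] f x * g x + f x * cdirD [:: v] g x.
Proof.
move=> sf sg; apply/funext => x.
have [fr fi] := csmooth_derivable x v sf; have [gr gi] := csmooth_derivable x v sg.
have dM := derivableM_fun.
apply: complex_ext.
  rewrite !(RecD, RecM) /cdirD /=; under eq_fun do rewrite RecM.
  rewrite (deriveB_fun (dM _ _ _ _ fr gr) (dM _ _ _ _ fi gi)).
  by rewrite (deriveM_fun fr gr) (deriveM_fun fi gi); ring.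
rewrite !(ImcD, ImcM) /cdirD /=; under eq_fun do rewrite ImcM.
rewrite (deriveD_fun (dM _ _ _ _ fr gi) (dM _ _ _ _ fi gr)).
by rewrite (deriveM_fun fr gi) (deriveM_fun fi gr); ring.
Qed.

Lemma cdirDD (vs : seq V) (f g : V -> R[i]) : csmooth f -> csmooth g ->
  cdirD vs (fun x => f x + g x) = fun x => cdirD vs f x + cdirD vs g x.
Proof.
elim/last_ind: vs f g => [|vs v IH] f g sf sg.
  by apply/funext => x; apply: complex_ext; rewrite ?RecD ?ImcD /cdirD /=.
by rewrite !cdirD_rcons (cdirD1D _ sf sg) IH; [|exact: csmooth_cdirD|exact: csmooth_cdirD].
Qed.

Lemma cdirDZ (vs : seq V) (z : R[i]) (f : V -> R[i]) : csmooth f ->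
  cdirD vs (fun x => z * f x) = fun x => z * cdirD vs f x.
Proof.
elim/last_ind: vs f => [|vs v IH] f sf.
  by apply/funext => x; apply: complex_ext; rewrite ?RecM ?ImcM /cdirD /=.
rewrite !cdirD_rcons -IH; last exact: csmooth_cdirD.
congr (cdirD vs _); rewrite (cdirD1M _ (csmooth_cst z) sf).
apply/funext => x; rewrite [X in X * _ + _](_ : _ = 0) ?mul0r ?add0r//.
by apply: complex_ext; exact: derive_cst.
Qed.

(** The mean value theorem holds for real functions, so it is applied to both components, whence the
    factor 2. The symmetric range |s| <= |t| covers the segment for either sign of t. *)
Lemma normc_lipschitz (f : V -> R[i]) x v (M t : R) : csmooth f ->
  (forall s, `|s| <= `|t| -> normc (cdirD [:: v] f (x + s *: v)) <= M) ->
  normc (f (x + t *: v) - f x) <= 2 * M * `|t|.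
Proof.
move=> [fr fi] fM.
suff h (g : V -> R) : smooth g ->
    (forall s, `|s| <= `|t| -> `|'D_v g (x + s *: v)| <= M) ->
    `|g (x + t *: v) - g x| <= M * `|t|.
  apply: le_trans (normc_ReIm _) _; rewrite RecD RecN ImcD ImcN -mulrA mulr_natl mulr2n.
  apply: lerD; [apply: (h _ fr) => s st|apply: (h _ fi) => s st].
    by apply: le_trans _ (fM s st); exact: (normr_Re_le (cdirD [:: v] f _)).
  by apply: le_trans _ (fM s st); exact: (normr_Im_le (cdirD [:: v] f _)).
move=> sg gM.
have d (s : R) : is_derive s (1 : R) (fun s : R => g (x + s *: v)) ('D_v g (x + s *: v)).
  by apply: derivable_is_derive_line; exact: smooth_derivable.
have c (a b : R) : {within `[a, b], continuous (fun s : R => g (x + s *: v))}.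
  apply: derivable_within_continuous => s _.
  by have [] := d s.
have [t0|t0] := leP 0 t.
  have [s] := MVT_segment t0 (fun s _ => d s) (c _ _).
  rewrite in_itv /= => /andP[s0 st].
  rewrite scale0r addr0 subr0 => ->.
  by rewrite normrM ler_wpM2r// gM// !ger0_norm.
have [s] := MVT_segment (ltW t0) (fun s _ => d s) (c _ _).
rewrite in_itv /= => /andP[ts s0].
rewrite scale0r addr0 => e; rewrite distrC e sub0r normrM normrN.
by rewrite ler_wpM2r// gM// !ler0_norm ?lerN2// ltW.
Qed.

Lemma derivable_shift f x v w : derivable f (x + w) v ->
  is_derive x v (fun y => f (y + w)) ('D_v f (x + w)).
Proof.
move=> df; apply: is_derive_line0.
have := @derivable_is_derive_line f (x + w) v 0; rewrite scale0r addr0 => /(_ df).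
by congr is_derive; apply/funext => s; rewrite addrAC.
Qed.

Lemma continuous_shift f w : continuous f -> continuous (fun x => f (x + w)).
Proof.
move=> fc x; apply: (@continuous_comp _ _ _ (fun x => x + w) f); last exact: fc.
by apply: (@cvgD _ _ _ _ _ id (fun=> w)); [exact: cvg_id|exact: cvg_cst].
Qed.

Lemma smoothn_shift k f w : smoothn k f -> smoothn k (fun x => f (x + w)).
Proof.
elim: k f => [|k IH] f sf; have fc := @continuous_shift _ w (smoothn_continuous sf);
  have fd := fun x v => @derivable_shift _ x v w (@smoothn_derivable _ _ (x + w) v sf).
  by apply: smoothn0 => [//|x v]; have [] := fd x v.
apply: smoothnS => [//|x v|v]; first by have [] := fd x v.
rewrite (_ : 'D_v _ = fun x => 'D_v f (x + w)).
  by apply: (IH ('D_v f)); exact: smoothn_derive.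
by apply/funext => x; have [_ ->] := fd x v.
Qed.

Lemma csmooth_shift (f : V -> R[i]) w : csmooth f -> csmooth (fun x => f (x + w)).
Proof.
move=> [/smoothP fr /smoothP fi]; split; apply/smoothP => k.
  exact: (smoothn_shift w (fr k)).
exact: (smoothn_shift w (fi k)).
Qed.

Lemma cdirD1_shift (f : V -> R[i]) v w : csmooth f ->
  cdirD [:: v] (fun x => f (x + w)) = fun x => cdirD [:: v] f (x + w).
Proof.
move=> sf; apply/funext => x; have [fr fi] := csmooth_derivable (x + w) v sf.
apply: complex_ext; rewrite /cdirD /=.
  by have [_ ->] := derivable_shift fr.
by have [_ ->] := derivable_shift fi.
Qed.

End smooth_calculus.

Section partial_smoothness.
Context {R : realType} {V W : normedModType R}.

Lemma derive_pair1 (f : V * W -> R) v x y :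
  'D_(v, 0) f (x, y) = 'D_v (fun z => f (z, y)) x.
Proof.
have e : (fun h : R => h^-1 *: ((f \o shift (x, y)) (h *: (v, 0)) - f (x, y))) =
    (fun h : R => h^-1 *: (((fun z => f (z, y)) \o shift x) (h *: v) - f (x, y))).
  apply/funext => h; congr (_ *: (f _ - _)).
  by congr (_, _); rewrite /= scaler0 add0r.
by rewrite /derive e.
Qed.

Lemma dirD_pair1 (vs : seq V) (f : V * W -> R) x y :
  dirD [seq (v, 0) | v <- vs] f (x, y) = dirD vs (fun z => f (z, y)) x.
Proof.
elim: vs x => [//|w vs IH] x; rewrite /= derive_pair1.
congr (@derive R _ _ _ _ w); apply/funext => z; exact: IH.
Qed.

Lemma cdirD_pair1 (vs : seq V) (f : V * W -> R[i]) x y :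
  cdirD [seq (v, 0) | v <- vs] f (x, y) = cdirD vs (fun z => f (z, y)) x.
Proof. by rewrite /cdirD !dirD_pair1. Qed.

Lemma continuous_pair1 (y : W) : continuous (fun x : V => (x, y)).
Proof. by move=> x; apply: cvg_pair; [exact: cvg_id|exact: cvg_cst]. Qed.

End partial_smoothness.

Section euclidean.
Context {R : realType} {d : nat}.
Implicit Types (x y v : 'rV[R]_d).

Lemma dotC x y : dot x y = dot y x.
Proof. by apply: eq_bigr => i _; rewrite mulrC. Qed.

Lemma dotDr x y v : dot x (y + v) = dot x y + dot x v.
Proof. by rewrite -big_split; apply: eq_bigr => i _; rewrite mxE mulrDr. Qed.

Lemma dotZr x (a : R) y : dot x (a *: y) = a * dot x y.
Proof. by rewrite mulr_sumr; apply: eq_bigr => i _; rewrite mxE mulrCA. Qed.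

Lemma dotDl x y v : dot (x + v) y = dot x y + dot v y.
Proof. by rewrite dotC dotDr !(dotC y). Qed.

Lemma dotZl (a : R) x y : dot (a *: x) y = a * dot x y.
Proof. by rewrite dotC dotZr dotC. Qed.

Lemma dotNl x y : dot (- x) y = - dot x y.
Proof. by rewrite -scaleN1r dotZl mulN1r. Qed.

Lemma dotNr x y : dot x (- y) = - dot x y.
Proof. by rewrite dotC dotNl dotC. Qed.

Lemma dot_delta x i : dot x (delta_mx 0 i) = x 0 i.
Proof.
rewrite /dot (bigD1 i)//= big1 ?addr0; first by rewrite mxE !eqxx mulr1.
by move=> j ji; rewrite mxE eqxx (negbTE ji) mulr0.
Qed.

Lemma continuous_coord i : continuous (fun x : 'rV[R]_d => x 0 i).
Proof. exact: coord_continuous. Qed.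

Lemma continuous_dot_pair : continuous (fun p : 'rV[R]_d * 'rV[R]_d => dot p.1 p.2).
Proof.
apply: continuous_sum => i p; apply: cvgM.
  apply: (@continuous_comp _ _ _ fst (fun x : 'rV[R]_d => x 0 i)).
    exact: cvg_fst.
  exact: continuous_coord.
apply: (@continuous_comp _ _ _ snd (fun x : 'rV[R]_d => x 0 i)).
  exact: cvg_snd.
exact: continuous_coord.
Qed.

Lemma continuous_dot v : continuous (dot v).
Proof.
apply: (@continuous_sum R 'rV[R]_d _ _ (fun i x => v 0 i * x 0 i)) => i.
apply: (@continuousM_fun R 'rV[R]_d (fun=> v 0 i)); first exact: cst_continuous.
exact: continuous_coord.
Qed.

Lemma smooth_dot v : smooth (dot v).
Proof.
apply: smooth_linear; first exact: continuous_dot.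
by move=> x w t; rewrite dotDr dotZr.
Qed.

Lemma dot_ge0 x : 0 <= dot x x.
Proof. by apply: sumr_ge0 => i _; exact: sqr_ge0. Qed.

Lemma enorm_ge0 x : 0 <= enorm x.
Proof. exact: sqrtr_ge0. Qed.

Lemma normr_coord_enorm x i : `|x 0 i| <= enorm x.
Proof.
rewrite /enorm -sqrtr_sqr ler_sqrt ?dot_ge0// /dot (bigD1 i)//= -expr2 lerDl.
by apply: sumr_ge0 => j _; exact: sqr_ge0.
Qed.

Lemma enorm_sum x : enorm x <= \sum_i `|x 0 i|.
Proof.
have s0 : 0 <= \sum_i `|x 0 i| by exact: sumr_ge0.
rewrite /enorm -[leRHS](ger0_norm s0) -sqrtr_sqr ler_sqrt ?sqr_ge0//.
rewrite expr2 mulr_suml; apply: ler_sum => i _.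
apply: le_trans (ler_norm _) _; rewrite normrM ler_wpM2l//.
by rewrite (bigD1 i)//= lerDl sumr_ge0.
Qed.

Lemma continuous_enorm : continuous (@enorm R d).
Proof.
move=> x; apply: (@continuous_comp _ _ _ (fun x => dot x x) Num.sqrt).
  apply: (@continuous_comp _ _ _ (fun x => (x, x))
    (fun p : 'rV[R]_d * 'rV[R]_d => dot p.1 p.2)).
    exact: (@cvg_pair _ _ _ (nbhs x) (nbhs x) (nbhs x) _ _ _ id id cvg_id cvg_id).
  exact: continuous_dot_pair.
exact: sqrt_continuous.
Qed.

Lemma continuous_cauchyw : continuous (@cauchyw R d).
Proof.
apply: continuous_prod => i x.
apply: (@continuous_comp _ _ _ (fun x : 'rV[R]_d => x 0 i) cauchy).
  exact: continuous_coord.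
exact: continuous_cauchy.
Qed.

End euclidean.

Section test_functions.
Context {R : realType} {d : nat}.
Implicit Types (f chi F : 'rV[R]_d -> R[i]).

Local Opaque smooth csmooth.

Lemma csupport_out f x : ~ csupport f x -> f x = 0.
Proof.
move=> h; apply/eqP/negPn/negP => fx; apply: h.
by apply: subset_closure.
Qed.

Lemma csupport_sub f g : (forall x, f x != 0 -> g x != 0) -> csupport f `<=` csupport g.
Proof. by move=> fg; apply: closure_subset => x; exact: fg. Qed.

Lemma test_intro f (K : set 'rV[R]_d) : csmooth f -> compact K ->
  csupport f `<=` K -> test f.
Proof.
move=> sf cK fK; split; [exact: sf| |exact: subsetT].
apply: (subclosed_compact _ cK fK); exact: closed_closure.
Qed.

Lemma test_compact f : test f -> compact (csupport f).
Proof. by case. Qed.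

Lemma test_csmooth f : test f -> csmooth f.
Proof. by case. Qed.

Lemma test_sub f g : csmooth f -> (forall x, f x != 0 -> g x != 0) ->
  test g -> test f.
Proof.
move=> sf fg tg; apply: (test_intro sf (test_compact tg)).
exact: csupport_sub.
Qed.

Lemma testM chi F : test chi -> csmooth F -> test (fun x => chi x * F x).
Proof.
move=> tc sF; apply: (test_sub _ _ tc).
  exact: (csmoothM (test_csmooth tc) sF).
by move=> x; apply: contra_neq => ->; rewrite mul0r.
Qed.

Lemma testZ (z : R[i]) chi : test chi -> test (fun x => z * chi x).
Proof.
move=> tc; under eq_fun do rewrite mulrC.
by apply: (testM tc); exact: csmooth_cst.
Qed.

Lemma test_conj chi : test chi -> test (fun x => conjc (chi x)).
Proof.
move=> tc; apply: (test_sub _ _ tc).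
  exact: (csmooth_conj (test_csmooth tc)).
by move=> x; apply: contra_neq => ->; apply: complex_ext; rewrite /= ?oppr0.
Qed.

Lemma testD f g : test f -> test g -> test (fun x => f x + g x).
Proof.
move=> tf tg; apply: (test_intro (csmoothD (test_csmooth tf) (test_csmooth tg))
  (compactU (test_compact tf) (test_compact tg))).
rewrite -closureU; apply: closure_subset => x /= h.
have [fx|fx] := eqVneq (f x) 0; last by left.
by right; apply: contra_neq h => gx; rewrite fx gx addr0.
Qed.

Lemma test_on_test (D : set 'rV[R]_d) f : test_on D f -> test f.
Proof. by case. Qed.

Lemma test_derive f v : test f -> test (cdirD [:: v] f).
Proof.
move=> tf; have sf := test_csmooth tf.
apply: (test_intro (csmooth_cdirD _ sf) (test_compact tf)).
have -> : csupport f = closure (csupport f).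
  by apply/closure_id; exact: closed_closure.
apply: closure_subset => x /= /negP h; apply: contrapT => sx; apply: h; apply/eqP.
(* Off its closed support f vanishes on an open set, so its derivative there is that of the zero
   function. *)
have [V [oV Vx Vf]] : exists V, [/\ open V, V x & forall y, V y -> f y = 0].
  exists (~` csupport f); split=> //.
    by apply: closed_openC; exact: closed_closure.
  by move=> y; exact: csupport_out.
have d0 (g : 'rV[R]_d -> R) : (forall y, V y -> g y = 0) -> 'D_v g x = 0.
  move=> g0; have -> : 'D_v g x = 'D_v (cst 0) x; last exact: derive_cst.
  apply: near_eq_derive.
  by apply: filterS (open_nbhs_nbhs (conj oV Vx)) => y Vy; rewrite g0.
apply: complex_ext; apply: d0 => y Vy; by rewrite Vf.
Qed.

(** The quotient of |f| by the weight is continuous, as the weight never vanishes, and is therefore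
    bounded on the compact support. *)
Lemma test_bounded f : test f -> exists C, rd_bounded C f.
Proof.
move=> tf; have fc := test_compact tf.
have cf := csmooth_ccontinuous (test_csmooth tf).
pose h (x : 'rV[R]_d) := normc (f x) / cauchyw x.
have hc : continuous h.
  apply: (continuousM_fun (continuous_normc cf)).
  apply: continuousV_fun => [x|]; first by rewrite gt_eqF ?cauchyw_gt0.
  exact: continuous_cauchyw.
have /compact_bounded[M [_ Mh]] : compact (h @` csupport f).
  by apply: continuous_compact fc; exact: continuous_subspaceT.
exists (`|M| + 1) => x; have [sx|/csupport_out ->] := pselect (csupport f x).
  rewrite -ler_pdivrMr ?cauchyw_gt0//.
  apply: le_trans (ler_norm _) (Mh (`|M| + 1) _ (h x) _).
    by rewrite (le_lt_trans (ler_norm _))// ltrDl.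
  by exists x.
rewrite Normc.normc0; apply: mulr_ge0; first exact: addr_ge0.
exact: ltW (cauchyw_gt0 _).
Qed.

End test_functions.

(** * Fourier transform of test functions *)

Section fourier_decay.
Context {R : realType} {d : nat}.
Implicit Types (phi F : 'rV[R]_d -> R[i]) (x y v xi : 'rV[R]_d).

Local Opaque smooth csmooth.

Lemma test_rd_measurable phi : test phi -> rd_measurable phi.
Proof.
by move=> t; apply: ccontinuous_rd_measurable; exact: (csmooth_ccontinuous (test_csmooth t)).
Qed.

Lemma rd_measurable_expi (q : 'rV[R]_d -> R) : continuous q ->
  rd_measurable (fun x => expi (q x)).
Proof. by move=> qc; apply: ccontinuous_rd_measurable; exact: ccontinuous_expi. Qed.

Lemma rd_measurable_character xi : rd_measurable (fun x => expi (- dot x xi)).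
Proof.
apply: rd_measurable_expi; under eq_fun do rewrite dotC -dotNl.
exact: continuous_dot.
Qed.

Lemma rd_bounded_expiM (C : R) F (q : 'rV[R]_d -> R) :
  rd_bounded C F -> rd_bounded C (fun x => expi (q x) * F x).
Proof. by move=> FC x; rewrite normc_expiM. Qed.

Lemma fourier_shift (C : R) F v xi : rd_measurable F -> rd_bounded C F ->
  fourier (fun x => F (x + v)) xi = expi (dot v xi) * fourier F xi.
Proof.
move=> mF FC; rewrite /fourier.
have mG := rd_measurableM (rd_measurable_character xi) mF.
have GC : rd_bounded C (fun x => expi (- dot x xi) * F x) by exact: rd_bounded_expiM.
rewrite -(integral_RdZ _ mG GC) -(integral_Rd_shift v _ (rd_bounded_expiM _ GC)).
  apply: eq_integral_Rd => x; rewrite mulrA -expiD; congr (expi _ * _).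
  by rewrite dotDl opprD addrCA subrr addr0.
apply: rd_measurableM mG; exact: (cmeasurable_cst (D := setT)).
Qed.

Definition difference v F x := F (x + v) - F x.

Definition differences k v F := iter k (difference v) F.

Lemma csmooth_difference v F : csmooth F -> csmooth (difference v F).
Proof.
move=> sF; rewrite /difference; under eq_fun do rewrite -mulN1r.
by apply: (csmoothD (csmooth_shift v sF)); apply: csmoothM sF; exact: csmooth_cst.
Qed.

Lemma csmooth_differences k v F : csmooth F -> csmooth (differences k v F).
Proof. by move=> sF; elim: k => [//|k IH]; exact: csmooth_difference. Qed.

Lemma cdirD1_difference v w F : csmooth F ->
  cdirD [:: w] (difference v F) = difference v (cdirD [:: w] F).
Proof.
move=> sF; rewrite /difference; apply/funext => x.
have e : (fun x => F (x + v) - F x) = (fun x => F (x + v) + (- 1) * F x).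
  by apply/funext => y; rewrite mulN1r.
rewrite e cdirD1D; [|exact: csmooth_shift|apply: csmoothM sF; exact: csmooth_cst].
by rewrite (cdirD1_shift _ _ sF) (cdirDZ _ _ sF) mulN1r.
Qed.

Lemma cdirD1_differences k v w F : csmooth F ->
  cdirD [:: w] (differences k v F) = differences k v (cdirD [:: w] F).
Proof.
move=> sF; elim: k => [//|k IH] /=.
by rewrite cdirD1_difference; [rewrite IH|exact: csmooth_differences].
Qed.

(** Bounds [shift_const] uniformly over displacements of length at most M along any coordinate axis;
    every coordinate is treated like the one that moves. *)
Definition line_const (M : R) : R := \prod_(j < d) (2 * (1 + M ^+ 2)).

Lemma shift_const_line (s M : R) i : `|s| <= M ->
  shift_const (s *: delta_mx 0 i : 'rV[R]_d) <= line_const M.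
Proof.
move=> sM; apply: ler_prod => j _; rewrite mulr_ge0 ?addr_ge0 ?sqr_ge0//=.
rewrite ler_pM2l// lerD2l mxE mxE eqxx /=.
have M0 : 0 <= M by exact: le_trans sM.
case: eqP => _; last by rewrite mulr0 expr0n sqr_ge0.
by rewrite mulr1 -ler_sqrt ?sqr_ge0// !sqrtr_sqr (ger0_norm M0).
Qed.

Lemma rd_bounded_difference i (A h M : R) F : csmooth F -> `|h| <= M ->
  rd_bounded A (cdirD [:: delta_mx 0 i] F) ->
  rd_bounded (2 * A * line_const M * `|h|) (difference (h *: delta_mx 0 i) F).
Proof.
move=> sF hM FA x; have A0 := rd_bounded_ge0 FA.
apply: le_trans (@normc_lipschitz _ _ F x _ (A * line_const M * cauchyw x) h sF _) _.
  move=> s sh; apply: le_trans (FA _) _; rewrite -mulrA ler_wpM2l//.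
  apply: le_trans (cauchyw_shift _ _) _; rewrite (ler_wpM2r (ltW (cauchyw_gt0 _)))//.
  exact/shift_const_line/(le_trans sh).
by rewrite le_eqVlt; apply/orP; left; apply/eqP; ring.
Qed.

(** Each difference costs one derivative and gains one factor |h|. Differences commute with
    differentiation, so the induction hypothesis is applied to the derivative of phi. *)
Lemma rd_bounded_differences i k (M : R) phi : test phi -> exists C : R,
  forall h, `|h| <= M ->
  rd_bounded (C * `|h| ^+ k) (differences k (h *: delta_mx 0 i) phi).
Proof.
elim: k phi => [|k IH] phi tphi.
  have [C phiC] := test_bounded tphi; exists C => h hM.
  by rewrite expr0 mulr1.
have [C HC] := IH _ (test_derive (delta_mx 0 i) tphi).
exists (2 * C * line_const M) => h hM.
have := @rd_bounded_difference i (C * `|h| ^+ k) h M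
  (differences k (h *: delta_mx 0 i) phi).
rewrite (cdirD1_differences _ _ _ (test_csmooth tphi)).
move=> /(_ (csmooth_differences _ _ (test_csmooth tphi)) hM (HC h hM)).
by rewrite exprSr (_ : 2 * (C * _) * _ * _ = 2 * C * line_const M * (`|h| ^+ k * `|h|));
  last ring.
Qed.

Lemma rd_bounded_bounded (C : R) F : rd_bounded C F -> forall x, normc (F x) <= C.
Proof.
move=> FC x; apply: le_trans (FC x) _; rewrite ler_piMr ?(rd_bounded_ge0 FC)//.
rewrite (_ : 1 = \prod_(i < d) (1 : R)); last by rewrite big1.
apply: ler_prod => i _; rewrite (ltW (cauchy_gt0 _)) /=.
by rewrite invf_le1 ?ltr_wpDr ?sqr_ge0// lerDl sqr_ge0.
Qed.

(* With h = pi / xi_i, translation by h e_i multiplies the character by -1. *)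
Lemma fourier_differences k (C : R) i xi phi : test phi -> xi 0 i != 0 ->
  (forall l, (l <= k)%N -> exists C, rd_bounded C
    (differences l ((pi / xi 0 i) *: delta_mx 0 i) phi)) ->
  fourier (differences k ((pi / xi 0 i) *: delta_mx 0 i) phi) xi =
  (- 2) ^+ k * fourier phi xi.
Proof.
move=> tphi xi0; set v := _ *: _; elim: k => [_|k IH kC]; first by rewrite mul1r.
have [B DB] := kC k (leqnSn k).
have mD : rd_measurable (differences k v phi).
  by apply: ccontinuous_rd_measurable; apply: csmooth_ccontinuous; exact/csmooth_differences/test_csmooth.
have DB' := rd_bounded_shift v DB.
have mD' : rd_measurable (fun x => differences k v phi (x + v)).
  apply: ccontinuous_rd_measurable; apply: csmooth_ccontinuous; apply: csmooth_shift.
  exact/csmooth_differences/test_csmooth.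
have mx := rd_measurable_character xi.
rewrite exprS -mulrA -IH; last by move=> l lk; apply: kC; exact: leqW.
rewrite {1}/fourier /= /difference; under eq_integral_Rd do rewrite mulrBr.
rewrite (integral_RdB (rd_measurableM mx mD') (rd_bounded_expiM _ DB')
  (rd_measurableM mx mD) (rd_bounded_expiM _ DB)).
rewrite -!/(fourier _ _) (fourier_shift _ _ mD DB).
rewrite /v dotZl dotC dot_delta divfK// expi_pi.
by rewrite -[X in _ - X]mul1r -mulrBl; congr (_ * _); rewrite -opprD.
Qed.

Lemma normcX (z : R[i]) k : normc (z ^+ k) = normc z ^+ k.
Proof.
elim: k => [|k IH]; first by rewrite !expr0 Normc.normc1.
by rewrite !exprS Normc.normcM IH.
Qed.

Lemma normc2 : normc (2 : R[i]) = 2 :> R.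
Proof.
have -> : (2 : R[i]) = (2 : R)%:C by rewrite rmorph_nat.
by rewrite normc_real ger0_norm.
Qed.

(** With step h = pi / xi_i the k-th difference is O(|h|^k), while its transform is (- 2)^k times
    that of phi; comparing the two yields decay of order k in xi_i. The assumption 1 <= |xi_i| keeps
    |h| below pi, where the difference bound is uniform. *)
Lemma fourier_coord_decay i k phi : test phi -> exists C, forall xi,
  1 <= `|xi 0 i| -> normc (fourier phi xi) * `|xi 0 i| ^+ k <= C.
Proof.
move=> tphi; have [C HC] := rd_bounded_differences i k pi tphi.
exists (C * pi ^+ k * rd_const (R := R) (n := d)) => xi xi1.
have xi0 : xi 0 i != 0 by rewrite -normr_gt0; exact: lt_le_trans xi1.
have hpi : `|pi / xi 0 i| <= pi.
  by rewrite normrM normfV (ger0_norm (pi_ge0 R)) ler_pdivrMr ?normr_gt0// ler_peMr ?pi_ge0.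
have := @fourier_differences k C i xi phi tphi xi0.
have h l : (l <= k)%N -> exists C, rd_bounded C
    (differences l ((pi / xi 0 i) *: delta_mx 0 i) phi).
  move=> _; have [B HB] := rd_bounded_differences i l pi tphi.
  by exists (B * `|pi / xi 0 i| ^+ l); exact: HB.
move=> /(_ h) e.
have : normc (fourier (differences k ((pi / xi 0 i) *: delta_mx 0 i) phi) xi) <=
    C * `|pi / xi 0 i| ^+ k * rd_const (R := R) (n := d).
  apply: normc_integral_Rd; last exact/rd_bounded_expiM/HC.
  apply: rd_measurableM; first exact: rd_measurable_character.
  apply: ccontinuous_rd_measurable; apply: csmooth_ccontinuous.
  exact/csmooth_differences/test_csmooth.
move: (rd_const (R := R) (n := d)) => K.
rewrite e Normc.normcM normrM normfV exprMn (ger0_norm (pi_ge0 R)) exprVn mulrA.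
rewrite mulrAC ler_pdivlMr ?exprn_gt0 ?normr_gt0//; apply: le_trans.
rewrite ler_wpM2r ?exprn_ge0// ler_peMl ?normc_ge0//.
by rewrite normcX normcN normc2 exprn_ege1// ler1n.
Qed.

Lemma fourier_bounded phi : test phi -> exists C, forall xi, normc (fourier phi xi) <= C.
Proof.
move=> tphi; have [C HC] := test_bounded tphi.
exists (C * rd_const (R := R) (n := d)) => xi.
apply: normc_integral_Rd; last exact: rd_bounded_expiM.
by apply: rd_measurableM; [exact: rd_measurable_character|exact: test_rd_measurable].
Qed.

Lemma fourier_decay k phi : test phi -> exists C, forall xi,
  normc (fourier phi xi) * (1 + enorm xi) ^+ k <= C.
Proof.
move=> tphi; have [C0 HC0] := fourier_bounded tphi.
have [C HC] := choice (fun i => fourier_coord_decay i k tphi).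
have C00 : 0 <= C0 by exact: le_trans (normc_ge0 _) (HC0 0).
pose K : R := (1 + d%:R) ^+ k.
have K0 : 0 <= K by rewrite exprn_ge0// addr_ge0.
have S0 : 0 <= \sum_i `|C i| by exact: sumr_ge0.
exists ((C0 + \sum_i `|C i|) * K) => xi.
have [big|small] := pselect (exists i, 1 <= `|xi 0 i|).
  have [i0 _] := big.
  (* Decay is used in the coordinate of largest modulus, which controls the Euclidean norm up to the
     factor d. *)
  case: (@arg_maxP _ _ _ i0 xpredT (fun i => `|xi 0 i|) isT) => j _ jmax.
  have xj1 : 1 <= `|xi 0 j| by have [i xi1] := big; exact: le_trans (jmax i isT).
  have le : 1 + enorm xi <= (1 + d%:R) * `|xi 0 j|.
    rewrite mulrDl mul1r lerD//; apply: le_trans (enorm_sum _) _.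
    apply: le_trans (ler_sum _ (fun i _ => jmax i isT)) _.
    by rewrite sumr_const card_ord mulr_natl.
  apply: (@le_trans _ _ (normc (fourier phi xi) * (K * `|xi 0 j| ^+ k))).
    rewrite ler_wpM2l ?normc_ge0// -exprMn lerXn2r// nnegrE ?mulr_ge0 ?addr_ge0//.
    exact: enorm_ge0.
  rewrite mulrCA mulrC ler_wpM2r//; apply: le_trans (HC j xi xj1) _.
  apply: le_trans (ler_norm _) _; rewrite (bigD1 j)//= addrCA lerDl addr_ge0//.
  exact: sumr_ge0.
have le : 1 + enorm xi <= 1 + d%:R.
  rewrite lerD2l; apply: le_trans (enorm_sum _) _.
  have h i : `|xi 0 i| <= 1.
    by rewrite leNgt; apply/negP => h; apply: small; exists i; exact: ltW.
  apply: le_trans (ler_sum _ (fun i _ => h i)) _.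
  by rewrite sumr_const card_ord.
apply: ler_pM; rewrite ?normc_ge0 ?exprn_ge0 ?addr_ge0 ?enorm_ge0//.
  by apply: le_trans (HC0 xi) _; rewrite lerDl.
by rewrite lerXn2r// nnegrE addr_ge0// enorm_ge0.
Qed.

Lemma enorm1_gt0 xi : 0 < 1 + enorm xi.
Proof. by rewrite ltr_wpDr ?enorm_ge0. Qed.

Lemma cauchyw_enorm xi : 1 <= cauchyw xi * (1 + enorm xi) ^+ (2 * d).
Proof.
rewrite exprM -[X in _ ^+ X]card_ord -prodr_const -big_split /=.
rewrite [leLHS](_ : 1 = \prod_(i < d) (1 : R)); last by rewrite big1.
apply: ler_prod => i _; rewrite ler01 /= mulrC ler_pdivlMr ?mul1r; last first.
  by rewrite ltr_wpDr ?sqr_ge0.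
have := normr_coord_enorm xi i; have := enorm_ge0 xi; have := normr_ge0 (xi 0 i).
rewrite -(real_normK (num_real (xi 0 i))); nra.
Qed.

Lemma fourier_weight_decay (s : R) phi : test phi -> exists C, forall xi,
  normc (fourier phi xi) * (1 + enorm xi) `^ s <= C * cauchyw xi.
Proof.
move=> tphi; have [N sN] : exists N : nat, s <= N%:R.
  exists (Num.truncn `|s|).+1; apply: le_trans (ler_norm s) _.
  exact: ltW (truncnS_gt _).
(* The N powers absorb the real exponent s; the other 2 d are exchanged for the weight by
   [cauchyw_enorm]. *)
have [C HC] := fourier_decay (N + 2 * d) tphi.
exists C => xi; have e0 := enorm1_gt0 xi.
apply: (@le_trans _ _ (normc (fourier phi xi) * (1 + enorm xi) ^+ N)).
  rewrite ler_wpM2l ?normc_ge0// -powR_mulrn; last exact: ltW.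
  by rewrite ler_powR// lerDl enorm_ge0.
apply: le_trans (ler_wpM2r (ltW (cauchyw_gt0 xi)) (HC xi)).
rewrite exprD mulrA -(mulrA _ _ (cauchyw xi)) ler_peMr//; last first.
  by rewrite mulrC cauchyw_enorm.
by rewrite mulr_ge0 ?normc_ge0// exprn_ge0//; exact: ltW e0.
Qed.

Lemma fourier_rd_bounded phi : test phi -> exists C, rd_bounded C (fourier phi).
Proof.
move=> tphi; have [C HC] := fourier_weight_decay 0 tphi; exists C => xi.
by have := HC xi; rewrite powRr0 mulr1.
Qed.

(** The bound does not decay in x, so Fubini does not apply to F itself. The integrand is first
    multiplied by the positive continuous factor [cauchyw x / c x], which is divided out
    afterwards. *)
Lemma rd_measurable_parameter (F : 'rV[R]_d * 'rV[R]_d -> R[i]) (c : 'rV[R]_d -> R) :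
  cmeasurable setT (fun p => F (rowt p.1, rowt p.2)) -> continuous c ->
  (forall x, 0 < c x) ->
  (forall x y, normc (F (x, y)) <= c x * cauchyw y) ->
  rd_measurable (fun x => integral_Rd (fun y => F (x, y))).
Proof.
move=> Fm cc c0 FC; pose w x := cauchyw x / c x.
have w0 x : 0 < w x by rewrite divr_gt0 ?cauchyw_gt0.
have wc : continuous w.
  apply: (continuousM_fun (@continuous_cauchyw _ _)).
  by apply: continuousV_fun => [x|//]; rewrite gt_eqF.
pose G (p : 'rV[R]_d * 'rV[R]_d) := (w p.1)%:C * F p.
have Gm : cmeasurable setT (fun p => G (rowt p.1, rowt p.2)).
  suff: cmeasurable setT (fun p : d.-tuple R * d.-tuple R => (w (rowt p.1))%:C) by move/cmeasurableM; apply.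
  apply: (ccontinuous_pair_measurable (F := fun p => (w p.1)%:C)).
  by apply: ccontinuous_real; exact: continuous_fst_comp wc.
have mF x : rd_measurable (fun y => F (x, y)).
  have -> : x = rowt [tuple x 0 i | i < d].
    by apply/rowP => i; rewrite mxE tnth_mktuple.
  exact: rd_measurable_pair2.
have h : rd_measurable (fun x => integral_Rd (fun y => G (x, y))).
  apply: (@rd_measurable_inner _ _ G 1 Gm) => x y.
  rewrite Normc.normcM normc_real /= (ger0_norm (ltW (w0 x))) mul1r.
  apply: le_trans (ler_wpM2l (ltW (w0 x)) (FC x y)) _.
  by rewrite mulrA divfK ?gt_eqF.
have -> : (fun x => integral_Rd (fun y => F (x, y))) =
    (fun x => ((w x)^-1)%:C * integral_Rd (fun y => G (x, y))).
  apply/funext => x; rewrite /G /= (integral_RdZ (w x)%:C (mF x) (FC x)) mulrA -rmorphM /=.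
  by rewrite mulVf ?mul1r ?gt_eqF.
apply: rd_measurableM h; apply: ccontinuous_rd_measurable; apply: ccontinuous_real.
by apply: continuousV_fun wc => x; rewrite gt_eqF.
Qed.

Lemma rd_measurable_fourier phi : test phi -> rd_measurable (fourier phi).
Proof.
move=> tphi; have [C HC] := test_bounded tphi.
pose F p := expi (- dot p.2 p.1) * phi p.2.
apply: (@rd_measurable_parameter F (fun=> `|C| + 1)).
- apply: (ccontinuous_pair_measurable (F := F)); apply: ccontinuousM.
    apply: ccontinuous_expi; apply: continuousN_fun.
    rewrite (_ : (fun p => _) = (fun p : 'rV[R]_d * 'rV[R]_d => dot p.1 p.2)).
      exact: continuous_dot_pair.
    by apply/funext => p; rewrite dotC.
  apply: (ccontinuous_comp (csmooth_ccontinuous (test_csmooth tphi))) => p.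
  exact: cvg_snd.
- exact: cst_continuous.
- by move=> x; rewrite ltr_wpDl.
- move=> x y; rewrite normc_expiM; apply: le_trans (HC y) _.
  by rewrite (ler_wpM2r (ltW (cauchyw_gt0 _)))// (le_trans (ler_norm _))// lerDl.
Qed.

End fourier_decay.

Lemma continuous_affine {R : realType} {V : normedModType R} (a : R) (x : V) :
  continuous (fun z : V => a *: z + x).
Proof.
move=> z; apply: (@cvgD _ _ _ _ _ (fun z : V => a *: z) (fun=> x)).
  exact: (@cvgZl_tmp _ _ _ _ _ a id z cvg_id).
exact: cvg_cst.
Qed.

(** * The Poisson kernel in one dimension *)

Section poisson_kernel.
Context {R : realType}.
Local Notation mu := (@lebesgue_measure R).

Lemma ge0_integral_reflection (f : R -> \bar R) :
  measurable_fun setT f -> (forall x, 0 <= f x)%E ->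
  (\int[mu]_x f (- x)%R = \int[mu]_x f x)%E.
Proof.
move=> mf f0.
have mN : measurable_fun setT (fun x : R => - x).
  by apply: continuous_measurable_fun; apply: (continuousN_fun (f := id)) => x; exact: cvg_id.
rewrite (@ge0_integral_image _ _ _ (measurableTypeR R) (measurableTypeR R) mu mu
  (fun x => - x) mN 1%:nng)//; first by rewrite mul1e.
move=> A mA; rewrite mul1e.
have [nu nuE] : exists nu : {measure set (measurableTypeR R) -> \bar R},
    forall B, nu B = mu ((fun x => - x) @^-1` B).
  by exists (@measure_function_pushforward__canonical__measure_function_Measure
      _ _ (measurableTypeR R) (measurableTypeR R) R mu (fun x => - x) mN).
transitivity (nu A); first by rewrite nuE.
apply/esym; apply: lebesgue_measure_unique => // _ [[u v] _ <-] /=.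
rewrite nuE; have -> : (fun x => - x) @^-1` `]u, v] = `[- v, - u[%classic.
  apply/seteqP; split=> x /=; rewrite !in_itv /=.
    by rewrite ltrNr lerNl andbC.
  by rewrite ltrNr lerNl andbC.
rewrite !lebesgue_measure_itv /= !lte_fin ltrN2.
by case: ifP => _ //; rewrite -!EFinB; congr EFin; ring.
Qed.

Lemma Rintegral_odd (f : R -> R) : mu.-integrable setT (EFin \o f) ->
  (forall x, f (- x) = - f x) -> \int[mu]_x f x = 0.
Proof.
move=> fi fodd; have mf := measurable_int _ fi.
rewrite /Rintegral integralE.
have -> : (\int[mu]_x (EFin \o f)^\-%E x = \int[mu]_x (EFin \o f)^\+%E x)%E.
  rewrite -(@ge0_integral_reflection (EFin \o f)^\-%E) //; last exact: measurable_funeneg.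
  apply: eq_integral => x _; rewrite funeposE funenegE /= fodd.
  by rewrite opprK.
rewrite subee//; exact: (integrable_pos_fin_num measurableT fi).
Qed.

Variable eps : R.
Hypothesis eps0 : 0 < eps.

Let g (t : R) := expR (- (eps * `|t|)).

Let g0 t : 0 < g t. Proof. exact: expR_gt0. Qed.

Lemma continuous_poisson : continuous (fun t : R => expR (- (eps * `|t|))).
Proof.
move=> t; apply: continuous_comp; last exact: continuous_expR.
apply: continuousN_fun; apply: (continuousM_fun (f := fun=> eps)).
  exact: cst_continuous.
exact: norm_continuous.
Qed.

Definition poisson_bound : R := 1 + 4 / eps ^+ 2.

(** From e^u >= (1 + u / 2)^2 with u = eps |t|; the constant 1 + 4 / eps^2 is what makes (1 + 4 /
    eps^2) (1 + u / 2)^2 at least 1 + t^2. *)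
Lemma poisson_le t : expR (- (eps * `|t|)) <= poisson_bound * cauchy t.
Proof.
have h : 1 + eps * `|t| / 2 <= expR (eps * `|t| / 2) by exact: expR_ge1Dx.
have e : expR (eps * `|t|) = expR (eps * `|t| / 2) ^+ 2.
  by rewrite expr2 -expRD -splitr.
have a0 : 0 <= eps * `|t| / 2 by rewrite divr_ge0// mulr_ge0// ltW.
rewrite expRN e ler_pdivlMr ?ltr_wpDr ?sqr_ge0//.
rewrite mulrC ler_pdivrMr ?exprn_gt0 ?expR_gt0//.
apply: (@le_trans _ _ (poisson_bound * (1 + eps * `|t| / 2) ^+ 2)); last first.
  rewrite ler_wpM2l ?addr_ge0 ?divr_ge0 ?sqr_ge0// lerXn2r// nnegrE ?expR_ge0//.
  by rewrite addr_ge0.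
rewrite /poisson_bound -(real_normK (num_real t)).
have -> : (1 + 4 / eps ^+ 2) * (1 + eps * `|t| / 2) ^+ 2 =
   (1 + eps * `|t| / 2) ^+ 2 + (4 / eps ^+ 2) * (1 + eps * `|t|) + `|t| ^+ 2.
  by field; rewrite gt_eqF.
rewrite lerD2r -[leLHS]addr0 lerD//.
  by rewrite exprn_ege1// lerDl.
by rewrite mulr_ge0 ?divr_ge0 ?sqr_ge0// addr_ge0// mulr_ge0// ltW.
Qed.

Lemma integrable_poisson_bound :
  mu.-integrable setT (EFin \o (fun t => poisson_bound * cauchy t)).
Proof. exact: (integrableZlR measurableT _ integrable_cauchy). Qed.

(** Evenness reduces the integral to a half line, where the fundamental theorem of calculus applies
    with primitive F. The sign condition on f comes from these two results and shapes the next
    computations. *)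
Let half_line_integral (f h F : R -> R) (l : R) :
  continuous f -> (forall t, 0 <= f t) -> (forall t, f (- t) = f t) ->
  (forall t, 0 < t -> f t = h t) ->
  (forall t : R, derivable F t 1 /\ 'D_1 F t = h t) -> F t @[t --> +oo] --> l ->
  \int[mu]_t f t = 2 * (l - F 0).
Proof.
move=> fc f0 fe fh dF Fl.
have e := @ge0_symfun_integralT R f f0 fc (fun x => esym (fe x)).
have c0 : {for 0, continuous F} by apply: differentiable_continuous; apply/derivable1_diffP; have [] := dF 0.
have h2 := @ge0_continuous_FTC2y R f F 0 l (fun x _ => f0 x)
  (continuous_subspaceT fc) Fl (fun x _ => (dF x).1)
  (cvg_at_right_filter c0).
rewrite /Rintegral e set_itvE in h2 *; rewrite h2 //.
move=> t; rewrite in_itv /= andbT => t0.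
by rewrite derive1E; have [_ ->] := dF t; rewrite fh.
Qed.

Let expm (t : R) := expR (- (eps * t)).

Let dexpm (t : R) : is_derive t (1 : R) expm (- eps * expm t).
Proof.
have h : is_derive t (1 : R) (fun s : R => - eps * s) (- eps).
  have := @is_deriveZ R R R id (- eps) t 1 1 (is_derive_id _ _).
  by rewrite [_ *: 1]mulr1.
have := is_derive1_comp (is_derive_expR (- eps * t)) h.
have -> : expR \o *%R (- eps) = expm by apply/funext => s /=; rewrite mulNr.
by move=> [dd e]; split; [exact: dd|rewrite e mulrC /expm -mulNr].
Qed.

Let cvg_expm : expm t @[t --> +oo] --> (0 : R).
Proof.
have h : (eps * t) @[t --> +oo] --> +oo.
  exact: gt0_cvgMry.
exact: (cvg_comp _ _ h (@cvgr_expR R)).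
Qed.

Let dcos (z t : R) : is_derive t (1 : R) (fun t => cos (z * t)) (- sin (z * t) * z).
Proof.
apply: is_derive1_comp.
have := @is_deriveZ R R R id z t 1 1 (is_derive_id _ _).
by rewrite [_ *: 1]mulr1.
Qed.

Let dsin (z t : R) : is_derive t (1 : R) (fun t => sin (z * t)) (cos (z * t) * z).
Proof.
apply: is_derive1_comp.
have := @is_deriveZ R R R id z t 1 1 (is_derive_id _ _).
by rewrite [_ *: 1]mulr1.
Qed.

Let cont_cos (z : R) : continuous (fun t => cos (z * t)).
Proof.
apply: continuous_cos_comp; apply: (continuousM_fun (@cst_continuous _ _ z)) => t.
exact: cvg_id.
Qed.

Let cont_sin (z : R) : continuous (fun t => sin (z * t)).
Proof.
apply: continuous_sin_comp; apply: (continuousM_fun (@cst_continuous _ _ z)) => t.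
exact: cvg_id.
Qed.

Let eps2 z : 0 < eps ^+ 2 + z ^+ 2.
Proof. by rewrite ltr_wpDr ?sqr_ge0 ?exprn_gt0. Qed.

Lemma Rintegral_damped : \int[mu]_t expR (- (eps * `|t|)) = 2 / eps.
Proof.
rewrite (@half_line_integral _ expm (fun t => (- eps^-1) * expm t) 0).
- by rewrite /expm mulr0 oppr0 expR0; field; rewrite gt_eqF.
- exact: continuous_poisson.
- by move=> t; exact: expR_ge0.
- by move=> t; rewrite normrN.
- by move=> t t0; rewrite gtr0_norm.
- move=> t; have [dd e] := @is_deriveZ R R R expm (- eps^-1) t 1 _ (dexpm t).
  split; first exact: dd.
  by apply: (etrans e); rewrite [_ *: _]mulrA mulrNN mulVf ?mul1r ?gt_eqF.
- rewrite -(mulr0 (- eps^-1)); apply: cvgM; [exact: cvg_cst|exact: cvg_expm].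
Qed.

(** [half_line_integral] asks for a nonnegative integrand, hence 1 + cos instead of cos; subtracting
    [Rintegral_damped] later leaves the cosine transform. *)
Lemma Rintegral_damped_cos1 (z : R) :
  \int[mu]_t (expR (- (eps * `|t|)) * (1 + cos (z * t))) =
  2 / eps + 2 * eps / (eps ^+ 2 + z ^+ 2).
Proof.
(* The second term is the real part of the primitive - e^(- (eps - i z) t) / (eps - i z) of the
   complex exponential. *)
pose F t := expm t * ((- eps^-1) +
  (eps ^+ 2 + z ^+ 2)^-1 * (- eps * cos (z * t) + z * sin (z * t))).
rewrite (@half_line_integral _ (fun t => expm t * (1 + cos (z * t))) F 0).
- rewrite /F /expm !mulr0 oppr0 expR0 cos0 sin0.
  by field; rewrite !gt_eqF//= eps2.
- apply: (continuousM_fun continuous_poisson).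
  by apply: (continuousD_fun (@cst_continuous _ _ (1 : R))); exact: cont_cos.
- move=> t; apply: mulr_ge0; first exact: expR_ge0.
  by rewrite -lerBlDl sub0r cos_geN1.
- by move=> t; rewrite normrN mulrN cosN.
- by move=> t t0; rewrite gtr0_norm.
- move=> t.
  have d1 := is_deriveD (@is_deriveZ R R R _ (- eps) t 1 _ (dcos z t))
    (@is_deriveZ R R R _ z t 1 _ (dsin z t)).
  have d2 := is_deriveD (is_derive_cst (- eps^-1) t (1 : R))
    (@is_deriveZ R R R _ (eps ^+ 2 + z ^+ 2)^-1 t 1 _ d1).
  have [dd e] := is_deriveM (dexpm t) d2.
  split; first exact: dd.
  apply: (etrans e); pose K := (eps ^+ 2 + z ^+ 2)^-1.
  transitivity (expm t * (0 + K * (- eps * (- sin (z * t) * z) + z * (cos (z * t) * z))) +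
    (- eps^-1 + K * (- eps * cos (z * t) + z * sin (z * t))) * (- eps * expm t)); first by [].
  by rewrite /K; field; rewrite !gt_eqF//= eps2.
- apply/cvgr0Pnorm_le => e e0.
  pose K := eps^-1 + (eps ^+ 2 + z ^+ 2)^-1 * (eps + `|z|).
  have i2 : 0 <= (eps ^+ 2 + z ^+ 2)^-1 by rewrite invr_ge0; exact: ltW (eps2 z).
  have K0 : 0 <= K.
    by rewrite addr_ge0 ?invr_ge0 ?(ltW eps0)// mulr_ge0// addr_ge0// (ltW eps0).
  have := cvg_expm => /cvgr0Pnorm_le /(_ (e / (K + 1))).
  have K1 : 0 < K + 1 by rewrite ltr_wpDl.
  move=> /(_ (divr_gt0 e0 K1)); apply: filterS => t; rewrite ler_pdivlMr//.
  apply: le_trans; rewrite normrM ler_wpM2l//.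
  apply: (@le_trans _ _ K); last by rewrite lerDl.
  apply: le_trans (ler_normD _ _) _; rewrite normrN gtr0_norm ?invr_gt0// lerD2l.
  rewrite normrM (ger0_norm i2) ler_wpM2l//.
  apply: le_trans (ler_normD _ _) _; rewrite !normrM normrN (gtr0_norm eps0).
  by rewrite lerD// ler_piMr ?(ltW eps0)// ler_norml ?cos_geN1 ?cos_le1 ?sin_geN1 ?sin_le1.
Qed.

Lemma cintegral_poisson (z : R) :
  cintegral mu setT (fun t => (expR (- (eps * `|t|)))%:C * expi (z * t)) =
  (2 * eps / (eps ^+ 2 + z ^+ 2))%:C.
Proof.
have mg := continuous_measurable_fun continuous_poisson.
have ig : mu.-integrable setT (EFin \o (fun t => expR (- (eps * `|t|)))).
  apply: (@le_integrableR R _ (measurableTypeR R) mu setT measurableT _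
    (fun t => poisson_bound * cauchy t)) integrable_poisson_bound => //.
  by move=> t _; rewrite ger0_norm ?expR_ge0// poisson_le.
have igc : mu.-integrable setT (EFin \o (fun t => expR (- (eps * `|t|)) * cos (z * t))).
  apply: (@le_integrableR R _ (measurableTypeR R) mu setT measurableT _
    (fun t => expR (- (eps * `|t|)))) ig.
    have cc := continuousM_fun continuous_poisson (@cont_cos z).
    exact: (continuous_measurable_fun cc).
  move=> t _; rewrite normrM ger0_norm ?expR_ge0// ler_piMr ?expR_ge0//.
  by rewrite ler_norml cos_geN1 cos_le1.
have igs : mu.-integrable setT (EFin \o (fun t => expR (- (eps * `|t|)) * sin (z * t))).
  apply: (@le_integrableR R _ (measurableTypeR R) mu setT measurableT _
    (fun t => expR (- (eps * `|t|)))) ig.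
    have cc := continuousM_fun continuous_poisson (@cont_sin z).
    exact: (continuous_measurable_fun cc).
  move=> t _; rewrite normrM ger0_norm ?expR_ge0// ler_piMr ?expR_ge0//.
  by rewrite ler_norml sin_geN1 sin_le1.
apply: complex_ext; rewrite ?Re_cintegral ?Im_cintegral.
  under eq_Rintegral do rewrite RecM /= mul0r subr0.
  have := Rintegral_damped_cos1 z.
  under eq_Rintegral do rewrite mulrDr mulr1.
  rewrite RintegralD// Rintegral_damped => /addrI -> //.
under eq_Rintegral do rewrite ImcM /= mul0r addr0.
apply: (Rintegral_odd igs) => t.
by rewrite normrN mulrN sinN mulrN.
Qed.

End poisson_kernel.

(** * Fourier inversion by Poisson regularisation *)

Section fourier_inversion.
Context {R : realType} {d : nat}.
Local Notation mu := (@lebesgue_measure R).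
Implicit Types (x y z xi : 'rV[R]_d) (phi : 'rV[R]_d -> R[i]).

(** A product over coordinates, rather than a function of the Euclidean norm, so that its Fourier
    integral factors into one-dimensional ones. *)
Definition poisson (eps : R) xi : R := \prod_i expR (- (eps * `|xi 0 i|)).

Lemma continuous_poissonw eps : continuous (poisson eps).
Proof.
apply: continuous_prod => i xi.
apply: (@continuous_comp _ _ _ (fun xi : 'rV[R]_d => xi 0 i)
  (fun t => expR (- (eps * `|t|)))); first exact: continuous_coord.
exact: continuous_poisson.
Qed.

Lemma poisson_ge0 eps xi : 0 <= poisson eps xi.
Proof. by apply: prodr_ge0 => i _; exact: expR_ge0. Qed.

Lemma poisson_le1 eps xi : 0 < eps -> poisson eps xi <= 1.
Proof.
move=> e0; rewrite [leRHS](_ : 1 = \prod_(i < d) (1 : R)); last by rewrite big1.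
apply: ler_prod => i _; rewrite expR_ge0 /= -expR0 ler_expR oppr_le0.
by rewrite mulr_ge0// ltW.
Qed.

Lemma poissonw_le eps xi : 0 < eps ->
  poisson eps xi <= poisson_bound eps ^+ d * cauchyw xi.
Proof.
move=> e0; rewrite -[X in _ ^+ X]card_ord -prodr_const -big_split /=.
by apply: ler_prod => i _; rewrite expR_ge0 poisson_le.
Qed.

Lemma integral_poisson eps z : 0 < eps ->
  integral_Rd (fun xi => (poisson eps xi)%:C * expi (dot z xi)) =
  (\prod_i (2 * eps / (eps ^+ 2 + z 0 i ^+ 2)))%:C.
Proof.
move=> e0.
pose K (i : 'I_d) (t : R) := (expR (- (eps * `|t|)))%:C * expi (z 0 i * t).
have -> : integral_Rd (fun xi => (poisson eps xi)%:C * expi (dot z xi)) =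
    cintegral (lebesgue_tuple d) setT (fun t => \prod_i K i (tnth t i)).
  apply: eq_cintegral => t _; rewrite /poisson /K big_split /= rmorph_prod /=.
  congr (_ * _); first by apply: eq_bigr => i _; rewrite mxE.
  rewrite /dot; elim/big_ind2 : _ => //; first exact: expi0.
    by move=> a b a' b' <- <-; rewrite expiD.
  by move=> i _; rewrite mxE.
rewrite (cintegral_tuple_prod (g := fun _ t => poisson_bound eps * cauchy t)).
- by rewrite rmorph_prod /=; apply: eq_bigr => i _; exact: cintegral_poisson.
- move=> i; apply: cmeasurableM.
    apply: cmeasurable_real; exact: continuous_measurable_fun (@continuous_poisson _ _).
  have cz : continuous (fun t => z 0 i * t).
    by apply: (continuousM_fun (@cst_continuous _ _ (z 0 i))) => t; exact: cvg_id.
  split; first exact: (continuous_measurable_fun (continuous_cos_comp cz)).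
  exact: (continuous_measurable_fun (continuous_sin_comp cz)).
- move=> i t; rewrite Normc.normcM normc_expi mulr1 normc_real ger0_norm ?expR_ge0//.
  exact: poisson_le.
- by move=> i; exact: integrable_poisson_bound.
Qed.

Variable phi : 'rV[R]_d -> R[i].
Hypothesis tphi : test phi.

(** Fubini, made legitimate by the damping, turns the left side into a convolution of phi with the
    product of the kernels 2 eps / (eps^2 + z_i^2). The substitution y = eps z + x replaces them by
    a fixed weight: (2 / eps)^d times the Jacobian eps^d gives 2^d. *)
Let regularized (eps : R) x : 0 < eps ->
  integral_Rd (fun xi => (poisson eps xi)%:C * (expi (dot x xi) * fourier phi xi)) =
  (2 ^+ d)%:C * integral_Rd (fun z => (cauchyw z)%:C * phi (eps *: z + x)).
Proof.
move=> e0; have [C HC] := test_bounded tphi.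
have mphi := test_rd_measurable tphi.
pose F (p : 'rV[R]_d * 'rV[R]_d) :=
  (poisson eps p.1)%:C * (expi (dot x p.1) * (expi (- dot p.2 p.1) * phi p.2)).
have Fc : ccontinuous F.
  apply: ccontinuousM.
    apply: ccontinuous_real; exact: (continuous_fst_comp (@continuous_poissonw eps)).
  apply: ccontinuousM.
    by apply: ccontinuous_expi; exact: (continuous_fst_comp (@continuous_dot _ _ x)).
  apply: ccontinuousM.
    apply: ccontinuous_expi; apply: continuousN_fun.
    rewrite (_ : (fun p => _) = (fun p : 'rV[R]_d * 'rV[R]_d => dot p.1 p.2)).
      exact: continuous_dot_pair.
    by apply/funext => p; rewrite dotC.
  apply: (ccontinuous_comp (csmooth_ccontinuous (test_csmooth tphi))) => p.
  exact: cvg_snd.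
have FC xi y : normc (F (xi, y)) <= (poisson_bound eps ^+ d * C) * cauchyw xi * cauchyw y.
  rewrite /F /= Normc.normcM !normc_expiM normc_real ger0_norm ?poisson_ge0//.
  rewrite (_ : _ * C * _ * _ = (poisson_bound eps ^+ d * cauchyw xi) * (C * cauchyw y));
    last by ring.
  apply: ler_pM; rewrite ?poisson_ge0 ?normc_ge0//; exact: poissonw_le.
transitivity (integral_Rd (fun xi => integral_Rd (fun y => F (xi, y)))).
  apply: eq_integral_Rd => xi.
  have mG : rd_measurable (fun y => expi (- dot y xi) * phi y).
    by apply: rd_measurableM => //; exact: rd_measurable_character.
  have GC := rd_bounded_expiM (fun y => - dot y xi) HC.
  rewrite mulrA /fourier -(integral_RdZ _ mG GC); apply: eq_integral_Rd => y.
  by rewrite /F /= -!mulrA.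
rewrite (integral_Rd_fubini (ccontinuous_pair_measurable Fc) FC).
pose G y := (\prod_i (2 * eps / (eps ^+ 2 + (x - y) 0 i ^+ 2)))%:C * phi y.
transitivity (integral_Rd G).
  apply: eq_integral_Rd => y; rewrite /G -integral_poisson// [RHS]mulrC.
  have mP : rd_measurable (fun xi => (poisson eps xi)%:C * expi (dot (x - y) xi)).
    apply: ccontinuous_rd_measurable; apply: ccontinuousM.
      by apply: ccontinuous_real; exact: continuous_poissonw.
    by apply: ccontinuous_expi; exact: continuous_dot.
  have PC : rd_bounded (poisson_bound eps ^+ d) (fun xi => (poisson eps xi)%:C * expi (dot (x - y) xi)).
    move=> xi; rewrite Normc.normcM normc_expi mulr1 normc_real ger0_norm ?poisson_ge0//.
    exact: poissonw_le.
  rewrite -(integral_RdZ _ mP PC); apply: eq_integral_Rd => xi; rewrite /F /=.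
  rewrite dotDl dotNl expiD; ring.
have prod_bound y : 0 <= \prod_i (2 * eps / (eps ^+ 2 + (x - y) 0 i ^+ 2)) <= (2 / eps) ^+ d.
  have p0 i : 0 <= 2 * eps / (eps ^+ 2 + (x - y) 0 i ^+ 2).
    by rewrite divr_ge0 ?mulr_ge0 ?addr_ge0 ?sqr_ge0// ltW.
  apply/andP; split; first by apply: prodr_ge0.
  rewrite -[X in _ <= _ ^+ X]card_ord -prodr_const; apply: ler_prod => i _.
  rewrite p0 /= ler_pdivrMr ?ltr_wpDr ?sqr_ge0 ?exprn_gt0//.
  rewrite mulrDr (_ : 2 / eps * eps ^+ 2 = 2 * eps); last by field; rewrite gt_eqF.
  by rewrite lerDl mulr_ge0 ?sqr_ge0 ?divr_ge0 ?ltW.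
have mG : rd_measurable G.
  apply: rd_measurableM => //; apply: ccontinuous_rd_measurable; apply: ccontinuous_real.
  apply: continuous_prod => i.
  apply: (continuousM_fun (@cst_continuous _ _ (2 * eps))).
  apply: continuousV_fun => [y|]; first by rewrite gt_eqF// ltr_wpDr ?sqr_ge0 ?exprn_gt0.
  apply: (continuousD_fun (@cst_continuous _ _ (eps ^+ 2))).
  rewrite (_ : (fun y => _) = (fun y : 'rV[R]_d => (x 0 i - y 0 i) * (x 0 i - y 0 i))).
    have c : continuous (fun y : 'rV[R]_d => x 0 i - y 0 i).
      apply: (continuousD_fun (@cst_continuous _ _ (x 0 i))).
      by apply: continuousN_fun; exact: continuous_coord.
    exact: (continuousM_fun c c).
  by apply/funext => y; rewrite !mxE expr2.
have GC : rd_bounded ((2 / eps) ^+ d * C) G.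
  move=> y; rewrite /G Normc.normcM normc_real -mulrA; have /andP[p0 p1] := prod_bound y.
  by apply: ler_pM; rewrite ?normr_ge0 ?normc_ge0// ?ger0_norm//; exact: HC.
have en : eps ^+ d != 0 by rewrite expf_neq0 ?gt_eqF.
have -> : integral_Rd G = (eps ^+ d)%:C * integral_Rd (fun z => G (eps *: z + x)).
  rewrite (integral_Rd_affine x e0 mG GC) mulrA -rmorphM divff; last exact: en.
  by rewrite rmorph1 mul1r.
have mH : rd_measurable (fun z => (cauchyw z)%:C * phi (eps *: z + x)).
  apply: rd_measurableM.
    by apply: ccontinuous_rd_measurable; apply: ccontinuous_real; exact: continuous_cauchyw.
  apply: ccontinuous_rd_measurable.
  apply: (ccontinuous_comp (csmooth_ccontinuous (test_csmooth tphi))).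
  exact: continuous_affine.
have HH : rd_bounded C (fun z => (cauchyw z)%:C * phi (eps *: z + x)).
  move=> z; rewrite Normc.normcM normc_real ger0_norm ?(ltW (cauchyw_gt0 _))// mulrC.
  by rewrite (ler_wpM2r (ltW (cauchyw_gt0 _)))// (rd_bounded_bounded HC).
have Gz z : G (eps *: z + x) = ((2 / eps) ^+ d)%:C * ((cauchyw z)%:C * phi (eps *: z + x)).
  rewrite /G mulrA -rmorphM /=; congr ((_)%:C * _).
  rewrite -[X in _ = _ ^+ X * _]card_ord -prodr_const -big_split /=; apply: eq_bigr => i _.
  rewrite !mxE /cauchy (_ : x 0 i - (eps * z 0 i + x 0 i) = - (eps * z 0 i)); last by ring.
  rewrite sqrrN exprMn; field.
  have p (a b : R) : 0 < a -> a + b ^+ 2 != 0.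
    by move=> a0; rewrite gt_eqF// ltr_wpDr ?sqr_ge0.
  by rewrite !p ?exprn_gt0// gt_eqF.
rewrite (eq_integral_Rd Gz) (integral_RdZ _ mH HH) mulrA -rmorphM /=.
by rewrite -exprMn mulrCA divff ?mulr1// gt_eqF.
Qed.

Lemma integral_cauchyw : integral_Rd (fun z => (cauchyw z)%:C) = (pi ^+ d)%:C :> R[i].
Proof.
transitivity (cintegral (lebesgue_tuple d) setT
    (fun t : d.-tuple R => \prod_(i < d) (cauchy (tnth t i))%:C)).
  apply: eq_cintegral => t _; rewrite /cauchyw rmorph_prod /=.
  by apply: eq_bigr => i _; rewrite mxE.
rewrite (cintegral_tuple_prod (K := fun _ t => (cauchy t)%:C) (g := fun _ t => cauchy t)).
- rewrite -[X in _ ^+ X]card_ord -prodr_const rmorph_prod /=; apply: eq_bigr => i _.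
  apply: complex_ext; rewrite ?Re_cintegral ?Im_cintegral /=.
    exact: Rintegral_cauchy.
  by rewrite Rintegral_cst// mul0r.
- move=> i; apply: cmeasurable_real.
  exact: continuous_measurable_fun (@continuous_cauchy _).
- by move=> i t; rewrite normc_real ger0_norm ?(ltW (cauchy_gt0 _)).
- by move=> i; exact: integrable_cauchy.
Qed.

(** As eps = 1 / (k + 1) tends to 0 in [regularized], the damping disappears on the left, and phi
    (eps z + x) tends to phi x on the right. The weight has total mass pi^d, whence the constant (2
    pi)^d. *)
Lemma fourier_inversion x :
  integral_Rd (fun xi => expi (dot x xi) * fourier phi xi) =
  ((2 * pi) ^+ d)%:C * phi x.
Proof.
have [C HC] := test_bounded tphi; have [B HB] := fourier_rd_bounded tphi.
pose e (k : nat) : R := k.+1%:R^-1.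
have e0 k : 0 < e k by rewrite invr_gt0.
have ecvg : e k @[k --> \oo] --> (0 : R) by exact: cvg_harmonic.
have cphi := csmooth_ccontinuous (test_csmooth tphi).
have l1 : ccvg \oo (fun k => integral_Rd (fun xi => (poisson (e k) xi)%:C *
    (expi (dot x xi) * fourier phi xi)))
    (integral_Rd (fun xi => expi (dot x xi) * fourier phi xi)).
  apply: (@integral_Rd_ccvg _ _ B).
  - move=> k; apply: rd_measurableM.
      by apply: ccontinuous_rd_measurable; apply: ccontinuous_real; exact: continuous_poissonw.
    apply: rd_measurableM (rd_measurable_fourier tphi).
    by apply: rd_measurable_expi; exact: continuous_dot.
  - move=> k xi; rewrite Normc.normcM normc_expiM normc_real ger0_norm ?poisson_ge0//.
    by apply: le_trans (HB xi); rewrite ler_piMl ?normc_ge0// poisson_le1.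
  - move=> xi; rewrite -[X in ccvg _ _ X]mul1r; apply: ccvgM; last exact: ccvg_cst.
    apply: (ccvg_real (l := 1)).
    rewrite (_ : 1 = \prod_(i < d) (1 : R)); last by rewrite big1.
    apply: cvg_big => [|i _]; first exact: mul_continuous.
    rewrite -expR0; apply: continuous_cvg; first exact: continuous_expR.
    have h : e k * `|xi 0 i| @[k --> \oo] --> (0 : R).
      by rewrite -(mul0r `|xi 0 i|); apply: cvgM; [exact: ecvg|exact: cvg_cst].
    have hN : - (e k * `|xi 0 i|) @[k --> \oo] --> - (0 : R) by apply: cvgN; exact: h.
    by rewrite oppr0 in hN; exact: hN.
have l2 : ccvg \oo (fun k => (2 ^+ d)%:C *
      integral_Rd (fun z => (cauchyw z)%:C * phi (e k *: z + x)))
    ((2 ^+ d)%:C * integral_Rd (fun z => (cauchyw z)%:C * phi x)).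
  apply: ccvgM; first exact: ccvg_cst.
  apply: (@integral_Rd_ccvg _ _ C).
  - move=> k; apply: rd_measurableM.
      by apply: ccontinuous_rd_measurable; apply: ccontinuous_real; exact: continuous_cauchyw.
    apply: ccontinuous_rd_measurable; apply: (ccontinuous_comp cphi).
    exact: continuous_affine.
  - move=> k z; rewrite Normc.normcM normc_real ger0_norm ?(ltW (cauchyw_gt0 _))// mulrC.
    by rewrite (ler_wpM2r (ltW (cauchyw_gt0 _)))// (rd_bounded_bounded HC).
  - move=> z; apply: ccvgM; first exact: ccvg_cst.
    have zc : e k *: z + x @[k --> \oo] --> x.
      rewrite -[X in _ --> X]add0r -(scale0r z).
      by apply: cvgD; [exact: cvgZr_tmp|exact: cvg_cst].
    have [cr ci] := cphi x.
    by split; [exact: (cvg_comp _ _ zc cr)|exact: (cvg_comp _ _ zc ci)].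
have -> : ((2 * pi) ^+ d)%:C * phi x =
    (2 ^+ d)%:C * integral_Rd (fun z => (cauchyw z)%:C * phi x).
  have mw : rd_measurable (fun z : 'rV[R]_d => (cauchyw z)%:C).
    by apply: ccontinuous_rd_measurable; apply: ccontinuous_real; exact: continuous_cauchyw.
  have wb : rd_bounded 1 (fun z : 'rV[R]_d => (cauchyw z)%:C).
    by move=> z; rewrite mul1r normc_real ger0_norm ?(ltW (cauchyw_gt0 _)).
  under eq_integral_Rd do rewrite mulrC.
  rewrite (integral_RdZ _ mw wb) integral_cauchyw exprMn rmorphM /=; ring.
have e1 : (fun k => integral_Rd (fun xi => (poisson (e k) xi)%:C *
    (expi (dot x xi) * fourier phi xi))) = (fun k => (2 ^+ d)%:C *
      integral_Rd (fun z => (cauchyw z)%:C * phi (e k *: z + x))).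
  by apply/funext => k; exact: regularized.
rewrite e1 in l1; have [r1 i1] := l1; have [r2 i2] := l2.
by apply: complex_ext; [exact: cvg_unique r1 r2|exact: cvg_unique i1 i2].
Qed.

End fourier_inversion.

(** * Unique continuation of the Fourier transform *)

Section exponential_remainder.
Context {R : realType}.

Definition taylor_term n (s : R) : R[i] := (s ^+ n / n`!%:R)%:C * (0 +i* 1) ^+ n.

Fixpoint expi_remainder n (s : R) : R[i] :=
  if n is n'.+1 then expi_remainder n' s - taylor_term n' s else expi s.

Lemma taylor_term_conj n (s : R) : taylor_term n (- s) = conjc (taylor_term n s).
Proof.
have cj m : conjc ((0 +i* 1 : R[i]) ^+ m) = (- (0 +i* 1)) ^+ m.
  elim: m => [|m IH]; first by rewrite !expr0; apply: complex_ext; rewrite /= ?oppr0.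
  by rewrite !exprS conjcM IH; congr (_ * _); apply: complex_ext; rewrite /= ?oppr0.
rewrite /taylor_term conjcM cj.
have -> : conjc ((s ^+ n / n`!%:R)%:C) = (s ^+ n / n`!%:R)%:C.
  by apply: complex_ext; rewrite /= ?oppr0.
rewrite exprNn (exprNn (0 +i* 1)) -(mulrA ((-1) ^+ n)) rmorphM rmorphXn rmorphN1 /=.
by rewrite mulrCA mulrA.
Qed.

Lemma expi_remainder_conj n (s : R) : expi_remainder n (- s) = conjc (expi_remainder n s).
Proof.
elim: n => [|n IH] /=; first exact: expiN.
by rewrite IH taylor_term_conj; apply: complex_ext; rewrite /= ?RecD ?ImcD ?RecN ?ImcN ?Rec_conj ?Imc_conj; ring.
Qed.

Lemma is_derive_pow_fact n (s : R) :
  is_derive s (1 : R) (fun s : R => s ^+ n.+1 / n.+1`!%:R) (s ^+ n / n`!%:R).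
Proof.
have [dd e] := @is_deriveZ R R R _ (n.+1`!%:R^-1) s 1 _
  (@is_deriveX R R id n.+1 s 1 1 (is_derive_id _ _)).
have -> : (fun s : R => s ^+ n.+1 / n.+1`!%:R) = (n.+1`!%:R^-1 \*: (id ^+ n.+1 : R -> R)).
  by apply/funext => x; rewrite mulrC /= fctE.
split; first exact: dd.
rewrite e /= factS natrM invfM /GRing.scale /=; field.
by rewrite pnatr_eq0 -lt0n fact_gt0 /= nat1r pnatr_eq0.
Qed.

Lemma Re_taylor n (s : R) : Re (taylor_term n s) = s ^+ n / n`!%:R * Re ((0 +i* 1) ^+ n).
Proof. by rewrite /taylor_term RecM /= mul0r subr0. Qed.

Lemma Im_taylor n (s : R) : Im (taylor_term n s) = s ^+ n / n`!%:R * Im ((0 +i* 1) ^+ n).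
Proof. by rewrite /taylor_term ImcM /= mul0r addr0. Qed.

(** The identity behind this is that each remainder has derivative i times the preceding one; it is
    split into components because derivatives are taken of real functions. *)
Lemma is_derive_expi_remainder n (s : R) :
  is_derive s (1 : R) (fun s => Re (expi_remainder n.+1 s)) (- Im (expi_remainder n s)) /\
  is_derive s (1 : R) (fun s => Im (expi_remainder n.+1 s)) (Re (expi_remainder n s)).
Proof.
elim: n s => [|n IH] s.
  have e0 x : expi_remainder 1 x = expi x - 1.
    by rewrite /= /taylor_term !expr0 fact0 divr1 mulr1.
  have r0 x : Re (expi_remainder 1 x) = cos x - 1.
    by rewrite e0 RecD.
  have i0 x : Im (expi_remainder 1 x) = sin x - 0.
    by rewrite e0 ImcD.
  split.
    rewrite (_ : (fun s => _) = cos - cst (1 : R)); last exact/funext.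
    have [dd e] := is_deriveB (is_derive_cos s) (is_derive_cst (1 : R) s (1 : R)).
    by split; [exact: dd|rewrite e subr0].
  rewrite (_ : (fun s => _) = sin - cst (0 : R)); last exact/funext.
  have [dd e] := is_deriveB (is_derive_sin s) (is_derive_cst (0 : R) s (1 : R)).
  by split; [exact: dd|rewrite e subr0].
have [dr di] := IH s; have dp := is_derive_pow_fact n s.
split.
  have [dd e] := is_deriveB dr (@is_deriveZ R R R _ (Re ((0 +i* 1) ^+ n.+1)) s 1 _ dp).
  rewrite (_ : (fun s => _) = (fun s => Re (expi_remainder n.+1 s)) -
    (Re ((0 +i* 1) ^+ n.+1) \*: (fun s : R => s ^+ n.+1 / n.+1`!%:R))).
    split; first exact: dd.
    rewrite e /GRing.scale /= ImcD ImcN Im_taylor exprS RecM /=; ring.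
  by apply/funext => x; rewrite /= RecD RecN Re_taylor fctE /GRing.scale /= mulrC.
have [dd e] := is_deriveB di (@is_deriveZ R R R _ (Im ((0 +i* 1) ^+ n.+1)) s 1 _ dp).
rewrite (_ : (fun s => _) = (fun s => Im (expi_remainder n.+1 s)) -
  (Im ((0 +i* 1) ^+ n.+1) \*: (fun s : R => s ^+ n.+1 / n.+1`!%:R))).
  split; first exact: dd.
  rewrite e /GRing.scale /= RecD RecN Re_taylor exprS ImcM /=; ring.
by apply/funext => x; rewrite /= ImcD ImcN Im_taylor fctE /GRing.scale /= mulrC.
Qed.

Lemma expi_remainder0 n : expi_remainder n.+1 0 = 0.
Proof.
elim: n => [|n IH]; first by rewrite /= expi0 /taylor_term !expr0 fact0 divr1 mulr1 subrr.
by rewrite [LHS]/= -/(expi_remainder n.+1 0) IH /taylor_term expr0n /= mul0r mul0r subrr.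
Qed.

(** The bound on the derivative is integrated by applying the mean value theorem to s^(n + 1) / (n +
    1)! - f and to the same function with - f. *)
Lemma le_pow_fact n (f f' : R -> R) : f 0 = 0 ->
  (forall s : R, derivable f s 1 /\ 'D_1 f s = f' s) ->
  (forall s, 0 <= s -> `|f' s| <= s ^+ n / n`!%:R) ->
  forall s, 0 <= s -> `|f s| <= s ^+ n.+1 / n.+1`!%:R.
Proof.
move=> f0 df bf s s0.
have key (g g' : R -> R) : g 0 = 0 -> (forall s : R, derivable g s 1 /\ 'D_1 g s = g' s) ->
    (forall s, 0 <= s -> g' s <= s ^+ n / n`!%:R) -> g s <= s ^+ n.+1 / n.+1`!%:R.
  move=> g0 dg bg.
  have dh (x : R) : is_derive x (1 : R) (fun x => x ^+ n.+1 / n.+1`!%:R - g x)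
      (x ^+ n / n`!%:R - g' x).
    have [d1 e1] := dg x.
    have dgx : is_derive x (1 : R) g (g' x) by split.
    exact: (is_deriveB (is_derive_pow_fact n x) dgx).
  have ch : {within `[0, s], continuous (fun x => x ^+ n.+1 / n.+1`!%:R - g x)}.
    by apply: derivable_within_continuous => x _; have [] := dh x.
  have [c] := MVT_segment s0 (fun x _ => dh x) ch.
  rewrite in_itv /= => /andP[c0 _]; rewrite g0 expr0n /= mul0r subr0 subr0 => e.
  by rewrite -subr_ge0 e mulr_ge0 ?subr0// subr_ge0 bg.
rewrite ler_norml lerNl; apply/andP; split.
  apply: (key (fun x => - f x) (fun x => - f' x)).
  - by rewrite f0 oppr0.
  - move=> x; have [d1 e1] := df x.
    have [d2 e2] := is_deriveN (DeriveDef d1 e1).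
    by split; [exact: d2|exact: e2].
  - by move=> x x0; apply: le_trans (ler_norm _) _; rewrite normrN bf.
by apply: (key f f' f0 df) => x x0; exact: le_trans (ler_norm _) (bf x x0).
Qed.

(** Negative arguments reduce to positive ones by conjugation. There the bounds |cos|, |sin| <= 1
    are integrated n times, for both components at once, whence the factor 2. *)
Lemma normc_expi_remainder n (s : R) :
  normc (expi_remainder n s) <= 2 * (`|s| ^+ n / n`!%:R).
Proof.
wlog s0 : s / 0 <= s.
  move=> h; have [|sn] := leP 0 s; first exact: h.
  by have := h (- s); rewrite expi_remainder_conj normc_conj normrN; apply; rewrite oppr_ge0 ltW.
rewrite ger0_norm// mulr_natl mulr2n; apply: le_trans (normc_ReIm _) _.
suff [hr hi] : `|Re (expi_remainder n s)| <= s ^+ n / n`!%:R /\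
    `|Im (expi_remainder n s)| <= s ^+ n / n`!%:R by exact: lerD.
elim: n s s0 => [|n IH] s s0.
  rewrite expr0 fact0 divr1 /= !ler_norml.
  by rewrite cos_geN1 cos_le1 sin_geN1 sin_le1.
split.
  apply: (@le_pow_fact n (fun s => Re (expi_remainder n.+1 s))
    (fun s => - Im (expi_remainder n s))) s0.
  - by rewrite expi_remainder0.
  - by move=> x; have [[d1 e1] _] := is_derive_expi_remainder n x.
  - by move=> x x0; rewrite normrN; have [] := IH x x0.
apply: (@le_pow_fact n (fun s => Im (expi_remainder n.+1 s))
  (fun s => Re (expi_remainder n s))) s0.
- by rewrite expi_remainder0.
- by move=> x; have [_ [d1 e1]] := is_derive_expi_remainder n x.
- by move=> x x0; have [] := IH x x0.
Qed.

Lemma continuous_taylor_term n : ccontinuous (fun s : R => taylor_term n s).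
Proof.
apply: ccontinuousM; last exact: ccontinuous_cst.
apply: ccontinuous_real; apply: continuousM_fun; last exact: cst_continuous.
exact: exprn_continuous.
Qed.

Lemma ccontinuous_expi_remainder n : ccontinuous (expi_remainder n).
Proof.
elim: n => [|n IH] /=; first by apply: (@ccontinuous_expi _ _ id) => s; exact: cvg_id.
by apply: ccontinuousD IH _; apply: ccontinuousN; exact: continuous_taylor_term.
Qed.

End exponential_remainder.

(** * Taylor expansion of the transform along a line *)

Section unique_continuation.
Context {R : realType} {d : nat}.
Variables (g : 'rV[R]_d -> R[i]) (xi0 eta : 'rV[R]_d).
Hypothesis tg : test g.

Local Notation K := (rd_const (R := R) (n := d)).

Let G x := expi (- dot x xi0) * g x.

Let moment n := integral_Rd (fun x => (dot x eta ^+ n)%:C * G x).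

(** The transform of g at xi0 + t eta minus the first n terms of its Taylor expansion in t, as
    [remainder0] and [remainderS] show. *)
Let remainder n t := integral_Rd (fun x => expi_remainder n (- t * dot x eta) * G x).

Let continuous_dotr : continuous (fun x : 'rV[R]_d => dot x eta).
Proof. by under eq_fun do rewrite dotC; exact: continuous_dot. Qed.

Let measurable_G : rd_measurable G.
Proof.
by apply: rd_measurableM; [exact: rd_measurable_character|exact: test_rd_measurable].
Qed.

Let dot_bound : exists2 M : R, 0 <= M & forall x, g x != 0 -> `|dot x eta| <= M.
Proof.
have /compact_bounded[M [_ Mh]] : compact ((fun x => dot x eta) @` csupport g).
  apply: continuous_compact (test_compact tg).
  exact: continuous_subspaceT continuous_dotr.
exists (`|M| + 1); first exact: addr_ge0.
move=> x gx; apply: (Mh (`|M| + 1)).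
  by rewrite (le_lt_trans (ler_norm _))// ltrDl.
by exists x => //; apply: subset_closure.
Qed.

Let dominated (M C c : R) (w : R -> R[i]) : 0 <= M -> rd_bounded C g ->
  (forall x, g x != 0 -> `|dot x eta| <= M) ->
  (forall s, `|s| <= M -> normc (w s) <= c) -> ccontinuous w ->
  rd_measurable (fun x => w (dot x eta) * G x) /\
  rd_bounded (c * C) (fun x => w (dot x eta) * G x).
Proof.
move=> M0 gC gM wc cw; split.
  apply: rd_measurableM measurable_G; apply: ccontinuous_rd_measurable.
  exact: (ccontinuous_comp cw continuous_dotr).
have c0 : 0 <= c by apply: le_trans (normc_ge0 _) (wc 0 _); rewrite normr0.
move=> x; rewrite Normc.normcM /G normc_expiM -mulrA.
have [->|gx] := eqVneq (g x) 0.
  rewrite Normc.normc0 mulr0 mulr_ge0// mulr_ge0 ?(ltW (cauchyw_gt0 _))//.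
  exact: rd_bounded_ge0 gC.
by apply: ler_pM; [exact: normc_ge0|exact: normc_ge0|exact/wc/gM|exact: gC].
Qed.

Let taylor_termM n (t s : R) : taylor_term n (t * s) = taylor_term n t * (s ^+ n)%:C.
Proof. by rewrite /taylor_term exprMn mulrAC rmorphM /= mulrAC. Qed.

Let remainder_bound (M C : R) n t : 0 <= M -> rd_bounded C g ->
  (forall x, g x != 0 -> `|dot x eta| <= M) ->
  let F x := expi_remainder n (- t * dot x eta) * G x in
  rd_measurable F /\ rd_bounded (2 * ((`|t| * M) ^+ n / n`!%:R) * C) F.
Proof.
move=> M0 gC gM; apply: (dominated (w := fun s => expi_remainder n (- t * s)) M0 gC gM).
  move=> s sM; apply: le_trans (normc_expi_remainder _ _) _.
  rewrite ler_pM2l// ler_wpM2r ?invr_ge0//.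
  by rewrite lerXn2r ?nnegrE ?mulr_ge0// normrM normrN ler_wpM2l.
apply: (ccontinuous_comp (@ccontinuous_expi_remainder _ n)).
by apply: (continuousM_fun (@cst_continuous _ _ (- t))) => s; exact: cvg_id.
Qed.

Let remainderS n t : remainder n.+1 t = remainder n t - taylor_term n (- t) * moment n.
Proof.
have [M M0 gM] := dot_bound; have [C gC] := test_bounded tg.
have [m1 b1] := remainder_bound n t M0 gC gM.
have [m2 b2] : rd_measurable (fun x => (dot x eta ^+ n)%:C * G x) /\
    rd_bounded (M ^+ n * C) (fun x => (dot x eta ^+ n)%:C * G x).
  apply: (dominated (w := fun s => (s ^+ n)%:C) M0 gC gM).
    by move=> s sM; rewrite normc_real normrX lerXn2r ?nnegrE.
  by apply: ccontinuous_real; exact: exprn_continuous.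
rewrite /remainder /moment -(integral_RdZ _ m2 b2).
have m3 : rd_measurable (fun x => taylor_term n (- t) * ((dot x eta ^+ n)%:C * G x)).
  by apply: rd_measurableM m2; apply: ccontinuous_rd_measurable; exact: ccontinuous_cst.
have b3 : rd_bounded (normc (taylor_term n (- t)) * (M ^+ n * C))
    (fun x => taylor_term n (- t) * ((dot x eta ^+ n)%:C * G x)).
  by move=> x; rewrite Normc.normcM -mulrA ler_wpM2l ?normc_ge0.
rewrite -(integral_RdB m1 b1 m3 b3); apply: eq_integral_Rd => x.
by rewrite /= taylor_termM mulrBl mulrA.
Qed.

Let remainder0 t : remainder 0 t = fourier g (xi0 + t *: eta).
Proof.
apply: eq_integral_Rd => x; rewrite /G /= mulrA -expiD; congr (expi _ * _).
by rewrite dotDr dotZr; ring.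
Qed.

Let normc_taylor n (t : R) : normc (taylor_term n t) = `|t| ^+ n / n`!%:R.
Proof.
rewrite Normc.normcM normcX normc_real normrM normrX normfV normr_nat.
by rewrite (_ : normc (0 +i* 1) = 1) ?expr1n ?mulr1//= expr0n expr1n add0r sqrtr1.
Qed.

Lemma fourier_line_zero : (\forall t \near (0 : R), fourier g (xi0 + t *: eta) = 0) ->
  fourier g (xi0 + eta) = 0.
Proof.
move=> /nbhs_ballP[del /= del0 gdel].
have [M M0 gM] := dot_bound; have [C gC] := test_bounded tg.
have C0 := rd_bounded_ge0 gC; have K0 : 0 <= K by exact: rd_const_ge0.
have rb n t : normc (remainder n t) <= 2 * ((`|t| * M) ^+ n / n`!%:R) * C * K.
  by have [m b] := remainder_bound n t M0 gC gM; exact: normc_integral_Rd.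
have const n : (forall j, (j < n)%N -> moment j = 0) -> forall t,
    remainder n t = fourier g (xi0 + t *: eta).
  elim: n => [|n IH] mj t; first exact: remainder0.
  by rewrite remainderS mj// mulr0 subr0 IH// => j jn; exact/mj/leqW.
have m0 n : moment n = 0.
  (* When the lower moments vanish and 0 < t < del, the n-th moment times t^n / n! is up to sign and
     a power of i the remainder of order n + 1, which is O(t^(n + 1)). Dividing by t^n and letting t
     tend to 0 shows that the moment is 0. *)
  elim/ltn_ind: n => n IH.
  pose B := 2 * M ^+ n.+1 * C * K.
  have B0 : 0 <= B.
    apply: mulr_ge0 K0; apply: mulr_ge0 C0; apply: mulr_ge0 => //.
    exact: exprn_ge0.
  have small t : 0 < t -> t < del -> normc (moment n) <= t * B.
    move=> t0 td; have := rb n.+1 t; rewrite remainderS const// gdel; last first.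
      by rewrite /= /ball /= sub0r normrN gtr0_norm.
    rewrite sub0r normcN Normc.normcM normc_taylor normrN gtr0_norm//.
    rewrite exprMn factS natrM invfM mulrAC ler_pdivrMr ?ltr0n ?fact_gt0//.
    rewrite -ler_pdivlMl ?exprn_gt0// => h; apply: le_trans h _.
    have n1 : (n.+1%:R : R)^-1 <= 1 by rewrite invf_le1 ?ltr0n// ler1n.
    have -> : (t ^+ n)^-1 * (2 * (t ^+ n.+1 * M ^+ n.+1 * (n.+1%:R^-1 / n`!%:R)) * C * K *
       n`!%:R) = t * B * n.+1%:R^-1.
      rewrite /B exprS; field.
      by rewrite expf_neq0 ?gt_eqF//= -natrS pnatr_eq0 pnatr_eq0 -lt0n fact_gt0.
    by rewrite ler_piMr// mulr_ge0// ltW.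
  apply: Normc.eq0_normc; apply/eqP; rewrite eq_le normc_ge0 andbT.
  apply/ler_addgt0Pl => e e0; rewrite addr0.
  pose t := Num.min (del / 2) (e / (B + 1)).
  have B1 : 0 < B + 1 by rewrite ltr_wpDl.
  have t0 : 0 < t by rewrite lt_min !divr_gt0.
  apply: le_trans (small t t0 _) _.
    by rewrite gt_min ltr_pdivrMr// ltr_pMr// ltr1n.
  apply: (@le_trans _ _ (e / (B + 1) * B)).
    by rewrite ler_wpM2r// ge_min lexx orbT.
  by rewrite mulrAC ler_pdivrMr// ler_wpM2l ?lerDl// ltW.
apply: Normc.eq0_normc; apply/eqP; rewrite eq_le normc_ge0 andbT.
(* With all moments zero, the remainder at t = 1 is the transform itself for every order n, while
   its bound is a multiple of M^n / n!, the general term of a convergent series. *)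
have lim : (2 * exp_coeff M n * C * K) @[n --> \oo] --> (0 : R).
  rewrite (_ : 0 = 2 * 0 * C * K); last by rewrite mulr0 !mul0r.
  apply: cvgM; last exact: cvg_cst.
  apply: cvgM; last exact: cvg_cst.
  apply: cvgM; first exact: cvg_cst.
  exact: (cvg_series_cvg_0 (is_cvg_series_exp_coeff M)).
apply: (cvgr_to_ge lim); apply: nearW => n; have := rb n 1.
rewrite const; last by move=> j _; exact: m0.
by rewrite scale1r normr1 mul1r.
Qed.

End unique_continuation.

Section fourier_uniqueness.
Context {R : realType} {d : nat}.
Implicit Types (g : 'rV[R]_d -> R[i]) (x : 'rV[R]_d).

Lemma fourier_injective g : test g -> (forall xi, fourier g xi = 0) ->
  forall x, g x = 0.
Proof.
move=> tg g0 x; have := fourier_inversion tg x.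
under eq_integral_Rd do rewrite g0 mulr0.
have z0 : integral_Rd (fun _ : 'rV[R]_d => 0) = 0 :> R[i].
  have m0 : rd_measurable (fun _ : 'rV[R]_d => 0 : R[i]).
    by apply: ccontinuous_rd_measurable; exact: ccontinuous_cst.
  have b0 : rd_bounded 0 (fun _ : 'rV[R]_d => 0 : R[i]).
    by move=> y; rewrite Normc.normc0 mul0r.
  rewrite -[RHS](mul0r (integral_Rd (fun _ : 'rV[R]_d => 0))) -(integral_RdZ _ m0 b0).
  by apply: eq_integral_Rd => y; rewrite mul0r.
rewrite z0 => /esym/eqP; rewrite mulf_eq0 => /orP[|/eqP//].
have p : (2 * pi) ^+ d != 0 :> R by rewrite expf_neq0// mulf_neq0// gt_eqF ?pi_gt0.
by move=> /eqP/(congr1 (@complex.Re R)) /= /eqP; rewrite (negbTE p).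
Qed.

Lemma enormZ (a : R) x : enorm (a *: x) = `|a| * enorm x.
Proof. by rewrite /enorm dotZl dotZr mulrA -expr2 sqrtrM ?sqr_ge0// sqrtr_sqr. Qed.

Lemma fourier_unique_open (Theta : set (R * 'rV[R]_d)) g :
  open_in (Rplus_sphere d) Theta -> Theta !=set0 -> test g ->
  (forall tau x, Theta (tau, x) -> fourier g (tau *: x) = 0) ->
  forall x, g x = 0.
Proof.
move=> [U oU ThetaU] [[tau0 x0] T0] tg gT; apply: (fourier_injective tg) => xi.
have [t0p x01] : 0 < tau0 /\ enorm x0 = 1 by move: T0; rewrite ThetaU => -[_].
have U0 : U (tau0, x0) by move: T0; rewrite ThetaU => -[].
pose xi0 := tau0 *: x0; pose eta := xi - xi0.
have -> : xi = xi0 + eta by rewrite addrC subrK.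
apply: (fourier_line_zero tg).
pose line (t : R) := xi0 + t *: eta.
have line0 : line 0 = xi0 by rewrite /line scale0r addr0.
have cl : continuous line.
  move=> t; apply: (@cvgD _ _ _ _ _ (fun=> xi0) (fun t : R => t *: eta)).
    exact: cvg_cst.
  exact: (@cvgZr_tmp _ _ _ _ _ id t eta cvg_id).
have ce : {for 0, continuous (fun t => enorm (line t))}.
  by apply: continuous_comp; [exact: cl|exact: continuous_enorm].
have e0 : enorm (line 0) = tau0 by rewrite line0 enormZ x01 mulr1 gtr0_norm.
(* Polar coordinates are continuous at xi0, whose norm tau0 is positive; hence points of the line
   near t = 0 have polar coordinates in U. *)
have cp : (enorm (line t), (enorm (line t))^-1 *: line t) @[t --> (0 : R)] --> (tau0, x0).
  have c1 : enorm (line t) @[t --> (0 : R)] --> tau0 by rewrite -e0; exact: ce.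
  suff c2 : (enorm (line t))^-1 *: line t @[t --> (0 : R)] --> x0 by exact: cvg_pair c1 c2.
  have -> : x0 = (enorm (line 0))^-1 *: line 0.
    by rewrite e0 line0 scalerA mulVf ?scale1r// gt_eqF.
  apply: cvgZ; last exact: cl.
  by apply: cvgV; [rewrite e0 gt_eqF|exact: ce].
have nU : nbhs (tau0, x0) U by exact: open_nbhs_nbhs.
have np : \forall t \near (0 : R), 0 < enorm (line t).
  have ce0 : enorm (line t) @[t --> (0 : R)] --> tau0 by rewrite -e0; exact: ce.
  by move/cvgrPdist_lt : ce0 => /(_ _ t0p); apply: filterS => t; rewrite ltr_distlC subrr => /andP[].
have nU' := cp U nU.
apply: filterS2 np nU' => t et Ut.
have -> : xi0 + t *: eta = enorm (line t) *: ((enorm (line t))^-1 *: line t).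
  by rewrite scalerA mulfV ?scale1r// gt_eqF.
apply: gT; rewrite ThetaU; split=> //; split=> //=.
by rewrite enormZ gtr0_norm ?invr_gt0// mulVf// gt_eqF.
Qed.

End fourier_uniqueness.

(** * Correlation kernel of a pseudo-differential operator *)

Section oscillation.
Context {R : realType} {d : nat}.
Implicit Types (F : 'rV[R]_d -> R[i]) (v x xi : 'rV[R]_d).
Local Notation K := (rd_const (R := R) (n := d)).

Lemma rd_measurable_shift F v : rd_measurable F -> rd_measurable (fun x => F (x + v)).
Proof.
pose b := [tuple v 0 i | i < d].
have rE t : rowt t + v = rowt (tuple_affine 1 b t).
  by apply/rowP => i; rewrite !mxE !tnth_mktuple mul1r.
move=> [mr mi]; split.
  under eq_fun do rewrite rE.
  exact: (measurableT_comp mr (@measurable_tuple_affine R d 1 b)).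
under eq_fun do rewrite rE.
exact: (measurableT_comp mi (@measurable_tuple_affine R d 1 b)).
Qed.

Lemma normc_fourier_le (C : R) F xi : rd_measurable F -> rd_bounded C F ->
  normc (fourier F xi) <= C * K.
Proof.
move=> mF bF; apply: normc_integral_Rd; last exact: rd_bounded_expiM.
exact: rd_measurableM (rd_measurable_character xi) mF.
Qed.

(* Translation by half a period of the character turns the Fourier integral into
   minus half that of a difference of F. *)
Lemma fourier_oscillation (A B : R) F i : rd_measurable F -> rd_bounded A F ->
  (forall h, `|h| <= 1 -> rd_bounded (B * `|h|) (difference (h *: delta_mx 0 i) F)) ->
  forall xi, normc (fourier F xi) <= (A + B) * K * (1 + pi) / (1 + `|xi 0 i|).
Proof.
move=> mF bF dF xi; have A0 := rd_bounded_ge0 bF.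
have B0 : 0 <= B.
  by have := rd_bounded_ge0 (dF 1 _); rewrite normr1 mulr1; exact.
have K0 := rd_const_ge0 (R := R) (n := d).
have pi0 := @pi_gt0 R; have p1 : 0 < 1 + `|xi 0 i| by rewrite ltr_wpDr.
rewrite ler_pdivlMr//.
(* Below pi the size bound suffices, since 1 + |xi_i| < 1 + pi. From pi on, the half period pi /
   xi_i has modulus at most 1, where the difference bound is assumed. *)
have [lt_pi|le_pi] := ltP `|xi 0 i| pi.
  apply: (@le_trans _ _ (A * K * (1 + pi))).
    apply: (ler_pM (normc_ge0 _) (ltW p1) (normc_fourier_le xi mF bF)).
    by rewrite lerD2l ltW.
  rewrite ler_wpM2r//; first by rewrite addr_ge0// ltW.
  by rewrite ler_wpM2r// lerDl.
have x0 : xi 0 i != 0 by rewrite -normr_gt0 (lt_le_trans pi0).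
pose h := pi / xi 0 i; pose w : 'rV[R]_d := h *: delta_mx 0 i.
have hE : `|h| = pi / `|xi 0 i| by rewrite normrM normfV gtr0_norm.
have h1 : `|h| <= 1 by rewrite hE ler_pdivrMr ?mul1r// normr_gt0.
have bw := rd_bounded_shift w bF; have mw := rd_measurable_shift w mF.
have e : fourier (difference w F) xi = (- 2) * fourier F xi.
  rewrite /fourier /difference.
  under eq_integral_Rd do rewrite mulrBr.
  rewrite (integral_RdB (rd_measurableM (rd_measurable_character xi) mw)
    (rd_bounded_expiM _ bw) (rd_measurableM (rd_measurable_character xi) mF)
    (rd_bounded_expiM _ bF)) -!/(fourier _ _) (fourier_shift _ _ mF bF).
  rewrite /w dotZl dotC dot_delta divfK// expi_pi.
  by rewrite -[X in _ - X]mul1r -mulrBl; congr (_ * _); rewrite -opprD.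
have md : rd_measurable (difference w F).
  apply: rd_measurableD mw _; under eq_fun do rewrite -mulN1r.
  by apply: rd_measurableM mF; exact: (cmeasurable_cst (D := setT)).
have := normc_fourier_le xi md (dF _ h1).
rewrite e Normc.normcM normcN normc2 hE => le2.
have u0 : 0 < `|xi 0 i| by rewrite normr_gt0.
have le1 : 2 * normc (fourier F xi) * `|xi 0 i| <= B * pi * K.
  by rewrite -ler_pdivlMr// (le_trans le2)// le_eqVlt; apply/orP; left; apply/eqP; ring.
have := normc_ge0 (fourier F xi); have := @pi_ge2 R.
have : 0 <= A * K by rewrite mulr_ge0.
have : 0 <= B * K by rewrite mulr_ge0.
have : 0 <= A * K * pi by exact: (mulr_ge0 (mulr_ge0 A0 K0) (ltW pi0)).
move: (normc _) `|_| le1 le_pi => n u le1 le_pi c1 c2 c3 p2 n0.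
have : 0 <= n * (u - 2) by rewrite mulr_ge0// subr_ge0 (le_trans p2).
nra.
Qed.

Lemma enormN x : enorm (- x) = enorm x.
Proof. by rewrite -scaleN1r enormZ normrN normr1 mul1r. Qed.

(** The sum of the norms is controlled coordinate by coordinate through [enorm_sum]; this is the
    origin of the dimensional constant. *)
Lemma enormD_dim x xi : 1 + enorm (x + xi) <= d.+1%:R * ((1 + enorm x) * (1 + enorm xi)).
Proof.
have s : enorm (x + xi) <= d%:R * (enorm x + enorm xi).
  apply: le_trans (enorm_sum _) _.
  rewrite -[d%:R]/(d%:R) mulrC -[X in _ * X%:R]card_ord mulr_natr -sumr_const.
  apply: ler_sum => i _; rewrite mxE; apply: le_trans (ler_normD _ _) _.
  by rewrite lerD// normr_coord_enorm.
have := enorm_ge0 x; have := enorm_ge0 xi; rewrite -natr1.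
have d0 : 0 <= d%:R :> R by [].
move: (enorm x) (enorm xi) (enorm _) d%:R d0 s => a b e n n0 s b0 a0.
have := mulr_ge0 a0 b0; have := mulr_ge0 n0 (mulr_ge0 a0 b0); nra.
Qed.

(** Peetre's inequality: translating a power weight costs only a power of the translation, for
    either sign of the exponent. *)
Lemma peetre (r : R) : exists2 C : R, 0 <= C & forall x xi,
  (1 + enorm (xi + x)) `^ r <= C * ((1 + enorm x) `^ r * (1 + enorm xi) `^ `|r|).
Proof.
exists (d.+1%:R `^ `|r|); first exact: powR_ge0.
move=> x xi.
have e0 (y : 'rV[R]_d) : 0 < 1 + enorm y by exact: enorm1_gt0.
have g (y : 'rV[R]_d) : 0 <= 1 + enorm y by exact: ltW.
have D0 : 0 <= d.+1%:R :> R by [].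
have [r0|r0] := leP 0 r.
  rewrite ger0_norm// -(powRM _ (g _) (g _)) -(powRM _ D0 (mulr_ge0 (g _) (g _))).
  apply: ge0_ler_powR; rewrite ?nnegrE ?(mulr_ge0 D0) ?(mulr_ge0 (g _) (g _))//.
  by have := enormD_dim xi x; rewrite (mulrC (1 + enorm xi)).
(* For r < 0 the inequality is inverted, and x is written as - xi + (xi + x). *)
rewrite ltr0_norm//.
have -> : r = - - r by rewrite opprK.
have nr : 0 <= - r by rewrite oppr_ge0 ltW.
move: (- r) nr => {r0}r r0; rewrite opprK !(powRN _ r).
rewrite mulrCA ler_pdivlMl ?powR_gt0// ler_pdivrMr ?powR_gt0//.
rewrite -(powRM _ D0 (g _)) -(powRM _ (mulr_ge0 D0 (g _)) (g _)).
apply: ge0_ler_powR; rewrite ?nnegrE ?(mulr_ge0 (mulr_ge0 D0 (g _)) (g _))//.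
by have := enormD_dim (- xi) (xi + x); rewrite addKr enormN mulrA.
Qed.

End oscillation.

Definition mode {R : realType} {d : nat} (chi : 'rV[R]_d -> R[i]) v (k : R) y : R[i] :=
  chi y * expi (- (k * dot v y)).

Section modes.
Context {R : realType} {d : nat}.
Implicit Types (v x xi : 'rV[R]_d).
Local Opaque smooth csmooth.

Lemma test_mode chi v k : test chi -> test (mode chi v k).
Proof.
move=> tchi; apply: (testM tchi); apply: csmooth_expi.
have -> : (fun y => - (k * dot v y)) = dot (- k *: v).
  by apply/funext => y; rewrite dotZl mulNr.
exact: smooth_dot.
Qed.

Lemma conj_mode chi v (k : R) :
  (fun y => conjc (mode chi v k y)) = mode (fun y => conjc (chi y)) (- v) k.
Proof.
by apply/funext => y; rewrite /mode conjcM -expiN opprK dotNl mulrN opprK.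
Qed.

Lemma modeN chi v (k : R) : mode chi (- v) (- k) = mode chi v k.
Proof. by apply/funext => y; rewrite /mode dotNl mulrNN. Qed.

Lemma fourier_mode chi v (k : R) xi : fourier (mode chi (- v) k) xi = fourier chi (xi - k *: v).
Proof.
apply: eq_integral_Rd => x; rewrite /mode mulrCA mulrC -expiD; congr (expi _ * _).
by rewrite dotNl mulrN opprK dotDr dotNr dotZr opprD opprK (dotC v).
Qed.

End modes.

Section partial_evaluation.
Context {R : realType} {V W : normedModType R}.

Lemma cdirD0 (f : V -> R[i]) : cdirD [::] f = f.
Proof. by apply/funext => x; rewrite /cdirD /=; case: (f x). Qed.

Lemma smooth_pair1 (f : V * W -> R) y : smooth f -> smooth (fun x => f (x, y)).
Proof.
move=> sf vs; split.
  rewrite (_ : dirD vs _ = fun x => dirD [seq (v, 0) | v <- vs] f (x, y)).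
    move=> x; apply: (@continuous_comp _ _ _ (fun x => (x, y)) (dirD _ f)).
      exact: continuous_pair1.
    exact: (smooth_continuous (smooth_dirD _ sf)).
  by apply/funext => x; rewrite dirD_pair1.
move=> x v.
have := @smooth_derivable _ _ _ (x, y) (v, 0) (smooth_dirD [seq (v, 0) | v <- vs] sf).
set g := dirD _ f.
have e : (fun h : R => h^-1 *: ((g \o shift (x, y)) (h *: (v, 0)) - g (x, y))) =
    (fun h : R => h^-1 *: ((dirD vs (fun z => f (z, y)) \o shift x) (h *: v) -
      dirD vs (fun z => f (z, y)) x)).
  apply/funext => h; rewrite -dirD_pair1 -/g /= -dirD_pair1 -/g.
  congr (_ *: (g _ - _)).
  by congr (_, _); rewrite /= scaler0 add0r.
by rewrite /derivable e.
Qed.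

Lemma csmooth_pair1 (f : V * W -> R[i]) y : csmooth f -> csmooth (fun x => f (x, y)).
Proof. by move=> [fr fi]; split; [exact: (smooth_pair1 y fr)|exact: (smooth_pair1 y fi)]. Qed.

End partial_evaluation.

Lemma ccvg_near_eq {R : realType} {T : Type} {F : set_system T} {FF : Filter F}
    (u v : T -> R[i]) l : (\forall x \near F, v x = u x) -> ccvg F v l -> ccvg F u l.
Proof.
move=> e [cr ci]; split.
  by apply: cvg_trans cr; apply: near_eq_cvg; apply: filterS e => x ->.
by apply: cvg_trans ci; apply: near_eq_cvg; apply: filterS e => x ->.
Qed.

Lemma cvg_powR1 {R : realType} {T : Type} {F : set_system T} {FF : Filter F}
    (w : T -> R) r : w x @[x --> F] --> (1 : R) -> w x `^ r @[x --> F] --> (1 : R).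
Proof.
move=> w1.
have w0 : \forall x \near F, 0 < w x.
  move/cvgrPdist_lt : w1 => /(_ _ ltr01).
  by apply: filterS => x; rewrite ltr_distlC subrr => /andP[].
apply: (@cvg_trans _ (expR (r * ln (w x)) @[x --> F])).
  by apply: near_eq_cvg; apply: filterS w0 => x x0; rewrite /powR gt_eqF.
rewrite -expR0 -(mulr0 r) -ln1.
have l1 : ln (w x) @[x --> F] --> ln (1 : R).
  exact: (cvg_comp _ _ w1 (continuous_ln ltr01)).
have l2 : r * ln (w x) @[x --> F] --> r * ln 1 by apply: cvgM; [exact: cvg_cst|].
by apply: continuous_cvg; [exact: continuous_expR|exact: l2].
Qed.

(** * Bound and limit of the kernel between two modes *)

Section kernel.
Context {R : realType} {d : nat}.
Local Notation K := (rd_const (R := R) (n := d)).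
Variables (sigma : 'rV[R]_d * 'rV[R]_d -> R[i]) (r : R) (v : 'rV[R]_d).
Variables (chi1 chi2 : 'rV[R]_d -> R[i]).
Hypotheses (sym : symbol_class r sigma) (tchi1 : test chi1) (tchi2 : test chi2).
Hypothesis v1 : enorm v = 1.
Local Opaque smooth csmooth.
Implicit Types (x eta : 'rV[R]_d).

(** The sign of v in the first mode covers both operators: with chi1 the conjugate of a cutoff it is
    the conjugate mode of frequency s, as in the covariance; with chi1 the cutoff itself it is the
    mode of frequency - s, as in the relation. *)
Definition kernel s t :=
  integral_Rd (fun x => pseudo_diff sigma (mode chi1 (- v) s) x * mode chi2 v t x).

(** Obtained by the substitution xi = eta + s v, which recentres the transform of the mode into
    [fourier chi1 eta]. Its rapid decay in eta does not depend on s and absorbs the growth of the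
    shifted symbol. *)
Let amp_integrand s (p : 'rV[R]_d * 'rV[R]_d) :=
  expi (dot p.1 p.2) * sigma (p.1, p.2 + s *: v) * fourier chi1 p.2.

Let amplitude s x := integral_Rd (fun eta => amp_integrand s (x, eta)).

Let weight_shift (q : R) : exists2 C, 0 <= C & forall s eta,
  (1 + enorm (eta + s *: v)) `^ q <= C * ((1 + `|s|) `^ q * (1 + enorm eta) `^ `|q|).
Proof.
have [C C0 HC] := @peetre R d q; exists C => // s eta.
by have := HC (s *: v) eta; rewrite enormZ v1 mulr1.
Qed.

Let symbol_bound : exists2 C, 0 <= C & forall s x eta,
  normc (sigma (x, eta + s *: v)) <= C * ((1 + `|s|) `^ r * (1 + enorm eta) `^ `|r|).
Proof.
have [B HB] := sym.2 [::] [::]; have [C C0 HC] := weight_shift r.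
exists (`|B| * C) => [|s x eta]; first by rewrite mulr_ge0.
have := HB x (eta + s *: v); rewrite cdirD0 subr0 => h; apply: le_trans h _.
apply: (@le_trans _ _ (`|B| * (1 + enorm (eta + s *: v)) `^ r)).
  by rewrite ler_wpM2r ?powR_ge0 ?ler_norm.
by rewrite -mulrA ler_wpM2l.
Qed.

(* Derivatives in x cost no decay in xi: only these are used, since the half-period
   translation acts on the space variable. *)
Let symbol_lipschitz i : exists2 C, 0 <= C & forall s x eta h,
  normc (sigma (x + h *: delta_mx 0 i, eta + s *: v) - sigma (x, eta + s *: v)) <=
    C * `|h| * ((1 + `|s|) `^ r * (1 + enorm eta) `^ `|r|).
Proof.
have [B HB] := sym.2 [::] [:: i]; have [C C0 HC] := weight_shift r.
exists (2 * (`|B| * C)) => [|s x eta h]; first by rewrite !mulr_ge0.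
have cs : csmooth (fun z => sigma (z, eta + s *: v)).
  exact: csmooth_pair1 sym.1.
have le z : normc (cdirD [:: delta_mx 0 i] (fun z => sigma (z, eta + s *: v)) z) <=
    `|B| * C * ((1 + `|s|) `^ r * (1 + enorm eta) `^ `|r|).
  rewrite -cdirD_pair1; have := HB z (eta + s *: v); rewrite cat0s subr0 => hz.
  apply: le_trans hz _.
  apply: (@le_trans _ _ (`|B| * (1 + enorm (eta + s *: v)) `^ r)).
    by rewrite ler_wpM2r ?powR_ge0 ?ler_norm.
  by rewrite -mulrA ler_wpM2l.
apply: le_trans (normc_lipschitz cs (fun s _ => le _)) _.
by rewrite le_eqVlt; apply/orP; left; apply/eqP; ring.
Qed.

Let measurable_amp s : cmeasurable setT (fun p => amp_integrand s (rowt p.1, rowt p.2)).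
Proof.
apply: cmeasurableM; last first.
  have [fr fi] := rd_measurable_fourier tchi1.
  by split; [exact: measurableT_comp fr measurable_snd|exact: measurableT_comp fi measurable_snd].
pose G (p : 'rV[R]_d * 'rV[R]_d) := expi (dot p.1 p.2) * sigma (p.1, p.2 + s *: v).
apply: (ccontinuous_pair_measurable (F := G)); apply: ccontinuousM.
  exact: ccontinuous_expi (@continuous_dot_pair R d).
apply: (ccontinuous_comp (csmooth_ccontinuous sym.1)) => p.
have c1 : q.1 @[q --> p] --> p.1 by exact: cvg_fst.
have c2 : q.2 + s *: v @[q --> p] --> p.2 + s *: v.
  by apply: cvgD; [exact: cvg_snd|exact: cvg_cst].
exact: cvg_pair c1 c2.
Qed.

Let amp_bound : exists2 C, 0 <= C & forall s x eta,
  normc (amp_integrand s (x, eta)) <= C * (1 + `|s|) `^ r * cauchyw eta.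
Proof.
have [C C0 HC] := symbol_bound; have [B HB] := fourier_weight_decay `|r| tchi1.
exists (C * `|B|) => [|s x eta]; first by rewrite mulr_ge0.
rewrite -[amp_integrand _ _]/(expi (dot x eta) * sigma (x, eta + s *: v) * fourier chi1 eta).
rewrite -mulrA normc_expiM Normc.normcM.
apply: le_trans (ler_wpM2r (normc_ge0 _) (HC s x eta)) _.
have -> : C * `|B| * (1 + `|s|) `^ r * cauchyw eta = C * (1 + `|s|) `^ r * (`|B| * cauchyw eta).
  by ring.
rewrite [leLHS](_ : _ = C * (1 + `|s|) `^ r *
  (normc (fourier chi1 eta) * (1 + enorm eta) `^ `|r|)); last by ring.
rewrite ler_wpM2l ?mulr_ge0 ?powR_ge0//.
apply: le_trans (HB eta) _; rewrite ler_wpM2r ?ler_norm//.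
by rewrite ltW// cauchyw_gt0.
Qed.

Let mamp2 s x : rd_measurable (fun eta => amp_integrand s (x, eta)).
Proof.
have -> : x = rowt [tuple x 0 i | i < d].
  by apply/rowP => i; rewrite mxE tnth_mktuple.
exact: rd_measurable_pair2 (measurable_amp s) _.
Qed.

(** The oscillation at frequency s is factored out. The remaining amplitude varies slowly: its
    Lipschitz constant in x is of the order of the symbol size at s. *)
Let amp_shift s : pseudo_diff sigma (mode chi1 (- v) s) =1
  fun x => (((2 * pi) ^+ d)^-1)%:C * (expi (s * dot v x) * amplitude s x).
Proof.
move=> x; rewrite /pseudo_diff; congr (_ * _).
have [C C0 HC] := amp_bound; have bA := HC s x.
rewrite -(integral_RdZ _ (mamp2 s x) bA).
pose G eta := expi (s * dot v x) * amp_integrand s (x, eta).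
have mG : rd_measurable G.
  by apply: rd_measurableM (mamp2 s x); exact: (cmeasurable_cst (D := setT)).
have bG : rd_bounded (C * (1 + `|s|) `^ r) G by move=> eta; rewrite normc_expiM.
rewrite -(integral_Rd_shift (- (s *: v)) mG bG); apply: eq_integral_Rd => xi.
rewrite /G /amp_integrand /= subrK fourier_mode !mulrA -expiD; congr (expi _ * _ * _).
by rewrite dotDr dotNr dotZr (dotC x v) addrCA subrr addr0.
Qed.

Let measurable_amplitude s : rd_measurable (amplitude s).
Proof.
have [C C0 HC] := amp_bound.
apply: (rd_measurable_parameter (measurable_amp s) (c := fun=> C * (1 + `|s|) `^ r + 1)).
- exact: cst_continuous.
- by move=> x; rewrite ltr_wpDl ?mulr_ge0 ?powR_ge0.
- move=> x eta; apply: le_trans (HC s x eta) _.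
  by rewrite ler_wpM2r ?lerDl// ltW// cauchyw_gt0.
Qed.

Lemma amplitude_bound : exists2 C, 0 <= C & forall s x,
  normc (amplitude s x) <= C * (1 + `|s|) `^ r.
Proof.
have [C C0 HC] := amp_bound.
exists (C * K) => [|s x]; first by rewrite mulr_ge0 ?rd_const_ge0.
by have := normc_integral_Rd (mamp2 s x) (HC s x); rewrite mulrAC.
Qed.

Let amp_lipschitz i : exists2 C, 0 <= C & forall s x eta h,
  normc (amp_integrand s (x + h *: delta_mx 0 i, eta) - amp_integrand s (x, eta)) <=
    C * `|h| * (1 + `|s|) `^ r * cauchyw eta.
Proof.
have [C1 C10 H1] := symbol_bound; have [C2 C20 H2] := symbol_lipschitz i.
(* One more power of decay than in [amp_bound]: moving x by h e_i also changes the character by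
   O(|h| |eta|). *)
have [B HB] := fourier_weight_decay (`|r| + 1) tchi1.
exists ((2 * C1 + C2) * `|B|) => [|s x eta h].
  by rewrite mulr_ge0// addr_ge0// mulr_ge0.
set xh := x + _; pose S z := sigma (z, eta + s *: v); pose F := fourier chi1 eta.
have -> : amp_integrand s (xh, eta) - amp_integrand s (x, eta) =
    (expi (dot x eta) * (expi (h * eta 0 i) - 1)) * (S xh * F) +
    expi (dot x eta) * ((S xh - S x) * F).
  rewrite /amp_integrand /= -!/(S _) -!/F /xh dotDl dotZl [dot (delta_mx _ _) _]dotC dot_delta expiD.
  by move: (S _) => u; move: (S _) F => w F; ring.
apply: le_trans (normcD _ _) _.
rewrite Normc.normcM !normc_expiM !Normc.normcM.
have e1 : normc (expi (h * eta 0 i) - 1) <= 2 * (`|h| * (1 + enorm eta)).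
  have e0 z : expi_remainder 1 z = expi z - 1 :> R[i].
    by rewrite /= /taylor_term !expr0 fact0 divr1 mulr1.
  have := normc_expi_remainder 1 (h * eta 0 i).
  rewrite e0 expr1 (_ : 1`! = 1%N)// divr1 normrM => le1.
  apply: le_trans le1 _; rewrite ler_wpM2l// ler_wpM2l//.
  by rewrite (le_trans (normr_coord_enorm _ _))// lerDr.
set W := (1 + `|s|) `^ r * (1 + enorm eta) `^ `|r|.
have W0 : 0 <= W by rewrite mulr_ge0 ?powR_ge0.
have en := enorm_ge0 eta.
have a1 : normc (expi (h * eta 0 i) - 1) * (normc (S xh) * normc F) <=
    2 * (`|h| * (1 + enorm eta)) * (C1 * W * normc F).
  apply: ler_pM => //; [exact: normc_ge0|by rewrite mulr_ge0 ?normc_ge0|].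
  by rewrite ler_wpM2r ?normc_ge0//; exact: H1.
have a2 : normc (S xh - S x) * normc F <= C2 * `|h| * W * normc F * (1 + enorm eta).
  apply: (@le_trans _ _ (C2 * `|h| * W * normc F)).
    by rewrite ler_wpM2r ?normc_ge0//; exact: H2.
  rewrite ler_peMr ?lerDl//.
  exact: (mulr_ge0 (mulr_ge0 (mulr_ge0 C20 (normr_ge0 h)) W0) (normc_ge0 _)).
apply: le_trans (lerD a1 a2) _.
have := HB eta; rewrite powRD; last by rewrite gt_eqF ?enorm1_gt0// implybT.
rewrite powRr1; last exact: ltW (enorm1_gt0 eta).
move=> hB.
have -> : 2 * (`|h| * (1 + enorm eta)) * (C1 * W * normc F) +
    C2 * `|h| * W * normc F * (1 + enorm eta) =
  (2 * C1 + C2) * `|h| * (1 + `|s|) `^ r *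
  (normc F * ((1 + enorm eta) `^ `|r| * (1 + enorm eta))) by rewrite /W; ring.
have -> : (2 * C1 + C2) * `|B| * `|h| * (1 + `|s|) `^ r * cauchyw eta =
  (2 * C1 + C2) * `|h| * (1 + `|s|) `^ r * (`|B| * cauchyw eta) by ring.
rewrite ler_wpM2l//.
  by rewrite mulr_ge0 ?powR_ge0// mulr_ge0// addr_ge0// mulr_ge0.
by apply: le_trans hB _; rewrite ler_wpM2r ?ler_norm// ltW// cauchyw_gt0.
Qed.

Let measurable_profile s : rd_measurable (fun x => amplitude s x * chi2 x).
Proof. exact: rd_measurableM (measurable_amplitude s) (test_rd_measurable tchi2). Qed.

Let profile_bound : exists2 C, 0 <= C & forall s,
  rd_bounded (C * (1 + `|s|) `^ r) (fun x => amplitude s x * chi2 x).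
Proof.
have [C C0 HC] := amplitude_bound; have [B HB] := test_bounded tchi2.
exists (C * B) => [|s x]; first by rewrite mulr_ge0// (rd_bounded_ge0 HB).
rewrite Normc.normcM.
have -> : C * B * (1 + `|s|) `^ r * cauchyw x = C * (1 + `|s|) `^ r * (B * cauchyw x) by ring.
by rewrite ler_pM ?normc_ge0.
Qed.

(** The two oscillations combine into a single character at (t - s) v, so decay in t - s becomes an
    instance of [fourier_oscillation] for the slowly varying profile. *)
Let kernelE s t : kernel s t =
  (((2 * pi) ^+ d)^-1)%:C * fourier (fun x => amplitude s x * chi2 x) ((t - s) *: v).
Proof.
have [C C0 HC] := profile_bound.
rewrite -(integral_RdZ _ (rd_measurableM (rd_measurable_character _) (measurable_profile s))
  (rd_bounded_expiM _ (HC s))).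
apply: eq_integral_Rd => x; rewrite amp_shift /mode -!mulrA; congr (_ * _).
have -> : - dot x ((t - s) *: v) = s * dot v x - t * dot v x.
  by rewrite dotZr (dotC x) -mulrBl -mulNr opprB.
by rewrite expiD; move: (expi _) (expi _) => a b; ring.
Qed.

Let profile_lipschitz i : exists2 C, 0 <= C & forall s h, `|h| <= 1 ->
  rd_bounded (C * (1 + `|s|) `^ r * `|h|)
    (difference (h *: delta_mx 0 i) (fun x => amplitude s x * chi2 x)).
Proof.
have [C1 C10 H1] := amplitude_bound; have [C2 C20 H2] := amp_lipschitz i.
have [B HB] := test_bounded tchi2.
have [A HA] := test_bounded (test_derive (delta_mx 0 i) tchi2).
have A0 := rd_bounded_ge0 HA; have B0 := rd_bounded_ge0 HB.
have K0 := rd_const_ge0 (R := R) (n := d).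
pose L := line_const (1 : R) (d := d).
have L0 : 0 <= L by apply: prodr_ge0 => j _; rewrite mulr_ge0// addr_ge0// sqr_ge0.
exists (C2 * K * (B * L) + C1 * (2 * A * L)) => [|s h h1 x].
  exact: (addr_ge0 (mulr_ge0 (mulr_ge0 C20 K0) (mulr_ge0 B0 L0))
    (mulr_ge0 C10 (mulr_ge0 (mulr_ge0 _ A0) L0))).
rewrite /difference; set xh := x + _.
have -> : amplitude s xh * chi2 xh - amplitude s x * chi2 x =
    (amplitude s xh - amplitude s x) * chi2 xh + amplitude s x * (chi2 xh - chi2 x) by ring.
have [C0 C00 HC0] := amp_bound.
have d1 : normc (amplitude s xh - amplitude s x) <= C2 * `|h| * (1 + `|s|) `^ r * K.
  rewrite /amplitude -(integral_RdB (mamp2 s xh) (HC0 s xh) (mamp2 s x) (HC0 s x)).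
  apply: normc_integral_Rd => [|eta]; last exact: H2.
  apply: rd_measurableD (mamp2 s xh) _; under eq_fun do rewrite -mulN1r.
  by apply: rd_measurableM (mamp2 s x); exact: (cmeasurable_cst (D := setT)).
have d2 : normc (chi2 xh) <= B * L * cauchyw x.
  apply: le_trans (rd_bounded_shift _ HB x) _.
  by rewrite ler_wpM2r ?ler_wpM2l ?shift_const_line// ltW// cauchyw_gt0.
have d3 := rd_bounded_difference (test_csmooth tchi2) h1 HA x.
apply: le_trans (normcD _ _) _; rewrite !Normc.normcM.
have t1 := ler_pM (normc_ge0 _) (normc_ge0 _) d1 d2.
have t2 := ler_pM (normc_ge0 _) (normc_ge0 _) (H1 s x) d3.
apply: le_trans (lerD t1 t2) _.
by rewrite le_eqVlt; apply/orP; left; apply/eqP; rewrite -/L; ring.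
Qed.

Lemma kernel_bound : exists2 C, 0 <= C & forall s t,
  normc (kernel s t) <= C * (1 + `|s|) `^ r / (1 + `|t - s|).
Proof.
(* A unit vector has a nonzero coordinate. Since |v_i| <= 1, the quantity 1 + |t - s| |v_i| is at
   least |v_i| (1 + |t - s|), which transfers the decay in that coordinate to t - s. *)
have [i vi] : exists i, v 0 i != 0.
  apply/existsP; apply: contraT; rewrite negb_exists => /forallP v0.
  suff : enorm v = 0 by rewrite v1 => /eqP; rewrite oner_eq0.
  rewrite /enorm /dot big1 ?sqrtr0// => i _.
  by have := v0 i; rewrite negbK => /eqP ->; rewrite mulr0.
have [A A0 HA] := profile_bound; have [B B0 HB] := profile_lipschitz i.
have K0 := rd_const_ge0 (R := R) (n := d).
have vi0 : 0 < `|v 0 i| by rewrite normr_gt0.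
have vi1 : `|v 0 i| <= 1 by rewrite -v1; exact: normr_coord_enorm.
pose c := ((2 * pi) ^+ d)^-1 : R.
have c0 : 0 <= c by rewrite invr_ge0 exprn_ge0// mulr_ge0// pi_ge0.
have pi1 : 0 <= 1 + pi :> R by rewrite addr_ge0// pi_ge0.
exists (c * ((A + B) * K * (1 + pi)) / `|v 0 i|) => [|s t].
  by rewrite divr_ge0// mulr_ge0// mulr_ge0// mulr_ge0// addr_ge0.
rewrite kernelE Normc.normcM normc_real -/c (ger0_norm c0).
have := fourier_oscillation (measurable_profile s) (HA s) (HB s) ((t - s) *: v).
rewrite mxE normrM -mulrDl => le1.
apply: le_trans (ler_wpM2l c0 le1) _.
have -> : c * ((A + B) * (1 + `|s|) `^ r * K * (1 + pi) / (1 + `|t - s| * `|v 0 i|)) =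
  c * ((A + B) * K * (1 + pi)) * (1 + `|s|) `^ r / (1 + `|t - s| * `|v 0 i|) by ring.
rewrite [leRHS](_ : _ = c * ((A + B) * K * (1 + pi)) * (1 + `|s|) `^ r *
  (`|v 0 i|^-1 / (1 + `|t - s|))); last by ring.
rewrite ler_wpM2l//.
  exact: (mulr_ge0 (mulr_ge0 c0 (mulr_ge0 (mulr_ge0 (addr_ge0 A0 B0) K0) pi1)) (powR_ge0 _ _)).
rewrite -invfM lef_pV2 ?posrE ?mulr_gt0 ?ltr_wpDr ?mulr_ge0//.
by rewrite mulrDr mulr1 (mulrC `|v 0 i|) lerD2r.
Qed.

Variables (a : 'rV[R]_d -> R[i]) (b : 'rV[R]_d * 'rV[R]_d -> R[i]).
Hypotheses (symb : symbol_class (r - 1) b) (ta : test a).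
Hypothesis sigmaE : forall x xi, 1 <= enorm xi ->
  sigma (x, xi) = a x * (enorm xi `^ r)%:C + b (x, xi).

Let scaled_enorm (u : R^nat) eta : u n @[n --> \oo] --> +oo -> (forall n, 1 <= u n) ->
  (u n)^-1 * enorm (eta + u n *: v) @[n --> \oo] --> (1 : R).
Proof.
move=> uoo u1; have u0 n : 0 < u n by exact: lt_le_trans ltr01 (u1 n).
have iu : (u n)^-1 @[n --> \oo] --> (0 : R).
  by apply/gtr0_cvgV0; [exact: nearW|exact: uoo].
rewrite -v1 (_ : (fun n => _) = fun n => enorm ((u n)^-1 *: eta + v)).
  have l1 : (u n)^-1 *: eta + v @[n --> \oo] --> v.
    rewrite -[X in _ --> X]add0r -(scale0r eta).
    by apply: cvgD; [exact: cvgZr_tmp|exact: cvg_cst].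
  exact: (cvg_comp _ _ l1 (@continuous_enorm _ _ v)).
apply/funext => n.
have -> : (u n)^-1 *: eta + v = (u n)^-1 *: (eta + u n *: v).
  by rewrite scalerDr scalerA mulVf ?scale1r// gt_eqF.
by rewrite enormZ gtr0_norm// invr_gt0.
Qed.

(** The product is ((1 + u) / u)^r, and the ratio lies between 1 and 2 for u >= 1. *)
Let scaled_weight (u : R) : 1 <= u -> u `^ (- r) * (1 + `|u|) `^ r <= 2 `^ `|r|.
Proof.
move=> u1; have u0 : 0 < u by exact: lt_le_trans u1.
rewrite (gtr0_norm u0).
have -> : 1 + u = (1 + u) / u * u by rewrite divfK// gt_eqF.
have q0 : 1 <= (1 + u) / u by rewrite ler_pdivlMr// mul1r lerDr.
rewrite (powRM _ (le_trans ler01 q0) (ltW u0)).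
rewrite powRN mulrCA mulVf ?gt_eqF ?powR_gt0// mulr1.
apply: le_trans (ler_powR q0 (ler_norm r)) _.
apply: ge0_ler_powR; rewrite ?nnegrE ?(le_trans ler01 q0)//.
by rewrite ler_pdivrMr//; lra.
Qed.

(** After division by u^r the principal part tends to a x, because |eta + u v| / u tends to 1. The
    term b is one order lower and contributes O(1 / |eta + u v|). *)
Let symbol_limit (u : R^nat) x eta : u n @[n --> \oo] --> +oo -> (forall n, 1 <= u n) ->
  ccvg \oo (fun n => (u n `^ (- r))%:C * sigma (x, eta + u n *: v)) (a x).
Proof.
move=> uoo u1; have u0 n : 0 < u n by exact: lt_le_trans ltr01 (u1 n).
have q1 := scaled_enorm eta uoo u1.
pose e n := enorm (eta + u n *: v).
have e2 : \forall n \near \oo, u n <= 2 * e n.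
  have h2 : 0 < 2^-1 :> R by rewrite invr_gt0.
  move/cvgrPdist_le : q1 => /(_ _ h2).
  apply: filterS => n; rewrite ler_distlC => /andP[+ _].
  by rewrite mulrC ler_pdivlMr// -/(e n) => ?; nra.
have eoo : e n @[n --> \oo] --> +oo.
  apply/cvgryPge => A; move/cvgryPge : uoo => /(_ (2 * A)).
  by apply: filterS2 e2 => n; lra.
have e1 : \forall n \near \oo, 1 <= e n.
  by move/cvgryPge : eoo; exact.
rewrite -[a x]addr0 -[X in X + _]mulr1.
have [B HB] := symb.2 [::] [::]; have [C C0 HC] := weight_shift r.
pose W := `|B| * C * (1 + enorm eta) `^ `|r| * 2 `^ `|r|.
have er n : 1 <= e n -> (u n `^ (- r)) * e n `^ r = ((u n)^-1 * e n) `^ r.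
  move=> en; have -> : e n = (u n)^-1 * e n * u n by rewrite mulrAC mulVf ?mul1r// gt_eqF.
  rewrite powRM ?mulr_ge0 ?invr_ge0 ?ltW ?(lt_le_trans ltr01 en)//.
  by rewrite powRN mulrCA mulVf ?mulr1 ?gt_eqF ?powR_gt0// mulrAC mulVf ?mul1r// gt_eqF.
apply: (@ccvg_near_eq _ _ _ _ _ (fun n => a x * (((u n)^-1 * e n) `^ r)%:C +
    (u n `^ (- r))%:C * b (x, eta + u n *: v))).
  apply: filterS e1 => n en; rewrite sigmaE// -/(e n) -er// rmorphM /=.
  by ring.
apply: ccvgD.
  apply: ccvgM; first exact: ccvg_cst.
  by apply: ccvg_real; exact: cvg_powR1.
apply: (ccvg_squeeze (g := fun n => W / e n)).
  rewrite -[X in _ --> X](mulr0 W); apply: cvgM; first exact: cvg_cst.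
  apply/gtr0_cvgV0; last exact: eoo.
  by apply: filterS e1 => n; apply: lt_le_trans.
apply: filterS e1 => n en; rewrite subr0 Normc.normcM normc_real ger0_norm ?powR_ge0//.
have := HB x (eta + u n *: v); rewrite cdirD0 subr0 => hb.
have := HC (u n) eta; have := scaled_weight (u1 n); move: hb.
have e0 := enorm1_gt0 (eta + u n *: v); rewrite -/(e n) in e0 *.
rewrite powRD; last by rewrite (gt_eqF e0) implybT.
rewrite (powRN (1 + e n)) (powRr1 (ltW e0)) {}/W.
set E := (1 + enorm eta) `^ `|r|; set p := u n `^ (- r); set q := (1 + e n) `^ r.
set U := (1 + `|u n|) `^ r; set t := 2 `^ `|r|; set nb := normc _ => hb h2 h1.
have p0 : 0 <= p := powR_ge0 _ _.
have E0 : 0 <= E := powR_ge0 _ _.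
have pq : p * q <= C * E * t.
  apply: le_trans (ler_wpM2l p0 h1) _; rewrite [leLHS](_ : _ = C * E * (p * U)); last by ring.
  by rewrite ler_wpM2l// mulr_ge0.
apply: le_trans (ler_wpM2l p0 hb) _.
rewrite [leLHS](_ : _ = B * ((p * q) / (1 + e n))); last by ring.
rewrite [leRHS](_ : _ = `|B| * ((C * E * t) / e n)); last by ring.
have pq0 : 0 <= p * q := mulr_ge0 p0 (powR_ge0 _ _).
apply: (@le_trans _ _ (`|B| * (p * q / (1 + e n)))).
  by rewrite ler_wpM2r ?ler_norm// divr_ge0// ltW.
have en0 : 0 < e n by exact: lt_le_trans ltr01 en.
rewrite ler_wpM2l// ler_pM//; first by rewrite invr_ge0 ltW.
by rewrite lef_pV2 ?posrE// lerDr.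
Qed.

(** Dominated convergence is applied twice: in eta, where Fourier inversion identifies the limit of
    the rescaled amplitude as (2 pi)^d a chi1, then in x. The hypothesis on the cutoffs removes chi1
    and chi2, and (2 pi)^d cancels the normalisation of [pseudo_diff]. *)
Lemma kernel_limit tau : (forall x, a x * chi1 x * chi2 x = a x) ->
  ccvg (pinfty_nbhs R) (fun k => (k `^ (- r))%:C * kernel k (k + tau)) (fourier a (tau *: v)).
Proof.
move=> achi; apply: ccvg_pinfty_seq => u uoo.
(* Raising u to at least 1 changes finitely many terms and makes [scaled_weight] available for every
   n. *)
wlog u1 : u uoo / forall n, 1 <= u n.
  have u1 : \forall n \near \oo, 1 <= u n by move/cvgryPge : uoo; exact.
  move=> /(_ (fun n => Num.max 1 (u n))) W.
  apply: (ccvg_near_eq _ (W _ _)).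
  - by apply: filterS u1 => n /max_idPr ->.
  - apply/cvgryPge => B; move/cvgryPge : uoo => /(_ B).
    by apply: filterS => n h; rewrite le_max h orbT.
  - by move=> n; rewrite le_max lexx.
pose A n x := (u n `^ (- r))%:C * amplitude (u n) x.
have [C C0 HC] := amp_bound; have [C' C'0 HC'] := profile_bound.
have cA x : ccvg \oo (A ^~ x) (a x * (((2 * pi) ^+ d)%:C * chi1 x)).
  rewrite -fourier_inversion//.
  have [B HB] := fourier_rd_bounded tchi1.
  rewrite -(integral_RdZ _ (rd_measurableM (rd_measurable_expi _) (rd_measurable_fourier tchi1))
    (rd_bounded_expiM _ HB)).
  rewrite (_ : A ^~ x = fun n => integral_Rd (fun eta =>
     (u n `^ (- r))%:C * amp_integrand (u n) (x, eta))); last first.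
    by apply/funext => n; rewrite (integral_RdZ _ (mamp2 (u n) x) (HC (u n) x)).
  apply: (@integral_Rd_ccvg _ _ (C * 2 `^ `|r|)).
  - move=> n; apply: rd_measurableM (mamp2 (u n) x).
    exact: (cmeasurable_cst (D := setT)).
  - move=> n eta; rewrite Normc.normcM normc_real ger0_norm ?powR_ge0//.
    apply: le_trans (ler_wpM2l (powR_ge0 _ _) (HC (u n) x eta)) _.
    rewrite [leLHS](_ : _ = C * (u n `^ (- r) * (1 + `|u n|) `^ r) * cauchyw eta); last by ring.
    rewrite ler_wpM2r ?ler_wpM2l ?scaled_weight//.
    exact: ltW (cauchyw_gt0 _).
  - move=> eta; rewrite /amp_integrand /=.
    rewrite (_ : (fun n => _) = fun n => expi (dot x eta) * fourier chi1 eta *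
        ((u n `^ (- r))%:C * sigma (x, eta + u n *: v))); last first.
      by apply/funext => n; ring.
    rewrite [X in ccvg _ _ X]mulrC.
    by apply: ccvgM; [exact: ccvg_cst|exact: symbol_limit].
  - exact: continuous_dot.
pose c : R[i] := (((2 * pi) ^+ d)^-1)%:C.
have cE : c * ((2 * pi) ^+ d)%:C = 1.
  rewrite /c -rmorphM /= mulVf// expf_neq0// mulf_neq0// gt_eqF ?pi_gt0//.
rewrite (_ : (fun n => _) = fun n => c * fourier (fun x => A n x * chi2 x) (tau *: v));
    last first.
  apply/funext => n; rewrite kernelE addrC addKr mulrCA; congr (_ * _).
  rewrite -(integral_RdZ _ (rd_measurableM (rd_measurable_character _)
    (measurable_profile (u n))) (rd_bounded_expiM _ (HC' (u n)))).
  by apply: eq_integral_Rd => x; rewrite /A; ring.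
have -> : fourier a (tau *: v) =
    c * fourier (fun x => a x * (((2 * pi) ^+ d)%:C * chi1 x) * chi2 x) (tau *: v).
  have [B HB] := test_bounded ta.
  pose q : R[i] := ((2 * pi) ^+ d)%:C.
  have -> : (fun x => a x * (q * chi1 x) * chi2 x) = fun x => q * a x.
    by apply/funext => x; rewrite -[a x in RHS]achi; ring.
  rewrite /fourier; under [in RHS]eq_integral_Rd do rewrite mulrCA.
  rewrite (integral_RdZ _ (rd_measurableM (rd_measurable_character _)
    (test_rd_measurable ta)) (rd_bounded_expiM _ HB)).
  by rewrite mulrA cE mul1r.
apply: ccvgM; first exact: ccvg_cst.
apply: (@integral_Rd_ccvg _ _ (C' * 2 `^ `|r|)).
- move=> n; apply: (rd_measurableM (rd_measurable_character _)).
  rewrite /A; under eq_fun do rewrite -mulrA.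
  apply: rd_measurableM (measurable_profile (u n)).
  exact: (cmeasurable_cst (D := setT)).
- move=> n x; rewrite normc_expiM /A -mulrA Normc.normcM normc_real ger0_norm ?powR_ge0//.
  apply: le_trans (ler_wpM2l (powR_ge0 _ _) (HC' (u n) x)) _.
  rewrite [leLHS](_ : _ = C' * (u n `^ (- r) * (1 + `|u n|) `^ r) * cauchyw x); last by ring.
  rewrite ler_wpM2r ?ler_wpM2l ?scaled_weight//.
  exact: ltW (cauchyw_gt0 _).
- move=> x; apply: ccvgM; first exact: ccvg_cst.
  apply: ccvgM; [exact: cA|exact: ccvg_cst].
Qed.

End kernel.

(** * Moments of Gaussian variables *)

Section gaussian_integrals.
Context {R : realType}.
Local Notation mu := (@lebesgue_measure R).

Lemma continuous_Rintegrable_itv (f : R -> R) a b : continuous f ->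
  mu.-integrable `[a, b] (EFin \o f).
Proof.
move=> cf; apply: continuous_compact_integrable; first exact: segment_compact.
exact: continuous_subspaceT.
Qed.

Lemma Rintegral_derive_itv (f F : R -> R) a b : a < b -> continuous f ->
  (forall x : R, is_derive x (1 : R) F (f x)) -> \int[mu]_(x in `[a, b]) f x = F b - F a.
Proof.
move=> ab cf dF.
have cF : continuous F.
  by move=> x; apply: differentiable_continuous; apply/derivable1_diffP; case: (dF x).
rewrite /Rintegral (@continuous_FTC2 R f F a b ab).
- by [].
- exact: continuous_subspaceT.
- split; [by move=> x _; case: (dF x)|exact: cvg_at_right_filter (cF a)|exact: cvg_at_left_filter (cF b)].
- by move=> x _; rewrite derive1E; case: (dF x).
Qed.

Lemma Rintegral_itv_cvg (f : R -> R) : mu.-integrable setT (EFin \o f) ->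
  \int[mu]_(x in `[- n%:R, n%:R]) f x @[n --> \oo] --> \int[mu]_x f x.
Proof.
move=> fi.
have mf : measurable_fun setT f by apply/measurable_EFinP; exact: measurable_int fi.
under eq_fun do rewrite Rintegral_mkcond.
apply: (@Rintegral_dominated_cvg R _ _ mu setT measurableT
  (fun n => f \_ `[- n%:R, n%:R]) f (fun x => `|f x|)).
- move=> n; apply: (measurable_restrictT _ _).1; first exact: measurable_itv.
  exact: measurable_funTS.
- move=> x _; apply: (@cvg_near_cst _ _ _ _).
  exists (Num.truncn `|x|).+1 => // n /= xn.
  rewrite patchE ifT// inE /= in_itv /= -ler_norml ltW// (lt_le_trans (truncnS_gt _))//.
  by rewrite ler_nat.
- have := integrable_abse fi; apply: eq_integrable => //.
- by move=> n x _; rewrite patchE; case: ifP => _ //; rewrite normr0.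
Qed.

(** The boundary terms vanish because F decays; this is integration by parts over the line, in the
    form used for Gaussian moments. *)
Lemma Rintegral_derive_eq0 (f F : R -> R) C : continuous f ->
  (forall x, `|f x| <= C * cauchy x) -> (forall x, `|F x| <= C * cauchy x) ->
  (forall x : R, is_derive x (1 : R) F (f x)) -> \int[mu]_x f x = 0.
Proof.
move=> cf fC FC dF.
have fi : mu.-integrable setT (EFin \o f).
  apply: (@le_integrableR R _ (measurableTypeR R) mu setT measurableT _
    (fun x => C * cauchy x)) => //.
    exact: continuous_measurable_fun.
  exact: (integrableZlR measurableT _ integrable_cauchy).
have h := Rintegral_itv_cvg fi.
have F0 : F n%:R - F (- n%:R) @[n --> \oo] --> (0 : R).
  have b n : `|F n%:R - F (- n%:R)| <= 2 * C * cauchy (n%:R : R).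
    apply: le_trans (ler_normB _ _) _.
    have -> : 2 * C * cauchy n%:R = C * cauchy (n%:R : R) + C * cauchy (- n%:R : R).
      by rewrite /cauchy sqrrN; ring.
    exact: lerD.
  have C0 : 0 <= C.
    by have := le_trans (normr_ge0 _) (FC 0); rewrite pmulr_lge0// cauchy_gt0.
  have b' n : `|F n%:R - F (- n%:R)| <= 4 * C * harmonic n.
    apply: le_trans (b n) _; rewrite /cauchy.
    have -> : 4 * C * harmonic n = 2 * C * (2^-1 * n.+1%:R)^-1.
      by rewrite /harmonic /= invfM invrK; ring.
    rewrite ler_wpM2l ?mulr_ge0// lef_pV2 ?posrE ?mulr_gt0 ?invr_gt0 ?ltr_pwDl ?sqr_ge0//.
    rewrite ler_pdivrMl// -natr1; move: (n%:R : R) => a; have := sqr_ge0 (a - 1); nra.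
  have h0 : 4 * C * harmonic n @[n --> \oo] --> (0 : R).
    by rewrite -(mulr0 (4 * C)); apply: cvgM; [exact: cvg_cst|exact: cvg_harmonic].
  apply: (@squeeze_cvgr _ _ _ _ (fun n => - (4 * C * harmonic n)) (fun n => 4 * C * harmonic n)) => //.
    by apply: nearW => n; rewrite -ler_norml.
  by rewrite -oppr0; apply: cvgN.
apply: (cvg_unique _ h) => //.
apply: cvg_trans F0; apply: near_eq_cvg; exists 1%N => // n /= n0.
rewrite (Rintegral_derive_itv (F := F))// -subr_gt0 opprK addr_gt0// ltr0n//.
Qed.

Variable s : R.
Hypothesis s0 : 0 < s.
Local Notation p := (normal_pdf 0 s).
Let sn0 : s != 0. Proof. by rewrite gt_eqF. Qed.

Let pE x : p x = normal_peak s * expR (- (x ^+ 2 / (s ^+ 2 *+ 2))).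
Proof. by rewrite (normal_pdfE _ sn0) /normal_fun subr0 mulNr. Qed.

Let dp (x : R) : is_derive x (1 : R) p (- (x / s ^+ 2) * p x).
Proof.
rewrite (_ : p = fun x => normal_peak s * expR (- (x ^+ 2 / (s ^+ 2 *+ 2)))); last first.
  by apply/funext => y; exact: pE.
have := is_derive_pow_fact 1 x; rewrite expr1 (_ : 1`! = 1%N)// divr1 => dq.
have dq' := @is_deriveZ R R R _ (- (s ^+ 2)^-1) x 1 _ dq.
have de := is_derive1_comp (is_derive_expR _) dq'.
have := @is_deriveZ R R R _ (normal_peak s) x 1 _ de.
set F := _ \*: _; have -> : F = fun x => normal_peak s * expR (- (x ^+ 2 / (s ^+ 2 *+ 2))).
  apply/funext => z; rewrite /F /=; congr (_ * expR _).
  rewrite [_ *: _]mulNr; congr (- _); rewrite (_ : 2`! = 2%N)//.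
  by field.
move=> dF; apply: is_derive_eq dF _.
have -> : expR ((- s ^- 2 \*: (fun s : R => s ^+ 2 / 2`!%:R)) x) =
    expR (- (x ^+ 2 / (s ^+ 2 *+ 2))).
  congr expR; rewrite /= [_ *: _]mulNr; congr (- _); rewrite (_ : 2`! = 2%N)//.
  by field.
rewrite [_ *: _]mulrCA [- s ^- 2 *: x]mulNr [X in - X]mulrC.
by ring.
Qed.

Let dX k (x : R) : is_derive x (1 : R) (fun x => x ^+ k.+1) (k.+1%:R * x ^+ k).
Proof.
have dq := @is_deriveZ R R R _ (k.+1`!%:R) x 1 _ (is_derive_pow_fact k x).
have f0 n : n`!%:R != 0 :> R by rewrite pnatr_eq0 -lt0n fact_gt0.
have -> : (fun x : R => x ^+ k.+1) = k.+1`!%:R \*: (fun x => x ^+ k.+1 / k.+1`!%:R).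
  by apply/funext => y; rewrite /= [RHS]mulrC divfK.
apply: is_derive_eq dq _.
rewrite -[LHS]/(k.+1`!%:R * (x ^+ k / k`!%:R)) factS natrM.
by field; exact: f0.
Qed.


(** The term y^4 / 4! of the exponential, with y = x^2 / (2 s^2), gives decay of order 8 in x and
    equals x^8 / c. Two powers go to the Cauchy weight and six remain, enough for the recursion that
    leads to the fourth moment. *)
Let p_bound k : (k <= 6)%N -> exists2 C, 0 <= C & forall x, `|x ^+ k * p x| <= C * cauchy x.
Proof.
move=> k6; pose c := 4`!%:R * (s ^+ 2 *+ 2) ^+ 4 : R.
have c0 : 0 < c by rewrite mulr_gt0 ?ltr0n ?exprn_gt0// pmulrn_rgt0// exprn_gt0.
exists (normal_peak s * (2 * (1 + c))) => [|x].
  by rewrite mulr_ge0 ?normal_peak_ge0// mulr_ge0// addr_ge0// ltW.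
rewrite normrM (ger0_norm (normal_pdf_ge0 _ _ _)) pE normrX mulrCA -[leRHS]mulrA ler_wpM2l ?normal_peak_ge0//.
set y := x ^+ 2 / _.
have y0 : 0 <= y by rewrite divr_ge0 ?sqr_ge0// mulrn_wge0// sqr_ge0.
have e1 : expR (- y) <= (1 + y ^+ 4 / 4`!%:R)^-1.
  rewrite expRN lef_pV2 ?posrE ?expR_gt0 ?ltr_pwDl ?divr_ge0 ?exprn_ge0//.
  exact: expR_ge1Dxn.
have yE : y ^+ 4 / 4`!%:R = `|x| ^+ 8 / c.
  rewrite /y -[x ^+ 2]real_normK ?num_real// /c.
  have S0 : s ^+ 2 *+ 2 != 0 by rewrite gt_eqF// pmulrn_rgt0// exprn_gt0.
  have f0 : 4`!%:R != 0 :> R by rewrite pnatr_eq0.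
  by move: (s ^+ 2 *+ 2) 4`!%:R S0 f0 => S f S0 f0; field; rewrite S0.
apply: le_trans (ler_wpM2l _ e1) _; first exact: exprn_ge0.
rewrite yE /cauchy -[x ^+ 2]real_normK ?num_real//.
have a0 := normr_ge0 x; move: `|x| a0 => a a0.
have a8 : 0 <= a ^+ 8 by rewrite exprn_ge0.
have h : a ^+ k * (1 + a ^+ 2) <= 2 * (1 + a ^+ 8).
  rewrite mulrDr mulr1 -exprD mulr_natl mulr2n.
  have pow n : (n <= 8)%N -> a ^+ n <= 1 + a ^+ 8.
    move=> n8; have [a1|a1] := lerP a 1.
      by apply: (@le_trans _ _ 1); [exact: exprn_ile1|rewrite lerDl].
    apply: (@le_trans _ _ (a ^+ 8)); last by rewrite lerDr.
    by rewrite ler_weXn2l// ltW.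
  by apply: lerD; apply: pow; rewrite ?addn2 ?ltnS// (leq_trans k6).
rewrite ler_pdivrMr ?ltr_pwDl ?divr_ge0 ?(ltW c0)//.
rewrite mulrAC ler_pdivlMr ?ltr_pwDl ?sqr_ge0//.
apply: le_trans h _.
rewrite -mulrA ler_wpM2l//.
have -> : (1 + c) * (1 + a ^+ 8 / c) = 1 + a ^+ 8 + (c + a ^+ 8 / c) by field; rewrite gt_eqF.
by rewrite lerDl addr_ge0 ?divr_ge0// ltW.
Qed.

Let cp : continuous p. Proof. exact: continuous_normal_pdf. Qed.

Let cXp k : continuous (fun x : R => x ^+ k * p x).
Proof. by apply: continuousM_fun cp; exact: exprn_continuous. Qed.

Lemma integrable_normal_moment k : (k <= 6)%N -> mu.-integrable setT (EFin \o (fun x => x ^+ k * p x)).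
Proof.
move=> /p_bound[C C0 HC].
apply: (@le_integrableR R _ (measurableTypeR R) mu setT measurableT _
  (fun x => C * cauchy x)) => //.
  exact: continuous_measurable_fun.
exact: (integrableZlR measurableT _ integrable_cauchy).
Qed.

Local Notation M k := (\int[mu]_x (x ^+ k * p x)).

(** Stein's identity: the integrand is the derivative of x^(k + 1) times the density. It yields a
    recursion on moments of step two. *)
Let moment_derive k : (k <= 4)%N ->
  \int[mu]_x (k.+1%:R * x ^+ k * p x - (s ^+ 2)^-1 * (x ^+ k.+2 * p x)) = 0.
Proof.
move=> k4.
have [C C0 HC] := p_bound (leq_trans k4 (isT : 4 <= 6)%N).
have [B B0 HB] := p_bound (k4 : k.+2 <= 6)%N.
have [A A0 HA] := p_bound (leq_trans (k4 : k.+1 <= 5) (isT : 5 <= 6))%N.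
have s2 : 0 <= (s ^+ 2)^-1 by rewrite invr_ge0 sqr_ge0.
apply: (@Rintegral_derive_eq0 _ (fun x => x ^+ k.+1 * p x)
  (k.+1%:R * C + (s ^+ 2)^-1 * B + A)).
- apply: continuousD_fun.
    apply: (continuousM_fun _ cp); apply: continuousM_fun (@exprn_continuous _ _).
    exact: cst_continuous.
  apply: continuousN_fun; apply: continuousM_fun; [exact: cst_continuous|exact: cXp].
- move=> x; apply: le_trans (ler_normB _ _) _.
  rewrite -mulrA !normrM (ger0_norm s2) normr_nat -!normrM.
  rewrite !mulrDl -!(mulrA _ _ (cauchy x)).
  rewrite -[leLHS]addr0 lerD// ?mulr_ge0 ?(ltW (cauchy_gt0 _))//.
  exact: (lerD (ler_wpM2l (ler0n _ _) (HC x)) (ler_wpM2l s2 (HB x))).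
- move=> x; apply: le_trans (HA x) _; rewrite ler_wpM2r ?(ltW (cauchy_gt0 _))//.
  by rewrite lerDr addr_ge0// mulr_ge0.
- move=> x; have [d e] := is_deriveM (dX k x) (dp x).
  apply: is_derive_eq (is_deriveM (dX k x) (dp x)) _.
  rewrite -[LHS]/(x ^+ k.+1 * (- (x / s ^+ 2) * p x) + p x * (k.+1%:R * x ^+ k)) !exprS.
  by ring.
Qed.

Let momentSS k : (k <= 4)%N -> M k.+2 = s ^+ 2 * k.+1%:R * M k.
Proof.
move=> k4; have := moment_derive k4.
have i1 := integrable_normal_moment (leq_trans k4 (isT : 4 <= 6)%N).
have i2 := integrable_normal_moment (k4 : k.+2 <= 6)%N.
under eq_Rintegral do rewrite -mulrA.
rewrite RintegralB//; last 2 first.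
- exact: (integrableZlR measurableT _ i1).
- exact: (integrableZlR measurableT _ i2).
rewrite !RintegralZl// => /eqP; rewrite subr_eq0 => /eqP e.
by rewrite -mulrA e mulrA mulfV ?mul1r// expf_neq0.
Qed.

Let moment0 : M 0 = 1.
Proof.
rewrite /Rintegral; under eq_integral do rewrite expr0 mul1r.
by rewrite integral_normal_pdf.
Qed.

Let moment1 : M 1 = 0.
Proof.
have [C C0 HC] := p_bound (isT : 0 <= 6)%N; have [B B0 HB] := p_bound (isT : 1 <= 6)%N.
have s2 : 0 <= (s ^+ 2)^-1 by rewrite invr_ge0 sqr_ge0.
have h : \int[mu]_x (- (s ^+ 2)^-1 * (x ^+ 1 * p x)) = 0.
  apply: (@Rintegral_derive_eq0 _ p ((s ^+ 2)^-1 * B + C)).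
  - apply: continuousM_fun; [exact: cst_continuous|exact: cXp].
  - move=> x; rewrite normrM normrN (ger0_norm s2) mulrDl -mulrA.
    rewrite -[leLHS]addr0 lerD// ?mulr_ge0 ?(ltW (cauchy_gt0 _))//.
    exact: (ler_wpM2l s2 (HB x)).
  - move=> x; have := HC x; rewrite mul1r => /le_trans; apply.
    by rewrite ler_wpM2r ?(ltW (cauchy_gt0 _))// lerDr mulr_ge0.
  - by move=> x; apply: is_derive_eq (dp x) _; rewrite expr1; ring.
move: h; rewrite RintegralZl//; last exact: integrable_normal_moment.
by move/eqP; rewrite mulf_eq0 oppr_eq0 invr_eq0 expf_eq0 (negbTE sn0) /= => /eqP.
Qed.

Lemma normal_moments : [/\ M 0 = 1, M 1 = 0, M 2 = s ^+ 2 & M 4 = 3 * s ^+ 4].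
Proof.
split; [exact: moment0|exact: moment1| |].
  by rewrite momentSS// moment0 !mulr1.
by rewrite !momentSS// moment0; ring.
Qed.

(** The Radon-Nikodym derivative of the normal law agrees almost everywhere with the density, since
    both have the same integral over every measurable set; a translation then centres the
    density. *)
Lemma ge0_integral_normal_prob m (g : R -> R) : measurable_fun setT g -> (forall x, 0 <= g x) ->
  (\int[normal_prob m s]_x (g x)%:E = \int[mu]_x (g (x + m) * p x)%:E)%E.
Proof.
move=> mg g0; have dom := @normal_prob_dominates R m s.
have mp := @measurable_normal_pdf R m s.
pose RN := Radon_Nikodym_SigmaFinite.f (normal_prob m s) mu.
have g0' x : (0 <= (g x)%:E)%E by rewrite lee_fin.
have mg' : measurable_fun setT (fun x => (g x)%:E) by exact/measurable_EFinP.
rewrite -(Radon_Nikodym_SigmaFinite.change_of_variables dom g0' measurableT mg').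
have RNi : mu.-integrable setT RN := Radon_Nikodym_SigmaFinite.f_integrable dom.
transitivity (\int[mu]_x ((g x)%:E * (normal_pdf m s x)%:E))%E.
  apply: ae_eq_integral => //.
  - apply: emeasurable_funM; first exact/measurable_EFinP.
    exact: measurable_int RNi.
  - by apply: emeasurable_funM; exact/measurable_EFinP.
  - apply: ae_eqe_mul2l; apply: integral_ae_eq => //.
    + exact/measurable_EFinP.
    + move=> E _ mE.
      by rewrite -(Radon_Nikodym_SigmaFinite.f_integral dom).
have h := @ge0_integral_affine R 1 m (fun x => (g x * normal_pdf m s x)%:E) ltr01.
rewrite invr1 mul1e in h.
under eq_integral do rewrite -EFinM.
rewrite -h; last 2 first.
- by apply/measurable_EFinP; exact: measurable_funM.
- by move=> x; rewrite lee_fin mulr_ge0 ?normal_pdf_ge0.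
apply: eq_integral => x _; rewrite mul1r; congr (_ * _)%:E.
by rewrite pE (normal_pdfE _ sn0) /normal_fun addrK mulNr.
Qed.

End gaussian_integrals.

Lemma EFin_Rintegral {R : realType} {d : measure_display} {T : measurableType d}
    (mu : {measure set T -> \bar R}) (f : T -> R) : mu.-integrable setT (EFin \o f) ->
  (\int[mu]_x (f x)%:E = (\int[mu]_x f x)%:E)%E.
Proof. by move=> fi; rewrite /Rintegral fineK//; exact: integrable_fin_num fi. Qed.

Section gaussian_variables.
Context {R : realType} {disp : measure_display} {Omega : measurableType disp}.
Variable P : probability Omega R.
Local Notation mu := (@lebesgue_measure R).
Implicit Types X Y : Omega -> R.

(** The law is transported to the line for nonnegative functions only, so that integrability need
    not be known beforehand. The mean is therefore recorded through (X + 1)^2 next to X^2. A Dirac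
    mass is the case v = 0. *)
Lemma gaussian_law_integral X : measurable_fun setT X -> gaussian_law (pushforward P X) ->
  exists (m : R) (v : R), [/\ 0 <= v,
    (\int[P]_w (X w ^+ 2)%:E = (m ^+ 2 + v)%:E)%E,
    (\int[P]_w ((X w + 1) ^+ 2)%:E = ((m + 1) ^+ 2 + v)%:E)%E &
    m = 0 -> (\int[P]_w (X w ^+ 4)%:E = (3 * v ^+ 2)%:E)%E].
Proof.
move=> mX [m gm].
have mpow n : measurable_fun setT (fun x : R => x ^+ n).
  by apply: continuous_measurable_fun; exact: exprn_continuous.
have mpow1 n : measurable_fun setT (fun x : R => (x + 1) ^+ n).
  by apply: measurable_funX; exact: measurable_funD.
have push (g : R -> R) : measurable_fun setT g -> (forall x, 0 <= g x) ->
    (\int[P]_w (g (X w))%:E =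
      \int[pushforward P (X : Omega -> measurableTypeR R)]_x (g x)%:E)%E.
  move=> mg g0; rewrite ge0_integral_pushforward//.
    exact/measurable_EFinP.
  by move=> y _; rewrite lee_fin.
case: gm => [[s s0 gm]|gm].
  have law (g : R -> R) : measurable_fun setT g -> (forall x, 0 <= g x) ->
      (\int[P]_w (g (X w))%:E = \int[mu]_x (g (x + m) * normal_pdf 0 s x)%:E)%E.
    move=> mg g0; rewrite push// -(ge0_integral_normal_prob s0)//.
    by apply: (@eq_measure_integral _ (measurableTypeR R)) => A mA _; exact: gm mA.
  have mom c : (\int[mu]_x ((x + c) ^+ 2 * normal_pdf 0 s x)%:E = (c ^+ 2 + s ^+ 2)%:E)%E.
    have [M0 M1 M2 _] := normal_moments s0.
    have i k (q : R) (k6 : (k <= 6)%N) :=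
      integrableZlR measurableT q (integrable_normal_moment s0 k6).
    have i0 := i 0%N (c ^+ 2) isT; have i1 := i 1%N (2 * c) isT.
    have i2 := integrable_normal_moment s0 (isT : 2 <= 6)%N.
    have i01 := integrableDR measurableT i1 i0.
    transitivity (\int[mu]_x (x ^+ 2 * normal_pdf 0 s x + (2 * c * (x ^+ 1 * normal_pdf 0 s x) +
        c ^+ 2 * (x ^+ 0 * normal_pdf 0 s x)))%:E)%E.
      by apply: eq_integral => x _; congr (_%:E); ring.
    rewrite EFin_Rintegral; last exact: (integrableDR measurableT i2 i01).
    rewrite RintegralD// RintegralD// RintegralZl//; last exact: (integrable_normal_moment s0 (isT : 1 <= 6)%N).
    rewrite RintegralZl//; last exact: (integrable_normal_moment s0 (isT : 0 <= 6)%N).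
    by rewrite M0 M1 M2; congr (_%:E); ring.
  exists m, (s ^+ 2); split.
  - exact: sqr_ge0.
  - by rewrite (law (fun x => x ^+ 2) (mpow 2)) ?mom// => x; exact: sqr_ge0.
  - rewrite (law (fun x => (x + 1) ^+ 2) (mpow1 2)); last by move=> x; exact: sqr_ge0.
    by under eq_integral do rewrite -addrA; rewrite mom.
  - move=> m0; rewrite (law (fun x => x ^+ 4) (mpow 4)); last first.
      by move=> x; rewrite (exprM x 2 2) sqr_ge0.
    rewrite m0; under eq_integral do rewrite addr0.
    rewrite EFin_Rintegral; last exact: integrable_normal_moment.
    by have [_ _ _ ->] := normal_moments s0; rewrite -exprM.
have law (g : R -> R) : measurable_fun setT g -> (forall x, 0 <= g x) ->
    (\int[P]_w (g (X w))%:E = (g m)%:E)%E.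
  move=> mg g0; rewrite push//.
  transitivity (\int[dirac (m : measurableTypeR R)]_x (g x)%:E)%E.
    by apply: (@eq_measure_integral _ (measurableTypeR R)) => A mA _; exact: gm mA.
  rewrite integral_dirac ?diracT ?mul1e//.
  exact/measurable_EFinP.
exists m, 0; split => //.
- by rewrite (law _ (mpow 2)) ?addr0// => x; exact: sqr_ge0.
- by rewrite (law (fun x => (x + 1) ^+ 2) (mpow1 2)) ?addr0// => x; exact: sqr_ge0.
- move=> m0; rewrite (law (fun x => x ^+ 4) (mpow 4)); last first.
    by move=> x; rewrite (exprM x 2 2) sqr_ge0.
  by rewrite m0 !expr0n /= mulr0.
Qed.

Lemma ge0_integrable X : measurable_fun setT X -> (forall w, 0 <= X w) ->
  (\int[P]_w (X w)%:E < +oo)%E -> P.-integrable setT (EFin \o X).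
Proof.
move=> mX X0 fX; apply/integrableP; split; first exact/measurable_EFinP.
by under eq_integral do rewrite /= ger0_norm//.
Qed.

Definition centered_gaussian X := [/\ measurable_fun setT X,
  gaussian_law (pushforward P X) & \int[P]_w X w = 0].

Lemma centered_gaussian_moments X : centered_gaussian X ->
  [/\ P.-integrable setT (EFin \o (fun w => X w ^+ 2)),
      P.-integrable setT (EFin \o (fun w => X w ^+ 4)) &
      \int[P]_w X w ^+ 4 = 3 * (\int[P]_w X w ^+ 2) ^+ 2].
Proof.
move=> [mX gX X0]; have [m [v [v0 h2 h1 h4]]] := gaussian_law_integral mX gX.
have i2 : P.-integrable setT (EFin \o (fun w => X w ^+ 2)).
  apply: ge0_integrable; [exact: measurable_funX|by move=> w; exact: sqr_ge0|].
  by rewrite h2 ltry.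
have i1 : P.-integrable setT (EFin \o (fun w => (X w + 1) ^+ 2)).
  apply: ge0_integrable; [|by move=> w; exact: sqr_ge0|].
    by apply: measurable_funX; exact: measurable_funD.
  by rewrite h1 ltry.
have ic : P.-integrable setT (EFin \o (fun=> 1 : R)) by exact: finite_measure_integrable_cst.
(* X is integrable because |X| <= X^2 + 1; comparing the value for (X + 1)^2 with its expansion then
   identifies m with the expectation of X. *)
have m0 : m = 0.
  have iX : P.-integrable setT (EFin \o X).
    apply: (le_integrableR measurableT (g := fun w => X w ^+ 2 + 1)) => //.
      move=> w _; have := real_normK (num_real (X w)) => <-.
      have := normr_ge0 (X w); move: `|X w| => a; have := sqr_ge0 (a - 1); nra.
    exact: integrableDR.
  have : \int[P]_w ((X w + 1) ^+ 2) = (m + 1) ^+ 2 + v by rewrite /Rintegral h1.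
  have -> : (fun w => (X w + 1) ^+ 2) = (fun w => X w ^+ 2 + (2 * X w + 1)).
    by apply/funext => w; ring.
  have iX2 := integrableZlR measurableT 2 iX.
  rewrite RintegralD//; last exact: integrableDR.
  rewrite RintegralD// RintegralZl// X0 mulr0 add0r.
  rewrite /Rintegral h2 integral_cst//= mul1e probability_setT /=; lra.
have {}h4 := h4 m0; split => //.
  apply: ge0_integrable; [exact: measurable_funX| |by rewrite h4 ltry].
  by move=> w; rewrite (exprM (X w) 2 2) sqr_ge0.
by rewrite /Rintegral h4 h2 m0 expr0n add0r.
Qed.

(* Polarization of E X^4 = 3 (E X^2)^2. *)
Lemma gaussian_square_product X Y :
  (forall a b, centered_gaussian (fun w => a * X w + b * Y w)) ->
  [/\ P.-integrable setT (EFin \o (fun w => X w * Y w)),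
      P.-integrable setT (EFin \o (fun w => X w ^+ 2 * Y w ^+ 2)) &
      \int[P]_w (X w ^+ 2 * Y w ^+ 2) =
      (\int[P]_w X w ^+ 2) * (\int[P]_w Y w ^+ 2) + 2 * (\int[P]_w (X w * Y w)) ^+ 2].
Proof.
move=> g.
have gX : centered_gaussian X.
  by have := g 1 0; congr centered_gaussian; apply/funext => w; ring.
have gY : centered_gaussian Y.
  by have := g 0 1; congr centered_gaussian; apply/funext => w; ring.
have [mX _ _] := gX; have [mY _ _] := gY.
have [iX2 iX4 eX] := centered_gaussian_moments gX.
have [iY2 iY4 eY] := centered_gaussian_moments gY.
have [iA2 iA4 eA] := centered_gaussian_moments (g 1 1).
have [iB2 iB4 eB] := centered_gaussian_moments (g 1 (-1)).
have iXY : P.-integrable setT (EFin \o (fun w => X w * Y w)).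
  apply: (le_integrableR measurableT (g := fun w => X w ^+ 2 + Y w ^+ 2)).
  - exact: measurable_funM.
  - move=> w _; rewrite normrM -(real_normK (num_real (X w))) -(real_normK (num_real (Y w))).
    have := sqr_ge0 (`|X w| - `|Y w|); nra.
  - exact: integrableDR.
have iXY2 : P.-integrable setT (EFin \o (fun w => X w ^+ 2 * Y w ^+ 2)).
  apply: (le_integrableR measurableT (g := fun w => X w ^+ 4 + Y w ^+ 4)).
  - by apply: measurable_funM; exact: measurable_funX.
  - move=> w _; rewrite ger0_norm; last exact: (mulr_ge0 (sqr_ge0 _) (sqr_ge0 _)).
    have e4 (x : R) : x ^+ 4 = x ^+ 2 * x ^+ 2 by ring.
    rewrite !e4.
    have := sqr_ge0 (X w ^+ 2 - Y w ^+ 2).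
    have := sqr_ge0 (X w); have := sqr_ge0 (Y w); nra.
  - exact: integrableDR.
split=> //.
have sq (e : R) : e ^+ 2 = 1 -> \int[P]_w (1 * X w + e * Y w) ^+ 2 =
    \int[P]_w X w ^+ 2 + \int[P]_w Y w ^+ 2 + 2 * e * \int[P]_w (X w * Y w).
  move=> e1.
  have -> : (fun w => (1 * X w + e * Y w) ^+ 2) =
      (fun w => X w ^+ 2 + Y w ^+ 2 + 2 * e * (X w * Y w)).
    by apply/funext => w; rewrite sqrrD exprMn [X in _ + X = _]exprMn e1; ring.
  rewrite RintegralD//; last 2 first.
  - exact: (integrableDR measurableT iX2 iY2).
  - exact: (integrableZlR measurableT _ iXY).
  by rewrite RintegralD// RintegralZl.
have q4 : \int[P]_w (1 * X w + 1 * Y w) ^+ 4 + \int[P]_w (1 * X w + (-1) * Y w) ^+ 4 =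
    2 * \int[P]_w X w ^+ 4 + 2 * \int[P]_w Y w ^+ 4 + 12 * \int[P]_w (X w ^+ 2 * Y w ^+ 2).
  rewrite -RintegralD//.
  have -> : (fun w => (1 * X w + 1 * Y w) ^+ 4 + (1 * X w + (-1) * Y w) ^+ 4) =
      (fun w => 2 * X w ^+ 4 + 2 * Y w ^+ 4 + 12 * (X w ^+ 2 * Y w ^+ 2)).
    by apply/funext => w; ring.
  have j1 := integrableZlR measurableT 2 iX4; have j2 := integrableZlR measurableT 2 iY4.
  have j3 := integrableZlR measurableT 12 iXY2.
  rewrite RintegralD//; last exact: (integrableDR measurableT j1 j2).
  by rewrite RintegralD// !RintegralZl.
move: q4; rewrite eA eB eX eY !sq ?sqrrN ?expr1n//.
move: (\int[P]_w (X w ^+ 2 * Y w ^+ 2)) (\int[P]_w (X w * Y w)) => u c.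
move: (\int[P]_w (X w ^+ 2)) (\int[P]_w (Y w ^+ 2)) => a b; nra.
Qed.

End gaussian_variables.

(** * Law of large numbers for band averages *)

Section measurable_paths.
Context {R : realType} {disp : measure_display} {Omega : measurableType disp}.

(** Rounding k down to the grid of step 1 / (n + 1) gives functions that are measurable on countably
    many measurable rectangles; continuity in k makes them converge pointwise to X. *)
Lemma measurable_caratheodory (X : R -> Omega -> R) :
  (forall k, measurable_fun setT (X k)) -> (forall w, continuous (X^~ w)) ->
  measurable_fun setT (fun p : measurableTypeR R * Omega => X p.1 p.2).
Proof.
move=> mX cX.
pose grid n (k : R) : R := (Num.floor (n.+1%:R * k))%:~R / n.+1%:R.
apply: (@measurable_fun_cvg _ _ _ _
    (fun n (p : measurableTypeR R * Omega) => X (grid n p.1) p.2)).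
  move=> n _ B mB; rewrite setTI.
  rewrite (_ : _ @^-1` B = \bigcup_(z : int)
     ([set k : measurableTypeR R | Num.floor (n.+1%:R * k) = z] `*`
      (X (z%:~R / n.+1%:R) @^-1` B))); last first.
    apply/seteqP; split => [[k w] /= Bk|[k w] [z _ [/= <-]]//].
    by exists (Num.floor (n.+1%:R * k)).
  apply: countable_bigcupT_measurable; first exact: countableP.
  move=> z; apply: measurableX; last first.
    by rewrite -[X in measurable X]setTI; exact: mX.
  rewrite (_ : [set _ | _] = `[z%:~R / n.+1%:R, (z + 1)%:~R / n.+1%:R[%classic).
    exact: measurable_itv.
  apply/seteqP; split => k /=; rewrite in_itv /= ler_pdivrMr// ltr_pdivlMr// (mulrC k).
    by move=> <-; rewrite floor_le_tmp floorD1_gt.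
  by move=> /andP[h1 h2]; apply: floor_def; rewrite h1.
move=> [k w] _ /=.
have gk : grid n k @[n --> \oo] --> k.
  have h : k - harmonic n @[n --> \oo] --> k.
    by rewrite -[X in _ --> X]subr0; apply: cvgB; [exact: cvg_cst|exact: cvg_harmonic].
  apply: (@squeeze_cvgr _ _ _ _ (fun n => k - harmonic n) (fun=> k)) => //; last exact: cvg_cst.
  apply: nearW => n; rewrite /grid /harmonic /=.
  rewrite ler_pdivrMr// ler_pdivlMr// mulrBl mulVf ?pnatr_eq0// (mulrC k).
  by rewrite floor_le_tmp andbT lerBlDr -[1]/(1%:~R) -intrD ltW// floorD1_gt.
exact: (cvg_comp _ _ gk (cX w k)).
Qed.

End measurable_paths.

Section summable.
Context {R : realType} {disp : measure_display} {Omega : measurableType disp}.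
Variable P : probability Omega R.

(** The random series of the squares has finite expectation, hence is almost surely finite, and its
    terms tend to 0. *)
Lemma ae_cvg0_summable (Y : nat -> Omega -> R) (c : nat -> R) :
  (forall n, measurable_fun setT (Y n)) ->
  (forall n, (\int[P]_w (Y n w ^+ 2)%:E <= (c n)%:E)%E) ->
  (\sum_(0 <= n <oo) (c n)%:E < +oo)%E ->
  {ae P, forall w, Y n w @[n --> \oo] --> (0 : R)}.
Proof.
move=> mY Yc cfin.
pose S w := (\sum_(0 <= n <oo) (Y n w ^+ 2)%:E)%E.
have Y0 n w : (0 <= (Y n w ^+ 2)%:E)%E by rewrite lee_fin sqr_ge0.
have mYE n : measurable_fun setT (fun w => (Y n w ^+ 2)%:E).
  by apply/measurable_EFinP; exact: measurable_funX.
have iS : P.-integrable setT S.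
  apply/integrableP; split.
    exact: ge0_emeasurable_sum.
  under eq_integral do rewrite gee0_abs ?nneseries_ge0//.
  rewrite integral_nneseries//; apply: le_lt_trans cfin.
  by apply: lee_nneseries => n *; [exact: integral_ge0|exact: Yc].
apply: filterS (integrable_ae measurableT iS) => w /(_ I).
rewrite ge0_fin_numE ?nneseries_ge0// => /nneseries_tail_cvg => /(_ (fun n _ => Y0 n w)) tail.
have sq0 : Y n w ^+ 2 @[n --> \oo] --> (0 : R).
  suff h : (Y n w ^+ 2)%:E @[n --> \oo] --> (0 : R)%:E by exact: (fine_cvg h).
  apply: squeeze_cvge tail; last exact: cvg_cst.
  apply: nearW => n; rewrite Y0 /=.
  have := @nneseries_lim_ge R (fun k => (Y k w ^+ 2)%:E) xpredT n n.+1 (fun k _ _ => Y0 k w).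
  by rewrite big_nat1.
have : Num.sqrt (Y n w ^+ 2) @[n --> \oo] --> Num.sqrt (0 : R).
  exact: (cvg_comp _ _ sq0 (@sqrt_continuous R 0)).
rewrite sqrtr0; under eq_fun do rewrite sqrtr_sqr.
exact: norm_cvg0.
Qed.

End summable.

Lemma Rintegral_probability_cst {R : realType} {d : measure_display}
    {T : measurableType d} (P : probability T R) (c : R) : \int[P]_w c = c.
Proof. by rewrite /Rintegral integral_cst//= probability_setT mule1. Qed.

Lemma Fubini_dominated {R : realType} {d1 d2 : measure_display} {T1 : measurableType d1}
    {T2 : measurableType d2} (m1 : {sigma_finite_measure set T1 -> \bar R})
    (m2 : {sigma_finite_measure set T2 -> \bar R}) (F : T1 * T2 -> R) (B : T1 -> R) :
  measurable_fun setT F -> m1.-integrable setT (EFin \o B) ->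
  (forall z, \int[m2]_w `|F (z, w)|%:E <= (B z)%:E)%E ->
  measurable_fun setT (fun z => \int[m2]_w (F (z, w))%:E)%E /\
  (\int[m2]_w \int[m1]_z (F (z, w))%:E = \int[m1]_z \int[m2]_w (F (z, w))%:E)%E.
Proof.
move=> mF iB FB.
suff iF : (m1 \x m2)%E.-integrable setT (EFin \o F).
  by split; [exact: (measurable_fubini_F iF)|rewrite -(Fubini iF)].
have mF' : measurable_fun setT (EFin \o F) by exact/measurable_EFinP.
apply/integrable12ltyP => //.
apply: (@le_lt_trans _ _ (\int[m1]_z (B z)%:E)%E); last by rewrite EFin_Rintegral// ltry.
have mB : measurable_fun setT (fun z => (B z)%:E) := measurable_int _ iB.
apply: ge0_le_integral => //.
- by move=> z _; exact: integral_ge0.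
- have := @measurable_fun_fubini_tonelli_F _ _ _ _ _ m2 (fun p => `|(F p)%:E|%E).
  by apply => //; exact: measurableT_comp.
- by move=> z _; exact: FB.
Qed.

(* The library makes m1 \x m2 sigma-finite only for finite measures. *)
Section product_measure.
Context {R : realType} {d1 d2 : measure_display}.
Context {T1 : measurableType d1} {T2 : measurableType d2}.
Variables (m1 : {sigma_finite_measure set T1 -> \bar R}).
Variables (m2 : {sigma_finite_measure set T2 -> \bar R}).

Definition product_measure := (m1 \x m2)%E.

HB.instance Definition _ := Measure.on product_measure.

Let product_measure_sigma_finite : sigma_finite setT product_measure.
Proof.
have /sigma_finiteP[F [TF ndF Foo]] := sigma_finiteT m1.
have /sigma_finiteP[G [TG ndG Goo]] := sigma_finiteT m2.
exists (fun n => F n `*` G n) => [|n].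
  apply/esym/seteqP; split=> // -[x y] _.
  have [i _ Fx] : (\bigcup_i F i) x by rewrite -TF.
  have [j _ Gy] : (\bigcup_j G j) y by rewrite -TG.
  exists (maxn i j) => //; split.
    by move: x Fx; exact/subsetPset/ndF/leq_maxl.
  by move: y Gy; exact/subsetPset/ndG/leq_maxr.
have [mF lF] := Foo n; have [mG lG] := Goo n; split; first exact: measurableX.
by rewrite /product_measure product_measure1E// lte_mul_pinfty// ge0_fin_numE.
Qed.

HB.instance Definition _ := Measure_isSigmaFinite.Build _ _ _ product_measure
  product_measure_sigma_finite.

End product_measure.

Section squared_integral.
Context {R : realType} {d1 d2 : measure_display}.
Context {T : measurableType d1} {Omega : measurableType d2}.
Variables (m : {sigma_finite_measure set T -> \bar R}) (P : probability Omega R).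
Variables (W : T * Omega -> R) (B : T * T -> R).
Hypothesis mW : measurable_fun setT W.
Hypothesis iW : forall w, m.-integrable setT (EFin \o (fun k => W (k, w))).
Hypothesis iB : (m \x m)%E.-integrable setT (EFin \o B).
Hypothesis WB : forall k l, (\int[P]_w `|W (k, w) * W (l, w)|%:E <= (B (k, l))%:E)%E.

Let F (q : (T * T) * Omega) := W (q.1.1, q.2) * W (q.1.2, q.2).

Let mF : measurable_fun setT F.
Proof.
apply: measurable_funM.
  apply: (measurableT_comp mW); apply: measurable_fun_pair; last exact: measurable_snd.
  exact: measurableT_comp measurable_fst measurable_fst.
apply: (measurableT_comp mW); apply: measurable_fun_pair; last exact: measurable_snd.
exact: measurableT_comp measurable_snd measurable_fst.
Qed.

(** The square is a double integral, which Fubini exchanges with the expectation. The products W (k,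
    w) W (l, w) have no sign, so the majorant B has to bound the expectation of their modulus. *)
Lemma integral_squared_Rintegral :
  measurable_fun setT (fun z : T * T => \int[P]_w (W (z.1, w) * W (z.2, w))%:E)%E /\
  (\int[P]_w ((\int[m]_k W (k, w)) ^+ 2)%:E =
   \int[(m \x m)]_z \int[P]_w (W (z.1, w) * W (z.2, w))%:E)%E.
Proof.
have FB z : (\int[P]_w `|F (z, w)|%:E <= (B z)%:E)%E by case: z => k l; exact: WB.
have [mPF e] := @Fubini_dominated _ _ _ _ _ (product_measure m m) P F B mF iB FB.
split; first exact: mPF.
rewrite -[RHS]e.
apply: eq_integral => w _.
have iN := integrable_abse (iW w).
have f2 : measurable_fun setT (fun z : T * T => W (z.1, w) * W (z.2, w)).
  have h := measurable_int _ (iW w); have {}h : measurable_fun setT (fun k => W (k, w)).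
    by apply/measurable_EFinP.
  apply: measurable_funM; first exact: measurableT_comp h measurable_fst.
  exact: measurableT_comp h measurable_snd.
have le2 k l : `|W (k, w) * W (l, w)| <= `|W (k, w)| * `|W (l, w)| by rewrite normrM.
rewrite EFin_Rintegral; last exact: (integrable_prod_dominated f2 le2 iN iN).
rewrite -(Rintegral_prod12 f2 le2 iN iN) /=; congr (_%:E).
under [RHS]eq_Rintegral do rewrite RintegralZl//.
by rewrite RintegralZr// expr2.
Qed.

End squared_integral.

Lemma mul_le_mean_sqr {R : realFieldType} (x y : R) : x * y <= 2^-1 * (x ^+ 2 + y ^+ 2).
Proof. have := sqr_ge0 (x - y); nra. Qed.

(** * Second moment of the fluctuation of a band integral *)

Section band_second_moment.
Context {R : realType} {disp : measure_display} {Omega : measurableType disp}.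
Variable P : probability Omega R.
Local Notation mu := (@lebesgue_measure R).
Variables (X : R -> Omega -> R) (C : R).
Hypothesis cX : forall w, continuous (X^~ w).
Hypothesis gX : forall k l a b, centered_gaussian P (fun w => a * X k w + b * X l w).
Hypothesis covX : forall k l, 1 <= k -> 1 <= l ->
  `|\int[P]_w (X k w * X l w)| <= C / (1 + `|k - l|).

Definition variance_at k := \int[P]_w (X k w ^+ 2).
Local Notation v := variance_at.

Let mX k : measurable_fun setT (X k).
Proof.
have [+ _ _] := gX k k 1 0.
by apply: eq_measurable_fun => w _; ring.
Qed.

Let gX1 k : centered_gaussian P (X k).
Proof.
by have := gX k k 1 0; congr centered_gaussian; apply/funext => w; ring.
Qed.

Let mXX : measurable_fun setT (fun p : measurableTypeR R * Omega => X p.1 p.2).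
Proof. exact: measurable_caratheodory. Qed.

Lemma measurable_variance_at : measurable_fun setT (v : measurableTypeR R -> R).
Proof.
have m2 : measurable_fun setT (fun p : measurableTypeR R * Omega => (X p.1 p.2 ^+ 2)%:E).
  by apply/measurable_EFinP; exact: measurable_funX.
have := measurable_fun_fubini_tonelli_F (m2 := P) _ m2.
rewrite /fubini_F /= => h; rewrite /variance_at /Rintegral.
have h' := measurableT_comp (fine_measurable _) (h (fun p => sqr_ge0 _)).
exact: h'.
Qed.

Lemma variance_at_ge0 k : 0 <= v k.
Proof. by apply: Rintegral_ge0 => w _; exact: sqr_ge0. Qed.

Lemma variance_at_le k : 1 <= k -> v k <= C.
Proof.
move=> k1; have := covX k1 k1; rewrite subrr normr0 addr0 divr1; apply: le_trans.
by rewrite (le_trans _ (ler_norm _)).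
Qed.

Variables (a b : R).
Hypothesis a1 : 1 <= a.

Let J : R -> R := \1_(`[a, b]).
Let V k w := X k w ^+ 2 - v k.
Let W (p : measurableTypeR R * Omega) := J p.1 * V p.1 p.2.

Let mJ : measurable_fun setT (J : measurableTypeR R -> R).
Proof. exact: measurable_indic. Qed.

Let J0 k : 0 <= J k. Proof. by rewrite /J indicE. Qed.

Let iJ : mu.-integrable setT (EFin \o J).
Proof.
apply/integrableP; split; first exact/measurable_EFinP.
under eq_integral do rewrite /= ger0_norm//.
rewrite (_ : integral _ _ _ = lebesgue_measure `[a, b]).
  by rewrite lebesgue_measure_itv /=; case: ifP => _; rewrite ltry.
by rewrite integral_indic// setIT.
Qed.

Let JE k : J k != 0 -> 1 <= k.
Proof.
rewrite /J indicE; case: (boolP (k \in _)) => [|_]; last by rewrite eqxx.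
by rewrite inE /= in_itv /= => /andP[/(le_trans a1)].
Qed.

Let mW : measurable_fun setT W.
Proof.
apply: measurable_funM; first exact: measurableT_comp mJ measurable_fst.
apply: measurable_funB; first exact: measurable_funX.
exact: measurableT_comp measurable_variance_at measurable_fst.
Qed.

Let covV k l : \int[P]_w (V k w * V l w) = 2 * (\int[P]_w (X k w * X l w)) ^+ 2 /\
  P.-integrable setT (EFin \o (fun w => V k w * V l w)).
Proof.
have [iXY iXY2 e] := gaussian_square_product (gX k l).
have [ik _ _] := centered_gaussian_moments (gX1 k).
have [il _ _] := centered_gaussian_moments (gX1 l).
have -> : (fun w => V k w * V l w) = (fun w => X k w ^+ 2 * X l w ^+ 2 +
    ((- v l) * X k w ^+ 2 + ((- v k) * X l w ^+ 2 + v k * v l))).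
  by apply/funext => w; rewrite /V; ring.
have ic : P.-integrable setT (EFin \o (fun=> v k * v l)) by exact: finite_measure_integrable_cst.
have j1 := integrableZlR measurableT (- v k) il.
have j2 := integrableZlR measurableT (- v l) ik.
have j3 := integrableDR measurableT j1 ic; have j4 := integrableDR measurableT j2 j3.
split; last exact: integrableDR.
rewrite (RintegralD measurableT iXY2 j4) e (RintegralD measurableT j2 j3).
rewrite (RintegralD measurableT j1 ic) !RintegralZl// -!/(v _).
  by rewrite Rintegral_probability_cst; ring.
exact: finite_measure_integrable_cst.
Qed.

Let iJM (f : R -> R) : mu.-integrable `[a, b] (EFin \o f) ->
  mu.-integrable setT (EFin \o (fun k => J k * f k)).
Proof.
move/integrable_mkcond => /(_ (measurable_itv _)); apply: eq_integrable => // k _.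
by rewrite patchE /= /J indicE; case: ifP => _; rewrite ?mul1r ?mul0r.
Qed.

Let iv : mu.-integrable setT (EFin \o (fun k => J k * v k)).
Proof.
have iC := integrableZlR measurableT C iJ.
apply: (@le_integrableR _ _ (measurableTypeR R) mu setT measurableT _ (fun k => C * J k)) => //.
  by apply: measurable_funM => //; exact: measurable_variance_at.
move=> k _; rewrite ger0_norm ?mulr_ge0 ?variance_at_ge0// mulrC.
have [->|Jk] := eqVneq (J k) 0; first by rewrite !mulr0.
by rewrite ler_wpM2r// variance_at_le// JE.
Qed.

Let iX2 w : mu.-integrable setT (EFin \o (fun k => J k * X k w ^+ 2)).
Proof.
apply: iJM; apply: continuous_Rintegrable_itv => k.
apply: (@continuous_comp _ _ _ (X^~ w) (fun x : R => x ^+ 2)); first exact: cX.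
exact: exprn_continuous.
Qed.

Let WE w : (fun k => W (k, w)) = (fun k => J k * X k w ^+ 2 - J k * v k).
Proof. by apply/funext => k; rewrite /W /V mulrBr. Qed.

Let iW w : mu.-integrable setT (EFin \o (fun k => W (k, w))).
Proof. by rewrite WE; exact: (integrableBR measurableT (iX2 w) iv). Qed.

Let S w := \int[mu]_k W (k, w).

Let SE w : S w = \int[mu]_k (J k * X k w ^+ 2) - \int[mu]_k (J k * v k).
Proof. by rewrite /S WE (RintegralB measurableT (iX2 w) iv). Qed.

Let mS2 : measurable_fun setT (fun w => \int[mu]_k (J k * X k w ^+ 2)).
Proof.
have m2 : measurable_fun setT
    (fun p : measurableTypeR R * Omega => (J p.1 * X p.1 p.2 ^+ 2)%:E).
  apply/measurable_EFinP; apply: measurable_funM; last exact: measurable_funX.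
  exact: measurableT_comp mJ measurable_fst.
have := measurable_fun_fubini_tonelli_G (m1 := mu) _ m2.
rewrite /fubini_G /= => h; rewrite /Rintegral.
have h' := measurableT_comp (fine_measurable _) (h (fun p => mulr_ge0 (J0 _) (sqr_ge0 _))).
exact: h'.
Qed.

(** Second-order decay comes from squaring the correlation: 1 / (1 + |k - l|)^2 is at most
    [cauchy (l - k)], which is integrable over the line. *)
Let cov_le k l : J k * J l * `|\int[P]_w (V k w * V l w)| <=
  2 * C ^+ 2 * (J k * (J l * cauchy (l - k))).
Proof.
have [->|Jk] := eqVneq (J k) 0; first by rewrite !(mul0r, mulr0).
have [->|Jl] := eqVneq (J l) 0; first by rewrite !(mul0r, mulr0).
rewrite [leRHS](_ : _ = J k * J l * (2 * (C ^+ 2 * cauchy (l - k)))); last by ring.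
apply: ler_wpM2l; first exact: mulr_ge0.
rewrite (covV k l).1 ger0_norm; last by rewrite mulr_ge0// sqr_ge0.
apply: ler_wpM2l => //.
have d0 : 0 < 1 + `|k - l| by rewrite ltr_wpDr.
have := covX (JE Jk) (JE Jl) => h.
rewrite -(real_normK (num_real (\int[P]_w _))).
apply: (@le_trans _ _ ((C / (1 + `|k - l|)) ^+ 2)).
  by rewrite ler_sqr ?nnegrE// (le_trans _ h).
rewrite expr_div_n ler_wpM2l ?sqr_ge0// /cauchy lef_pV2 ?posrE ?exprn_gt0 ?ltr_pwDl ?sqr_ge0//.
rewrite -(real_normK (num_real (l - k))) (distrC l) sqrrD expr1n.
by rewrite lerD2r lerDl mulr2n addr_ge0 ?mulr_ge0.
Qed.

Let iJJ : (mu \x mu)%E.-integrable setT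
  (EFin \o (fun z : measurableTypeR R * measurableTypeR R => J z.1 * J z.2)).
Proof.
apply: (@integrable_prod_dominated _ _ _ (measurableTypeR R) (measurableTypeR R) mu mu _ J J) => //.
  apply: measurable_funM; first exact: measurableT_comp mJ measurable_fst.
  exact: measurableT_comp mJ measurable_snd.
by move=> k l; rewrite ger0_norm// mulr_ge0.
Qed.

(** The Gaussian product formula is lost under absolute values, so |V k V l| is bounded by the mean
    of the two squares. The bound has no decay in k - l, but it serves only to justify Fubini on a
    bounded band. *)
Let norm_cov_le k l : (\int[P]_w `|J k * J l * (V k w * V l w)|%:E <=
  (2 * C ^+ 2 * (J k * J l))%:E)%E.
Proof.
have [ek ik] := covV k k; have [el il] := covV l l.
have j1 := integrableZlR measurableT (J k * J l / 2) ik.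
have j2 := integrableZlR measurableT (J k * J l / 2) il.
have j3 := integrableDR measurableT j1 j2.
apply: (@le_trans _ _ (\int[P]_w (J k * J l / 2 * (V k w * V k w) +
    J k * J l / 2 * (V l w * V l w))%:E)%E).
  apply: ge0_le_integral => //.
  - apply/measurable_EFinP; apply: measurableT_comp => //; apply: measurable_funM => //.
    by have [_ h] := covV k l; apply/measurable_EFinP; exact: measurable_int h.
  - by apply: measurable_int j3.
  - move=> w _; rewrite lee_fin normrM ger0_norm ?mulr_ge0// -mulrDr -mulrA ler_wpM2l ?mulr_ge0//.
    rewrite normrM -[V k w * V k w](real_normK (num_real (V k w))).
    rewrite -[V l w * V l w](real_normK (num_real (V l w))).
    exact: mul_le_mean_sqr.
rewrite EFin_Rintegral// lee_fin RintegralD// !RintegralZl//.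
have c2 k' : J k' != 0 -> \int[P]_w (V k' w * V k' w) <= 2 * C ^+ 2.
  move=> Jk; rewrite (covV k' k').1 ler_wpM2l//.
  rewrite -[\int[P]_w _]/(v k') ler_sqr ?nnegrE ?variance_at_ge0 ?variance_at_le ?JE//.
  by rewrite (le_trans (variance_at_ge0 k') (variance_at_le (JE Jk))).
have z0 x y : 0 / 2 * x + 0 / 2 * y <= 2 * C ^+ 2 * 0 by rewrite !mul0r mulr0 addr0.
have [->|Jk] := eqVneq (J k) 0; first by rewrite mul0r; exact: z0.
have [->|Jl] := eqVneq (J l) 0; first by rewrite mulr0; exact: z0.
have := c2 _ Jk; have := c2 _ Jl; have : 0 <= J k * J l by rewrite mulr_ge0.
move: (\int[P]_w _) (\int[P]_w _) (J k * J l) => A B j j0 lB lA.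
rewrite [leLHS](_ : _ = j * ((A + B) / 2)); last by ring.
by rewrite [leRHS]mulrC ler_wpM2l// ler_pdivrMr// mulr_natr mulr2n lerD.
Qed.

Let normW_le k l : (\int[P]_w `|W (k, w) * W (l, w)|%:E <=
  (2 * C ^+ 2 * (J k * J l))%:E)%E.
Proof.
by apply: le_trans (norm_cov_le k l); under eq_integral do rewrite /W /= mulrACA.
Qed.

Lemma band_second_moment : a <= b ->
  measurable_fun setT (fun w => \int[mu]_(k in `[a, b]) X k w ^+ 2) /\
  (\int[P]_w (((\int[mu]_(k in `[a, b]) X k w ^+ 2) -
     \int[mu]_(k in `[a, b]) v k) ^+ 2)%:E <= (2 * C ^+ 2 * pi * (b - a))%:E)%E.
Proof.
move=> ab.
have JI f : \int[mu]_(k in `[a, b]) f k = \int[mu]_k (J k * f k).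
  rewrite Rintegral_mkcond; apply: eq_Rintegral => k _.
  by rewrite patchE /J indicE; case: ifP => _; rewrite ?mul1r ?mul0r.
split; first by under eq_fun do rewrite JI; exact: mS2.
under eq_integral do rewrite !JI -SE.
have [mEW ->] := @integral_squared_Rintegral R _ _ (measurableTypeR R) Omega mu P W
  (fun z => 2 * C ^+ 2 * (J z.1 * J z.2)) mW iW (integrableZlR measurableT _ iJJ) normW_le.
pose g (z : measurableTypeR R * measurableTypeR R) := (2 * C ^+ 2 * (J z.1 * (J z.2 * cauchy (z.2 - z.1))))%:E.
have K0 : 0 <= 2 * C ^+ 2 by rewrite mulr_ge0// sqr_ge0.
have g0 z : (0 <= g z)%E.
  rewrite lee_fin; apply: (mulr_ge0 K0); apply: (mulr_ge0 (J0 _)).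
  exact: (mulr_ge0 (J0 _) (ltW (cauchy_gt0 _))).
have mJ2 := measurableT_comp mJ (@measurable_snd _ _ (measurableTypeR R) (measurableTypeR R)).
have mJ1 := measurableT_comp mJ (@measurable_fst _ _ (measurableTypeR R) (measurableTypeR R)).
have mcau : measurable_fun setT (cauchy : measurableTypeR R -> R).
  exact: continuous_measurable_fun (@continuous_cauchy R).
have msub : measurable_fun setT
    (fun z : measurableTypeR R * measurableTypeR R => z.2 - z.1 : measurableTypeR R).
  by apply: measurable_funB; [exact: measurable_snd|exact: measurable_fst].
have mcau1 k : measurable_fun setT (fun l : measurableTypeR R => cauchy (1 * l - k)).
  exact: measurableT_comp mcau (measurable_affine 1 (- k)).
have J1 k : J k <= 1 by rewrite /J indicE; case: (_ \in _).
have mg : measurable_fun setT g.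
  apply/measurable_EFinP.
  apply: (measurable_funM (measurable_cst _)); apply: (measurable_funM mJ1).
  exact: (measurable_funM mJ2 (measurableT_comp mcau msub)).
have iV k l : P.-integrable setT (EFin \o (fun w => W (k, w) * W (l, w))).
  have := integrableZlR measurableT (J k * J l) (covV k l).2.
  by apply: eq_integrable => // w _; rewrite /W /= mulrACA.
have EW k l : (\int[P]_w (W (k, w) * W (l, w))%:E =
    (J k * J l * \int[P]_w (V k w * V l w))%:E)%E.
  rewrite EFin_Rintegral//; have := (covV k l).2 => icov; rewrite -RintegralZl//.
  by congr (_%:E); apply: eq_Rintegral => w _; rewrite /W /= mulrACA.
apply: (@le_trans _ _ (\int[(mu \x mu)%E]_z g z)%E).
  apply: ge0_le_integral => //.
  - move=> z _; rewrite EW lee_fin (mulr_ge0 (mulr_ge0 (J0 _) (J0 _)))// (covV _ _).1.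
    by rewrite mulr_ge0// sqr_ge0.
  - move=> z _; rewrite EW lee_fin; apply: le_trans (cov_le z.1 z.2).
    by rewrite (ler_wpM2l (mulr_ge0 (J0 _) (J0 _)))// ler_norm.
rewrite (fubini_tonelli1 _ mg g0) /fubini_F.
apply: (@le_trans _ _ (\int[mu]_k ((2 * C ^+ 2 * pi) * J k)%:E)%E).
  apply: ge0_le_integral => //.
  - by move=> k _; apply: integral_ge0.
  - have := measurable_fun_fubini_tonelli_F (m2 := mu) _ mg; exact.
  - by apply/measurable_EFinP; exact: measurable_funM.
  - move=> k _.
    (* Dropping the cutoff in l extends the integral of the Cauchy weight to the whole line, which
       gives the factor pi; the form 1 * l - k fits the affine change of variables. *)
    apply: (@le_trans _ _ (\int[mu]_l (2 * C ^+ 2 * J k * cauchy (1 * l - k))%:E)%E).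
      apply: ge0_le_integral => //.
      - by apply: measurableT_comp mg _; exact: measurable_fun_pair.
      - by apply/measurable_EFinP; apply: measurable_funM => //; exact: mcau1.
      - move=> l _; rewrite lee_fin mul1r /= -[leRHS]mulrA; apply: (ler_wpM2l K0).
        apply: (ler_wpM2l (J0 _)); rewrite -[leRHS]mul1r.
        by apply: (ler_wpM2r (ltW (cauchy_gt0 _))); exact: J1.
    rewrite (@ge0_integral_affine R 1 (- k) (fun x => (2 * C ^+ 2 * J k * cauchy x)%:E))//.
      rewrite invr1 mul1e; under eq_integral do rewrite EFinM.
      rewrite ge0_integralZl_EFin//.
      + by rewrite integral_cauchy -EFinM lee_fin mulrAC.
      + by move=> x _; rewrite lee_fin ltW// cauchy_gt0.
      + exact/measurable_EFinP.
      + exact: (mulr_ge0 K0 (J0 _)).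
      + by apply/measurable_EFinP; exact: measurable_funM.
      + move=> x; rewrite lee_fin; apply: mulr_ge0; last exact: ltW (cauchy_gt0 _).
        exact: (mulr_ge0 K0 (J0 _)).
rewrite EFin_Rintegral; last exact: (integrableZlR measurableT _ iJ).
rewrite RintegralZl// lee_fin; apply: ler_wpM2l; first by rewrite mulr_ge0// pi_ge0.
rewrite /Rintegral integral_indic//= setIT lebesgue_measure_itv /= lte_fin.
by case: ifP => _ //=; rewrite subr_ge0.
Qed.

End band_second_moment.

(** * Almost sure convergence of averages of squares *)

Section law_of_large_numbers.
Context {R : realType} {disp : measure_display} {Omega : measurableType disp}.
Variable P : probability Omega R.
Local Notation mu := (@lebesgue_measure R).
Variables (X : R -> Omega -> R) (C L : R).
Hypothesis cX : forall w, continuous (X^~ w).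
Hypothesis gX : forall k l a b, centered_gaussian P (fun w => a * X k w + b * X l w).
Hypothesis covX : forall k l, 1 <= k -> 1 <= l ->
  `|\int[P]_w (X k w * X l w)| <= C / (1 + `|k - l|).
Hypothesis varX : \int[P]_w (X k w ^+ 2) @[k --> +oo] --> L.
Local Notation v := (variance_at P X).

(* The shift by 3 ensures q (n + 1) <= 2 q n for every n. *)
Let q (n : nat) : R := n.+3%:R ^+ 2.

Let q_gt0 n : 0 < q n. Proof. by rewrite exprn_gt0. Qed.

Let q_ge1 n : 1 <= q n. Proof. by rewrite exprn_ege1// ler1n. Qed.

Let qS n : q n <= q n.+1 <= 2 * q n.
Proof.
rewrite /q; have -> : n.+4%:R = n.+3%:R + 1 :> R by rewrite -natr1.
have : 3 <= n.+3%:R :> R by rewrite ler_nat.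
by move: (n.+3%:R) => a a3; apply/andP; split; nra.
Qed.

Let q_ratio : q n.+1 / q n @[n --> \oo] --> (1 : R).
Proof.
have -> : (fun n => q n.+1 / q n) = (fun n => (1 + harmonic n.+2) ^+ 2).
  apply/funext => n; rewrite /q /harmonic /= -expr_div_n; congr (_ ^+ 2).
  by rewrite -[n.+4%:R]natr1 mulrDl mulfV ?pnatr_eq0// mul1r.
have h : harmonic n.+2 @[n --> \oo] --> (0 : R).
  by have := @cvg_harmonic R; rewrite -(cvg_shiftn 2); under eq_fun do rewrite addn2.
have h1 : 1 + harmonic n.+2 @[n --> \oo] --> (1 + 0 : R).
  by apply: cvgD; [exact: cvg_cst|].
rewrite addr0 in h1; rewrite -[X in _ --> X](expr1n R 2).
exact: (cvg_comp _ _ h1 (@exprn_continuous R 2 1)).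
Qed.

(** The summand is a telescoping majorant of K / q n, since 1 / (n + 3)^2 <= 1 / (n + 2) - 1 / (n +
    3). *)
Let q_summable (K : R) : 0 <= K ->
  (\sum_(0 <= n <oo) (K * (n.+2%:R^-1 - n.+3%:R^-1))%:E < +oo)%E.
Proof.
move=> K0.
have pos n : 0 <= K * (n.+2%:R^-1 - n.+3%:R^-1).
  by rewrite mulr_ge0// subr_ge0 lef_pV2 ?posrE// ler_nat.
apply: (@le_lt_trans _ _ (K * 2^-1)%:E); last by rewrite ltry.
apply: lime_le; first by apply: is_cvg_nneseries => n _ _; rewrite lee_fin.
apply: nearW => n; rewrite sumEFin lee_fin.
suff -> : \sum_(0 <= i < n) K * (i.+2%:R^-1 - i.+3%:R^-1) = K * (2^-1 - n.+2%:R^-1).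
  by rewrite ler_wpM2l// gerBl invr_ge0.
elim: n => [|n IH]; first by rewrite big_nil subrr mulr0.
by rewrite big_nat_recr//= IH -mulrDr addrA subrK.
Qed.

Let average_bound (a b e : R) : 1 <= a -> a <= b ->
  (forall k, a <= k -> `|L - v k| <= e) ->
  `|L * (b - a) - \int[mu]_(k in `[a, b]) v k| <= e * (b - a).
Proof.
move=> a1 ab ve.
have mab : mu `[a, b] = (b - a)%:E.
  rewrite lebesgue_measure_itv /= lte_fin; have [//|ba] := ltP a b.
  by have -> : b = a; [apply/le_anti; rewrite ab ba|rewrite subrr].
have ic c : mu.-integrable `[a, b] (EFin \o (fun=> c)).
  by apply: continuous_Rintegrable_itv; exact: cst_continuous.
have cst c : \int[mu]_(k in `[a, b]) c = c * (b - a).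
  rewrite /Rintegral integral_cst//.
  by rewrite [X in (_ * X)%E]mab.
have iv : mu.-integrable `[a, b] (EFin \o v).
  apply: (@le_integrableR _ _ (measurableTypeR R) mu _ _ _ (fun=> C)) => //.
    exact: measurable_funTS (measurable_variance_at cX gX).
  move=> k; rewrite /= in_itv /= => /andP[ak _].
  by rewrite ger0_norm ?variance_at_ge0// (variance_at_le covX)// (le_trans a1).
have b1 : \int[mu]_(k in `[a, b]) v k <= (L + e) * (b - a).
  rewrite -cst; apply: le_Rintegral => // k; rewrite /= in_itv /= => /andP[ak _].
  by have := ve k ak; rewrite ler_distlC => /andP[].
have b2 : (L - e) * (b - a) <= \int[mu]_(k in `[a, b]) v k.
  rewrite -cst; apply: le_Rintegral => // k; rewrite /= in_itv /= => /andP[ak _].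
  by have := ve k ak; rewrite ler_distlC => /andP[].
rewrite ler_norml; move: b1 b2; rewrite mulrDl mulrBl.
by move: (L * _) (e * _) (Rintegral _ _ _) => x y z b1 b2; apply/andP; split; lra.
Qed.

(** The intervals are left general because the law is used along two families, one inside and one
    around the bands [Q, 2 Q]. A length of at most 4 q n gives the normalised fluctuation a second
    moment of at most 8 C^2 pi / q n. *)
Let interval_average (a b : nat -> R) : (forall n, q n <= a n) -> (forall n, a n <= b n) ->
  (forall n, b n - a n <= 4 * q n) -> (b n - a n) / q n @[n --> \oo] --> (1 : R) ->
  {ae P, forall w, (q n)^-1 * \int[mu]_(k in `[a n, b n]) X k w ^+ 2 @[n --> \oo] --> L}.
Proof.
move=> qa ab baq ba1.
have a1 n : 1 <= a n := le_trans (q_ge1 n) (qa n).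
have m2 n := band_second_moment cX gX covX (a1 n) (ab n).
pose Y n w := (q n)^-1 * (\int[mu]_(k in `[a n, b n]) X k w ^+ 2 -
  \int[mu]_(k in `[a n, b n]) v k).
pose K := 8 * C ^+ 2 * pi.
have K0 : 0 <= K by rewrite mulr_ge0 ?pi_ge0// mulr_ge0// sqr_ge0.
have mY n : measurable_fun setT (Y n).
  apply: measurable_funM => //; apply: measurable_funB => //; exact: (m2 n).1.
have Y2 n : (\int[P]_w (Y n w ^+ 2)%:E <= (K * (n.+2%:R^-1 - n.+3%:R^-1))%:E)%E.
  rewrite /Y; under eq_integral do rewrite exprMn EFinM.
  rewrite ge0_integralZl_EFin ?sqr_ge0//; last 2 first.
  - by move=> w _; rewrite lee_fin sqr_ge0.
  - apply/measurable_EFinP; apply: measurable_funX; apply: measurable_funB => //.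
    exact: (m2 n).1.
  have sq0 : (0 <= ((q n)^-1 ^+ 2)%:E)%E by rewrite lee_fin sqr_ge0.
  apply: le_trans (lee_wpmul2l sq0 (m2 n).2) _; rewrite -EFinM lee_fin.
  apply: (@le_trans _ _ ((q n)^-1 ^+ 2 * (2 * C ^+ 2 * pi * (4 * q n)))).
    rewrite ler_wpM2l ?sqr_ge0//; apply: ler_wpM2l (baq n).
    by apply: mulr_ge0 (pi_ge0 R); rewrite mulr_ge0// sqr_ge0.
  rewrite (_ : _ ^+ 2 * _ = K * (q n)^-1); last first.
    by rewrite /K; field; rewrite gt_eqF.
  apply: (ler_wpM2l K0); rewrite /q.
  have -> : n.+3%:R = n.+2%:R + 1 :> R by rewrite natr1.
  have : 0 < n.+2%:R :> R by [].
  move: (n.+2%:R) => u u0.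
  have -> : u^-1 - (u + 1)^-1 = (u * (u + 1))^-1.
    by field; rewrite !gt_eqF// addr_gt0.
  rewrite lef_pV2 ?posrE ?exprn_gt0 ?mulr_gt0 ?addr_gt0//.
  by rewrite expr2 ler_wpM2r ?addr_ge0 ?ltW// ltrDl.
apply: filterS (ae_cvg0_summable mY Y2 (q_summable K0)) => w Yw.
have vL : (q n)^-1 * \int[mu]_(k in `[a n, b n]) v k @[n --> \oo] --> L.
  have L1 : `|L| * `|1 - (b n - a n) / q n| @[n --> \oo] --> (0 : R).
    rewrite -(mulr0 `|L|); apply: cvgM; first exact: cvg_cst.
    rewrite -(normr0 R) -(subrr 1); apply: cvg_norm.
    by apply: cvgB => //; exact: cvg_cst.
  apply/cvgrPdist_le => e e0.
  (* The normalised length is at most 4, so a deviation e / 8 of the variances contributes at most e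
     / 2; the other e / 2 covers the convergence of the normalised length. *)
  have e8 : 0 < e / 8 by rewrite divr_gt0.
  have e2 : 0 < e / 2 by rewrite divr_gt0.
  move/cvgrPdist_le : varX => /(_ _ e8)[A [_ HA]].
  move/cvgrPdist_le : L1 => /(_ _ e2) L1.
  have qA : \forall n \near \oo, A < q n.
    exists (Num.truncn `|A|).+1 => // n /= An.
    apply: le_lt_trans (ler_norm A) _; apply: (lt_le_trans (truncnS_gt _)).
    apply: (@le_trans _ _ n.+3%:R); first by rewrite ler_nat (leq_trans An)// ltnW// ltnW// ltnS.
    by rewrite /q expr2 ler_peMr// ler1n.
  apply: filterS2 qA L1 => n An; rewrite sub0r normrN ger0_norm ?mulr_ge0// => L1.
  have r4 : (b n - a n) / q n <= 4 by rewrite ler_pdivrMr.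
  have r0 : 0 <= (b n - a n) / q n by rewrite divr_ge0 ?subr_ge0// ltW.
  have vint := average_bound (a1 n) (ab n) (fun k ak => HA k (lt_le_trans An (le_trans (qa n) ak))).
  have -> : L - (q n)^-1 * \int[mu]_(k in `[a n, b n]) v k =
     L * (1 - (b n - a n) / q n) +
     (q n)^-1 * (L * (b n - a n) - \int[mu]_(k in `[a n, b n]) v k) by ring.
  apply: le_trans (ler_normD _ _) _; rewrite !normrM (ger0_norm (_ : 0 <= (q n)^-1)); last first.
    by rewrite invr_ge0 ltW.
  have h : (q n)^-1 * `|L * (b n - a n) - \int[mu]_(k in `[a n, b n]) v k| <=
      e / 8 * ((b n - a n) / q n).
    have iq0 : 0 <= (q n)^-1 by rewrite invr_ge0 ltW.
    by apply: le_trans (ler_wpM2l iq0 vint) _; rewrite mulrC mulrA.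
  have h' := ler_wpM2l (ltW e8) r4.
  have := lerD L1 (le_trans h h'); move/le_trans; apply.
  by rewrite le_eqVlt; apply/orP; left; apply/eqP; field.
have -> : (fun n => (q n)^-1 * \int[mu]_(k in `[a n, b n]) X k w ^+ 2) =
    (fun n => Y n w + (q n)^-1 * \int[mu]_(k in `[a n, b n]) v k).
  by apply/funext => n; rewrite /Y mulrBr subrK.
by rewrite -[X in _ --> X]add0r; exact: cvgD.
Qed.

Let Rintegral_itv_le w (a b c d : R) : c <= a -> b <= d ->
  \int[mu]_(k in `[a, b]) X k w ^+ 2 <= \int[mu]_(k in `[c, d]) X k w ^+ 2.
Proof.
move=> ca bd.
have cX2 : continuous (fun k => X k w ^+ 2).
  move=> k; apply: (@continuous_comp _ _ _ (X^~ w) (fun x : R => x ^+ 2)); first exact: cX.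
  exact: exprn_continuous.
have fin e f : (\int[mu]_(k in `[e, f]) (X k w ^+ 2)%:E)%E \is a fin_num.
  by apply: integrable_fin_num => //; exact: continuous_Rintegrable_itv.
rewrite /Rintegral; apply: fine_le => //.
apply: ge0_subset_integral => //.
- apply/measurable_EFinP; apply: measurable_funTS.
  exact: continuous_measurable_fun.
- by move=> x _; rewrite lee_fin sqr_ge0.
- by apply: subset_itv; rewrite bnd_simp.
Qed.

(** For q n <= Q <= q (n + 1) the band [Q, 2 Q] contains [q (n + 1), 2 q n] and lies in
    [q n, 2 q (n + 1)]; the integrand is nonnegative, so the averages are squeezed. *)
Lemma gaussian_band_lln :
  {ae P, forall w, Q^-1 * \int[mu]_(k in `[Q, 2 * Q]) X k w ^+ 2 @[Q --> +oo] --> L}.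
Proof.
have hi := @interval_average q (fun n => 2 * q n.+1).
have lo := @interval_average (fun n => q n.+1) (fun n => 2 * q n).
have qS1 n : q n <= q n.+1 by case/andP: (qS n).
have qS2 n : q n.+1 <= 2 * q n by case/andP: (qS n).
have q0 := q_gt0.
have r2 : 2 * (q n.+1 / q n) - 1 @[n --> \oo] --> (1 : R).
  have e : 2 * 1 - 1 = 1 :> R by ring.
  rewrite -[X in _ --> X]e.
  by apply: cvgB; [apply: cvgM => //; exact: cvg_cst|exact: cvg_cst].
have r1 : 2 - q n.+1 / q n @[n --> \oo] --> (1 : R).
  have e : 2 - 1 = 1 :> R by ring.
  rewrite -[X in _ --> X]e.
  by apply: cvgB => //; exact: cvg_cst.
have {}hi : {ae P, forall w, (q n)^-1 *
    \int[mu]_(k in `[q n, 2 * q n.+1]) X k w ^+ 2 @[n --> \oo] --> L}.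
  apply: hi => //.
  - by move=> n; apply: le_trans (qS1 n) _; have := q0 n.+1; lra.
  - by move=> n; have := qS2 n; have := q0 n; lra.
  - apply: cvg_trans r2; apply: near_eq_cvg; apply: nearW => n /=.
    by rewrite mulrBl divff ?mulrA// gt_eqF.
have {}lo : {ae P, forall w, (q n)^-1 *
    \int[mu]_(k in `[q n.+1, 2 * q n]) X k w ^+ 2 @[n --> \oo] --> L}.
  apply: lo => //.
  - by move=> n; have := qS1 n; have := q0 n; lra.
  - apply: cvg_trans r1; apply: near_eq_cvg; apply: nearW => n /=.
    by rewrite mulrBl mulfK ?gt_eqF.
apply: filterS2 hi lo => w hi lo.
(* On this range of Q the lower bound for Q^-1 is the inverse of q (n + 1), so the inner averages
   are renormalised; the ratio of the two normalisations tends to 1. *)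
have {}lo : (q n.+1)^-1 * \int[mu]_(k in `[q n.+1, 2 * q n]) X k w ^+ 2 @[n --> \oo] --> L.
  have iq : (q n.+1 / q n)^-1 @[n --> \oo] --> (1 : R).
    by rewrite -[X in _ --> X]invr1; apply: cvgV => //; exact: oner_neq0.
  have -> : (fun n => (q n.+1)^-1 * \int[mu]_(k in `[q n.+1, 2 * q n]) X k w ^+ 2) =
      (fun n => (q n.+1 / q n)^-1 * ((q n)^-1 * \int[mu]_(k in `[q n.+1, 2 * q n]) X k w ^+ 2)).
    apply/funext => n; rewrite invf_div mulrA; congr (_ * _).
    by rewrite mulrAC mulfV ?mul1r// gt_eqF.
  by rewrite -[X in _ --> X]mul1r; exact: cvgM.
(* [idx Q] is the n with q n <= Q < q (n + 1). The truncated subtraction is exact once Q >= 9, which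
   is imposed below. *)
pose idx (Q : R) := (Num.truncn (Num.sqrt Q) - 3)%N.
have idx_oo : idx Q @[Q --> +oo] --> \oo.
  move=> A [N _ NA]; exists (q N); split; first exact: num_real.
  move=> Q NQ; apply: NA; rewrite /= /idx -(addnK 3 N) leq_sub2r// addn3.
  rewrite truncn_ge_nat ?sqrtr_ge0// -(@ler_sqr R) ?nnegrE ?sqrtr_ge0//.
  by rewrite sqr_sqrtr ltW// (lt_trans _ NQ)// q_gt0.
have hi' := cvg_comp _ _ idx_oo hi; have lo' := cvg_comp _ _ idx_oo lo.
apply: squeeze_cvgr lo' hi'.
exists 9; split; first exact: num_real.
move=> Q Q9 /=.
have Q0 : 0 < Q by exact: lt_trans Q9.
have [Q1 Q2] : q (idx Q) <= Q /\ Q <= q (idx Q).+1.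
  have s0 := sqrtr_ge0 Q; have sQ : Num.sqrt Q ^+ 2 = Q by rewrite sqr_sqrtr// ltW.
  have s3 : (3 <= Num.truncn (Num.sqrt Q))%N.
    by rewrite truncn_ge_nat// -(@ler_sqr R) ?nnegrE// sQ; lra.
  have iE : (idx Q).+3 = Num.truncn (Num.sqrt Q) by rewrite /idx -addn3 subnK.
  rewrite /q iE -[X in _ <= X /\ _]sQ -[X in _ /\ X <= _]sQ !ler_sqr ?nnegrE//.
  by split; [rewrite truncn_le|exact: ltW (truncnS_gt _)].
have I0 e f : 0 <= \int[mu]_(k in `[e, f]) X k w ^+ 2.
  by apply: Rintegral_ge0 => k _; exact: sqr_ge0.
apply/andP; split.
  apply: ler_pM => //; first by rewrite invr_ge0 ltW.
    by rewrite lef_pV2 ?posrE.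
  by apply: Rintegral_itv_le => //; lra.
apply: ler_pM => //; first by rewrite invr_ge0 ltW.
  by rewrite lef_pV2 ?posrE.
by apply: Rintegral_itv_le => //; lra.
Qed.

End law_of_large_numbers.

(** * The random far field *)

Section path_continuity.
Context {R : realType} {d : nat}.
Local Opaque smooth csmooth.
Implicit Types (phi : 'rV[R]_d -> R[i]) (v : 'rV[R]_d).

Lemma is_derive_dot v x e : is_derive x e (dot v) (dot v e).
Proof.
apply: is_derive_line0.
rewrite (_ : (fun s => dot v (x + s *: e)) = fun s => dot v x + s * dot v e).
  have h := @is_deriveD _ _ _ (cst (dot v x)) (fun s : R => s * dot v e) 0 1 0 (dot v e)
    (is_derive_cst _ _ _) _.
  apply: is_derive_eq (h _) _; last by rewrite add0r.
  have := @is_deriveZ R R R id (dot v e) 0 1 1 (is_derive_id _ _).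
  rewrite [_ *: 1]mulr1; congr is_derive.
  by apply/funext => s /=; rewrite [LHS]mulrC.
by apply/funext => s; rewrite dotDr dotZr.
Qed.

Lemma cdirD_expi_dot v e (s : R) :
  cdirD [:: e] (fun x => expi (- (s * dot v x))) =
  fun x => s%:C * ((0 +i* (- dot v e)) * expi (- (s * dot v x))).
Proof.
apply/funext => x.
have dq : is_derive x e (fun x => - (s * dot v x)) (- (s * dot v e)).
  rewrite (_ : (fun x => _) = dot (- s *: v)).
    by apply: is_derive_eq (is_derive_dot _ _ _) _; rewrite dotZl mulNr.
  by apply/funext => y; rewrite dotZl mulNr.
have [dq1 dq2] := dq.
have [_ dc] := is_derive_cos_comp dq1; have [_ ds] := is_derive_sin_comp dq1.
apply: complex_ext; rewrite /= ?dc ?ds dq2; ring.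
Qed.

Lemma pderiv_bounded N phi : test phi ->
  exists2 C, 0 <= C & forall alpha x, (size alpha <= N)%N -> normc (pderiv alpha phi x) <= C.
Proof.
elim: N phi => [|N IH] phi tphi; have [B HB] := test_bounded tphi.
  exists B => [|alpha x]; first exact: rd_bounded_ge0 HB.
  rewrite leqn0 size_eq0 => /eqP ->; have -> : pderiv [::] phi = phi by exact: cdirD0.
  exact: rd_bounded_bounded HB x.
have /fin_all_exists[C HC] : forall i : 'I_d, exists C : R, 0 <= C /\
    forall alpha x, (size alpha <= N)%N ->
    normc (pderiv alpha (cdirD [:: delta_mx 0 i] phi) x) <= C.
  by move=> i; have [C C0 HC] := IH _ (test_derive (delta_mx 0 i) tphi); exists C.
have B0 := rd_bounded_ge0 HB.
have S0 : 0 <= \sum_i C i by apply: sumr_ge0 => i _; case: (HC i).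
exists (B + \sum_i C i) => [|alpha x]; first exact: addr_ge0.
case/lastP: alpha => [|alpha i] sN.
  have -> : pderiv [::] phi = phi by exact: cdirD0.
  by rewrite (le_trans (rd_bounded_bounded HB x))// lerDl.
rewrite size_rcons ltnS in sN.
rewrite /pderiv map_rcons cdirD_rcons; apply: le_trans ((HC i).2 _ _ sN) _.
rewrite (bigD1 i)//= addrCA lerDl addr_ge0//.
by apply: sumr_ge0 => j _; case: (HC j).
Qed.

Lemma csmooth_wave v (s : R) : csmooth (fun x => expi (- (s * dot v x)) - 1).
Proof.
apply: csmoothD; last exact: csmooth_cst.
apply: csmooth_expi.
have -> : (fun y => - (s * dot v y)) = dot (- s *: v).
  by apply/funext => y; rewrite dotZl mulNr.
exact: smooth_dot.
Qed.

Lemma phase_bound v phi : test phi -> exists2 C, 0 <= C & forall x s,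
  normc (phi x * (expi (- (s * dot v x)) - 1)) <= C * `|s|.
Proof.
move=> tphi.
have sd : csmooth (fun x => (dot v x)%:C) by split; [exact: smooth_dot|exact: smooth_cst].
have [B HB] := test_bounded (testM tphi sd).
exists (2 * B) => [|x s]; first by rewrite mulr_ge0// (rd_bounded_ge0 HB).
have e0 z : expi_remainder 1 z = expi z - 1 :> R[i].
  by rewrite /= /taylor_term !expr0 fact0 divr1 mulr1.
have := normc_expi_remainder 1 (- (s * dot v x)).
rewrite e0 expr1 (_ : 1`! = 1%N)// divr1 normrN normrM => le1.
have := rd_bounded_bounded HB x; rewrite Normc.normcM normc_real => le2.
rewrite Normc.normcM; apply: le_trans (ler_wpM2l (normc_ge0 _) le1) _.
rewrite [leLHS](_ : _ = 2 * (normc (phi x) * `|dot v x|) * `|s|); last by ring.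
by rewrite ler_wpM2r// ler_wpM2l.
Qed.

(** Induction on the order: the innermost derivative falls on phi, or on the exponential, where it
    produces the factor s. For this reason lists are split at their end. *)
Lemma pderiv_phase_bound N v phi : test phi ->
  exists2 C, 0 <= C & forall alpha x s, (size alpha <= N)%N -> `|s| <= 1 ->
    normc (pderiv alpha (fun x => phi x * (expi (- (s * dot v x)) - 1)) x) <= C * `|s|.
Proof.
elim: N phi => [|N IH] phi tphi; have [B B0 HB] := phase_bound v tphi.
  exists B => // alpha x s; rewrite leqn0 size_eq0 => /eqP -> _.
  have -> : pderiv [::] (fun x => phi x * (expi (- (s * dot v x)) - 1)) =
      (fun x => phi x * (expi (- (s * dot v x)) - 1)) by exact: cdirD0.
  exact: HB.
pose w i : R[i] := 0 +i* (- dot v (delta_mx 0 i)).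
have /fin_all_exists[C HC] : forall i : 'I_d, exists C : R, 0 <= C /\
    forall alpha x s, (size alpha <= N)%N -> `|s| <= 1 ->
    normc (pderiv (rcons alpha i) (fun x => phi x * (expi (- (s * dot v x)) - 1)) x) <= C * `|s|.
  move=> i; have td := test_derive (delta_mx 0 i) tphi.
  have tw := testZ (w i) tphi.
  have [C1 C10 H1] := IH _ td; have [C2 C20 H2] := IH _ tw.
  have [C3 C30 H3] := pderiv_bounded N tw.
  exists (C1 + C2 + C3); split=> [|alpha x s sN s1]; first by rewrite !addr_ge0.
  have sw := csmooth_wave v s.
  have se : csmooth (fun x => expi (- (s * dot v x))).
    have -> : (fun x => expi (- (s * dot v x))) = (fun x => (expi (- (s * dot v x)) - 1) + 1).
      by apply/funext => y; rewrite subrK.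
    exact: (csmoothD sw (csmooth_cst 1)).
  have d1 : cdirD [:: delta_mx 0 i] (fun x => expi (- (s * dot v x)) - 1) =
      fun x => s%:C * (w i * expi (- (s * dot v x))).
    rewrite (cdirD1D _ se (csmooth_cst (-1))) cdirD_expi_dot; apply/funext => y.
    rewrite [X in _ + X](_ : _ = 0) ?addr0// /cdirD /=.
    by rewrite !derive_cst.
  rewrite /pderiv map_rcons cdirD_rcons (cdirD1M _ (test_csmooth tphi) sw) d1.
  set g := cdirD [:: _] phi.
  (* Writing e as (e - 1) + 1 after differentiating the exponential makes each term an instance of
     lower order, or s times a fixed test function. *)
  have -> : (fun x => g x * (expi (- (s * dot v x)) - 1) +
       phi x * (s%:C * (w i * expi (- (s * dot v x))))) =
     (fun x => g x * (expi (- (s * dot v x)) - 1) +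
       (s%:C * (w i * phi x * (expi (- (s * dot v x)) - 1)) + s%:C * (w i * phi x))).
    by apply/funext => y; ring.
  have c1 : csmooth (fun x => g x * (expi (- (s * dot v x)) - 1)).
    exact: (csmoothM (test_csmooth td) sw).
  have c2 : csmooth (fun x => w i * phi x * (expi (- (s * dot v x)) - 1)).
    exact: (csmoothM (test_csmooth tw) sw).
  have c2' := csmoothM (csmooth_cst s%:C) c2.
  have c3' := csmoothM (csmooth_cst s%:C) (test_csmooth tw).
  rewrite (cdirDD _ c1 (csmoothD c2' c3')) (cdirDD _ c2' c3').
  rewrite (cdirDZ _ _ c2) (cdirDZ _ _ (test_csmooth tw)).
  have h1 := H1 _ x s sN s1; have h2 := H2 _ x s sN s1; have h3 := H3 _ x sN.
  apply: le_trans (normcD _ _) _; apply: le_trans (lerD h1 (normcD _ _)) _.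
  rewrite !Normc.normcM normc_real.
  have s0 := normr_ge0 s.
  apply: le_trans (lerD (lexx _) (lerD (ler_wpM2l s0 h2) (ler_wpM2l s0 h3))) _.
  have : `|s| * (C2 * `|s|) <= C2 * `|s| by rewrite ler_piMl// mulr_ge0.
  by rewrite !mulrDl (mulrC _ C3) -addrA !lerD2l lerD2r.
have S0 : 0 <= \sum_i C i by apply: sumr_ge0 => i _; case: (HC i).
exists (B + \sum_i C i) => [|alpha x s]; first exact: addr_ge0.
case/lastP: alpha => [|alpha i] sN s1.
  have -> : pderiv [::] (fun x => phi x * (expi (- (s * dot v x)) - 1)) =
      (fun x => phi x * (expi (- (s * dot v x)) - 1)) by exact: cdirD0.
  by apply: le_trans (HB x s) _; rewrite ler_wpM2r// lerDl.
rewrite size_rcons ltnS in sN.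
apply: le_trans ((HC i).2 _ _ _ sN s1) _; rewrite ler_wpM2r//.
rewrite (bigD1 i)//= addrCA lerDl addr_ge0//.
by apply: sumr_ge0 => j _; case: (HC j).
Qed.

Lemma dpairB (T : schwartz_distr d) phi psi : test phi -> test psi ->
  T (fun x => phi x - psi x) = T phi - T psi.
Proof.
move=> tp ts; have := dpair_linear T (-1) ts tp.
rewrite mulN1r addrC => <-; congr (T _); apply/funext => x.
by rewrite mulN1r addrC.
Qed.

(** The difference of the modes k and k0 is the mode k0 times e^(- i (k - k0) v.y) - 1. It is
    supported in the support of chi and its derivatives up to order N are O(|k - k0|), so the
    seminorm estimate for T applies. *)
Lemma ccontinuous_dpair_mode (T : schwartz_distr d) chi v : test chi ->
  ccontinuous (fun k : R => T (mode chi v k)).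
Proof.
move=> tchi k0; have [C [N HT]] := dpair_continuous T (test_compact tchi).
have [B B0 HB] := pderiv_phase_bound N v (test_mode v k0 tchi).
have bound k : `|k - k0| <= 1 ->
    normc (T (mode chi v k) - T (mode chi v k0)) <= C * (B * `|k - k0|).
  move=> k1; rewrite -dpairB; [|exact: test_mode|exact: test_mode].
  have -> : (fun x => mode chi v k x - mode chi v k0 x) =
      (fun x => mode chi v k0 x * (expi (- ((k - k0) * dot v x)) - 1)).
    apply/funext => x; rewrite /mode mulrBr mulr1 -mulrA -expiD; congr (_ * expi _ - _).
    by ring.
  apply: HT.
  - by apply: testM; [exact: test_mode|exact: csmooth_wave].
  - apply: csupport_sub => x; apply: contraNneq; rewrite /mode => ->.
    by rewrite !mul0r.
  - by move=> alpha x sN; exact: HB.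
apply: (ccvg_squeeze (g := fun k => C * (B * `|k - k0|))).
  have -> : 0 = C * (B * `|k0 - k0|) :> R by rewrite subrr normr0 !mulr0.
  apply: cvgM; first exact: cvg_cst.
  apply: cvgM; first exact: cvg_cst.
  by apply: cvg_norm; apply: cvgB; [exact: cvg_id|exact: cvg_cst].
apply/nbhs_ballP; exists 1 => //= k; rewrite /ball /= => /ltW; rewrite distrC.
exact: bound.
Qed.

End path_continuity.

(** * Averages of products of two processes *)

Section product_law_of_large_numbers.
Context {R : realType} {disp : measure_display} {Omega : measurableType disp}.
Variable P : probability Omega R.
Local Notation mu := (@lebesgue_measure R).
Variables (Y Z : R -> Omega -> R) (C LY LZ L : R).
Hypotheses (cY : forall w, continuous (Y^~ w)) (cZ : forall w, continuous (Z^~ w)).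
Hypothesis gYZ : forall k l a b c e,
  centered_gaussian P (fun w => a * Y k w + b * Z k w + (c * Y l w + e * Z l w)).
Hypothesis covY : forall k l, 1 <= k -> 1 <= l ->
  `|\int[P]_w (Y k w * Y l w)| <= C / (1 + `|k - l|).
Hypothesis covZ : forall k l, 1 <= k -> 1 <= l ->
  `|\int[P]_w (Z k w * Z l w)| <= C / (1 + `|k - l|).
Hypothesis covYZ : forall k l, 1 <= k -> 1 <= l ->
  `|\int[P]_w (Y k w * Z l w)| <= C / (1 + `|k - l|).
Hypothesis limY : \int[P]_w (Y k w ^+ 2) @[k --> +oo] --> LY.
Hypothesis limZ : \int[P]_w (Z k w ^+ 2) @[k --> +oo] --> LZ.
Hypothesis limYZ : \int[P]_w (Y k w * Z k w) @[k --> +oo] --> L.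

Let iYY k l : P.-integrable setT (EFin \o (fun w => Y k w * Y l w)).
Proof.
have [] // := @gaussian_square_product _ _ _ P (Y k) (Y l).
move=> a b; have := gYZ k l a 0 b 0; congr centered_gaussian; apply/funext => w; ring.
Qed.

Let iZZ k l : P.-integrable setT (EFin \o (fun w => Z k w * Z l w)).
Proof.
have [] // := @gaussian_square_product _ _ _ P (Z k) (Z l).
move=> a b; have := gYZ k l 0 a 0 b; congr centered_gaussian; apply/funext => w; ring.
Qed.

Let iYZ k l : P.-integrable setT (EFin \o (fun w => Y k w * Z l w)).
Proof.
have [] // := @gaussian_square_product _ _ _ P (Y k) (Z l).
move=> a b; have := gYZ k l a 0 0 b; congr centered_gaussian; apply/funext => w; ring.
Qed.

Let X (e : R) k w := Y k w + e * Z k w.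

Let cX e w : continuous (X e ^~ w).
Proof.
apply: continuousD_fun; first exact: cY.
by apply: continuousM_fun; [exact: cst_continuous|exact: cZ].
Qed.

Let XX e k l : \int[P]_w (X e k w * X e l w) =
  \int[P]_w (Y k w * Y l w) + e * \int[P]_w (Y k w * Z l w) +
  (e * \int[P]_w (Y l w * Z k w) + e ^+ 2 * \int[P]_w (Z k w * Z l w)).
Proof.
have j1 := integrableZlR measurableT e (iYZ k l).
have j2 := integrableZlR measurableT e (iYZ l k).
have j3 := integrableZlR measurableT (e ^+ 2) (iZZ k l).
have j4 := integrableDR measurableT (iYY k l) j1; have j5 := integrableDR measurableT j2 j3.
have -> : (fun w => X e k w * X e l w) = (fun w => Y k w * Y l w + e * (Y k w * Z l w) +
    (e * (Y l w * Z k w) + e ^+ 2 * (Z k w * Z l w))).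
  by apply/funext => w; rewrite /X; ring.
by rewrite (RintegralD measurableT j4 j5) RintegralD// RintegralD// !RintegralZl.
Qed.

(** Used for e = 1 and e = - 1: the two limits differ by 4 L, which isolates the product. *)
Let lln e : e ^+ 2 = 1 -> {ae P, forall w,
  Q^-1 * \int[mu]_(k in `[Q, 2 * Q]) X e k w ^+ 2 @[Q --> +oo] --> LY + LZ + 2 * e * L}.
Proof.
move=> e1; have ne : `|e| = 1.
  by apply/eqP; rewrite -sqrp_eq1// real_normK ?num_real// e1.
apply: (gaussian_band_lln (C := 4 * C)).
- exact: cX.
- move=> k l a b; have := gYZ k l a (a * e) b (b * e).
  by congr centered_gaussian; apply/funext => w; rewrite /X; ring.
- move=> k l k1 l1; rewrite XX e1 mul1r.
  have h1 := covY k1 l1; have h2 := covZ k1 l1; have h3 := covYZ k1 l1.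
  have := covYZ l1 k1; rewrite (distrC l) => h4.
  apply: le_trans (ler_normD _ _) _.
  apply: le_trans (lerD (ler_normD _ _) (ler_normD _ _)) _.
  rewrite !normrM ne !mul1r [leRHS](_ : _ = C / (1 + `|k - l|) + C / (1 + `|k - l|) +
    (C / (1 + `|k - l|) + C / (1 + `|k - l|))); last by ring.
  by rewrite !lerD.
- have -> : (fun k => \int[P]_w (X e k w ^+ 2)) = (fun k =>
      \int[P]_w (Y k w ^+ 2) + \int[P]_w (Z k w ^+ 2) + 2 * e * \int[P]_w (Y k w * Z k w)).
    apply/funext => k; have := XX e k k; rewrite e1.
    under eq_Rintegral do rewrite -expr2.
    by move=> ->; under eq_Rintegral do rewrite -expr2; ring.
  apply: cvgD; first exact: cvgD.
  by apply: cvgM; first exact: cvg_cst.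
Qed.

Lemma product_band_lln :
  {ae P, forall w, Q^-1 * \int[mu]_(k in `[Q, 2 * Q]) (Y k w * Z k w) @[Q --> +oo] --> L}.
Proof.
have p1 : (1 : R) ^+ 2 = 1 by rewrite expr1n.
have m1 : (-1 : R) ^+ 2 = 1 by rewrite sqrrN expr1n.
apply: filterS2 (lln p1) (lln m1) => w h1 h2.
have i e (Q : R) : mu.-integrable `[Q, 2 * Q] (EFin \o (fun k => X e k w ^+ 2)).
  apply: continuous_Rintegrable_itv => k.
  apply: (@continuous_comp _ _ _ (X e ^~ w) (fun x : R => x ^+ 2)); first exact: cX.
  exact: exprn_continuous.
have -> : (fun Q => Q^-1 * \int[mu]_(k in `[Q, 2 * Q]) (Y k w * Z k w)) = (fun Q : R =>
    4^-1 * (Q^-1 * \int[mu]_(k in `[Q, 2 * Q]) X 1 k w ^+ 2 -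
     Q^-1 * \int[mu]_(k in `[Q, 2 * Q]) X (-1) k w ^+ 2)).
  apply/funext => Q; rewrite -mulrBr mulrCA; congr (_ * _).
  rewrite -RintegralB// -RintegralZl//; last first.
    by apply: (@integrableBR R _ (measurableTypeR R) mu `[Q, 2 * Q] _ _ _ (i 1 Q) (i (-1) Q)).
  by apply: eq_Rintegral => k _; rewrite /X; field.
have -> : L = 4^-1 * (LY + LZ + 2 * 1 * L - (LY + LZ + 2 * (-1) * L)) by field.
by apply: cvgM; [exact: cvg_cst|exact: cvgB].
Qed.

End product_law_of_large_numbers.

Lemma isotropic_kernel {R : realType} {d : nat} (D : set 'rV[R]_d) (m : R) B a
    (chi1 chi2 : 'rV[R]_d -> R[i]) v :
  microlocally_isotropic D m B a -> test chi1 -> test chi2 ->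
  (forall x, a x * chi1 x * chi2 x = a x) -> enorm v = 1 ->
  (exists2 C, 0 <= C & forall s t, normc (B (mode chi1 (- v) s) (mode chi2 v t)) <=
    C * (1 + `|s|) `^ (- m) / (1 + `|t - s|)) /\
  forall tau, ccvg (pinfty_nbhs R)
    (fun k => (k `^ m)%:C * B (mode chi1 (- v) k) (mode chi2 v (k + tau)))
    (fourier a (tau *: v)).
Proof.
move=> [sigma [b [hB [ssym _] ta [bsym _] sE]]] t1 t2 achi v1.
have BE s t : B (mode chi1 (- v) s) (mode chi2 v t) = kernel sigma v chi1 chi2 s t.
  by apply: hB; exact: test_mode.
split=> [|tau].
  have [C C0 HC] := kernel_bound ssym t1 t2 v1.
  by exists C => // s t; rewrite BE; exact: HC.
under eq_fun do rewrite BE -[X in _ `^ X]opprK.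
exact: (kernel_limit ssym t1 t2 v1 bsym (test_on_test ta) sE).
Qed.

Section distribution_algebra.
Context {R : realType} {d : nat} (T : schwartz_distr (R := R) d).
Implicit Types phi psi : 'rV[R]_d -> R[i].

Lemma dpairD phi psi : test phi -> test psi ->
  T (fun x => phi x + psi x) = T phi + T psi.
Proof.
move=> tp ts; have := dpair_linear T 1 tp ts; rewrite mul1r => <-.
by congr (T _); apply/funext => x; rewrite mul1r.
Qed.

Lemma dpairZ z phi : test phi -> T (fun x => z * phi x) = z * T phi.
Proof.
move=> tp; have := dpair_linear T (z - 1) tp tp.
rewrite mulrBl mul1r subrK => <-; congr (T _); apply/funext => x.
by rewrite mulrBl mul1r subrK.
Qed.

End distribution_algebra.

Lemma cutoff_supportK {R : realType} {d : nat} (D : set 'rV[R]_d) chi a :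
  cutoff (closure D) chi -> test_on D a -> forall x, a x * chi x = a x.
Proof.
move=> [_ [U [_ DU chi1]]] [_ _ aD] x; have [->|ax] := eqVneq (a x) 0; first by rewrite mul0r.
by rewrite chi1 ?mulr1//; apply: DU; apply: subset_closure; apply: aD; apply: subset_closure.
Qed.

(** * Second-order structure of the random field *)

Section random_field.
Context {R : realType} {disp : measure_display} {Omega : measurableType disp}.
Context {d : nat} (P : probability Omega R) (f : Omega -> @schwartz_distr R d).
Hypothesis gf : forall psi, test psi -> complex_gaussian P (fun w => f w psi).
Hypothesis cf : forall psi, test psi -> cexpectation P (fun w => f w psi) = 0.
Implicit Types phi psi : 'rV[R]_d -> R[i].

(** By complex linearity of the pairing, a real combination of real and imaginary parts of values of
    f is the real part of f at one test function. This statement thus contains the joint Gaussianity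
    needed later. *)
Lemma centered_gaussian_Re psi : test psi -> centered_gaussian P (fun w => Re (f w psi)).
Proof.
move=> tp; have [mr mi g] := gf tp; split=> //.
  have := g 1 0; congr (gaussian_law (pushforward P _)).
  by apply/funext => w; ring.
by have := congr1 (@complex.Re R) (cf tp).
Qed.

Definition covariance phi psi := cexpectation P (fun w => conjc (f w phi) * f w psi).
Definition relation phi psi := cexpectation P (fun w => f w phi * f w psi).

Lemma integrable_Re_Re phi psi : test phi -> test psi ->
  P.-integrable setT (EFin \o (fun w => Re (f w phi) * Re (f w psi))).
Proof.
move=> tp ts.
have [] // := @gaussian_square_product _ _ _ P (fun w => Re (f w phi)) (fun w => Re (f w psi)).
move=> a b; have := centered_gaussian_Re (testD (testZ a%:C tp) (testZ b%:C ts)).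
congr centered_gaussian; apply/funext => w.
rewrite (dpairD _ (testZ _ tp) (testZ _ ts)) (dpairZ _ _ tp) (dpairZ _ _ ts).
by rewrite RecD !RecM /=; ring.
Qed.

Let minus_i : R[i] := 0 +i* (-1).

Let Im_minus_i (z : R[i]) : Im z = Re (minus_i * z).
Proof. by rewrite RecM /=; ring. Qed.

Lemma cintegrable_pairM phi psi : test phi -> test psi ->
  cintegrable P setT (fun w => conjc (f w phi) * f w psi) /\
  cintegrable P setT (fun w => f w phi * f w psi).
Proof.
move=> tp ts.
have tpi := testZ minus_i tp; have tsi := testZ minus_i ts.
have rr := integrable_Re_Re tp ts; have ii := integrable_Re_Re tpi tsi.
have ri := integrable_Re_Re tp tsi; have ir := integrable_Re_Re tpi ts.
have ip w : Re (f w (fun x => minus_i * phi x)) = Im (f w phi).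
  by rewrite (dpairZ _ _ tp) Im_minus_i.
have is_ w : Re (f w (fun x => minus_i * psi x)) = Im (f w psi).
  by rewrite (dpairZ _ _ ts) Im_minus_i.
have eqi (g h : Omega -> R) : P.-integrable setT (EFin \o g) -> g =1 h ->
    P.-integrable setT (EFin \o h) by move=> + /funext <-.
split; split.
- apply: (eqi _ _ (integrableDR measurableT rr ii)) => w.
  by rewrite ip is_ RecM Rec_conj Imc_conj; ring.
- apply: (eqi _ _ (integrableBR measurableT ri ir)) => w.
  by rewrite ip is_ ImcM Rec_conj Imc_conj; ring.
- apply: (eqi _ _ (integrableBR measurableT rr ii)) => w.
  by rewrite ip is_ RecM.
- apply: (eqi _ _ (integrableDR measurableT ri ir)) => w.
  by rewrite ip is_ ImcM.
Qed.

Lemma integrable_component (g h : R[i]) phi psi : test phi -> test psi ->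
  P.-integrable setT (EFin \o (fun w => Re (g * f w phi) * Re (h * f w psi))).
Proof.
move=> tp ts; have := integrable_Re_Re (testZ g tp) (testZ h ts).
by under eq_fun do rewrite (dpairZ _ _ tp) (dpairZ _ _ ts).
Qed.

(** From Re A Re B = Re (conj A B + A B) / 2, with A and B the rotated values of f. *)
Lemma component_covariance (g h : R[i]) phi psi : test phi -> test psi ->
  \int[P]_w (Re (g * f w phi) * Re (h * f w psi)) =
  2^-1 * Re (conjc g * h * covariance phi psi + g * h * relation phi psi).
Proof.
move=> tp ts; have [ic ir] := cintegrable_pairM tp ts.
rewrite /covariance /relation /cexpectation -!(cintegralZ measurableT)// -(cintegralD measurableT);
  [|exact: (cintegrableZ measurableT)|exact: (cintegrableZ measurableT)].
rewrite Re_cintegral -RintegralZl//; last first.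
  have [] // := cintegrableD measurableT (cintegrableZ measurableT (conjc g * h) ic)
    (cintegrableZ measurableT (g * h) ir).
apply: eq_Rintegral => w _.
rewrite !(RecD, RecM, ImcM, Rec_conj, Imc_conj).
by field.
Qed.

Lemma covariance_conj phi psi : test phi -> test psi ->
  covariance psi phi = conjc (covariance phi psi).
Proof.
move=> tp ts; rewrite /covariance /cexpectation; apply: complex_ext.
  rewrite Rec_conj !Re_cintegral; apply: eq_Rintegral => w _.
  by rewrite !(RecM, Rec_conj, Imc_conj); ring.
rewrite Imc_conj !Im_cintegral; have [[_ ii] _] := cintegrable_pairM tp ts.
rewrite -mulN1r -RintegralZl//; apply: eq_Rintegral => w _.
by rewrite !(ImcM, Rec_conj, Imc_conj); ring.
Qed.

Lemma relationC phi psi : relation psi phi = relation phi psi.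
Proof. by apply: eq_cintegral => w _; rewrite mulrC. Qed.

End random_field.

Lemma powR_norm_le {R : realType} (q c p : R) : 1 <= q -> q <= c -> q `^ p <= c `^ `|p|.
Proof.
move=> q1 qc; apply: le_trans (ler_powR q1 (ler_norm p)) _.
by apply: ge0_ler_powR; rewrite ?nnegrE// (le_trans ler01)// (le_trans q1).
Qed.

Lemma continuous_powR_comp {R : realType} (f : R -> R) (p : R) : continuous f ->
  (forall k, 0 < f k) -> continuous (fun k => f k `^ p).
Proof.
move=> cf f0.
have -> : (fun k => f k `^ p) = (fun k => expR (p * ln (f k))).
  by apply/funext => k; rewrite /powR gt_eqF.
move=> k; apply: (@continuous_comp _ _ _ (fun k => p * ln (f k)) expR); last exact: continuous_expR.
apply: (@continuousM_fun _ _ (cst p)); first exact: cst_continuous.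
by move=> x; apply: (@continuous_comp _ _ _ f (@ln R)); [exact: cf|exact: continuous_ln].
Qed.

Lemma dilation_bound {R : realFieldType} (k t : R) : 1 <= k -> 0 <= t ->
  (k <= 1 + k /\ 1 + k <= (2 + t) * k) /\
  (k <= 1 + (k + t) /\ 1 + (k + t) <= (2 + t) * k).
Proof.
move=> k1 t0; have tk : t <= t * k by rewrite ler_peMr.
by rewrite mulrDl; split; split; lra.
Qed.

(** * The frequency weight *)

Section weight.
Context {R : realType}.
Variables (m p tau : R).
Hypothesis tau0 : 0 <= tau.

(* With p = (d - 7) / 2 this is k^(m + 7 - d) (k + tau)^p k^p, where the last two
   factors come from the far fields at k + tau and k. *)
Definition weight k : R := k `^ m * ((k + tau) / k) `^ p.

Lemma weight_ge0 k : 0 <= weight k.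
Proof. by rewrite mulr_ge0 ?powR_ge0. Qed.

Definition weight_const : R := (2 + tau) `^ `|m| * (1 + tau) `^ `|p|.

Lemma weight_const_ge0 : 0 <= weight_const.
Proof. by rewrite mulr_ge0 ?powR_ge0. Qed.

(** In both cases 1 + |s| lies between k and (2 + tau) k, so k^m compensates the symbol size (1 +
    |s|)^(- m) up to a constant independent of k. *)
Lemma weight_bound (k s : R) : 1 <= k -> `|s| = k \/ `|s| = k + tau ->
  weight k * (1 + `|s|) `^ (- m) <= weight_const.
Proof.
move=> k1 sk; have k0 : 0 < k by exact: lt_le_trans k1.
have tk1 : tau <= tau * k by rewrite ler_peMr.
have [s1 s2] : k <= 1 + `|s| /\ 1 + `|s| <= (2 + tau) * k.
  by case: sk => ->; have [] := dilation_bound k1 tau0.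
have q1 : 1 <= (1 + `|s|) / k by rewrite ler_pdivlMr// mul1r.
have q0 := le_trans ler01 q1.
have kk : (1 + `|s|) `^ (- m) = ((1 + `|s|) / k) `^ (- m) * k `^ (- m).
  by rewrite -powRM ?divfK ?gt_eqF// ltW.
have tk : 1 <= (k + tau) / k by rewrite ler_pdivlMr// mul1r lerDl.
rewrite kk /weight (powRN k) [leLHS](_ : _ = ((1 + `|s|) / k) `^ (- m) *
   ((k + tau) / k) `^ p * (k `^ m / k `^ m)); last by ring.
rewrite divff ?gt_eqF ?powR_gt0// mulr1; apply: ler_pM; rewrite ?powR_ge0//.
  rewrite -(normrN m); apply: powR_norm_le => //.
  by rewrite ler_pdivrMr.
apply: powR_norm_le => //; rewrite ler_pdivrMr//; nra.
Qed.

Lemma continuous_max1 : continuous (fun k : R => Num.max 1 k).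
Proof.
by move=> k; apply: (@continuous_max R R (cst 1) id); [exact: cvg_cst|exact: cvg_id].
Qed.

Lemma continuous_weight_max : continuous (fun k : R => weight (Num.max 1 k)).
Proof.
have K0 k : 0 < Num.max 1 k :> R by rewrite lt_max ltr01.
apply: continuousM_fun.
  by apply: continuous_powR_comp; [exact: continuous_max1|exact: K0].
apply: continuous_powR_comp.
  apply: continuousM_fun.
    by apply: continuousD_fun; [exact: continuous_max1|exact: cst_continuous].
  by apply: continuousV_fun; [move=> k; rewrite gt_eqF|exact: continuous_max1].
by move=> k; rewrite divr_gt0// ltr_wpDr.
Qed.

Let ratio_cvg1 : (k + tau) / k @[k --> +oo] --> (1 : R).
Proof.
have h : 1 + tau * k^-1 @[k --> +oo] --> (1 : R).
  rewrite -[X in _ --> X]addr0 -(mulr0 tau).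
  apply: cvgD; [exact: cvg_cst|apply: cvgM; [exact: cvg_cst|]].
  apply/gtr0_cvgV0; last exact: cvg_id.
  by exists 0; split; first exact: num_real.
apply: cvg_trans h; apply: near_eq_cvg; exists 0; split; first exact: num_real.
by move=> k k0; rewrite mulrDl mulfV// gt_eqF.
Qed.

Lemma weight_limit (F : R -> R[i]) l :
  ccvg (pinfty_nbhs R) (fun k => (k `^ m)%:C * F k) l ->
  ccvg (pinfty_nbhs R) (fun k => (weight k)%:C * F k) l.
Proof.
move=> Fl; rewrite -[l]mul1r.
have -> : (fun k => (weight k)%:C * F k) =
    (fun k => (((k + tau) / k) `^ p)%:C * ((k `^ m)%:C * F k)).
  by apply/funext => k; rewrite /weight rmorphM /= mulrA [X in X * _]mulrC.
by apply: ccvgM => //; apply: ccvg_real; exact: (cvg_powR1 p ratio_cvg1).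
Qed.

Lemma weight_limit_shift (F : R -> R[i]) l :
  ccvg (pinfty_nbhs R) (fun k => (k `^ m)%:C * F k) l ->
  ccvg (pinfty_nbhs R) (fun k => (weight k)%:C * F (k + tau)) l.
Proof.
move=> [Fr Fi]; rewrite -[l]mul1r.
have sh : k + tau @[k --> +oo] --> +oo.
  apply/cvgryPge => A; exists A; split; first exact: num_real.
  by move=> k /ltW Ak; rewrite (le_trans Ak)// lerDl.
have Fs : ccvg (pinfty_nbhs R) (fun k => ((k + tau) `^ m)%:C * F (k + tau)) l.
  by split; [exact: (cvg_comp _ _ sh Fr)|exact: (cvg_comp _ _ sh Fi)].
(* Passing from k^m to (k + tau)^m leaves the ratio (k + tau) / k to the power p - m, which tends to
   1. *)
apply: (ccvg_near_eq _ (ccvgM (ccvg_real (cvg_powR1 (p - m) ratio_cvg1)) Fs)).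
exists 0; split; first exact: num_real.
move=> k k0; rewrite mulrA -rmorphM /=; congr (_%:C * _).
have q0 : 0 < (k + tau) / k by rewrite divr_gt0// ltr_wpDr.
have -> : (k + tau) `^ m = ((k + tau) / k) `^ m * k `^ m.
  by rewrite -powRM ?divfK ?gt_eqF// ltW.
rewrite mulrA -powRD; last by rewrite (gt_eqF q0) implybT.
by rewrite subrK mulrC.
Qed.

(** Applies when the kernel decay is evaluated at frequencies whose difference (for the covariance)
    or sum (for the relation) is at least k in modulus, which leaves the factor 1 / (1 + k). *)
Lemma weight_decay (F : R -> R[i]) (s : R -> R) C : 0 <= C ->
  (forall k, 1 <= k -> `|s k| = k \/ `|s k| = k + tau) ->
  (forall k, 1 <= k -> normc (F k) <= C * (1 + `|s k|) `^ (- m) / (1 + k)) ->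
  ccvg (pinfty_nbhs R) (fun k => (weight k)%:C * F k) 0.
Proof.
move=> C0 hs FC; apply: (ccvg_squeeze (g := fun k => C * weight_const * k^-1)).
  rewrite -(mulr0 (C * weight_const)); apply: cvgM; first exact: cvg_cst.
  apply/gtr0_cvgV0; last exact: cvg_id.
  by exists 0; split; first exact: num_real.
exists 1; split; first exact: num_real.
move=> k /ltW k1; rewrite subr0 Normc.normcM normc_real ger0_norm ?weight_ge0//.
have k0 : 0 < k by exact: lt_le_trans k1.
apply: le_trans (ler_wpM2l (weight_ge0 k) (FC k k1)) _.
rewrite [leLHS](_ : _ = C * (weight k * (1 + `|s k|) `^ (- m)) * (1 + k)^-1); last by ring.
apply: ler_pM.
- by rewrite mulr_ge0// mulr_ge0 ?powR_ge0 ?weight_ge0.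
- by rewrite invr_ge0 addr_ge0// ltW.
- by apply: ler_wpM2l => //; apply: weight_bound => //; exact: hs.
by rewrite lef_pV2 ?posrE ?ltr_pwDl ?lerDr// ltW.
Qed.

End weight.

(** * Weighted processes of components of modes *)

Section mode_process.
Context {R : realType} {disp : measure_display} {Omega : measurableType disp}.
Context {d : nat} (P : probability Omega R) (f : Omega -> @schwartz_distr R d).
Local Notation mu := (@lebesgue_measure R).
Hypothesis gf : forall psi, test psi -> complex_gaussian P (fun w => f w psi).
Hypothesis cf : forall psi, test psi -> cexpectation P (fun w => f w psi) = 0.
Variables (chi : 'rV[R]_d -> R[i]) (v : 'rV[R]_d) (m p tau sg C : R).
Hypotheses (tchi : test chi) (tau0 : 0 <= tau) (sg1 : `|sg| = 1) (C0 : 0 <= C).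
Let Z s w := f w (mode chi v s).
Let Cv s t := covariance P f (mode chi v s) (mode chi v t).
Let Rv s t := relation P f (mode chi v s) (mode chi v t).
Hypothesis Cv_bound : forall s t, normc (Cv s t) <= C * (1 + `|s|) `^ (- m) / (1 + `|t - s|).
Hypothesis Rv_bound : forall s t, normc (Rv s t) <= C * (1 + `|s|) `^ (- m) / (1 + `|t + s|).

Local Notation rho := (weight m p tau).

Let rho_ge0 k : 0 <= rho k. Proof. exact: weight_ge0. Qed.

Let M : R := weight_const m p tau.

Let M0 : 0 <= M. Proof. exact: weight_const_ge0. Qed.

Let E (g h : R[i]) s t := \int[P]_w (Re (g * Z s w) * Re (h * Z t w)).

(** Covariances decay in |t - s| and relations in |t + s|. Both are at least the distance between
    |s| and |t|, a form that treats all sign combinations alike. *)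
Let E_bound g h s t : normc g = 1 -> normc h = 1 ->
  `|E g h s t| <= C * (1 + `|s|) `^ (- m) / (1 + `| `|s| - `|t| |).
Proof.
move=> g1 h1; rewrite /E (component_covariance gf cf _ _ (test_mode v s tchi) (test_mode v t tchi)).
have u0 : 0 <= C * (1 + `|s|) `^ (- m) by rewrite mulr_ge0 ?powR_ge0.
have le1 : normc (Cv s t) <= C * (1 + `|s|) `^ (- m) / (1 + `| `|s| - `|t| |).
  apply: le_trans (Cv_bound s t) _; rewrite ler_wpM2l// lef_pV2 ?posrE ?ltr_pwDl// lerD2l.
  by rewrite (distrC t); exact: ler_dist_dist.
have le2 : normc (Rv s t) <= C * (1 + `|s|) `^ (- m) / (1 + `| `|s| - `|t| |).
  apply: le_trans (Rv_bound s t) _; rewrite ler_wpM2l// lef_pV2 ?posrE ?ltr_pwDl// lerD2l.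
  by have := ler_dist_dist s (- t); rewrite opprK normrN (addrC t).
rewrite normrM ger0_norm ?invr_ge0// ler_pdivrMl//.
apply: le_trans (normr_Re_le _) _; apply: le_trans (normcD _ _) _.
rewrite !Normc.normcM normc_conj g1 h1 !mul1r -/(Cv s t) -/(Rv s t).
by rewrite mulrDl mul1r lerD.
Qed.

Let EC g h s t : E g h s t = E h g t s.
Proof. by apply: eq_Rintegral => w _; rewrite mulrC. Qed.

(* Num.max 1 keeps the paths continuous on all of R; bands with Q >= 1 do not see it. *)
Let Y (g : R[i]) (sh : R -> R) k w :=
  Num.sqrt (rho (Num.max 1 k)) * Re (g * Z (sh (Num.max 1 k)) w).

Let YY g h sh sh' k l : 1 <= k -> 1 <= l ->
  \int[P]_w (Y g sh k w * Y h sh' l w) =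
  Num.sqrt (rho k) * Num.sqrt (rho l) * E g h (sh k) (sh' l).
Proof.
move=> k1 l1; rewrite /E -RintegralZl//; last first.
  exact: (integrable_component gf cf _ _ (test_mode _ _ tchi) (test_mode _ _ tchi)).
by apply: eq_Rintegral => w _; rewrite /Y !max_r//; ring.
Qed.

(** The bound on E carries the symbol size at one frequency, and by symmetry this may be either of
    the two. Multiplying the two versions bounds E^2, where each weight meets the symbol size at its
    own frequency. *)
Let covYY g h sh sh' k l : normc g = 1 -> normc h = 1 ->
  (forall k, 1 <= k -> `|sh k| = k \/ `|sh k| = k + tau) ->
  (forall k, 1 <= k -> `|sh' k| = k \/ `|sh' k| = k + tau) ->
  1 <= k -> 1 <= l ->
  `|\int[P]_w (Y g sh k w * Y h sh' l w)| <= C * M * (1 + tau) / (1 + `|k - l|).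
Proof.
move=> g1 h1 hsh hsh' k1 l1; rewrite YY//.
set s := sh k; set t := sh' l; set D := 1 + `| `|s| - `|t| |.
have D0 : 0 < D by rewrite ltr_pwDl.
have e1 := E_bound s t g1 h1; have e2 := E_bound t s h1 g1.
rewrite -EC (distrC `|t|) -/D in e2; rewrite -/D in e1.
have w1 := weight_bound m p tau0 k1 (hsh k k1).
have w2 := weight_bound m p tau0 l1 (hsh' l l1).
rewrite -/M in w1 w2.
apply: (@le_trans _ _ (C * M / D)).
  have CM0 : 0 <= C * M / D := divr_ge0 (mulr_ge0 C0 M0) (ltW D0).
  rewrite -ler_sqr ?nnegrE//.
  have sq : (Num.sqrt (rho k) * Num.sqrt (rho l) * E g h s t) ^+ 2 =
      rho k * rho l * `|E g h s t| ^+ 2.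
    by rewrite real_normK ?num_real// exprMn exprMn !sqr_sqrtr.
  rewrite real_normK ?num_real// sq.
  set a := (1 + `|s|) `^ (- m) in e1 w1; set b := (1 + `|t|) `^ (- m) in e2 w2.
  apply: (@le_trans _ _ (rho k * rho l * ((C * a / D) * (C * b / D)))).
    by rewrite expr2; apply: ler_wpM2l; [exact: mulr_ge0|exact: ler_pM].
  rewrite [leLHS](_ : _ = (C / D) ^+ 2 * ((rho k * a) * (rho l * b))); last by ring.
  rewrite [leRHS](_ : _ = (C / D) ^+ 2 * (M * M)); last by ring.
  by rewrite ler_wpM2l ?sqr_ge0// ler_pM// mulr_ge0// powR_ge0.
(* Each frequency exceeds its index by 0 or tau in modulus, so replacing the distance of moduli by
   |k - l| costs the factor 1 + tau. *)
have kl : 1 + `|k - l| <= (1 + tau) * D.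
  suff kl : `|k - l| <= `| `|s| - `|t| | + tau.
    rewrite /D; have := mulr_ge0 tau0 (normr_ge0 (`|s| - `|t|)); nra.
  have [hs|hs] := hsh _ k1; have [ht|ht] := hsh' _ l1; rewrite hs ht.
  - by rewrite lerDl.
  - rewrite [k - l](_ : _ = k - (l + tau) + tau); last by ring.
    by apply: le_trans (ler_normD _ _) _; rewrite (ger0_norm tau0).
  - rewrite [k - l](_ : _ = k + tau - l - tau); last by ring.
    by apply: le_trans (ler_normB _ _) _; rewrite (ger0_norm tau0).
  - by rewrite [_ + tau - (_ + _)](_ : _ = k - l) ?lerDl//; ring.
rewrite ler_pdivrMr// mulrAC ler_pdivlMr ?ltr_pwDl// -(mulrA (C * M)).
exact: ler_wpM2l (mulr_ge0 C0 M0) _ _ kl.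
Qed.

Let cY g sh w : continuous sh -> continuous (Y g sh ^~ w).
Proof.
move=> csh.
apply: continuousM_fun.
  have cr : continuous (fun k : R => rho (Num.max 1 k)) by exact: continuous_weight_max.
  by move=> k; apply: continuous_comp; [exact: cr|exact: sqrt_continuous].
have cz : ccontinuous (fun k : R => g * Z (sh (Num.max 1 k)) w).
  apply: ccontinuousM; first exact: ccontinuous_cst.
  apply: (ccontinuous_comp (ccontinuous_dpair_mode (f w) v tchi)) => k.
  by apply: continuous_comp; [exact: continuous_max1|exact: csh].
by have [] := (ccontinuousP _).1 cz.
Qed.

Let YE g sh k w : Y g sh k w =
  Re ((Num.sqrt (rho (Num.max 1 k)))%:C * g * Z (sh (Num.max 1 k)) w).
Proof. by rewrite -mulrA RecM /= mul0r subr0. Qed.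

Let gYY g h sh sh' k l a b c e : centered_gaussian P (fun w =>
  a * Y g sh k w + b * Y h sh' k w + (c * Y g sh l w + e * Y h sh' l w)).
Proof.
pose q (x : R) g k : R[i] := x%:C * ((Num.sqrt (rho (Num.max 1 k)))%:C * g).
pose mo (sh : R -> R) k := mode chi v (sh (Num.max 1 k)).
have t (z : R[i]) sh0 k0 : test (fun x => z * mo sh0 k0 x) by apply: testZ; exact: test_mode.
have t1 := testD (t (q a g k) sh k) (t (q b h k) sh' k).
have t2 := testD (t (q c g l) sh l) (t (q e h l) sh' l).
have := centered_gaussian_Re gf cf (testD t1 t2); congr centered_gaussian.
apply/funext => w; rewrite !YE.
rewrite (dpairD _ t1 t2) (dpairD _ (t _ _ _) (t _ _ _)) (dpairD _ (t _ _ _) (t _ _ _)).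
rewrite !(dpairZ _ _ (test_mode _ _ tchi)) !RecD.
by congr (_ + _ + (_ + _)); rewrite /q -[in LHS]mulrA [LHS]RecM /= mul0r subr0.
Qed.

Variables (alpha alpha' beta beta' : R[i]).
Hypothesis limC1 : ccvg (pinfty_nbhs R) (fun k => (rho k)%:C * Cv (k + tau) (k + tau)) alpha.
Hypothesis limC2 : ccvg (pinfty_nbhs R) (fun k => (rho k)%:C * Cv (sg * k) (sg * k)) alpha'.
Hypothesis limC : ccvg (pinfty_nbhs R) (fun k => (rho k)%:C * Cv (k + tau) (sg * k)) beta.
Hypothesis limR : ccvg (pinfty_nbhs R) (fun k => (rho k)%:C * Rv (k + tau) (sg * k)) beta'.

Let limYY g h sh sh' bc br :
  ccvg (pinfty_nbhs R) (fun k => (rho k)%:C * Cv (sh k) (sh' k)) bc ->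
  ccvg (pinfty_nbhs R) (fun k => (rho k)%:C * Rv (sh k) (sh' k)) br ->
  \int[P]_w (Y g sh k w * Y h sh' k w) @[k --> +oo] -->
    2^-1 * Re (conjc g * h * bc + g * h * br).
Proof.
move=> lc lr.
have [+ _] : ccvg (pinfty_nbhs R) (fun k => conjc g * h * ((rho k)%:C * Cv (sh k) (sh' k)) +
    g * h * ((rho k)%:C * Rv (sh k) (sh' k))) (conjc g * h * bc + g * h * br).
  by apply: ccvgD; apply: ccvgM => //; exact: ccvg_cst.
move=> /(@cvgM _ _ _ _ _ _ _ _ (cvg_cst (2^-1 : R))); apply: cvg_trans; apply: near_eq_cvg.
exists 1; split; first exact: num_real.
move=> k /ltW k1 /=; rewrite YY// -expr2 sqr_sqrtr// /E.
rewrite (component_covariance gf cf _ _ (test_mode v _ tchi) (test_mode v _ tchi)).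
rewrite -/(Cv _ _) -/(Rv _ _) [RHS]mulrCA; congr (_ * _).
have ReZ (x : R) (z : R[i]) : Re (x%:C * z) = x * Re z by rewrite RecM /= mul0r subr0.
by rewrite -ReZ; congr Re; ring.
Qed.

(** At a repeated frequency s the decay variable of the relation is 2 s, so only the covariance
    contributes to the limiting variances. *)
Let limR0 sh : (forall k, 1 <= k -> `|sh k| = k \/ `|sh k| = k + tau) ->
  ccvg (pinfty_nbhs R) (fun k => (rho k)%:C * Rv (sh k) (sh k)) 0.
Proof.
move=> hsh; apply: (weight_decay p tau0 C0 hsh) => k k1.
apply: le_trans (Rv_bound _ _) _.
apply: ler_wpM2l; first by rewrite mulr_ge0 ?powR_ge0.
have k0 : 0 < 1 + k by rewrite addr_gt0// (lt_le_trans ltr01).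
have q0 : 0 < 1 + `|sh k + sh k| by rewrite ltr_pwDl.
rewrite lef_pV2 ?posrE// lerD2l -mulr2n normrMn mulr2n.
have : k <= `|sh k| by case: (hsh _ k1) => ->; rewrite ?lerDl.
by have := normr_ge0 (sh k); lra.
Qed.

(** The second frequency is sg k: sg = 1 serves the covariance limit and sg = - 1 the relation
    limit, with beta or beta' equal to 0 accordingly. *)
Lemma component_band_lln g h : normc g = 1 -> normc h = 1 -> {ae P, forall w,
  Q^-1 * \int[mu]_(k in `[Q, 2 * Q]) (rho (Num.max 1 k) * (Re (g * Z (k + tau) w) * Re (h * Z (sg * k) w)))
    @[Q --> +oo] --> 2^-1 * Re (conjc g * h * beta + g * h * beta')}.
Proof.
move=> g1 h1.
have s1 k : 1 <= k -> `|k + tau| = k \/ `|k + tau| = k + tau.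
  by move=> k1; right; rewrite ger0_norm// addr_ge0// (le_trans ler01).
have s2 k : 1 <= k -> `|sg * k| = k \/ `|sg * k| = k + tau.
  by move=> k1; left; rewrite normrM sg1 mul1r ger0_norm// (le_trans ler01).
pose Y1 := Y g (fun k => k + tau); pose Y2 := Y h (fun k => sg * k).
have := @product_band_lln _ _ _ P Y1 Y2 (C * M * (1 + tau))
  (2^-1 * Re (conjc g * g * alpha + g * g * 0)) (2^-1 * Re (conjc h * h * alpha' + h * h * 0))
  (2^-1 * Re (conjc g * h * beta + g * h * beta')).
move=> lln; apply: filterS (lln _ _ _ _ _ _ _ _ _) => {lln}.
- move=> w; apply: cvg_trans; apply: near_eq_cvg; exists 1; split; first exact: num_real.
  move=> Q Q1 /=; congr (_ * _); apply: eq_Rintegral => k.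
  rewrite inE /= in_itv /= => /andP[Qk _].
  have k1 : 1 <= k by rewrite (le_trans _ Qk)// ltW.
  rewrite /Y1 /Y2 /Y !max_r// mulrACA -expr2 sqr_sqrtr//.
- by move=> w; apply: cY; apply: continuousD_fun; [move=> k; exact: cvg_id|exact: cst_continuous].
- by move=> w; apply: cY; apply: continuousM_fun; [exact: cst_continuous|move=> k; exact: cvg_id].
- by move=> *; exact: gYY.
- by move=> k l; exact: covYY.
- by move=> k l; exact: covYY.
- by move=> k l; exact: covYY.
- by under eq_fun do under eq_Rintegral do rewrite expr2; exact: limYY limC1 (limR0 s1).
- by under eq_fun do under eq_Rintegral do rewrite expr2; exact: limYY limC2 (limR0 s2).
- exact: limYY limC limR.
Qed.

End mode_process.

(** * From real components to complex averages *)

Section band_components.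
Context {R : realType}.
Local Notation mu := (@lebesgue_measure R).
Variables (W : R -> R) (z1 z2 : R -> R[i]) (l : R[i] -> R[i] -> R).
Hypotheses (cW : continuous W) (c1 : ccontinuous z1) (c2 : ccontinuous z2).
Let mi : R[i] := 0 +i* (-1).
Hypothesis lim : forall g h, g \in [:: 1; mi] -> h \in [:: 1; mi] ->
  Q^-1 * \int[mu]_(k in `[Q, 2 * Q]) (W k * (Re (g * z1 k) * Re (h * z2 k))) @[Q --> +oo] --> l g h.

Let I g h (Q : R) := \int[mu]_(k in `[Q, 2 * Q]) (W k * (Re (g * z1 k) * Re (h * z2 k))).

Let ig g h (Q : R) :
  mu.-integrable `[Q, 2 * Q] (EFin \o (fun k => W k * (Re (g * z1 k) * Re (h * z2 k)))).
Proof.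
apply: continuous_Rintegrable_itv; apply: (continuousM_fun cW); apply: continuousM_fun.
  exact: ((ccontinuousP _).1 (ccontinuousM (ccontinuous_cst g) c1)).1.
exact: ((ccontinuousP _).1 (ccontinuousM (ccontinuous_cst h) c2)).1.
Qed.

Let sum_limit g h g' h' (u : R -> R) (e : R) : g \in [:: 1; mi] -> h \in [:: 1; mi] ->
  g' \in [:: 1; mi] -> h' \in [:: 1; mi] ->
  (forall k, u k = Re (g * z1 k) * Re (h * z2 k) + e * (Re (g' * z1 k) * Re (h' * z2 k))) ->
  Q^-1 * \int[mu]_(k in `[Q, 2 * Q]) (W k * u k) @[Q --> +oo] --> l g h + e * l g' h'.
Proof.
move=> g1 h1 g1' h1' uE.
have -> : (fun Q => Q^-1 * \int[mu]_(k in `[Q, 2 * Q]) (W k * u k)) =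
    (fun Q => Q^-1 * I g h Q + e * (Q^-1 * I g' h' Q)).
  apply/funext => Q; rewrite mulrCA -mulrDr; congr (_ * _).
  rewrite -RintegralZl// -RintegralD//; last first.
    exact: (@integrableZlR _ _ (measurableTypeR R) mu _ (measurable_itv _) _ e (ig g' h' Q)).
  by apply: eq_Rintegral => k _; rewrite uE; ring.
by apply: cvgD; [exact: lim|apply: cvgM; [exact: cvg_cst|exact: lim]].
Qed.

Let band (F : R -> R[i]) (Q : R) : R[i] :=
  (Q^-1)%:C * cintegral mu `[Q, 2 * Q] (fun k => (W k)%:C * F k).

Let band_limit (F : R -> R[i]) (L : R[i]) :
  Q^-1 * \int[mu]_(k in `[Q, 2 * Q]) (W k * Re (F k)) @[Q --> +oo] --> Re L ->
  Q^-1 * \int[mu]_(k in `[Q, 2 * Q]) (W k * Im (F k)) @[Q --> +oo] --> Im L ->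
  ccvg (pinfty_nbhs R) (band F) L.
Proof.
have e1 Q : Re (band F Q) = Q^-1 * \int[mu]_(k in `[Q, 2 * Q]) (W k * Re (F k)).
  rewrite RecM mul0r subr0 Re_cintegral; congr (_ * _); apply: eq_Rintegral => k _.
  by rewrite RecM mul0r subr0.
have e2 Q : Im (band F Q) = Q^-1 * \int[mu]_(k in `[Q, 2 * Q]) (W k * Im (F k)).
  rewrite ImcM mul0r addr0 Im_cintegral; congr (_ * _); apply: eq_Rintegral => k _.
  by rewrite ImcM mul0r addr0.
by move=> h1 h2; split; [under eq_fun do rewrite e1|under eq_fun do rewrite e2].
Qed.

(** Uses Re (z1 conj z2) = Re z1 Re z2 + Im z1 Im z2 and Im (z1 conj z2) = Im z1 Re z2 - Re z1 Im
    z2, the factor [mi] standing for the extraction of an imaginary part. *)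
Lemma band_conj_limit L : Re L = l 1 1 + 1 * l mi mi -> Im L = l mi 1 + (-1) * l 1 mi ->
  ccvg (pinfty_nbhs R) (band (fun k => z1 k * conjc (z2 k))) L.
Proof.
move=> eR eI; apply: band_limit; rewrite ?eR ?eI; apply: sum_limit; rewrite ?inE ?eqxx ?orbT// => k.
  by rewrite !(RecM, ImcM, Rec_conj, Imc_conj) /=; ring.
by rewrite !(RecM, ImcM, Rec_conj, Imc_conj) /=; ring.
Qed.

Lemma band_mul_limit L : Re L = l 1 1 + (-1) * l mi mi -> Im L = l mi 1 + 1 * l 1 mi ->
  ccvg (pinfty_nbhs R) (band (fun k => z1 k * z2 k)) L.
Proof.
move=> eR eI; apply: band_limit; rewrite ?eR ?eI; apply: sum_limit; rewrite ?inE ?eqxx ?orbT// => k.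
  by rewrite !(RecM, ImcM) /=; ring.
by rewrite !(RecM, ImcM) /=; ring.
Qed.

End band_components.

Lemma normc_sqr {R : realType} (z : R[i]) : (normc z ^+ 2)%:C = z * conjc z.
Proof.
case: z => a b; rewrite /= sqr_sqrtr ?addr_ge0 ?sqr_ge0//.
by apply: complex_ext; rewrite /=; ring.
Qed.

(** Bands with Q >= 1 see only k >= 1, so the integrand may be exchanged there for one that is
    continuous on the whole line. *)
Lemma band_average_ccvg {R : realType} (s : R) (F : R -> R[i]) (c L : R[i])
    (W : R -> R) (G : R -> R[i]) : continuous W -> ccontinuous G ->
  (forall k, 1 <= k -> (k `^ s)%:C * F k = c * ((W k)%:C * G k)) ->
  ccvg (pinfty_nbhs R) (fun Q => (Q^-1)%:C *
    cintegral (@lebesgue_measure R) `[Q, 2 * Q] (fun k => (W k)%:C * G k)) L ->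
  ccvg_pinfty (band_average s F) (c * L).
Proof.
move=> cW cG FG GL; apply/ccvg_pinftyE.
apply: ccvg_near_eq (ccvgM (ccvg_cst c) GL).
exists 1; split; first exact: num_real.
move=> Q /ltW Q1; rewrite mulrCA -cintegralZ//; last first.
  by split; apply: continuous_Rintegrable_itv;
    [have [+ _] := (ccontinuousP _).1 (ccontinuousM (ccontinuous_real cW) cG)|
     have [_ +] := (ccontinuousP _).1 (ccontinuousM (ccontinuous_real cW) cG)].
congr (_ * _); apply: eq_cintegral => k; rewrite /= in_itv /= => /andP[Qk _].
by rewrite FG// (le_trans Q1).
Qed.

(** * Limits for the far field of the random source *)

Section far_field_limits.
Context {R : realType} {disp : measure_display} {Omega : measurableType disp}.
Context {d : nat} (P : probability Omega R) (f : Omega -> @schwartz_distr R d).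
Local Notation mu := (@lebesgue_measure R).
Variables (D : set 'rV[R]_d) (m : R) (chi ac ar : 'rV[R]_d -> R[i]).
Hypothesis hchi : cutoff (closure D) chi.
Hypothesis hf : centered_GMIG P D m f ac ar.
Variables (v : 'rV[R]_d) (tau : R).
Hypotheses (v1 : enorm v = 1) (tau0 : 0 <= tau).

Let gf psi : test psi -> complex_gaussian P (fun w => f w psi).
Proof. by have [g _ _ _] := hf; exact: g. Qed.

Let cf psi : test psi -> cexpectation P (fun w => f w psi) = 0.
Proof. by have [_ c _ _] := hf; exact: c. Qed.

Let tchi : test chi. Proof. by case: hchi. Qed.

Let p : R := (d%:R - 7) / 2.
Let Z s w := f w (mode chi v s).
Let Cv s t := covariance P f (mode chi v s) (mode chi v t).
Let Rv s t := relation P f (mode chi v s) (mode chi v t).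

Let covariance_opE phi psi :
  covariance_op P f (fun y => conjc (phi y)) psi = covariance P f phi psi.
Proof.
rewrite /covariance_op /covariance; congr cexpectation; apply/funext => w.
rewrite /conj_pair; congr (conjc _ * _); congr (f w _).
by apply/funext => y; exact: conjc_involutive.
Qed.

Let covE u s t : covariance_op P f (mode (fun y => conjc (chi y)) (- u) s) (mode chi u t) =
  covariance P f (mode chi u s) (mode chi u t).
Proof. by rewrite -conj_mode covariance_opE. Qed.

Let acK x : ac x * conjc (chi x) * chi x = ac x.
Proof.
have [_ _ [s [b [_ _ ta _ _]]] _] := hf.
have e := cutoff_supportK hchi ta x.
have [->|a0] := eqVneq (ac x) 0; first by rewrite !mul0r.
have -> : chi x = 1 by apply: (mulfI a0); rewrite e mulr1.
by rewrite conjc1 !mulr1.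
Qed.

Let arK x : ar x * chi x * chi x = ar x.
Proof.
have [_ _ _ [s [b [_ _ ta _ _]]]] := hf.
by rewrite !(cutoff_supportK hchi ta).
Qed.

Let cov_kernel u : enorm u = 1 ->
  (exists2 C, 0 <= C & forall s t, normc (covariance P f (mode chi u s) (mode chi u t)) <=
    C * (1 + `|s|) `^ (- m) / (1 + `|t - s|)) /\
  forall r, ccvg (pinfty_nbhs R)
    (fun k => (k `^ m)%:C * covariance P f (mode chi u k) (mode chi u (k + r)))
    (fourier ac (r *: u)).
Proof.
move=> u1; have [_ _ ic _] := hf.
have [[C C0 HC] HL] := isotropic_kernel ic (test_conj tchi) tchi acK u1.
split=> [|r]; first by exists C => // s t; rewrite -covE.
by have := HL r; under eq_fun do rewrite covE.
Qed.

Let rel_kernel :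
  (exists2 C, 0 <= C & forall s t, normc (Rv s t) <= C * (1 + `|s|) `^ (- m) / (1 + `|t + s|)) /\
  forall r, ccvg (pinfty_nbhs R) (fun k => (k `^ m)%:C * Rv (- k) (k + r)) (fourier ar (r *: v)).
Proof.
have [_ _ _ ir] := hf.
have [[C C0 HC] HL] := isotropic_kernel ir tchi tchi arK v1.
have E s t : Rv (- s) t = relation_op P f (mode chi (- v) s) (mode chi v t).
  by rewrite /Rv /relation /relation_op -(modeN chi v (- s)) opprK.
split=> [|r]; last by have := HL r; under eq_fun do rewrite -E.
by exists C => // s t; have := HC (- s) t; rewrite -E opprK normrN.
Qed.

Let bounds : exists2 C, 0 <= C &
  (forall s t, normc (Cv s t) <= C * (1 + `|s|) `^ (- m) / (1 + `|t - s|)) /\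
  (forall s t, normc (Rv s t) <= C * (1 + `|s|) `^ (- m) / (1 + `|t + s|)).
Proof.
have [[C1 C10 H1] _] := cov_kernel v1; have [[C2 C20 H2] _] := rel_kernel.
exists (C1 + C2); first exact: addr_ge0.
split=> s t.
  apply: le_trans (H1 s t) _; rewrite ler_wpM2r ?invr_ge0 ?addr_ge0// ler_wpM2r ?powR_ge0//.
  by rewrite lerDl.
apply: le_trans (H2 s t) _; rewrite ler_wpM2r ?invr_ge0 ?addr_ge0// ler_wpM2r ?powR_ge0//.
by rewrite lerDr.
Qed.

Let limC u : enorm u = 1 -> ccvg (pinfty_nbhs R)
  (fun k => (k `^ m)%:C * covariance P f (mode chi u k) (mode chi u k)) (fourier ac 0).
Proof.
move=> u1; have := (cov_kernel u1).2 0; rewrite scale0r.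
by under eq_fun do rewrite addr0.
Qed.

Local Notation rho := (weight m p tau).

Let limC1 : ccvg (pinfty_nbhs R) (fun k => (rho k)%:C * Cv (k + tau) (k + tau)) (fourier ac 0).
Proof. exact: (weight_limit_shift p tau0 (limC v1)). Qed.

Let normc1 : normc (1 : R[i]) = 1. Proof. exact: Normc.normc1. Qed.

(** The covariance at (k + tau, k) is the conjugate of the kernel at (k, k + tau), hence the
    conjugate in the limit. The relation at these frequencies, whose sum is at least k, contributes
    0. *)
Let covariance_components g h : normc g = 1 -> normc h = 1 -> {ae P, forall w,
  Q^-1 * \int[mu]_(k in `[Q, 2 * Q])
    (rho (Num.max 1 k) * (Re (g * Z (k + tau) w) * Re (h * Z (1 * k) w)))
  @[Q --> +oo] --> 2^-1 * Re (conjc g * h * conjc (fourier ac (tau *: v)) + g * h * 0)}.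
Proof.
move=> g1 h1; have [C C0 [HC HR]] := bounds.
apply: (component_band_lln gf cf tchi tau0 (normr1 R) C0 HC HR limC1 _ _ _ g1 h1).
- by under eq_fun do rewrite mul1r; exact: (weight_limit _ _ (limC v1)).
- have -> : (fun k => (rho k)%:C * covariance P f (mode chi v (k + tau)) (mode chi v (1 * k))) =
      (fun k => conjc ((rho k)%:C * covariance P f (mode chi v k) (mode chi v (k + tau)))).
    apply/funext => k; rewrite conjcM mul1r.
    rewrite (covariance_conj gf cf (test_mode _ _ tchi) (test_mode _ _ tchi)).
    by congr (_ * _); apply: complex_ext; rewrite /= ?oppr0.
  exact: ccvg_conj (weight_limit _ _ ((cov_kernel v1).2 tau)).
- apply: (@weight_decay _ m p tau tau0 _ (fun k => k + tau) C C0) => k k1.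
    by right; rewrite ger0_norm// addr_ge0// (le_trans ler01).
  apply: le_trans (HR _ _) _; apply: ler_wpM2l; first by rewrite mulr_ge0 ?powR_ge0.
  have k0 : 0 <= k by rewrite (le_trans ler01).
  rewrite mul1r (ger0_norm (addr_ge0 k0 (addr_ge0 k0 tau0))).
  by rewrite lef_pV2 ?posrE ?ltr_pwDl// ?lerD2l ?lerDl ?addr_ge0.
Qed.

(** Opposite frequencies exchange the roles: the relation at (k + tau, - k) converges, while the
    covariance at frequencies at least k apart contributes 0. *)
Let relation_components g h : normc g = 1 -> normc h = 1 -> {ae P, forall w,
  Q^-1 * \int[mu]_(k in `[Q, 2 * Q])
    (rho (Num.max 1 k) * (Re (g * Z (k + tau) w) * Re (h * Z (- 1 * k) w)))
  @[Q --> +oo] --> 2^-1 * Re (conjc g * h * 0 + g * h * fourier ar (tau *: v))}.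
Proof.
move=> g1 h1; have [C C0 [HC HR]] := bounds.
have sg1 : `|-1| = 1 :> R by rewrite normrN normr1.
have u1 : enorm (- v) = 1 by rewrite enormN.
apply: (component_band_lln gf cf tchi tau0 sg1 C0 HC HR limC1 _ _ _ g1 h1).
- have -> : (fun k => (rho k)%:C * covariance P f (mode chi v (-1 * k)) (mode chi v (-1 * k))) =
      (fun k => (rho k)%:C * covariance P f (mode chi (- v) k) (mode chi (- v) k)).
    by apply/funext => k; rewrite mulN1r -(modeN chi v (- k)) opprK.
  exact: (weight_limit _ _ (limC u1)).
- apply: (@weight_decay _ m p tau tau0 _ (fun k => k + tau) C C0) => k k1.
    by right; rewrite ger0_norm// addr_ge0// (le_trans ler01).
  apply: le_trans (HC _ _) _; apply: ler_wpM2l; first by rewrite mulr_ge0 ?powR_ge0.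
  have k0 : 0 <= k by rewrite (le_trans ler01).
  rewrite mulN1r -opprD normrN (ger0_norm (addr_ge0 k0 (addr_ge0 k0 tau0))).
  by rewrite lef_pV2 ?posrE ?ltr_pwDl// ?lerD2l ?lerDl ?addr_ge0.
- have -> : (fun k => (rho k)%:C * relation P f (mode chi v (k + tau)) (mode chi v (-1 * k))) =
      (fun k => (rho k)%:C * relation P f (mode chi v (- k)) (mode chi v (k + tau))).
    by apply/funext => k; rewrite mulN1r relationC.
  exact: (weight_limit _ _ (rel_kernel.2 tau)).
Qed.

(* Re (g z) for g = 1 and g = -i gives the real and imaginary parts of z. *)
Let directions : seq R[i] := [:: 1; 0 +i* (-1)].

Let normc_direction g : g \in directions -> normc g = 1.
Proof.
rewrite !inE => /orP[]/eqP->; first exact: normc1.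
by rewrite /= expr0n add0r sqrrN expr1n sqrtr1.
Qed.

Let ae_directions (Q : R[i] -> R[i] -> set Omega) :
  (forall g h, normc g = 1 -> normc h = 1 -> {ae P, forall w, Q g h w}) ->
  {ae P, forall w, forall g h, g \in directions -> h \in directions -> Q g h w}.
Proof.
have e1 : 1 \in directions by rewrite inE eqxx.
have e2 : 0 +i* (-1) \in directions by rewrite !inE eqxx orbT.
move=> H; have h1 := H _ _ (normc_direction e1) (normc_direction e1).
have h2 := H _ _ (normc_direction e1) (normc_direction e2).
have h3 := H _ _ (normc_direction e2) (normc_direction e1).
have h4 := H _ _ (normc_direction e2) (normc_direction e2).
apply: filterS2 (filterI h1 h2) (filterI h3 h4) => w [q1 q2] [q3 q4] g h.
by rewrite !inE => /orP[]/eqP-> /orP[]/eqP->.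
Qed.

Let cZ (h : R -> R) w : continuous h -> ccontinuous (fun k => Z (h k) w).
Proof. exact: (ccontinuous_comp (ccontinuous_dpair_mode (f w) v tchi)). Qed.

Let cshift : continuous (fun k : R => k + tau).
Proof. by apply: continuousD_fun; [move=> k; exact: cvg_id|exact: cst_continuous]. Qed.

Let cscale c : continuous (fun k : R => c * k).
Proof. by apply: continuousM_fun; [exact: cst_continuous|move=> k; exact: cvg_id]. Qed.

(** The exponents add up to m because 2 p = d - 7; of the shifted factor there remains the ratio (k
    + tau) / k to the power p. *)
Let weightE k : 1 <= k ->
  k `^ (m + 7 - d%:R) * ((k + tau) `^ p * k `^ p) = rho (Num.max 1 k).
Proof.
move=> k1; have k0 : 0 < k by exact: lt_le_trans k1.
have q0 : 0 < (k + tau) / k by rewrite divr_gt0// ltr_wpDr.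
have -> : (k + tau) `^ p = ((k + tau) / k) `^ p * k `^ p.
  by rewrite -powRM ?divfK ?gt_eqF// ltW.
rewrite max_r// /weight -mulrA -powRD; last by rewrite (gt_eqF k0) implybT.
rewrite mulrCA -powRD; last by rewrite (gt_eqF k0) implybT.
by rewrite mulrC; congr (_ `^ _ * _); rewrite /p; lra.
Qed.

(** The almost sure events of the four pairs of directions are intersected, and the factors 1 / 2 of
    the component limits cancel, as two pairs contribute to each part. The prefactor 1 / 4 comes
    from the factor [Cst d / 2] in each far field. *)
Lemma far_field_limits_ae : {ae P, forall w,
  covariance_limit chi m (f w) v tau
    (4^-1 * (normc (Cst d) ^+ 2)%:C * fourier ac (tau *: v)) /\
  relation_limit chi m (f w) v tau (4^-1 * Cst d ^+ 2 * fourier ar (tau *: v))}.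
Proof.
have cW : continuous (fun k : R => rho (Num.max 1 k)) by exact: continuous_weight_max.
apply: filterS2 (ae_directions covariance_components) (ae_directions relation_components).
move=> w Hc Hr; split.
- apply: (band_average_ccvg (W := fun k => rho (Num.max 1 k))
    (G := fun k => Z (k + tau) w * conjc (Z (1 * k) w)) cW).
  + by apply: ccontinuousM; [exact: cZ|apply: ccontinuous_conj; exact: cZ].
  + move=> k k1; rewrite -(weightE k1) mul1r /far_field -/(mode chi v _) -/(mode chi v _) -/p.
    rewrite -/(Z _ _) -/(Z _ _) -[Num.conj _]/(conjc _) !conjcM conjc_inv conjc_real.
    by rewrite conjc_nat normc_sqr !rmorphM /=; field.
  + apply: (@band_conj_limit _ _ _ _ (fun g h => 2^-1 * Re (conjc g * h *
      conjc (fourier ac (tau *: v)) + g * h * 0)) cW (cZ w cshift) (cZ w (@cscale 1)) Hc).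
      by rewrite !(RecD, RecM, ImcM, Rec_conj, Imc_conj) /=; field.
    by rewrite !(RecD, RecM, ImcM, Rec_conj, Imc_conj) /=; field.
- apply: (band_average_ccvg (W := fun k => rho (Num.max 1 k))
    (G := fun k => Z (k + tau) w * Z (- 1 * k) w) cW).
  + by apply: ccontinuousM; exact: cZ.
  + move=> k k1; rewrite -(weightE k1) mulN1r /far_field -/(mode chi v _) -/(mode chi (- v) _) -/p.
    have -> : mode chi (- v) k = mode chi v (- k) by rewrite -(modeN chi v (- k)) opprK.
    rewrite -/(Z _ _) -/(Z _ _) !rmorphM /=.
    by field.
  + apply: (@band_mul_limit _ _ _ _ (fun g h => 2^-1 * Re (conjc g * h * 0 +
      g * h * fourier ar (tau *: v))) cW (cZ w cshift) (cZ w (@cscale (-1))) Hr).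
      by rewrite !(RecD, RecM, ImcM, Rec_conj, Imc_conj) /=; field.
    by rewrite !(RecD, RecM, ImcM, Rec_conj, Imc_conj) /=; field.
Qed.

End far_field_limits.

Lemma ae_exists {R : realType} disp (T : measurableType disp) (P : probability T R) (A : set T) :
  {ae P, forall w, A w} -> A !=set0.
Proof.
move=> [B [mB PB0 AB]]; apply/set0P/eqP => A0.
have BT : B = setT by apply/seteqP; split=> // x _; apply: AB; rewrite A0.
have := probability_setT P; rewrite -BT PB0 => -[] /eqP.
by rewrite eq_sym oner_eq0.
Qed.

Lemma ccvg_pinfty_unique {R : realType} (g : R -> R[i]) l l' :
  ccvg_pinfty g l -> ccvg_pinfty g l' -> l = l'.
Proof.
move=> /ccvg_pinftyE[gr gi] /ccvg_pinftyE[gr' gi'].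
by apply: complex_ext; [exact: (cvg_unique _ gr gr')|exact: (cvg_unique _ gi gi')].
Qed.

Lemma Cst_neq0 {R : realType} d : Cst d != 0 :> R[i].
Proof.
have e0 x : expi x != 0 :> R[i].
  apply/eqP => e; have := normc_expi x; rewrite e Normc.normc0 => /eqP.
  by rewrite eq_sym oner_eq0.
have real_neq0 (x : R) : 0 < x -> x%:C != 0 by move=> x0; rewrite fmorph_eq0 gt_eqF.
rewrite /Cst; case: ifP => _; last by rewrite real_neq0// invr_gt0 mulr_gt0// pi_gt0.
by rewrite mulf_neq0// real_neq0// invr_gt0 sqrtr_gt0 mulr_gt0// pi_gt0.
Qed.

Lemma fourier_determines {R : realType} d (Theta : set (R * 'rV[R]_d)) (a b : 'rV[R]_d -> R[i]) :
  open_in (Rplus_sphere d) Theta -> Theta !=set0 -> test a -> test b ->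
  (forall tau x, Theta (tau, x) -> fourier a (tau *: x) = fourier b (tau *: x)) -> a = b.
Proof.
move=> oT T0 ta tb ab.
have tab : test (fun x => a x - b x).
  have := testD ta (testZ (-1) tb); congr test.
  by apply/funext => x; rewrite mulN1r.
apply/funext => x; apply/eqP; rewrite -subr_eq0; apply/eqP; move: x.
apply: (fourier_unique_open oT T0 tab) => tau x Tx.
have [Ca ba] := test_bounded ta; have [Cb bb] := test_bounded tb.
have mE (c : 'rV[R]_d -> R[i]) : test c ->
    rd_measurable (fun y => expi (- dot y (tau *: x)) * c y).
  by move=> tc; apply: rd_measurableM; [exact: rd_measurable_character|exact: test_rd_measurable].
have bE C (c : 'rV[R]_d -> R[i]) : rd_bounded C c ->
    rd_bounded C (fun y => expi (- dot y (tau *: x)) * c y).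
  exact: rd_bounded_expiM.
rewrite /fourier (eq_integral_Rd (G := fun y => expi (- dot y (tau *: x)) * a y -
    expi (- dot y (tau *: x)) * b y)); last by move=> y; rewrite mulrBr.
rewrite (integral_RdB (mE a ta) (bE _ _ ba) (mE b tb) (bE _ _ bb)).
by apply/eqP; rewrite subr_eq0; apply/eqP; exact: ab.
Qed.

Section uniqueness.
Context {R : realType} {d : nat}.
Variables (D : set 'rV[R]_d) (m : R) (chi : 'rV[R]_d -> R[i]).
Hypothesis hchi : cutoff (closure D) chi.
Variables (disp : measure_display) (Omega : measurableType disp) (P : probability Omega R).
Variables (f : Omega -> @schwartz_distr R d) (ac ar : 'rV[R]_d -> R[i]).
Hypothesis hf : centered_GMIG P D m f ac ar.
Variables (x : 'rV[R]_d) (tau : R) (L : R[i]).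
Hypotheses (x1 : enorm x = 1) (tau0 : 0 <= tau).

(** Two almost sure events share an outcome, at which uniqueness of limits identifies the
    deterministic number L. *)
Lemma covariance_limit_value : {ae P, forall w, covariance_limit chi m (f w) x tau L} ->
  L = 4^-1 * (normc (Cst d) ^+ 2)%:C * fourier ac (tau *: x).
Proof.
move=> HL; have [w [[Hw _] Hw']] := ae_exists (filterI (far_field_limits_ae hchi hf x1 tau0) HL).
exact: ccvg_pinfty_unique Hw' Hw.
Qed.

Lemma relation_limit_value : {ae P, forall w, relation_limit chi m (f w) x tau L} ->
  L = 4^-1 * Cst d ^+ 2 * fourier ar (tau *: x).
Proof.
move=> HL; have [w [[_ Hw] Hw']] := ae_exists (filterI (far_field_limits_ae hchi hf x1 tau0) HL).
exact: ccvg_pinfty_unique Hw' Hw.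
Qed.

End uniqueness.

Lemma GMIG_symbols_test {R : realType} {d : nat} (D : set 'rV[R]_d) (m : R)
    (disp : measure_display) (Omega : measurableType disp) (P : probability Omega R)
    (f : Omega -> @schwartz_distr R d) (ac ar : 'rV[R]_d -> R[i]) :
  centered_GMIG P D m f ac ar -> test ac /\ test ar.
Proof.
move=> [_ _ [s [b [_ _ [sa ca _] _ _]]] [s' [b' [_ _ [sa' ca' _] _ _]]]].
by split; split.
Qed.

Theorem theorem4p2 (R : realType) (d : nat) (hd : d = 2%N \/ d = 3%N)
    (D : set 'rV[R]_d) (hD : domain D) (bD : bounded_set D)
    (m : R) (hm : d%:R - 6 < m <= d%:R)
    (chi : 'rV[R]_d -> R[i]) (hchi : cutoff (closure D) chi)
    (disp : measure_display) (Omega : measurableType disp)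
    (P : probability Omega R) (hP : measure_is_complete P)
    (f : Omega -> schwartz_distr d) (ac ar : 'rV[R]_d -> R[i])
    (hf : centered_GMIG P D m f ac ar) :
  (forall (xhat : 'rV[R]_d) (tau : R), enorm xhat = 1 -> 0 <= tau ->
    {ae P, forall w,
      covariance_limit chi m (f w) xhat tau
        (4^-1 * (Normc.normc (Cst d) ^+ 2)%:C * fourier ac (tau *: xhat)) /\
      relation_limit chi m (f w) xhat tau
        (4^-1 * Cst d ^+ 2 * fourier ar (tau *: xhat))}) /\
  (forall Theta : set (R * 'rV[R]_d),
    open_in (Rplus_sphere d) Theta -> Theta !=set0 ->
    forall (disp' : measure_display) (Omega' : measurableType disp')
      (P' : probability Omega' R) (hP' : measure_is_complete P')
      (f' : Omega' -> schwartz_distr d) (ac' ar' : 'rV[R]_d -> R[i])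
      (hf' : centered_GMIG P' D m f' ac' ar'),
    ((forall (tau : R) (xhat : 'rV[R]_d), Theta (tau, xhat) ->
       exists L : R[i],
         {ae P, forall w, covariance_limit chi m (f w) xhat tau L} /\
         {ae P', forall w, covariance_limit chi m (f' w) xhat tau L}) ->
     ac = ac') /\
    ((forall (tau : R) (xhat : 'rV[R]_d), Theta (tau, xhat) ->
       exists L : R[i],
         {ae P, forall w, relation_limit chi m (f w) xhat tau L} /\
         {ae P', forall w, relation_limit chi m (f' w) xhat tau L}) ->
     ar = ar')).
Proof.
split=> [x tau x1 tau0|Theta oT T0 disp' Omega' P' hP' f' ac' ar' hf'].
  exact (far_field_limits_ae hchi hf x1 tau0).
have [tc tr] := GMIG_symbols_test hf; have [tc' tr'] := GMIG_symbols_test hf'.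
have Theta_sphere tau x : Theta (tau, x) -> 0 <= tau /\ enorm x = 1.
  by case: oT => U _ -> [_ [/= /ltW]].
(* The prefactors of both limits are nonzero, so a common limit gives equal Fourier transforms on
   the cone over Theta. *)
have c0 := Cst_neq0 (R := R) d.
have k0 : 4^-1 * (normc (Cst d : R[i]) ^+ 2)%:C != 0.
  by rewrite mulf_neq0 ?invr_eq0 ?pnatr_eq0// normc_sqr mulf_neq0// conjc_eq0.
have k0' : 4^-1 * (Cst d : R[i]) ^+ 2 != 0.
  by rewrite mulf_neq0 ?invr_eq0 ?pnatr_eq0// expf_neq0.
split=> h; [apply: (fourier_determines oT T0 tc tc') | apply: (fourier_determines oT T0 tr tr')];
    move=> tau x Tx; have [L [HL HL']] := h _ _ Tx; have [t0 x1] := Theta_sphere _ _ Tx.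
  apply: (mulfI k0).
  by rewrite -(covariance_limit_value hchi hf x1 t0 HL) (covariance_limit_value hchi hf' x1 t0 HL').
apply: (mulfI k0').
by rewrite -(relation_limit_value hchi hf x1 t0 HL) (relation_limit_value hchi hf' x1 t0 HL').
Qed.
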